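(* Assume the setting and assumptions (A1)–(A4) described in the context. For each $x\in V$, as $T\to+\infty$ along $T=nT_0$ with $n$ a positive integer, the family of probability measures $\{\mathbb P_x\circ(\bar\mu_T,\bar Q_T)^{-1}\}$ on $\mathcal P(V)\times\mathbb R_+^E$ satisfies a large deviation principle with speed $T$ and good convex rate functional $$\bar I(\bar\mu,\bar Q)=\inf_{(\mu_t,Q_t)_{t\in\mathcal S_{T_0}}}\frac1{T_0}\int_0^{T_0}I_t(\mu_t,Q_t)\,dt,$$ where the infimum (equal to $+\infty$ if taken over the empty set) runs over all measurable maps $\mathcal S_{T_0}\ni t\mapsto(\mu_t,Q_t)\in\mathcal P(V)\times\mathbb R_+^E$ such that $\partial_t\mu_t+\mathrm{div}\,Q_t=0$ weakly, $\frac1{T_0}\int_0^{T_0}\mu_t\,dt=\bar\mu$ and $\frac1{T_0}\int_0^{T_0}Q_t\,dt=\bar Q$.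
   Context: Let $V$ be a finite set and $T_0>0$; let $\mathcal S_{T_0}:=\mathbb R/T_0\mathbb Z$ (functions on $\mathcal S_{T_0}$ are identified with $T_0$-periodic functions). For $y,z\in V$ let $r(y,z;\cdot):[0,\infty)\to[0,\infty)$ be measurable, locally integrable and $T_0$-periodic, with $r(x,x;t)\equiv0$. Let $E$ be the set of ordered pairs $(y,z)$, $y\ne z$, with $r(y,z;t)>0$ for all $t>0$. Assumptions: (A1) if $r(y,z;t)>0$ for some $t>0$ then $r(y,z;t)>0$ for all $t>0$; (A2) the directed graph $(V,E)$ is strongly connected; (A3) $\max_{(y,z)\in E}\sup_{t\in[0,T_0]}r(y,z;t)<\infty$ and $\min_{(y,z)\in E}\inf_{t\in[0,T_0]}r(y,z;t)>0$; (A4) the set of points of $\mathcal S_{T_0}$ at which some map $t\mapsto r(y,z;t)$ ($y,z\in V$) is discontinuous has Lebesgue measure zero. Let $(\xi_t)_{t\ge0}$ be the time-inhomogeneous continuous-time Markov chain on $V$ with càdlàg paths and jump rate $r(y,z;t)$ from $y$ to $z$ at time $t$; $\mathbb P_x$ denotes its law on $D(\mathbb R_+;V)$ when $\xi_0=x$. For a path $X\in D(\mathbb R_+;V)$ and $T>0$: the empirical measure $\bar\mu_T(X)=\frac1T\int_0^T\delta_{X_t}dt\in\mathcal P(V)$ and the empirical flow $\bar Q_T(X)(y,z)=\frac1T\#\{t\in[0,T]:X_{t-}=y,X_t=z\}$, $(y,z)\in E$. $\Phi:\mathbb R_+\times\mathbb R_+\to[0,\infty]$: $\Phi(q,p)=q\log\frac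 qp-(q-p)$ if $q,p>0$; $\Phi(0,p)=p$ for $p\ge0$; $\Phi(q,0)=+\infty$ for $q>0$. For $t\in\mathcal S_{T_0}$, $I_t(\mu,Q):=\sum_{(y,z)\in E}\Phi\big(Q(y,z),\mu(y)r(y,z;t)\big)$ for $\mu\in\mathcal P(V)$, $Q\in\mathbb R_+^E$. For $A\in\mathbb R_+^E$ (extended by $A(y,z)=0$ for $(y,z)\notin E$), $\mathrm{div}A(y)=\sum_zA(y,z)-\sum_zA(z,y)$. The equation $\partial_t\mu_t+\mathrm{div}\,Q_t=0$ weakly means $\int_0^{T_0}\sum_y\mu_s(y)\partial_sf(y,s)\,ds=\int_0^{T_0}\sum_y\mathrm{div}\,Q_s(y)f(y,s)\,ds$ for every $f:V\times\mathcal S_{T_0}\to\mathbb R$ that is $C^1$ in time. *)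

(* Defs.v *)
From HB Require Import structures.
From mathcomp Require Import all_boot all_order all_algebra.
From mathcomp Require Import all_classical all_reals all_analysis.

Set Implicit Arguments.
Unset Strict Implicit.
Unset Printing Implicit Defensive.
Import Order.TTheory GRing.Theory Num.Theory.
Import numFieldNormedType.Exports.

Local Open Scope classical_set_scope.
Local Open Scope ring_scope.

(** the state space P(V) x R_+^E is embedded in R^V x R^(V x V), with the
    product (= Euclidean) topology *)
Definition state_space (R : realType) (V : finType) :=
  ({ptws V -> R} * {ptws V -> {ptws V -> R}})%type.

Section PeriodicChain.
Variables (R : realType) (V : finType).

Notation leb := (@lebesgue_measure R).

Definition rates := V -> V -> R -> R.

Definition edge (r : rates) (y z : V) : bool :=
  `[< y != z /\ forall t : R, 0 < t -> 0 < r y z t >].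

Definition periodic (T0 : R) (f : R -> R) := forall t, f (t + T0) = f t.

Definition rates_assumptions (T0 : R) (r : rates) : Prop :=
  [/\ (forall y z t, 0 <= r y z t) /\
      (forall y z, measurable_fun setT (r y z)),
      (forall y z (a b : R), leb.-integrable `[a, b] (fun t => (r y z t)%:E)),
      (forall y z, periodic T0 (r y z)),
      (forall y t, r y y t = 0) &
      [/\
          (forall y z, (exists t, 0 < t /\ 0 < r y z t) ->
                       forall t, 0 < t -> 0 < r y z t),
          (forall y z, connect (edge r) y z),
          (exists M : R, forall y z t, edge r y z -> 0 <= t <= T0 -> r y z t <= M),
          (exists m : R, 0 < m /\
             forall y z t, edge r y z -> 0 <= t <= T0 -> m <= r y z t) &
          leb.-negligible
            ([set t : R | 0 <= t <= T0] `&`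
             [set t | exists y z, ~ {for t, continuous (r y z)}])]].

Definition gen (r : rates) (u : R) (c b : V) : R :=
  if c == b then - \sum_(b' : V) r c b' u else r c b u.

(** p s t a b = transition probability from a at time s to b at time t:
    the (unique) solution of the integral Kolmogorov forward equation
    P(s,t) = Id + \int_s^t P(s,u) L(u) du. *)
Definition kolmogorov (r : rates) (p : R -> R -> V -> V -> R) : Prop :=
  forall s t a b, 0 <= s <= t ->
    leb.-integrable `[s, t]
      (fun u => (\sum_(c : V) p s u a c * gen r u c b)%:E) /\
    p s t a b = (a == b)%:R +
      Rintegral leb `[s, t] (fun u => \sum_(c : V) p s u a c * gen r u c b).

Definition cadlag (X : R -> V) : Prop :=
  (forall t, 0 <= t -> exists d : R, 0 < d /\
     forall s, t <= s < t + d -> X s = X t) /\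
  (forall t, 0 < t -> exists (v : V) (d : R), 0 < d <= t /\
     forall s, t - d < s < t -> X s = v).

Definition jump_at (X : R -> V) (y z : V) (t : R) : Prop :=
  (exists d : R, 0 < d /\ forall s, t - d < s < t -> X s = y) /\ X t = z.

Definition emp_measure (T : R) (X : R -> V) : V -> R :=
  fun y => T^-1 * fine (leb [set t | 0 <= t <= T /\ X t = y]).

Definition emp_flow (r : rates) (T : R) (X : R -> V) : V -> V -> R :=
  fun y z => if edge r y z then
    T^-1 * fine (counting [set t : R | 0 < t <= T /\ jump_at X y z t])
  else 0.

Definition Phi (q p : R) : \bar R :=
  if q == 0 then p%:E
  else if p == 0 then +oo%E
  else (q * ln (q / p) - (q - p))%:E.

Definition It (r : rates) (t : R) (mu : V -> R) (Q : V -> V -> R) : \bar R :=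
  (\sum_(y : V) \sum_(z : V)
     (if edge r y z then Phi (Q y z) (mu y * r y z t) else 0%E))%E.

Definition div (Q : V -> V -> R) (y : V) : R :=
  \sum_(z : V) Q y z - \sum_(z : V) Q z y.

Definition test_fun (T0 : R) (f : V -> R -> R) : Prop :=
  forall y, [/\ periodic T0 (f y),
               (forall t, derivable (f y) t 1) &
               continuous (f y)^`()%classic].

Definition admissible (r : rates) (T0 : R) (mubar : V -> R) (Qbar : V -> V -> R)
    (mu : R -> V -> R) (Q : R -> V -> V -> R) : Prop :=
  [/\ (forall t, mu (t + T0) = mu t /\ Q (t + T0) = Q t) /\
      (forall t, (forall y, 0 <= mu t y) /\ \sum_(y : V) mu t y = 1),
      (forall t y z, 0 <= Q t y z /\ (~~ edge r y z -> Q t y z = 0)),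
      (forall y, measurable_fun setT (fun t => mu t y)) /\
      (forall y z, measurable_fun setT (fun t => Q t y z)),
      (forall f, test_fun T0 f ->
         Rintegral leb `[0, T0] (fun s => \sum_(y : V) mu s y * (f y)^`()%classic s) =
         Rintegral leb `[0, T0] (fun s => \sum_(y : V) div (Q s) y * f y s)) &
      (forall y, (\int[leb]_(t in `[0%R, T0]) (mu t y)%:E = (T0 * mubar y)%:E)%E) /\
      (forall y z, (\int[leb]_(t in `[0%R, T0]) (Q t y z)%:E = (T0 * Qbar y z)%:E)%E)].

(** the rate functional \bar I (inf over the empty set is +oo) *)
Definition Ibar (r : rates) (T0 : R) (pt : state_space R V) : \bar R :=
  ereal_inf [set v : \bar R | exists mu Q, admissible r T0 pt.1 pt.2 mu Q /\
     v = ((T0^-1)%:E * \int[leb]_(t in `[0%R, T0]) It r t (mu t) (Q t))%E].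

End PeriodicChain.

Section LDP.
Variable (R : realType).
Local Open Scope ereal_scope.

Definition good_rate_function (X : topologicalType) (I : X -> \bar R) : Prop :=
  (forall x, 0 <= I x) /\
  (forall a : R, closed [set x | I x <= a%:E]) /\
  (forall a : R, compact [set x | I x <= a%:E]).

Definition LDP (X : topologicalType) (mu : nat -> set X -> \bar R)
    (s : nat -> R) (I : X -> \bar R) : Prop :=
  good_rate_function I /\
  (forall C : set X, closed C ->
     limn_esup (fun n => (s n)^-1%:E * lne (mu n C)) <= - ereal_inf (I @` C)) /\
  (forall G : set X, open G ->
     - ereal_inf (I @` G) <= limn_einf (fun n => (s n)^-1%:E * lne (mu n G))).

End LDP.

Definition convex_functional (R : realType) (V : finType)
    (I : state_space R V -> \bar R) : Prop :=
  forall (a b : state_space R V) (l : R), (0 <= l <= 1)%R ->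
    (I ((fun y => l * a.1 y + (1 - l) * b.1 y)%R,
        (fun y z => l * a.2 y z + (1 - l) * b.2 y z)%R)
     <= l%:E * I a + (1 - l)%R%:E * I b)%E.

(* Main.v *)
(* For a direction th = (H, g), tilting the jump rates by exp g and the time spent by H gives a
   linear T0-periodic system. Perron-Frobenius theory for its period map yields a multiplier rho
   with positive forward and backward solutions v, u. Telescoping u along the discretized chain
   shows that the exponential moment of T (th . (mu, Q)) is exp (T Lam th) up to constants, where
   Lam th = ln rho / T0, which gives exponential bounds on half-spaces.

   On the other side the Fenchel inequality for Phi, summed along an admissible path and combined
   with the weak continuity equation tested against ln u, gives Ibar >= th . pt - Lam th, with
   equality at the point Xpt th carried by the path (u v, v r exp(g) u). Hence Xpt th is a
   subgradient of Lam at th; it depends continuously on th, so Lam is differentiable. Minimizing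
   Lam th - th . pt + eps |th|^2 / 2 (Moreau regularization) shows that every pt with finite
   Legendre transform is a limit of points Xpt th with no larger transform; since the level sets of
   Ibar are closed, Ibar is the Legendre transform of Lam. The upper bound then follows by covering
   with half-spaces and the lower bound by tilting towards the exposed points Xpt th.

   The level sets of Ibar are closed because near-minimizers of the strictly convex sum of the
   integrals of q ln q - q + 1 over the near-optimal admissible pairs converge in L^1. *)

Require Import Defs.
From HB Require Import structures.
From mathcomp Require Import all_boot all_order all_algebra.
From mathcomp Require Import finmap.
From mathcomp Require Import all_classical all_reals all_analysis.
From mathcomp Require Import measurable_realfun ring lra.
Set Implicit Arguments.
Unset Strict Implicit.
Unset Printing Implicit Defensive.
Import Order.TTheory GRing.Theory Num.Theory.
Import numFieldNormedType.Exports.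
Local Open Scope classical_set_scope.
Local Open Scope ring_scope.

(** * Integration of locally bounded functions *)
Section Calculus.
Variable R : realType.
Implicit Types (f g F G : R -> R) (a b c s t : R).
Local Notation leb := (@lebesgue_measure R).

(** The rates are merely bounded and measurable in time, so the linear systems cannot be
    differentiated pointwise: every equation is kept in integral form, and the rules for products
    and logarithms are proved for primitives of locally bounded functions. The law of the chain is
    given only through finite-dimensional distributions. Exponential moments are therefore computed
    exactly for the chain sampled on a grid, and the mesh then tends to zero: Fatou yields the upper
    bound, and a second moment, supplied by the doubled tilt, prevents loss of mass in the lower
    bound. Discontinuities of the rates matter only where [ln u] enters the weak equation: it is
    Lipschitz, it is smoothed by averaging, and the derivatives of the averages converge wherever
    the rates are continuous. In the closedness of the level sets, strong L^1 convergence takes the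
    place of weak compactness, so that the nonlinear cost passes to the limit by lower
    semicontinuity of [Phi] and Fatou. *)

Definition lbm f := measurable_fun setT f /\
  forall a b, exists C : R, 0 <= C /\ forall t, a <= t <= b -> `|f t| <= C.

Definition RI a b f : R := Rintegral leb `[a, b] f.

Lemma leb_itvcc a b : a <= b -> leb `[a, b] = (b - a)%:E.
Proof.
move=> ab; rewrite lebesgue_measure_itv/= lte_fin.
case: ltP => [_|ba]; first by rewrite EFinB.
by congr EFin; apply/eqP; rewrite eq_sym subr_eq0 eq_le ab ba.
Qed.

Lemma leb_itv_fin a b : (leb `[a, b] < +oo)%E.
Proof. by rewrite lebesgue_measure_itv/=; case: ifP => // _; rewrite -EFinB ltry. Qed.

Lemma lbm_integrable f a b : lbm f -> leb.-integrable `[a, b] (EFin \o f).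
Proof.
case=> mf /(_ a b)[C [C0 HC]].
apply: measurable_bounded_integrable => //.
- exact: leb_itv_fin.
- exact: measurable_funS mf.
- exists C; split; first exact: num_real.
  move=> M CM x /=; rewrite in_itv/= => xab.
  exact: le_trans (HC _ xab) (ltW CM).
Qed.

Lemma lbm_cst c : lbm (fun=> c).
Proof.
split; first exact: measurable_cst.
by move=> a b; exists `|c|; split.
Qed.

Lemma lbmD f g : lbm f -> lbm g -> lbm (fun t => f t + g t).
Proof.
move=> [mf hf] [mg hg]; split; first exact: measurable_funD.
move=> a b; have [C [C0 HC]] := hf a b; have [D [D0 HD]] := hg a b.
exists (C + D); split; first exact: addr_ge0.
move=> t tab; apply: (le_trans (ler_normD _ _)).
by apply: lerD; [exact: HC|exact: HD].
Qed.

Lemma lbmM f g : lbm f -> lbm g -> lbm (fun t => f t * g t).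
Proof.
move=> [mf hf] [mg hg]; split; first exact: measurable_funM.
move=> a b; have [C [C0 HC]] := hf a b; have [D [D0 HD]] := hg a b.
exists (C * D); split; first exact: mulr_ge0.
move=> t tab; rewrite normrM.
by apply: ler_pM => //; [exact: HC|exact: HD].
Qed.

Lemma lbmN f : lbm f -> lbm (fun t => - f t).
Proof.
move=> hf; have := @lbmM (fun=> -1) f (lbm_cst _) hf.
by under eq_fun do rewrite mulN1r.
Qed.

Lemma lbmB f g : lbm f -> lbm g -> lbm (fun t => f t - g t).
Proof. by move=> hf /lbmN; exact: lbmD. Qed.

Lemma lbm_sum (I : Type) (s : seq I) (f : I -> R -> R) :
  (forall i, lbm (f i)) -> lbm (fun t => \sum_(i <- s) f i t).
Proof.
move=> hf; elim: s => [|i s IH].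
  by under eq_fun do rewrite big_nil; exact: lbm_cst.
by under eq_fun do rewrite big_cons; exact: lbmD.
Qed.

Lemma lbm_cont f : continuous f -> lbm f.
Proof.
move=> cf; split.
  exact: continuous_measurable_fun.
move=> a b; case: (leP a b) => [ab|ba]; last first.
  exists 0; split => // t /andP[h1 h2].
  by have := le_trans h1 h2; rewrite leNgt ba.
have : compact (f @` `[a, b]).
  apply: continuous_compact; last exact: segment_compact.
  exact: continuous_subspaceT.
move=> /compact_bounded[M [Mr HM]].
exists (`|M| + 1); split; first by rewrite addr_ge0.
move=> t tab; apply: (HM (`|M| + 1)).
  by rewrite (le_lt_trans (ler_norm M))// ltrDl.
by exists t.
Qed.

Lemma lbm_shift f c : lbm f -> lbm (fun t => f (t + c)).
Proof.
move=> [mf hf]; split.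
  apply: (measurableT_comp mf).
  exact: measurable_funD.
move=> a b; have [C [C0 HC]] := hf (a + c) (b + c).
by exists C; split => // t /andP[h1 h2]; apply: HC; rewrite !lerD2r h1.
Qed.

Lemma lbm_opp f : lbm f -> lbm (fun t => f (- t)).
Proof.
move=> [mf hf]; split.
  exact: (measurableT_comp mf).
move=> a b; have [C [C0 HC]] := hf (- b) (- a).
by exists C; split => // t /andP[h1 h2]; apply: HC; rewrite !lerN2 h2.
Qed.

Lemma eq_RI f g a b : (forall t, a <= t <= b -> f t = g t) -> RI a b f = RI a b g.
Proof. by move=> fg; apply: eq_Rintegral => t; rewrite inE/= in_itv/=; exact: fg. Qed.

Lemma RID f g a b : lbm f -> lbm g ->
  RI a b (fun t => f t + g t) = RI a b f + RI a b g.
Proof. by move=> hf hg; apply: RintegralD => //; exact: lbm_integrable. Qed.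

Lemma RIB f g a b : lbm f -> lbm g ->
  RI a b (fun t => f t - g t) = RI a b f - RI a b g.
Proof. by move=> hf hg; apply: RintegralB => //; exact: lbm_integrable. Qed.

Lemma RIZ f c a b : lbm f -> RI a b (fun t => c * f t) = c * RI a b f.
Proof. by move=> hf; apply: RintegralZl => //; exact: lbm_integrable. Qed.

Lemma RI_cst c a b : a <= b -> RI a b (fun=> c) = c * (b - a).
Proof. move=> ab; rewrite /RI Rintegral_cst//; congr (_ * _).
exact: (congr1 fine (leb_itvcc ab)). Qed.

Lemma RI_sum (I : Type) (r : seq I) (f : I -> R -> R) a b :
  (forall i, lbm (f i)) ->
  RI a b (fun t => \sum_(i <- r) f i t) = \sum_(i <- r) RI a b (f i).
Proof.
move=> hf; elim: r => [|i r IH].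
  under eq_RI => t _ do rewrite big_nil.
  rewrite big_nil /RI Rintegral_cst// mul0r//.
under eq_RI => t _ do rewrite big_cons.
rewrite big_cons RID ?IH//; exact: lbm_sum.
Qed.

Lemma RI_le f g a b : lbm f -> lbm g -> (forall t, a <= t <= b -> f t <= g t) ->
  RI a b f <= RI a b g.
Proof.
move=> hf hg fg; apply: le_Rintegral => //; exact: lbm_integrable.
Qed.

Lemma RI_ge0 f a b : (forall t, a <= t <= b -> 0 <= f t) -> 0 <= RI a b f.
Proof. by move=> h; apply: Rintegral_ge0 => t /=; rewrite in_itv/=; exact: h. Qed.

Lemma RI_bound f a b C : lbm f -> a <= b -> (forall t, a <= t <= b -> `|f t| <= C) ->
  `|RI a b f| <= C * (b - a).
Proof.
move=> hf ab hC; rewrite -RI_cst// ler_norml; apply/andP; split.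
  have -> : - RI a b (fun=> C) = RI a b (fun=> - C) by rewrite !RI_cst// mulNr.
  apply: RI_le => //; first exact: lbm_cst.
  by move=> t /hC; rewrite ler_norml => /andP[].
apply: RI_le => //; first exact: lbm_cst.
by move=> t /hC; rewrite ler_norml => /andP[].
Qed.

Lemma RI_chasles f a b c : lbm f -> a <= b -> b <= c ->
  RI a c f = RI a b f + RI b c f.
Proof.
move=> hf ab bc; have := @Rintegral_itvB _ f (BLeft a) (BRight c) b.
move=> /(_ (lbm_integrable a c hf)); rewrite !bnd_simp => /(_ ab bc).
rewrite Rintegral_itv_obnd_cbnd; last first.
  apply: integrableS (lbm_integrable b c hf) => //.
  by apply: subset_itvr; rewrite bnd_simp.
by rewrite /RI => <-; rewrite addrC subrK.
Qed.

Lemma RI_same f a : RI a a f = 0.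
Proof. by rewrite /RI set_itv1 Rintegral_set1. Qed.

Lemma RI_gt f a b : b < a -> RI a b f = 0.
Proof. by move=> ba; rewrite /RI set_itv_ge ?Rintegral_set0// bnd_simp -ltNge. Qed.

(** By uniqueness of Lebesgue measure, it is enough that the pushforward gives half-open intervals
    their length. *)
Lemma lebesgue_measure_shift c (A : set R) : measurable A ->
  pushforward leb ((fun t => t + c) : _ -> measurableTypeR R) A = leb A.
Proof.
move=> mA; apply/esym.
have mc : measurable_fun setT ((fun t => t + c) : R -> measurableTypeR R).
  exact: measurable_funD.
pose H := isMeasurableFun.Build _ _ _ _ ((fun t => t + c) : R -> measurableTypeR R) mc.
pose F : {mfun R >-> measurableTypeR R} := HB.pack ((fun t => t + c) : R -> measurableTypeR R) H.
apply: (@lebesgue_measure_unique R (pushforward leb F)) => //= _ [[a b]] _ <-.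
rewrite /pushforward/=.
rewrite (_ : (fun t => t + c) @^-1` _ = `]a - c, b - c]%classic).
  rewrite !lebesgue_measure_itv/= !lte_fin ltrD2r.
  by case: ifP => //= _; congr EFin; lra.
by apply/seteqP; split => t /=; rewrite !in_itv/= ltrBlDr lerBrDr.
Qed.

Lemma RI_shift f a b c : lbm f -> RI (a + c) (b + c) f = RI a b (fun t => f (t + c)).
Proof.
move=> hf; rewrite /RI /Rintegral; congr fine.
have mc : measurable_fun setT ((fun t => t + c) : measurableTypeR R -> measurableTypeR R).
  exact: measurable_funD.
have E : (fun t => t + c) @^-1` `[a + c, b + c]%classic = `[a, b]%classic.
  by apply/seteqP; split => t /=; rewrite !in_itv/= !lerD2r.
have := @integral_pushforward _ _ (measurableTypeR R) (measurableTypeR R) R (fun t : R => t + c) mc leb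
  `[a + c, b + c]%classic (EFin \o f).
rewrite E => <- //; last 2 first.
- by apply/measurable_EFinP; case: hf.
- exact: (lbm_integrable a b (lbm_shift c hf)).
by apply: eq_measure_integral => A mA _; apply/esym/lebesgue_measure_shift.
Qed.

Lemma RI_opp f a b : lbm f -> RI (- b) (- a) f = RI a b (fun t => f (- t)).
Proof.
move=> hf; rewrite /RI /Rintegral; congr fine.
have E : (-%R) @^-1` `[- b, - a]%classic = `[a, b]%classic.
  by apply/seteqP; split => t /=; rewrite !in_itv/= !lerN2 andbC.
have mc : measurable_fun setT (-%R : measurableTypeR R -> measurableTypeR R) by [].
have := @integral_pushforward _ _ (measurableTypeR R) (measurableTypeR R) R (-%R : R -> R) mc leb
  `[- b, - a]%classic (EFin \o f).
rewrite E => <- //; last 2 first.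
- by apply/measurable_EFinP; case: hf.
- exact: (lbm_integrable a b (lbm_opp hf)).
by apply: eq_measure_integral => A mA _; apply/esym/lebesgue_measureN.
Qed.

(** Integral form of the equation F' = f on [a, b]. With measurable rates a solution is only
    Lipschitz, so this replaces the derivative throughout. *)
Definition prim_on a b F f := forall s t, a <= s -> s <= t -> t <= b ->
  F t - F s = RI s t f.

Lemma prim_on_lip f F a b C : lbm f -> prim_on a b F f ->
  (forall t, a <= t <= b -> `|f t| <= C) ->
  forall s t, a <= s -> s <= t -> t <= b -> `|F t - F s| <= C * (t - s).
Proof.
move=> hf pF hC s t as_ st tb; rewrite pF//; apply: RI_bound => // u /andP[su ut].
by apply: hC; rewrite (le_trans as_ su) (le_trans ut tb).
Qed.

Lemma lip_cont F : (forall a b, exists C : R, 0 <= C /\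
    forall s t, a <= s -> s <= t -> t <= b -> `|F t - F s| <= C * (t - s)) ->
  continuous F.
Proof.
move=> h x; have [C [C0 HC]] := h (x - 1) (x + 1).
apply/cvgrPdist_le => /= e e0; near=> t.
have d : `|x - t| <= Num.min 1 (e / (C + 1)).
  near: t; apply: cvgr_dist_le; first exact: cvg_id.
  by rewrite lt_min ltr01 divr_gt0// ltr_wpDl.
have d1 : `|x - t| <= 1 by rewrite (le_trans d)// ge_min lexx.
have d2 : `|x - t| <= e / (C + 1) by rewrite (le_trans d)// ge_min lexx orbT.
have Ce : C * `|x - t| <= e.
  apply: (@le_trans _ _ ((C + 1) * (e / (C + 1)))).
    by apply: ler_pM => //; rewrite lerDl.
  by rewrite mulrC divfK// gt_eqF// ltr_wpDl.
move: d1; rewrite ler_norml => /andP[d1 d1'].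
case: (leP t x) => tx.
  apply: (le_trans (HC t x _ _ _)) => //; try lra.
  by move: Ce; rewrite ger0_norm//; lra.
rewrite distrC; apply: (le_trans (HC x t _ _ _)) => //; try lra.
by move: Ce; rewrite ler0_norm; lra.
Unshelve. all: by end_near. Qed.

Lemma prim_cont f F : lbm f -> (forall a b, prim_on a b F f) -> continuous F.
Proof.
move=> hf pF; apply: lip_cont => a b; have [C [C0 HC]] := hf.2 a b.
by exists C; split => //; exact: prim_on_lip (pF a b) HC.
Qed.

Lemma RI_cont f a : lbm f -> continuous (fun t => RI a t f).
Proof.
move=> hf; apply: lip_cont => x y; have [C [C0 HC]] := hf.2 (Num.min a x) y.
exists C; split => // s t xs st ty.
case: (leP a s) => as_.
  rewrite (RI_chasles hf as_ st) addrC addKr; apply: RI_bound => // u /andP[h1 h2].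
  by apply: HC; rewrite ge_min (le_trans xs h1) orbT (le_trans h2 ty).
rewrite (RI_gt _ as_) subr0.
case: (leP a t) => at_; last by rewrite (RI_gt _ at_) normr0 mulr_ge0// subr_ge0.
apply: (@le_trans _ _ (C * (t - a))).
  apply: RI_bound => // u /andP[h1 h2].
  by apply: HC; rewrite ge_min h1 (le_trans h2 ty).
by apply: ler_wpM2l => //; lra.
Qed.

(* Telescoping over n cells leaves an error of order 1/n. *)
Lemma quad_const (D : R -> R) a b C : a <= b ->
  (forall s t, a <= s -> s <= t -> t <= b -> `|D t - D s| <= C * (t - s) ^+ 2) ->
  D b = D a.
Proof.
move=> ab hD; apply/eqP; rewrite -subr_eq0 -normr_le0.
have key n : `|D b - D a| <= C * (b - a) ^+ 2 / n.+1%:R.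
  pose x i := a + (b - a) * i%:R / n.+1%:R.
  have n0 : 0 < n.+1%:R :> R by rewrite ltr0n.
  have -> : D b - D a = \sum_(0 <= i < n.+1) (D (x i.+1) - D (x i)).
    rewrite telescope_sumr// /x; congr (D _ - D _).
      by rewrite mulfK ?gt_eqF//; lra.
    by rewrite mulr0 mul0r addr0.
  rewrite big_mkord; apply: (le_trans (ler_norm_sum _ _ _)).
  have -> : C * (b - a) ^+ 2 / n.+1%:R =
      \sum_(i < n.+1) C * ((b - a) / n.+1%:R) ^+ 2.
    rewrite sumr_const card_ord -[RHS]mulr_natr.
    have : n.+1%:R != 0 :> R by rewrite gt_eqF.
    by move: n.+1%:R => q q0; field.
  apply: ler_sum => i _.
  have dx : x i.+1 - x i = (b - a) / n.+1%:R.
    rewrite /x -(@natr1 R i); move: (i%:R) => q; field.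
    by rewrite gt_eqF.
  rewrite -dx; apply: hD.
  - by rewrite /x lerDl divr_ge0// mulr_ge0// ?ler0n// subr_ge0.
  - by rewrite -subr_ge0 dx divr_ge0// ?subr_ge0// ltW.
  - rewrite /x -lerBrDl ler_pdivrMr//; apply: ler_wpM2l; first by rewrite subr_ge0.
    by rewrite ler_nat.
apply/ler_addgt0Pr => e e0; rewrite add0r.
pose K := C * (b - a) ^+ 2.
have [n Hn] : exists n, K / n.+1%:R <= e.
  exists (Num.truncn (`|K| / e)).
  rewrite ler_pdivrMr ?ltr0n// mulrC -ler_pdivrMr//.
  apply: (@le_trans _ _ (`|K| / e)); first by rewrite ler_pM2r ?invr_gt0// ler_norm.
  by rewrite ltW// truncnS_gt.
exact: le_trans (key n) Hn.
Qed.

(** A second-order error on every subinterval already forces equality: [quad_const] applied to the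
    difference of F and the indefinite integral of f. The rules for products and logarithms below
    only have to be checked to this precision. *)
Lemma prim_quad f F a b C : lbm f -> a <= b ->
  (forall s t, a <= s -> s <= t -> t <= b ->
     `|F t - F s - RI s t f| <= C * (t - s) ^+ 2) ->
  prim_on a b F f.
Proof.
move=> hf ab h s t as_ st tb.
have := @quad_const (fun u => F u - RI s u f) s t C st.
move=> /(_ _)/eqP; rewrite RI_same subr0 => H; apply/eqP; rewrite subr_eq addrC -subr_eq.
apply: H => u v su uv vt.
rewrite (RI_chasles hf su uv).
rewrite (_ : _ - _ - (_ - _) = F v - F u - RI u v f); last by ring.
by apply: h => //; [exact: le_trans su|exact: le_trans tb].
Qed.

(** Bounds A, B on f, g are Lipschitz constants of F, G. The factor 3 counts two errors from
    freezing G and F at the left end under the integral, and one from the product of the two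
    increments, each of size A B (t - s)^2. *)
Lemma prim_mul F G f g a b : a <= b -> lbm f -> lbm g -> lbm F -> lbm G ->
  prim_on a b F f -> prim_on a b G g ->
  prim_on a b (fun t => F t * G t) (fun t => f t * G t + F t * g t).
Proof.
move=> ab hf hg hF hG pF pG.
have [A [A0 HA]] := hf.2 a b; have [B [B0 HB]] := hg.2 a b.
have [C [C0 HC]] := hF.2 a b; have [D [D0 HD]] := hG.2 a b.
apply: (@prim_quad _ _ _ _ (3 * (A * B))) => //.
  by apply: lbmD; exact: lbmM.
move=> s t as_ st tb.
have ts0 : 0 <= t - s by rewrite subr_ge0.
have LF u v : a <= u -> u <= v -> v <= b -> `|F v - F u| <= A * (v - u).
  exact: prim_on_lip pF HA u v.
have LG u v : a <= u -> u <= v -> v <= b -> `|G v - G u| <= B * (v - u).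
  exact: prim_on_lip pG HB u v.
have -> : F t * G t - F s * G s =
  G s * (F t - F s) + F s * (G t - G s) + (F t - F s) * (G t - G s) by ring.
rewrite (pF s t)// (pG s t)//.
rewrite -(@RIZ _ (G s) s t hf) -(@RIZ _ (F s) s t hg) -RID; try (apply: lbmM => //; exact: lbm_cst).
have -> x y z : x + y - z = (x - z) + y :> R by ring.
rewrite -RIB; last 2 first.
- by apply: lbmD; apply: lbmM => //; exact: lbm_cst.
- by apply: lbmD; apply: lbmM.
apply: (le_trans (ler_normD _ _)).
have -> : 3 * (A * B) * (t - s) ^+ 2 =
  (2 * (A * B) * (t - s)) * (t - s) + (A * (t - s)) * (B * (t - s)) by ring.
apply: lerD.
  apply: RI_bound => //.
    apply: lbmB; first by apply: lbmD; apply: lbmM => //; exact: lbm_cst.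
    by apply: lbmD; apply: lbmM.
  move=> u /andP[su ut].
  have au : a <= u by exact: le_trans su.
  have ub : u <= b by exact: le_trans tb.
  have -> : G s * f u + F s * g u - (f u * G u + F u * g u) =
    - (f u * (G u - G s) + (F u - F s) * g u) by ring.
  rewrite normrN; apply: (le_trans (ler_normD _ _)).
  have -> : 2 * (A * B) * (t - s) = A * (B * (t - s)) + (A * (t - s)) * B by ring.
  rewrite !normrM; apply: lerD; apply: ler_pM => //.
  - by apply: HA; rewrite au.
  - apply: (le_trans (LG s u _ _ _)) => //; apply: ler_wpM2l => //; lra.
  - apply: (le_trans (LF s u _ _ _)) => //; apply: ler_wpM2l => //; lra.
  - by apply: HB; rewrite au.
rewrite normrM; apply: ler_pM => //.
  by rewrite -(pF s t)//; exact: LF.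
by rewrite -(pG s t)//; exact: LG.
Qed.

Lemma ln_bounds (x y : R) : 0 < x -> 0 < y ->
  (y - x) / y <= ln y - ln x <= (y - x) / x.
Proof.
move=> x0 y0.
have key (u v : R) : 0 < u -> 0 < v -> ln v - ln u <= (v - u) / u.
  move=> u0 v0; rewrite -ln_div ?posrE//.
  have -> : (v - u) / u = v / u - 1 by rewrite mulrBl divff// gt_eqF.
  have := @le_ln1Dx R (v / u - 1).
  by rewrite subrKC; apply; rewrite ltrBrDl subrr divr_gt0.
rewrite key// andbT.
have := key y x y0 x0; move=> h; rewrite -lerN2; apply: le_trans (_ : ln x - ln y <= _).
  by rewrite opprB.
apply: (le_trans h); by rewrite -mulNr opprB.
Qed.

(** By [ln_bounds] the increment of ln F lies between the increment of F divided by F t and by F s.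
    Both this gap and the error of freezing 1 / F under the integral are quadratic, since F >= e
    makes the inverse Lipschitz with constant e^-2. *)
Lemma prim_ln F f a b e : a <= b -> lbm f -> lbm F -> lbm (fun t => (F t)^-1) -> 0 < e ->
  (forall t, a <= t <= b -> e <= F t) ->
  prim_on a b F f -> prim_on a b (fun t => ln (F t)) (fun t => f t / F t).
Proof.
move=> ab hf hF hFV e0 He pF.
have [A [A0 HA]] := hf.2 a b.
have LF u v : a <= u -> u <= v -> v <= b -> `|F v - F u| <= A * (v - u).
  exact: prim_on_lip pF HA u v.
apply: (@prim_quad _ _ _ _ (2 * (A * A / (e * e)))) => //; first exact: lbmM.
move=> s t as_ st tb.
have ts0 : 0 <= t - s by rewrite subr_ge0.
have Fs : e <= F s by apply: He; rewrite as_ (le_trans st).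
have Ft : e <= F t by apply: He; rewrite tb (le_trans as_).
have Fs0 := lt_le_trans e0 Fs; have Ft0 := lt_le_trans e0 Ft.
have diff u v : e <= u -> e <= v -> `|u^-1 - v^-1| <= `|u - v| / (e * e).
  move=> eu ev; have u0 := lt_le_trans e0 eu; have v0 := lt_le_trans e0 ev.
  have -> : u^-1 - v^-1 = (v - u) / (u * v) by field; rewrite !gt_eqF.
  rewrite normrM (ger0_norm (_ : 0 <= (u * v)^-1)); last by rewrite invr_ge0 mulr_ge0// ltW.
  rewrite distrC; apply: ler_wpM2l => //.
  by rewrite lef_pV2 ?posrE ?mulr_gt0//; apply: ler_pM => //; exact: ltW.
have dF : `|F t - F s| <= A * (t - s) by exact: LF.
have -> : 2 * (A * A / (e * e)) * (t - s) ^+ 2 =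
   (A * (t - s)) * ((A * (t - s)) / (e * e)) + (A * ((A * (t - s)) / (e * e))) * (t - s).
  by field; rewrite gt_eqF.
have -> : ln (F t) - ln (F s) - RI s t (fun u => f u / F u) =
  (ln (F t) - ln (F s) - (F t - F s) / F s) +
    RI s t (fun u => (F s)^-1 * f u - f u / F u).
  rewrite RIB//; [|exact: lbmM (lbm_cst _) hf|exact: lbmM].
  rewrite RIZ// -pF//; ring.
apply: (le_trans (ler_normD _ _)); apply: lerD.
  have /andP[h1 h2] := ln_bounds Fs0 Ft0.
  rewrite ler0_norm ?subr_le0// opprB.
  apply: (@le_trans _ _ (`|F t - F s| * `|(F s)^-1 - (F t)^-1|)).
    rewrite -normrM; apply: le_trans (ler_norm _).
    rewrite mulrBr; lra.
  apply: ler_pM => //; apply: (le_trans (diff _ _ Fs Ft)).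
  by rewrite ler_wpM2r ?invr_ge0 ?mulr_ge0 ?(ltW e0)// distrC.
apply: RI_bound => //.
  by apply: lbmB; apply: lbmM => //; exact: lbm_cst.
move=> u /andP[su ut].
have au : a <= u by exact: le_trans su.
have ub : u <= b by exact: le_trans tb.
rewrite [_ * f u]mulrC -mulrBr normrM; apply: ler_pM => //.
  by apply: HA; rewrite au.
apply: (le_trans (diff _ _ Fs _)); first by apply: He; rewrite au.
rewrite ler_wpM2r ?invr_ge0 ?mulr_ge0 ?(ltW e0)// distrC.
apply: (le_trans (LF s u _ _ _)) => //; apply: ler_wpM2l => //; lra.
Qed.

Lemma lbm_expR c : lbm (fun t => expR (c * t)).
Proof.
apply: lbm_cont => x; apply: continuous_comp; last exact: continuous_expR.
by apply: continuousM; [exact: cst_continuous|exact: cvg_id].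
Qed.

Lemma RI_expR c t : 0 < c -> 0 <= t ->
  RI 0 t (fun s => expR (c * s)) = (expR (c * t) - 1) / c.
Proof.
move=> c0; rewrite le_eqVlt => /orP[/eqP <-|t0].
  by rewrite RI_same mulr0 expR0 subrr mul0r.
have d1 (x : R) : is_derive x 1 (fun s => expR (c * s) / c) (expR (c * x)).
  have : is_derive x 1 (fun s : R => c * s) c.
    have := @is_deriveM R R (fun=> c) id x 1 0 1 (is_derive_cst _ _ _) (is_derive_id _ _).
    by rewrite /= scaler0 addr0 /GRing.scale/= mulr1.
  move=> /(is_derive1_comp (is_derive_expR _)) h.
  have := @is_deriveM R R (expR \o (fun s : R => c * s)) (fun=> c^-1) x 1 _ 0 h (is_derive_cst _ _ _).
  rewrite /= scaler0 add0r /GRing.scale/= => h2.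
  apply: is_derive_eq h2 _.
  by field; rewrite gt_eqF.
have cexp : continuous (fun s => expR (c * s)).
  move=> x; apply: continuous_comp; last exact: continuous_expR.
  by apply: continuousM; [exact: cst_continuous|exact: cvg_id].
rewrite /RI /Rintegral (@continuous_FTC2 _ _ (fun s => expR (c * s) / c))//=.
- by rewrite mulr0 expR0 mulrBl.
- exact: continuous_subspaceT.
- have cF : continuous (fun s => expR (c * s) / c).
    move=> x; apply: differentiable_continuous; apply/derivable1_diffP.
    by have [] := d1 x.
  split.
  + by move=> x _; have [] := d1 x.
  + by apply: cvg_at_right_filter; exact: cF.
  + by apply: cvg_at_left_filter; exact: cF.
- by move=> x _; rewrite derive1E; have [_ ->] := d1 x.
Qed.

Lemma cvg_sumr (I T : Type) (F : set_system T) {FF : Filter F} (r : seq I)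
    (f : I -> T -> R) (l : I -> R) :
  (forall i, f i x @[x --> F] --> l i) ->
  \sum_(i <- r) f i x @[x --> F] --> \sum_(i <- r) l i.
Proof.
move=> h; elim: r => [|i r IH].
  by rewrite big_nil; under eq_cvg do rewrite big_nil; exact: cvg_cst.
by rewrite big_cons; under eq_cvg do rewrite big_cons; exact: cvgD.
Qed.

Lemma RI_dominated (f_ : nat -> R -> R) f a b (C : R) :
  (forall n, lbm (f_ n)) -> lbm f ->
  (forall n t, a <= t <= b -> `|f_ n t| <= C) ->
  (forall t, a <= t <= b -> f_ n t @[n --> \oo] --> f t) ->
  RI a b (f_ n) @[n --> \oo] --> RI a b f.
Proof.
move=> hf_ hf hC cvf.
have mC : leb.-integrable `[a, b] (EFin \o (fun=> C)) by exact: lbm_integrable (lbm_cst C).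
have := @dominated_convergence _ _ R leb `[a, b]%classic (measurable_itv _)
  (fun n => EFin \o f_ n) (EFin \o f) (EFin \o (fun=> C)).
case=> //.
- by move=> n; apply/measurable_EFinP; exact: measurable_funS (hf_ n).1.
- by apply/measurable_EFinP; exact: measurable_funS hf.1.
- apply: aeW => t /=; rewrite in_itv/= => tab.
  by apply: cvg_EFin; [exact: nearW|exact: cvf].
- by apply: aeW => t n /=; rewrite in_itv/= lee_fin => tab; exact: hC.
move=> _ _ h; rewrite /RI /Rintegral.
apply: fine_cvg; rewrite fineK//.
by apply: integrable_fin_num => //; exact: lbm_integrable.
Qed.

(* The weight expR (2 C t) turns the integral operator into a 1/2-contraction for the sup norm. *)
Lemma gronwall (D : R -> R) (A C T : R) : 0 <= T -> 0 < C -> 0 <= A -> lbm D ->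
  (forall t, 0 <= t <= T -> D t <= A + C * RI 0 t D) ->
  forall t, 0 <= t <= T -> D t <= 2 * A * expR (2 * C * T).
Proof.
move=> T0 C0 A0 hD H.
have [B [B0 HB]] := hD.2 0 T.
pose E := [set D t * expR (- (2 * C * t)) | t in `[0, T]].
have c2 : 0 < 2 * C by rewrite mulr_gt0.
have Eub : has_ubound E.
  exists B; move=> z [t]; rewrite /= in_itv/= => tT <-.
  apply: (@le_trans _ _ (B * 1)); last by rewrite mulr1.
  apply: (le_trans (ler_norm _)); rewrite normrM; apply: ler_pM => //; first exact: HB.
  rewrite ger0_norm ?expR_ge0// -[leRHS]expR0 ler_expR oppr_le0 mulr_ge0 ?(ltW c2)//.
  by case/andP: tT.
pose S := sup E.
have HS t : 0 <= t <= T -> D t <= S * expR (2 * C * t).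
  move=> tT; rewrite -ler_pdivrMr ?expR_gt0// -expRN; apply: ub_le_sup => //.
  by exists t => //=; rewrite in_itv.
have hexp := lbm_expR (2 * C).
have intexp t : 0 <= t -> RI 0 t (fun s => expR (2 * C * s)) = (expR (2 * C * t) - 1) / (2 * C).
  exact: RI_expR.
have HA t : 0 <= t <= T -> D t * expR (- (2 * C * t)) <= A + `|S| / 2.
  move=> tT; have t0 : 0 <= t by case/andP: tT.
  rewrite expRN ler_pdivrMr ?expR_gt0//.
  apply: (le_trans (H t tT)).
  have : RI 0 t D <= RI 0 t (fun s => `|S| * expR (2 * C * s)).
    apply: RI_le => //; first by apply: lbmM => //; exact: lbm_cst.
    move=> s /andP[s0 st]; apply: (@le_trans _ _ (S * expR (2 * C * s))).
      by apply: HS; rewrite s0 (le_trans st)//; case/andP: tT.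
    by rewrite ler_wpM2r ?expR_ge0// ler_norm.
  rewrite RIZ// intexp//.
  have e1 : 1 <= expR (2 * C * t) by rewrite -[leLHS]expR0 ler_expR mulr_ge0// ltW.
  move=> h; apply: (@le_trans _ _ (A + C * (`|S| * ((expR (2 * C * t) - 1) / (2 * C))))).
    by rewrite lerD2l ler_pM2l.
  have -> : C * (`|S| * ((expR (2 * C * t) - 1) / (2 * C))) = `|S| / 2 * (expR (2 * C * t) - 1).
    by field; rewrite gt_eqF.
  have S0 : 0 <= `|S| by [].
  move: e1; move: (expR _) => q q1; nra.
have SA : S <= A + `|S| / 2.
  apply: sup_le_ub.
    by exists (D 0 * expR (- (2 * C * 0))); exists 0 => //=; rewrite in_itv/= lexx.
  by move=> z [t]; rewrite /= in_itv/= => tT <-; exact: HA.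
have S2A : S <= 2 * A by case: (lerP 0 S) SA => S0; [rewrite ger0_norm//|]; lra.
move=> t tT; apply: (le_trans (HS t tT)).
apply: (@le_trans _ _ (2 * A * expR (2 * C * t))).
  by rewrite ler_wpM2r ?expR_ge0.
rewrite ler_wpM2l ?mulr_ge0// ler_expR ler_pM2l//.
by case/andP: tT.
Qed.

End Calculus.

(** * Linear differential systems with nonnegative coefficients *)
Section Flow.
Variables (R : realType) (V : finType).
Implicit Types (A : R -> V -> V -> R) (v : R -> V -> R) (w : V -> R).

Let n : R := #|V|%:R.

Lemma sum_le_card (f : V -> R) (C : R) : (forall z, f z <= C) -> \sum_z f z <= n * C.
Proof.
move=> h; rewrite /n mulr_natl -sumr_const; apply: ler_sum => z _; exact: h.
Qed.

Definition lbmx A := forall y z, lbm (fun t => A t y z).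
Definition vmul v A (t : R) (z : V) : R := \sum_c v t c * A t c z.

Definition sol A (T : R) v := (forall z, lbm (v^~ z)) /\
  forall (t : R) z, 0 <= t <= T -> v t z = v 0 z + RI 0 t (fun s => vmul v A s z).

Lemma lbm_vmul v A z : (forall c, lbm (v^~ c)) -> lbmx A -> lbm (fun s => vmul v A s z).
Proof. by move=> hv hA; apply: lbm_sum => c; apply: lbmM. Qed.

Lemma lbm_norm (f : R -> R) : lbm f -> lbm (fun t => `|f t|).
Proof.
move=> [mf hf]; split; first by apply: measurableT_comp.
move=> a b; have [C [C0 HC]] := hf a b; exists C; split => // t tab.
by rewrite normr_id; exact: HC.
Qed.

(** Gronwall for the l^1 distance D of the two solutions. The integrand is split as v' (A - A') + A
    (v - v'), which explains why A and v' are the quantities to be bounded. Writing n + 1 for n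
    keeps the Gronwall constant positive without a case on V. *)
Lemma sol_stab (T C B e h : R) A A' v v' : 0 <= T -> 0 < C -> 0 <= B -> 0 <= e -> 0 <= h ->
  lbmx A -> lbmx A' -> sol A T v -> sol A' T v' ->
  (forall (t : R) y z, 0 <= t <= T -> `|A t y z| <= C) ->
  (forall (t : R) y, 0 <= t <= T -> `|v' t y| <= B) ->
  (forall (t : R) y z, 0 <= t <= T -> `|A t y z - A' t y z| <= e) ->
  (forall z, `|v 0 z - v' 0 z| <= h) ->
  forall (t : R) z, 0 <= t <= T ->
    `|v t z - v' t z| <= 2 * ((n + 1) * (h + n * (B * e) * T)) * expR (2 * ((n + 1) * C) * T).
Proof.
move=> T0 C0 B0 e0 h0 lA lA' [lv sv] [lv' sv'] AC vB Ae vh.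
have n0 : 0 <= n by rewrite /n ler0n.
pose D t : R := \sum_z `|v t z - v' t z|.
have lD : lbm D by apply: lbm_sum => z; apply: lbm_norm; exact: lbmB.
have D0 t : 0 <= D t by apply: sumr_ge0.
have key (t : R) z : 0 <= t <= T -> `|v t z - v' t z| <= (h + n * (B * e) * T) + C * RI 0 t D.
  move=> tT; have /andP[t0 tT'] := tT.
  rewrite (sv _ _ tT) (sv' _ _ tT).
  have -> (x y p q : R) : x + p - (y + q) = (x - y) + (p - q) by ring.
  rewrite -RIB; try exact: lbm_vmul.
  apply: (le_trans (ler_normD _ _)); rewrite -addrA; apply: lerD => //.
  pose g s := n * (B * e) + C * D s.
  have lg : lbm g by apply: lbmD; [exact: lbm_cst|apply: lbmM => //; exact: lbm_cst].
  have gs (s : R) : 0 <= s <= T -> `|vmul v A s z - vmul v' A' s z| <= g s.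
    move=> sT; rewrite /vmul -sumrB; apply: (le_trans (ler_norm_sum _ _ _)).
    rewrite /g /D mulr_sumr /n mulr_natl -sumr_const -big_split/=.
    apply: ler_sum => c _.
    have -> : v s c * A s c z - v' s c * A' s c z =
      v' s c * (A s c z - A' s c z) + A s c z * (v s c - v' s c) by ring.
    apply: (le_trans (ler_normD _ _)); rewrite !normrM; apply: lerD; apply: ler_pM => //.
    - exact: vB.
    - exact: Ae.
    - exact: AC.
  have : `|RI 0 t (fun s => vmul v A s z - vmul v' A' s z)| <= RI 0 t g.
    rewrite ler_norml; apply/andP; split.
      have -> : - RI 0 t g = RI 0 t (fun s => -1 * g s) by rewrite RIZ// mulN1r.
      apply: RI_le; [by apply: lbmM => //; exact: lbm_cst| |].
        by apply: lbmB; exact: lbm_vmul.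
      move=> s /andP[s0 st]; rewrite mulN1r.
      have : `|vmul v A s z - vmul v' A' s z| <= g s by apply: gs; rewrite s0 (le_trans st).
      by rewrite ler_norml => /andP[].
    apply: RI_le => //; first by apply: lbmB; exact: lbm_vmul.
    move=> s /andP[s0 st].
    have : `|vmul v A s z - vmul v' A' s z| <= g s by apply: gs; rewrite s0 (le_trans st).
    by rewrite ler_norml => /andP[].
  move=> /le_trans; apply.
  rewrite RID; [|exact: lbm_cst|by apply: lbmM => //; exact: lbm_cst].
  rewrite RI_cst// RIZ// subr0 lerD2r.
  by apply: ler_wpM2l => //; rewrite !mulr_ge0.
have Dle (t : R) : 0 <= t <= T -> D t <= (n + 1) * (h + n * (B * e) * T) + ((n + 1) * C) * RI 0 t D.
  move=> tT; apply: (le_trans (sum_le_card (fun z => key t z tT))).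
  have i0 : 0 <= RI 0 t D by apply: RI_ge0.
  rewrite -[X in _ <= _ + X]mulrA -mulrDr ler_wpM2r//; last by rewrite lerDl.
  by rewrite addr_ge0 ?mulr_ge0 ?addr_ge0 ?mulr_ge0// ltW.
have n1 : 0 < n + 1 by rewrite ltr_wpDl.
move=> t z tT.
have := @gronwall R D ((n + 1) * (h + n * (B * e) * T)) ((n + 1) * C) T T0.
move=> /(_ _ _ lD Dle t tT) H; apply: le_trans (H _ _); last 2 first.
- by rewrite mulr_gt0.
- by rewrite mulr_ge0 ?(ltW n1)// addr_ge0// !mulr_ge0.
by rewrite /D (bigD1 z)//= lerDl sumr_ge0.
Qed.

Lemma sol_uniq (T C : R) A v v' : 0 <= T -> 0 < C -> lbmx A -> sol A T v -> sol A T v' ->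
  (forall (t : R) y z, 0 <= t <= T -> `|A t y z| <= C) ->
  (forall z, v 0 z = v' 0 z) -> forall (t : R) z, 0 <= t <= T -> v t z = v' t z.
Proof.
move=> T0 C0 lA sv sv' AC v0 t z tT.
have : exists B, 0 <= B /\ forall (t : R) y, 0 <= t <= T -> `|v' t y| <= B.
  have /choice[b Hb] := fun y => (sv'.1 y).2 0 T.
  exists (\sum_y b y); split; first by apply: sumr_ge0 => y _; exact: (Hb y).1.
  move=> s y sT; apply: (le_trans ((Hb y).2 s sT)).
  by rewrite (bigD1 y)//= lerDl sumr_ge0// => i _; exact: (Hb i).1.
move=> [B [B0 vB]].
have := @sol_stab T C B 0 0 A A v v' T0 C0 B0 (lexx _) (lexx _) lA lA sv sv' AC vB.
move=> /(_ _ _ t z tT) H; apply/eqP; rewrite -subr_eq0 -normr_le0.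
apply: (le_trans (H _ _)).
- by move=> ? ? ? _; rewrite subrr normr0.
- by move=> ?; rewrite v0 subrr normr0.
- by rewrite !(mulr0, mul0r, addr0).
Qed.

(** The iteration starts at zero and not at w: for a nonnegative matrix the iterates then increase
    with k, and convergence only needs the upper bound [picard_le]. *)
Fixpoint picard A w k : R -> V -> R :=
  if k is k'.+1 then fun t z => w z + RI 0 t (fun s => vmul (picard A w k') A s z)
  else fun _ _ => 0.

Section Exists.
Variables (A : R -> V -> V -> R) (C : R) (w : V -> R) (W : R).
Hypotheses (lA : lbmx A) (A0 : forall t y z, 0 <= A t y z)
  (AC : forall t y z, A t y z <= C) (C0 : 0 < C).
Hypotheses (w0 : forall z, 0 <= w z) (wW : forall z, w z <= W).
Let W0 (z : V) : 0 <= W. Proof. exact: le_trans (w0 z) (wW z). Qed.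

Lemma lbm_picard k z : lbm (picard A w k ^~ z).
Proof.
elim: k z => [|k IH] z; first exact: lbm_cst.
apply: lbmD; first exact: lbm_cst.
by apply: lbm_cont; apply: RI_cont; exact: lbm_vmul.
Qed.

Lemma picard_ge0 k t z : 0 <= picard A w k t z.
Proof.
elim: k t z => [|k IH] t z //=; apply: addr_ge0 => //.
by apply: RI_ge0 => s _; apply: sumr_ge0 => c _; exact: mulr_ge0.
Qed.

Lemma picard_nd t z : {homo (fun k => picard A w k t z) : k l / (k <= l)%N >-> k <= l}.
Proof.
apply: homo_leq => [//||k]; first by move=> a b c; exact: le_trans.
elim: k t z => [|k IH] t z; first exact: picard_ge0.
rewrite /= lerD2l; apply: RI_le.
- by apply: lbm_vmul => // c; exact: lbm_picard.
- by apply: lbm_vmul => // c; exact: (lbm_picard k.+1).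
- by move=> s _; apply: ler_sum => c _; apply: ler_wpM2r => //; exact: IH.
Qed.

(** The right-hand side is a supersolution of the integral equation, so the bound survives each
    iteration. For negative t the integral from 0 to t is zero by convention, hence the absolute
    value. *)
Lemma picard_le k t z : picard A w k t z <= W * expR ((n + 1) * C * `|t|).
Proof.
have n0 : 0 <= n by rewrite /n ler0n.
have K0 : 0 < (n + 1) * C by rewrite mulr_gt0// ltr_wpDl.
have e1 (t' : R) : 1 <= expR ((n + 1) * C * `|t'|).
  by rewrite -[leLHS]expR0 ler_expR mulr_ge0// ltW.
elim: k t z => [|k IH] t z; first by rewrite mulr_ge0 ?expR_ge0 ?(W0 z).
rewrite [X in X <= _]/=.
have [t0|t0] := leP 0 t; last first.
  rewrite RI_gt// addr0; apply: (le_trans (wW z)).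
  by rewrite ler_peMr ?(W0 z).
have : RI 0 t (fun s => vmul (picard A w k) A s z) <=
       RI 0 t (fun s => (W * ((n + 1) * C)) * expR ((n + 1) * C * s)).
  apply: RI_le.
  - by apply: lbm_vmul => // c; exact: lbm_picard.
  - by apply: lbmM; [exact: lbm_cst|exact: lbm_expR].
  move=> s /andP[s0 _]; rewrite /vmul.
  apply: (@le_trans _ _ (n * (W * expR ((n + 1) * C * s) * C))).
    apply: sum_le_card => c; apply: ler_pM => //; first exact: picard_ge0.
    by have := IH s c; rewrite ger0_norm.
  have -> : W * ((n + 1) * C) * expR ((n + 1) * C * s) =
     (n + 1) * (W * expR ((n + 1) * C * s) * C) by ring.
  by rewrite ler_wpM2r ?lerDl// mulr_ge0 ?(ltW C0)// mulr_ge0 ?expR_ge0 ?(W0 z).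
rewrite RIZ; last exact: lbm_expR.
rewrite RI_expR// ger0_norm// => h.
apply: (le_trans (lerD (wW z) h)).
have -> : W * ((n + 1) * C) * ((expR ((n + 1) * C * t) - 1) / ((n + 1) * C)) =
    W * (expR ((n + 1) * C * t) - 1).
  by field; rewrite !gt_eqF// ltr_wpDl.
lra.
Qed.

Definition flow t z : R := limn (fun k => picard A w k t z).

Lemma picard_cvg t z : picard A w k t z @[k --> \oo] --> flow t z.
Proof.
apply: nondecreasing_is_cvgn; first exact: picard_nd.
by exists (W * expR ((n + 1) * C * `|t|)) => _ [k _ <-]; exact: picard_le.
Qed.

Lemma flow_le t z : flow t z <= W * expR ((n + 1) * C * `|t|).
Proof.
apply: limr_le; first by apply/cvg_ex; eexists; exact: picard_cvg.
by apply: nearW => k; exact: picard_le.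
Qed.

Lemma flow_ge0 t z : 0 <= flow t z.
Proof.
apply: limr_ge; first by apply/cvg_ex; eexists; exact: picard_cvg.
by apply: nearW => k; exact: picard_ge0.
Qed.

Lemma lbm_flow z : lbm (flow ^~ z).
Proof.
split.
  apply: (@measurable_fun_cvg _ _ _ _ (fun k t => picard A w k t z)) => //.
    by move=> k; exact: (lbm_picard k z).1.
  by move=> t _; exact: picard_cvg.
move=> a b; exists (W * expR ((n + 1) * C * (`|a| + `|b|))); split.
  by rewrite mulr_ge0 ?expR_ge0 ?(W0 z).
move=> t /andP[ta tb]; rewrite ger0_norm ?flow_ge0//; apply: (le_trans (flow_le _ _)).
rewrite ler_wpM2l ?(W0 z)// ler_expR ler_wpM2l//.
  by rewrite mulr_ge0 ?(ltW C0)// addr_ge0// /n ler0n.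
have [t0|t0] := leP 0 t.
  by rewrite ger0_norm//; apply: (le_trans (le_trans tb (ler_norm b))); rewrite lerDr.
by apply: (@le_trans _ _ `|a|); [rewrite -normrN -(normrN a) !ger0_norm; lra|rewrite lerDl].
Qed.

Lemma flow0 z : flow 0 z = w z.
Proof.
apply/cvg_lim => //; rewrite -cvg_shiftS.
rewrite (_ : (fun k => _) = (fun=> w z)); first exact: cvg_cst.
by apply/funext => k /=; rewrite RI_same addr0.
Qed.

Lemma flow_sol T : sol A T flow.
Proof.
split; first exact: lbm_flow.
move=> t z /andP[t0 tT]; rewrite flow0.
have h1 : picard A w k.+1 t z @[k --> \oo] --> flow t z.
  by rewrite (@cvg_shiftS _ (fun k => picard A w k t z)); exact: picard_cvg.
have h2 : picard A w k.+1 t z @[k --> \oo] --> w z + RI 0 t (fun s => vmul flow A s z).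
  rewrite /=; apply: cvgD; first exact: cvg_cst.
  apply: (@RI_dominated _ _ _ _ _ (n * (W * expR ((n + 1) * C * t) * C))).
  - by move=> k; apply: lbm_vmul => // c; exact: lbm_picard.
  - by apply: lbm_vmul => // c; exact: lbm_flow.
  - move=> k s /andP[s0 st]; rewrite ger0_norm; last first.
      by apply: sumr_ge0 => c _; rewrite mulr_ge0 ?picard_ge0.
    apply: sum_le_card => c; apply: ler_pM => //; first exact: picard_ge0.
    apply: (le_trans (picard_le _ _ _)); rewrite ler_wpM2l ?(W0 z)// ler_expR ler_wpM2l//.
      by rewrite mulr_ge0 ?(ltW C0)// addr_ge0// /n ler0n.
    by rewrite ger0_norm.
  - move=> s _; rewrite /vmul; apply: cvg_sumr => c.
    by apply: cvgM; [exact: picard_cvg|exact: cvg_cst].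
by apply: (cvg_unique _ h1 h2).
Qed.

End Exists.

End Flow.

(** * Periodic Perron-Frobenius theory *)
Section Perron.
Variables (R : realType) (V : finType).

Lemma exists_pos_lb (I : finType) (f : I -> R) : (forall i, 0 < f i) ->
  exists2 e : R, 0 < e & forall i, e <= f i.
Proof.
move=> f0; exists (\big[Num.min/1]_i f i); last by move=> i; exact: bigmin_le.
by apply: lt_bigmin => // i _; exact: f0.
Qed.

Lemma coord_continuous (z : V) : continuous (fun w : {ptws V -> R} => w z).
Proof. exact: (@proj_continuous V (fun=> R) z). Qed.

Lemma lin_continuous (k : V -> R) :
  continuous (fun w : {ptws V -> R} => \sum_y w y * k y).
Proof.
move=> w; apply: (@cvg_sumr R V {ptws V -> R} (nbhs w) _ (index_enum V)
  (fun y w => w y * k y) (fun y => w y * k y)) => y.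
by apply: cvgM; [exact: (@coord_continuous y w)|exact: cvg_cst].
Qed.

Lemma simplex_compact :
  compact [set w : {ptws V -> R} | (forall z, 0 <= w z) /\ \sum_z w z = 1].
Proof.
have cb : compact ([set f | forall i, `[0, 1]%classic (f i)] : set {ptws V -> R}).
  exact: (@tychonoff V (fun=> R) (fun=> `[0, 1]%classic) (fun=> @segment_compact R 0 1)).
apply: (subclosed_compact _ cb); last first.
  move=> w /= [w0 w1] z /=; rewrite in_itv/= w0/= -w1 (bigD1 z)//= lerDl.
  by apply: sumr_ge0.
rewrite (_ : [set w | _] = (\bigcap_z [set w : {ptws V -> R} | 0 <= w z]) `&`
  [set w : {ptws V -> R} | \sum_z w z = 1]); last first.
  by apply/seteqP; split => w /=; [move=> [h ?]; split => // z _; exact: h|move=> [h ?]; split => // z; exact: h].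
apply: closedI.
  apply: closed_bigI => z _.
  apply: (@preimage_closed {ptws V -> R} R (fun w => w z) [set x | 0 <= x]).
    by move=> w _; exact: coord_continuous.
  exact: closed_ge.
apply: (@preimage_closed {ptws V -> R} R (fun w => \sum_z w z) [set x | x = 1]).
  move=> w _; have := @lin_continuous (fun=> 1) w.
  rewrite (_ : (fun w0 : {ptws V -> R} => \sum_y w0 y * 1) = (fun w0 => \sum_z w0 z))//.
  by apply/funext => w'; apply: eq_bigr => y _; rewrite mulr1.
exact: closed_eq.
Qed.

(** Collatz-Wielandt: maximize over the simplex the smallest ratio between successive iterates of
    the matrix. At a maximizer c the vector M c is an eigenvector, because any strict inequality
    would be spread to all coordinates by one more application of M. *)
Lemma perron (K : V -> V -> R) (x0 : V) : (forall y z, 0 < K y z) ->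
  exists (rho : R) (w : V -> R), [/\ 0 < rho, forall z, 0 < w z,
    \sum_z w z = 1 & forall z, \sum_y w y * K y z = rho * w z].
Proof.
move=> K0.
pose M (w : V -> R) z : R := \sum_y w y * K y z.
pose S := [set w : {ptws V -> R} | (forall z, 0 <= w z) /\ \sum_z w z = 1].
have Mpos (w : V -> R) y z : (forall z, 0 <= w z) -> 0 < w y -> 0 < M w z.
  move=> w0 wy; rewrite /M (bigD1 y)//= ltr_pwDl ?mulr_gt0//.
  by apply: sumr_ge0 => i _; rewrite mulr_ge0// ltW.
have Spos w z : S w -> 0 < M w z.
  move=> [w0 w1]; have [y wy] : exists y, 0 < w y.
    apply: contrapT => /forallNP h; have : \sum_z w z = 0.
      by apply: big1 => y _; apply/eqP; rewrite eq_le w0 andbT leNgt; exact/negP/h.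
    by rewrite w1 => /eqP; rewrite oner_eq0.
  exact: Mpos wy.
have Mcont z : continuous (fun w : {ptws V -> R} => M w z).
  exact: lin_continuous (K ^~ z).
have MMcont z : continuous (fun w : {ptws V -> R} => M (M w) z).
  move=> w; apply: (@cvg_sumr R V {ptws V -> R} (nbhs w) _ (index_enum V)
    (fun y w => M w y * K y z) (fun y => M w y * K y z)) => y.
  by apply: cvgM; [exact: (Mcont y w)|exact: cvg_cst].
(* Ratios of M (M w) to M w rather than of M w to w: M w is positive on the whole simplex, so the
   ratio stays continuous on its boundary. *)
pose q z (w : {ptws V -> R}) : R := M (M w) z / M w z.
have qcont z w : S w -> {for w, continuous (q z)}.
  move=> Sw; have h1 := MMcont z w; have M0 : M w z != 0 by rewrite gt_eqF// Spos.
  have h2 := @continuousV R {ptws V -> R} (fun w => M w z) w M0 (Mcont z w).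
  exact: (continuousM h1 h2).
(* The default value is one of the ratios, so it does not change the minimum. *)
pose phi (w : {ptws V -> R}) : R := \big[Num.min/q x0 w]_z q z w.
have phicont : {within S, continuous phi}.
  apply: continuous_in_subspaceT => w /set_mem Sw; rewrite /phi.
  elim: (index_enum V) => [|z r IH].
    rewrite (_ : (fun w0 => _) = q x0); first exact: qcont.
    by apply/funext => w'; rewrite big_nil.
  rewrite (_ : (fun w0 => _) =
    (q z \min (fun w' => \big[Num.min/q x0 w']_(z <- r) q z w'))).
    by apply: (@continuous_min R {ptws V -> R}); [exact: qcont|exact: IH].
  by apply/funext => w'; rewrite big_cons.
have Sne : S !=set0.
  exists (fun z => (z == x0)%:R); split => /= [z|]; first by rewrite ler0n.
  by rewrite (bigD1 x0)//= eqxx big1 ?addr0// => z /negbTE ->.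
have [c /set_mem Sc cmax] := compact_EVT_max Sne simplex_compact phicont.
pose rho := phi c; pose w := M c.
have w0 z : 0 < w z by exact: Spos.
have wK z : rho * w z <= M w z.
  rewrite -ler_pdivlMr//; exact: (bigmin_le _ z (q ^~ c)).
have eqw z : M w z = rho * w z.
  (* If M w exceeds rho w at z, the vector d = M w - rho w is nonnegative and nonzero, so M d is
     positive everywhere; the normalized w then has all its ratios above rho, against maximality. *)
  apply/eqP; rewrite eq_le wK andbT leNgt; apply/negP => lt.
  pose d y := M w y - rho * w y.
  have d0 y : 0 <= d y by rewrite subr_ge0.
  have Md y : 0 < M d y by apply: (@Mpos d z) => //; rewrite subr_gt0.
  have MdE y : M d y = M (M w) y - rho * M w y.
    by rewrite /M mulr_sumr -sumrB; apply: eq_bigr => i _; rewrite /d mulrBl mulrA.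
  have sw : 0 < \sum_z w z by rewrite (bigD1 x0)//= ltr_pwDl// sumr_ge0// => i _; exact: ltW.
  pose w' : {ptws V -> R} := fun z => w z / \sum_z w z.
  have Sw' : S w'.
    split => [y|]; first by rewrite divr_ge0// ltW.
    by rewrite -mulr_suml divff// gt_eqF.
  have Mw' y : M w' y = M w y / \sum_z w z.
    by rewrite /M mulr_suml; apply: eq_bigr => i _; rewrite /w' mulrAC.
  have MMw' y : M (M w') y = M (M w) y / \sum_z w z.
    by rewrite /M mulr_suml; apply: eq_bigr => i _; rewrite -/(M w' i) Mw' mulrAC.
  have qw' y : rho < q y w'.
    have Mw0 : 0 < M w y by apply: (@Mpos w x0) => // i; exact: ltW.
    rewrite /q MMw' Mw' -mulf_div divff ?invr_eq0 ?gt_eqF// mulr1 ltr_pdivlMr//.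
    by rewrite -subr_gt0 -MdE.
  have : phi w' <= phi c by apply: cmax; exact: mem_set.
  by apply/negP; rewrite -ltNge; apply: lt_bigmin.
have sw : 0 < \sum_z w z by rewrite (bigD1 x0)//= ltr_pwDl// sumr_ge0// => i _; exact: ltW.
have rho0 : 0 < rho.
  have : 0 < M w x0 by apply: (@Mpos w x0) => // i; exact: ltW.
  by rewrite eqw pmulr_lgt0.
exists rho, (fun z => w z / \sum_z w z); split => //.
- by move=> z; rewrite divr_gt0.
- by rewrite -mulr_suml divff// gt_eqF.
- move=> z; rewrite mulrA -eqw /M mulr_suml; apply: eq_bigr => y _.
  by rewrite mulrAC.
Qed.

End Perron.

(** * Positive Floquet solutions of a periodic linear system and their stability *)

Section Eigen.
Variables (R : realType) (V : finType) (x0 : V).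
Implicit Types (A : R -> V -> V -> R) (v : R -> V -> R).
Let n : R := #|V|%:R.

Definition dl (y z : V) : R := (y == z)%:R.

(** A positive Floquet solution on the whole real line: v' = v A, multiplied by rho over each
    period. The normalization at time 0 makes v comparable between different matrices. *)
Definition eigsol A (T0 rho : R) v := [/\ 0 < rho,
   (forall t z, 0 < v t z) /\ (forall z, lbm (v^~ z)),
   (forall t z, v (t + T0) z = rho * v t z), \sum_z v 0 z = 1 &
   forall (s t : R) z, s <= t -> v t z - v s z = RI s t (fun u => vmul v A u z)].

Lemma sol_sum A (T : R) (f : V -> R -> V -> R) (w : V -> R) : lbmx A ->
  (forall y, sol A T (f y)) -> sol A T (fun t z => \sum_y w y * f y t z).
Proof.
move=> lA sf; have lf y z : lbm (f y ^~ z) by exact: (sf y).1.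
split; first by move=> z; apply: lbm_sum => y; apply: lbmM => //; exact: lbm_cst.
move=> t z tT.
have -> : RI 0 t (fun s => vmul (fun t z => \sum_y w y * f y t z) A s z) =
   \sum_y w y * RI 0 t (fun s => vmul (f y) A s z).
  have -> : (fun s => vmul (fun t z => \sum_y w y * f y t z) A s z) =
            (fun s => \sum_y w y * vmul (f y) A s z).
    apply/funext => s; rewrite /vmul.
    under eq_bigr => c _ do rewrite mulr_suml.
    rewrite exchange_big; apply: eq_bigr => y _.
    by rewrite mulr_sumr; apply: eq_bigr => c _; rewrite mulrA.
  rewrite RI_sum; last by move=> y; apply: lbmM; [exact: lbm_cst|exact: lbm_vmul].
  by apply: eq_bigr => y _; rewrite RIZ//; exact: lbm_vmul.
rewrite -big_split; apply: eq_bigr => y _ /=.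
by rewrite -mulrDr -(sf y).2.
Qed.

Lemma eigsol_sol A (T0 rho T : R) v : eigsol A T0 rho v -> sol A T v.
Proof.
move=> [_ [_ lv] _ _ h]; split => // t z /andP[t0 _].
by rewrite -h// addrC subrK.
Qed.

(** The total mass satisfies a scalar linear integral inequality, and Gronwall bounds it by a
    quantity that depends on A only through C. *)
Lemma sol_mass A (T C : R) v : 0 <= T -> 0 < C -> lbmx A ->
  (forall t y z, 0 <= A t y z) -> (forall t y z, A t y z <= C) -> sol A T v ->
  (forall t z, 0 <= v t z) -> \sum_z v 0 z = 1 ->
  forall (t : R) z, 0 <= t <= T -> v t z <= 2 * expR (2 * ((n + 1) * C) * T).
Proof.
move=> T0 C0 lA A0 AC [lv sv] v0 v1.
have n0 : 0 <= n by rewrite ler0n.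
pose D t : R := \sum_z v t z.
have lD : lbm D by exact: lbm_sum.
have D0 t : 0 <= D t by exact: sumr_ge0.
have Dle (t : R) : 0 <= t <= T -> D t <= 1 + ((n + 1) * C) * RI 0 t D.
  move=> tT; rewrite /D; under eq_bigr => z _ do rewrite (sv _ _ tT).
  rewrite big_split/= v1 lerD2l -RI_sum; last by move=> z; exact: lbm_vmul.
  rewrite -RIZ//; apply: RI_le.
  - by apply: lbm_sum => z; exact: lbm_vmul.
  - by apply: lbmM => //; exact: lbm_cst.
  move=> s _; rewrite /vmul exchange_big/= mulr_sumr; apply: ler_sum => c _.
  rewrite -mulr_sumr mulrC; apply: ler_wpM2r => //.
  apply: (le_trans (@sum_le_card R V _ C _)); first by move=> z; exact: AC.
  by rewrite ler_wpM2r ?(ltW C0)// lerDl.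
move=> t z tT; apply: (@le_trans _ _ (D t)).
  by rewrite /D (bigD1 z)//= lerDl sumr_ge0.
have := @gronwall R D 1 ((n + 1) * C) T T0.
rewrite mulr1; apply => //.
by rewrite mulr_gt0// ltr_wpDl.
Qed.

Section Irr.
Variables (A : R -> V -> V -> R) (C m T0 : R) (e : rel V).
Hypotheses (lA : lbmx A) (A0 : forall t y z, 0 <= A t y z)
  (AC : forall t y z, A t y z <= C) (C0 : 0 < C) (T00 : 0 < T0) (m0 : 0 < m).
Hypotheses (Am : forall t y z, e y z -> m <= A t y z) (econ : forall y z, connect e y z).
Hypothesis Aper : forall t y z, A (t + T0) y z = A t y z.

(** Row y of the fundamental matrix started at time 0; its value at T0 is row y of the period
    map. *)
Let fl y := flow A (dl y).
Let dl0 y z : 0 <= dl y z. Proof. by rewrite ler0n. Qed.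
Let dl1 y z : dl y z <= 1. Proof. by rewrite lern1 leq_b1. Qed.
Let fl_sol y T : sol A T (fl y).
Proof. exact: (flow_sol lA A0 AC C0 (dl0 y) (dl1 y)). Qed.
Let fl_ge0 y t z : 0 <= fl y t z.
Proof. exact: (flow_ge0 lA A0 AC C0 (dl0 y) (dl1 y)). Qed.
Let fl_0 y z : fl y 0 z = dl y z.
Proof. exact: flow0. Qed.

Let fl_diff y (s t : R) z : 0 <= s -> s <= t ->
  fl y t z = fl y s z + RI s t (fun u => vmul (fl y) A u z).
Proof.
move=> s0 st; have t0 := le_trans s0 st.
have [lf sf] := fl_sol y t.
rewrite (sf t z) ?t0 ?lexx// (sf s z) ?s0//.
by rewrite -addrA -RI_chasles//; exact: lbm_vmul.
Qed.

Let fl_nd y (s t : R) z : 0 <= s -> s <= t -> fl y s z <= fl y t z.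
Proof.
move=> s0 st; rewrite (fl_diff _ _ s0 st) lerDl; apply: RI_ge0 => u _.
by apply: sumr_ge0 => c _; rewrite mulr_ge0.
Qed.

(** Positivity travels along edges: on [u / 2, u] the mass already at c flows into its successor at
    rate at least m. Since A is nonnegative, mass never decreases, so no aperiodicity is involved;
    the induction carries positivity at all positive times because each edge consumes half of the
    time. *)
Lemma flow_gt0 y z (t : R) : 0 < t -> 0 < flow A (dl y) t z.
Proof.
have Py (u : R) : 0 < u -> 0 < fl y u y.
  by move=> u0; apply: lt_le_trans (fl_nd _ _ (lexx 0) (ltW u0)); rewrite fl_0 /dl eqxx.
have step c z' : (forall u : R, 0 < u -> 0 < fl y u c) -> e c z' ->
    forall u : R, 0 < u -> 0 < fl y u z'.
  move=> Pc ez u u0.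
  have u20 : 0 < u / 2 by rewrite divr_gt0.
  have u2u : u / 2 <= u by lra.
  rewrite (fl_diff _ _ (ltW u20) u2u); apply: ltr_wpDl => //.
  apply: (@lt_le_trans _ _ (RI (u / 2) u (fun=> fl y (u / 2) c * m))).
    rewrite RI_cst// mulr_gt0//; last by lra.
    by rewrite mulr_gt0// Pc.
  apply: RI_le; first exact: lbm_cst.
    by apply: lbm_vmul => //; exact: (fl_sol y 0).1.
  move=> s /andP[us su]; rewrite /vmul (bigD1 c)//=.
  apply: (@le_trans _ _ (fl y s c * A s c z')).
    apply: ler_pM => //; first exact: ltW.
      by apply: fl_nd => //; exact: ltW.
    exact: Am.
  by rewrite lerDl; apply: sumr_ge0 => i _; rewrite mulr_ge0.
move=> t0; have /connectP[p pp ->] := econ y z.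
suff H q c : (forall u : R, 0 < u -> 0 < fl y u c) -> path e c q ->
  forall u : R, 0 < u -> 0 < fl y u (last c q) by exact: H.
elim: q c => [|d q IH] c Pc //= /andP[ecd pq].
by apply: IH => //; exact: step ecd.
Qed.

(** By uniqueness v is the combination of the rows of the fundamental matrix with weights v 0; at
    time T0 this is the eigenvector equation of the period map. *)
Lemma eig_matrix (rho : R) v : eigsol A T0 rho v ->
  forall z, rho * v 0 z = \sum_y v 0 y * flow A (dl y) T0 z.
Proof.
move=> ev; have [_ _ vq _ _] := ev; move=> z; rewrite -vq add0r.
apply: (@sol_uniq R V T0 C A v (fun t z => \sum_y v 0 y * fl y t z)) => //.
- exact: ltW.
- exact: eigsol_sol ev.
- by apply: sol_sum => // y; exact: fl_sol.
- by move=> t y z' _; rewrite ger0_norm.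
- move=> z'; rewrite (bigD1 z')//= fl_0 /dl eqxx mulr1 big1 ?addr0// => y yz.
  by rewrite fl_0 /dl (negbTE yz) mulr0.
- by rewrite (ltW T00) lexx.
Qed.

(** The period map has positive entries, so it has a Perron eigenvector w. The solution started from
    w is multiplied by rho over a period, because both sides of this identity solve the same
    periodic system with the same initial value. It remains to extend it to negative times. *)
Lemma eigsol_exists : exists rho v, eigsol A T0 rho v.
Proof.
have [rho [w [rho0 w0 w1 Hw]]] := @perron R V (fun y z => fl y T0 z) x0
  (fun y z => flow_gt0 y z T00).
pose v t z : R := \sum_y w y * fl y t z.
have sv T : sol A T v by apply: sol_sum => // y; exact: fl_sol.
have lv z : lbm (v^~ z) by exact: (sv 0).1.
have v0 z : v 0 z = w z.
  rewrite /v (bigD1 z)//= fl_0 /dl eqxx mulr1 big1 ?addr0// => y yz.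
  by rewrite fl_0 /dl (negbTE yz) mulr0.
have vT z : v T0 z = rho * v 0 z by rewrite v0 -Hw.
have vdiff (s t : R) z : 0 <= s -> s <= t -> v t z - v s z = RI s t (fun u => vmul v A u z).
  move=> s0 st; have t0 := le_trans s0 st.
  rewrite ((sv t).2 t z) ?t0 ?lexx// ((sv t).2 s z) ?s0//.
  rewrite (RI_chasles (lbm_vmul z lv lA) s0 st); ring.
have vge0 t z : 0 <= v t z by apply: sumr_ge0 => y _; rewrite mulr_ge0// ltW.
have vpos (t : R) z : 0 <= t -> 0 < v t z.
  move=> t0; apply: (@lt_le_trans _ _ (v 0 z)); first by rewrite v0.
  rewrite -subr_ge0 vdiff//; apply: RI_ge0 => u _.
  by apply: sumr_ge0 => c _; rewrite mulr_ge0.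
have vquasi (t : R) z : 0 <= t -> v (t + T0) z = rho * v t z.
  move=> t0.
  apply: (@sol_uniq R V t C A (fun t z => v (t + T0) z) (fun t z => rho * v t z)) => //.
  - split; first by move=> z'; exact: (lbm_shift T0 (lv z')).
    move=> s z' /andP[s0 _]; rewrite add0r.
    have T0s : T0 <= s + T0 by rewrite lerDr.
    have -> : v (s + T0) z' = v T0 z' + RI T0 (s + T0) (fun u => vmul v A u z').
      by rewrite -(vdiff T0 (s + T0) z')// ?(ltW T00)// subrKC.
    congr (_ + _); rewrite -{1}(add0r T0) RI_shift; last exact: lbm_vmul.
    by apply: eq_RI => u _; rewrite /vmul; apply: eq_bigr => c _; rewrite Aper.
  - split; first by move=> z'; apply: lbmM => //; exact: lbm_cst.
    move=> s z' /andP[s0 _].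
    rewrite ((sv s).2 s z') ?s0 ?lexx// mulrDr; congr (_ + _).
    rewrite -RIZ; last exact: lbm_vmul.
    apply: eq_RI => u _; rewrite /vmul mulr_sumr.
    by apply: eq_bigr => c _; rewrite mulrA.
  - by move=> s y z' _; rewrite ger0_norm.
  - by move=> z'; rewrite add0r vT.
  - by rewrite t0 lexx.
(* Enough periods to move t to nonnegative times. *)
pose N (t : R) := (Num.truncn (`|t| / T0)).+1.
have NT (t : R) : 0 <= t + (N t)%:R * T0.
  have : `|t| / T0 <= (N t)%:R by rewrite ltW// truncnS_gt.
  rewrite ler_pdivrMr// => h; have := ler_norm (- t); rewrite normrN; lra.
(* Extension by quasi-periodicity. By [vRE] any sufficient number of periods gives the same value,
   so on a half-line one common number can be used. *)
pose vR t z : R := rho^-1 ^+ (N t) * v (t + (N t)%:R * T0) z.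
have vk k j (t : R) z : 0 <= t + k%:R * T0 ->
    rho^-1 ^+ (k + j) * v (t + (k + j)%:R * T0) z = rho^-1 ^+ k * v (t + k%:R * T0) z.
  move=> h; elim: j => [|j IH]; first by rewrite addn0.
  rewrite addnS -IH exprS -natr1 mulrDl mul1r addrA vquasi; last first.
    apply: (le_trans h); rewrite lerD2l ler_wpM2r// ?(ltW T00)//.
    by rewrite ler_nat leq_addr.
  by rewrite [rho^-1 * _]mulrC -mulrA mulKf// gt_eqF.
have vRE k (t : R) z : 0 <= t + k%:R * T0 -> vR t z = rho^-1 ^+ k * v (t + k%:R * T0) z.
  by move=> h; rewrite /vR -(vk (N t) k)// -(vk k (N t))// addnC.
have exk (a : R) : exists k, forall t : R, a <= t -> 0 <= t + k%:R * T0.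
  by exists (N a) => t at_; apply: (le_trans (NT a)); rewrite lerD2r.
have Aperk k t y z : A (t + k%:R * T0) y z = A t y z.
  elim: k => [|k IH]; first by rewrite mul0r addr0.
  by rewrite -natr1 mulrDl mul1r addrA Aper.
have rk k : 0 < rho^-1 ^+ k by rewrite exprn_gt0// invr_gt0.
have vRdiff (s t : R) z k : (forall t : R, s <= t -> 0 <= t + k%:R * T0) -> s <= t ->
  vR t z - vR s z = rho^-1 ^+ k * RI (s + k%:R * T0) (t + k%:R * T0) (fun u => vmul v A u z).
  move=> hk st; rewrite !(vRE k) ?hk// -mulrBr vdiff ?hk//; by rewrite lerD2r.
have lvR z : lbm (vR^~ z).
  apply: lbm_cont; apply: lip_cont => a b; have [k hk] := exk a.
  have [L [L0 HL]] := (lbm_vmul z lv lA).2 (a + k%:R * T0) (b + k%:R * T0).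
  exists (rho^-1 ^+ k * L); split; first by rewrite mulr_ge0// ltW.
  move=> s t as_ st tb; rewrite (vRdiff _ _ _ k)//; last first.
    by move=> u su; apply: hk; exact: le_trans su.
  rewrite normrM gtr0_norm// -mulrA ler_wpM2l ?(ltW (rk k))//.
  apply: (le_trans (RI_bound (lbm_vmul z lv lA) _ _ (C := L))).
  - by rewrite lerD2r.
  - move=> u /andP[h1 h2]; apply: HL; rewrite (le_trans _ h1) ?lerD2r//.
    by rewrite (le_trans h2)// lerD2r.
  - by rewrite opprD addrACA subrr addr0.
exists rho, vR; split => //.
- by split => // t z; rewrite /vR mulr_gt0// vpos.
- move=> t z; have [k hk] := exk t.
  have h1 := hk t (lexx t).
  rewrite (vRE k) ?hk ?lerDl ?(ltW T00)// (vRE k)// addrAC vquasi//.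
  by rewrite mulrCA.
- under eq_bigr => z _ do rewrite (vRE 0%N) ?mul0r ?addr0// expr0 mul1r v0.
  exact: w1.
- move=> s t z st; have [k hk] := exk s.
  rewrite (vRdiff _ _ _ k)// RI_shift; last exact: lbm_vmul.
  rewrite -RIZ; last exact: (lbm_shift (k%:R * T0) (lbm_vmul z lv lA)).
  apply: eq_RI => u /andP[su _]; rewrite /vmul mulr_sumr; apply: eq_bigr => c _.
  by rewrite Aperk (vRE k) ?hk// mulrA.
Qed.

(** By [sol_stab] the period maps differ by at most c1 del, so v' 0 is almost an eigenvector of the
    unperturbed period map. Comparing v' 0 with v 0 through their extremal ratios first bounds rho'
    - rho from above, and then, as the entries of the period map are at least k, shows that v' 0 - v
    0 is small. A last use of [sol_stab] covers the period. *)
Lemma eigsol_stab (rho : R) v (eps : R) : eigsol A T0 rho v -> 0 < eps ->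
  exists2 del : R, 0 < del & forall A' rho' v', lbmx A' ->
    (forall t y z, 0 <= A' t y z) -> (forall t y z, A' t y z <= C) ->
    eigsol A' T0 rho' v' ->
    (forall (t : R) y z, 0 <= t <= T0 -> `|A t y z - A' t y z| <= del) ->
    (forall (t : R) z, 0 <= t <= T0 -> `|v t z - v' t z| <= eps) /\ `|rho - rho'| <= eps.
Proof.
move=> ev eps0; have [rho0 [vpos lv] vq v1 vd] := ev.
have n0 : 0 <= n by rewrite ler0n.
pose B := 2 * expR (2 * ((n + 1) * C) * T0).
pose E := expR (2 * ((n + 1) * C) * T0).
have E0 : 0 < E by exact: expR_gt0.
have B0 : 0 < B by rewrite mulr_gt0.
have T0' := ltW T00.
have [k k0 Hk] := @exists_pos_lb R (V * V)%type (fun yz => flow A (dl yz.1) T0 yz.2)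
   (fun yz => flow_gt0 yz.1 yz.2 T00).
have [b b0 Hb] := @exists_pos_lb R V (fun z => v 0 z) (vpos 0).
pose c1 := 2 * ((n + 1) * (n * B * T0)) * E.
have c10 : 0 <= c1 by rewrite /c1 !mulr_ge0 ?addr_ge0// ltW.
pose h1 := 2 * (c1 * (b^-1 + 1) / k).
have h10 : 0 <= h1 by rewrite /h1 !mulr_ge0 ?invr_ge0 ?addr_ge0 ?invr_ge0// ltW.
pose c2 := 2 * ((n + 1) * (h1 + n * B * T0)) * E.
have c20 : 0 <= c2.
  apply: mulr_ge0; last exact: ltW.
  apply: mulr_ge0 => //; apply: mulr_ge0; first exact: addr_ge0.
  by apply: addr_ge0 => //; rewrite !mulr_ge0// ltW.
(* c2 del will bound the distance of the solutions over one period; the factor n + 1 leaves room for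
   the sum over V that controls rho. *)
pose del := eps / ((n + 1) * c2 + 1).
have den0 : 0 < (n + 1) * c2 + 1 by rewrite ltr_wpDl// mulr_ge0// addr_ge0.
exists del; first by rewrite divr_gt0.
have del0 : 0 <= del by rewrite divr_ge0// ltW.
have c2d : (n + 1) * c2 * del <= eps.
  rewrite mulrC /del mulrAC ler_pdivrMr// ler_pM2l//; lra.
move=> A' rho' v' lA' A'0 A'C ev' Ad; have [rho'0 [v'pos lv'] v'q v'1 v'd] := ev'.
have B1 (t : R) z : 0 <= t <= T0 -> `|v' t z| <= B.
  move=> tT; rewrite gtr0_norm//.
  apply: (@sol_mass A' T0 C v') => //; first exact: eigsol_sol ev'.
  by move=> s y; exact: ltW.
pose fl' y := flow A' (dl y).
have fl'_sol y T : sol A' T (fl' y) by exact: (flow_sol lA' A'0 A'C C0 (dl0 y) (dl1 y)).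
have fl'_ge0 y t z : 0 <= fl' y t z by exact: (flow_ge0 lA' A'0 A'C C0 (dl0 y) (dl1 y)).
have Kd y z : `|fl y T0 z - fl' y T0 z| <= c1 * del.
  have := @sol_stab R V T0 C B del 0 A A' (fl y) (fl' y) T0' C0 (ltW B0) del0 (lexx _) lA lA'
    (fl_sol y T0) (fl'_sol y T0).
  move=> /(_ _ _ Ad _ T0 z) H; apply: (le_trans (H _ _ _ _)).
  - by move=> t y' z' _; rewrite ger0_norm.
  - move=> t y' tT; rewrite ger0_norm//.
    apply: (@sol_mass A' T0 C (fl' y)) => //.
    rewrite (bigD1 y)//= [fl' y 0 y]flow0 /dl eqxx big1 ?addr0// => i iy.
    by rewrite [fl' y 0 i]flow0 /dl eq_sym (negbTE iy).
  - by move=> z'; rewrite fl_0 [fl' y 0 z']flow0 subrr normr0.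
  - by rewrite T0' lexx.
  - by rewrite add0r -/n -/E /c1; rewrite le_eqVlt; apply/orP; left; apply/eqP; ring.
have K1 := eig_matrix ev.
have K2 z : rho' * v' 0 z = \sum_y v' 0 y * fl' y T0 z.
  rewrite -v'q add0r.
  apply: (@sol_uniq R V T0 C A' v' (fun t z => \sum_y v' 0 y * fl' y t z)) => //.
  - exact: eigsol_sol ev'.
  - by apply: sol_sum => // y; exact: fl'_sol.
  - by move=> t y z' _; rewrite ger0_norm.
  - move=> z'; rewrite (bigD1 z')//= [fl' z' 0 z']flow0 /dl eqxx mulr1 big1 ?addr0// => y yz.
    by rewrite [fl' y 0 z']flow0 /dl (negbTE yz) mulr0.
  - by rewrite T0' lexx.
have v'le1 z : v' 0 z <= 1.
  by rewrite -v'1 (bigD1 z)//= lerDl sumr_ge0// => i _; exact: ltW.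
have err z : `|\sum_y v' 0 y * fl y T0 z - rho' * v' 0 z| <= c1 * del.
  rewrite K2 -sumrB; apply: (le_trans (ler_norm_sum _ _ _)).
  apply: (@le_trans _ _ (\sum_y v' 0 y * (c1 * del))); last by rewrite -mulr_suml v'1 mul1r.
  apply: ler_sum => y _; rewrite -mulrBr normrM gtr0_norm//.
  by apply: ler_wpM2l => //; exact: ltW.
pose q z := v' 0 z / v 0 z.
have qv z : v' 0 z = q z * v 0 z by rewrite /q divfK// gt_eqF.
have [z0 q_min] : exists z0, forall z, q z0 <= q z.
  by case: (arg_minP q (erefl (predT x0))) => i _ h; exists i => z; exact: h.
have [z1 q_max] : exists z1, forall z, q z <= q z1.
  by case: (arg_maxP q (erefl (predT x0))) => i _ h; exists i => z; exact: h.
have q1 : 1 <= q z1.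
  rewrite -v'1 -[leRHS]mulr1 -v1 mulr_sumr; apply: ler_sum => z _.
  by rewrite qv ler_wpM2r// ltW.
have q0 : q z0 <= 1.
  rewrite -[leRHS]v'1 -[leLHS]mulr1 -v1 mulr_sumr; apply: ler_sum => z _.
  by rewrite [leRHS]qv ler_wpM2r// ltW.
(* At the index z1 of the largest ratio, q z1 v 0 dominates v' 0; applying the positive period map
   gives an upper bound on rho' times v' 0 z1 by rho times the same number, up to the error. Here v'
   0 z1 >= b because the largest ratio is at least 1. *)
have rd : rho' - rho <= c1 * del / b.
  have : 0 <= \sum_y (q z1 * v 0 y - v' 0 y) * fl y T0 z1.
    apply: sumr_ge0 => y _; apply: mulr_ge0 => //.
    by rewrite qv -mulrBl mulr_ge0 ?subr_ge0// ltW.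
  have -> : \sum_y (q z1 * v 0 y - v' 0 y) * fl y T0 z1 =
      rho * v' 0 z1 - \sum_y v' 0 y * fl y T0 z1.
    under eq_bigr => y _ do rewrite mulrBl -mulrA.
    by rewrite sumrB -mulr_sumr -K1 (qv z1); ring.
  move=> h; have := err z1; rewrite ler_norml => /andP[h2 _].
  have h3 : (rho' - rho) * v' 0 z1 <= c1 * del by lra.
  have bv : b <= v' 0 z1.
    rewrite qv; apply: (le_trans (Hb z1)); rewrite ler_peMl// ltW//.
  rewrite ler_pdivlMr//; case: (lerP 0 (rho' - rho)) => s.
    by apply: le_trans h3; rewrite ler_wpM2l.
  apply: (@le_trans _ _ 0); first by rewrite nmulr_rle0// ltW.
  by rewrite mulr_ge0.
(* Nonnegative and zero at z0, the index of the smallest ratio. Its image at z0 is at least k times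
   its mass, and this image is small, so the mass 1 - q z0 is small too. *)
pose w z := v' 0 z - q z0 * v 0 z.
have w0 z : 0 <= w z by rewrite /w qv -mulrBl mulr_ge0 ?subr_ge0// ltW.
have sw : \sum_z w z <= c1 * (b^-1 + 1) / k * del.
  rewrite mulrAC ler_pdivlMr// mulr_suml.
  apply: (@le_trans _ _ (\sum_y w y * fl y T0 z0)).
    by apply: ler_sum => y _; apply: ler_wpM2l => //; exact: (Hk (y, z0)).
  have -> : \sum_y w y * fl y T0 z0 = \sum_y v' 0 y * fl y T0 z0 - rho * v' 0 z0.
    rewrite /w; under eq_bigr => y _ do rewrite mulrBl -mulrA.
    by rewrite sumrB -mulr_sumr -K1 (qv z0); ring.
  have := err z0; rewrite ler_norml => /andP[_ h2].
  have h3 : (rho' - rho) * v' 0 z0 <= c1 * del / b.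
    apply: (@le_trans _ _ (c1 * del / b * v' 0 z0)).
      by rewrite ler_wpM2r// ltW.
    by rewrite ler_piMr// divr_ge0 ?(ltW b0) ?(mulr_ge0 c10 del0).
  have -> : c1 * (b^-1 + 1) * del = c1 * del / b + c1 * del by ring.
  lra.
have swE : \sum_z w z = 1 - q z0 by rewrite /w sumrB v'1 -mulr_sumr v1 mulr1.
have v0d z : `|v 0 z - v' 0 z| <= h1 * del.
  have -> : v 0 z - v' 0 z = (1 - q z0) * v 0 z - w z by rewrite /w; ring.
  apply: (le_trans (ler_normB _ _)).
  rewrite (ger0_norm (w0 z)) ger0_norm; last by rewrite mulr_ge0 ?subr_ge0// ltW.
  have wz : w z <= \sum_z w z by rewrite (bigD1 z)//= lerDl sumr_ge0.
  have vz1 : v 0 z <= 1 by rewrite -v1 (bigD1 z)//= lerDl sumr_ge0// => i _; exact: ltW.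
  have : (1 - q z0) * v 0 z <= \sum_z w z by rewrite swE ler_piMr// subr_ge0.
  rewrite /h1 -mulrA; lra.
have vd' (t : R) z : 0 <= t <= T0 -> `|v t z - v' t z| <= c2 * del.
  move=> tT.
  have := @sol_stab R V T0 C B del (h1 * del) A A' v v' T0' C0 (ltW B0) del0
    (mulr_ge0 h10 del0) lA lA' (eigsol_sol T0 ev) (eigsol_sol T0 ev').
  move=> /(_ _ B1 Ad v0d t z tT) H; apply: (le_trans (H _)).
    by move=> s y' z' _; rewrite ger0_norm.
  by rewrite -/n -/E /c2; rewrite le_eqVlt; apply/orP; left; apply/eqP; ring.
split.
  move=> t z tT; apply: (le_trans (vd' t z tT)); apply: le_trans c2d.
  by rewrite ler_wpM2r// ler_peMl// lerDr.
(* Both solutions have mass 1 at time 0, so the multipliers are the masses at time T0. *)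
have -> : rho - rho' = \sum_z (v T0 z - v' T0 z).
  rewrite sumrB -[T0 in v T0]add0r -[T0 in v' T0]add0r.
  under eq_bigr => z _ do rewrite vq.
  under [X in _ = _ - X]eq_bigr => z _ do rewrite v'q.
  by rewrite -!mulr_sumr v1 v'1 !mulr1.
apply: (le_trans (ler_norm_sum _ _ _)).
apply: (@le_trans _ _ (n * (c2 * del))).
  by apply: sum_le_card => z; apply: vd'; rewrite T0' lexx.
by apply: le_trans c2d; rewrite mulrA ler_wpM2r// ler_wpM2r// lerDl.
Qed.

End Irr.
End Eigen.

(** * Discretization of cadlag paths *)
Section Paths.
Variables (R : realType) (V : finType).
Implicit Types (X : R -> V) (s t : R).
Local Notation leb := (@lebesgue_measure R).

(* A cell is good when X has at most one jump in it. *)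
Definition gcell X s t := exists tau : R, [/\ s < tau,
  (forall u, s <= u -> u <= t -> u < tau -> X u = X s) &
  (forall u, u <= t -> tau <= u -> X u = X t)].

(** Around each point x the path is constant just before x and constant from x on, so short cells
    near x see at most one jump. Compactness of [0, T], in near-covering form, makes the length
    uniform. *)
Lemma cadlag_gcell X (T : R) : cadlag X -> exists2 d : R, 0 < d &
  forall s t, 0 <= s -> s <= T -> s <= t -> t - s <= d -> gcell X s t.
Proof.
move=> [rc ll].
have := @segment_compact R 0 T; rewrite compact_near_coveringP => cov.
have := cov R (0^'+) (fun i x => forall s t, 0 <= s -> s <= x -> x <= t -> t - s <= i -> gcell X s t) _.
case=> [x /=|d /= d0 H]; last first.
  exists (d / 2); first by rewrite divr_gt0.
  move=> s t s0 sT st tsd; apply: (H (d / 2)) => //=.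
  - by rewrite sub0r normrN gtr0_norm ?divr_gt0//; lra.
  - by rewrite divr_gt0.
  - by rewrite in_itv/= s0.
rewrite in_itv/= => /andP[x0 xT].
have [d1 [d10 H1]] := rc x x0.
(* At x = 0 there is no left limit; restricting to u >= 0 makes the condition vacuous there. *)
have [l [d2 [d20 H2]]] : exists (l : V) (d2 : R), 0 < d2 /\
    forall u, 0 <= u -> x - d2 < u < x -> X u = l.
  move: x0; rewrite le_eqVlt => /orP[/eqP <-|x0].
    by exists (X 0), 1; split => // u u0 /andP[_]; rewrite ltNge u0.
  by have [l [d2 [/andP[d20 _] H2]]] := ll x x0; exists l, d2; split => // u _; exact: H2.
pose d := Num.min d1 d2.
have d0 : 0 < d by rewrite lt_min d10.
have dd1 : d <= d1 by rewrite ge_min lexx.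
have dd2 : d <= d2 by rewrite ge_min lexx orbT.
near=> x' i => s t s0 sx xt tsi.
have xx' : `|x - x'| < d / 2 by near: x'; apply: cvgr_dist_lt; [exact: cvg_id|rewrite divr_gt0].
have id : i < d / 2 by near: i; apply: nbhs_right_lt; rewrite divr_gt0.
move: xx'; rewrite ltr_norml => /andP[h1 h2].
move: sx xt tsi => /= sx xt tsi.
have XL u : s <= u -> u <= t -> u < x -> X u = l.
  by move=> su ut ux; apply: H2; [lra|apply/andP; split; lra].
have XR u : s <= u -> u <= t -> x <= u -> X u = X x.
  by move=> su ut xu; apply: H1; apply/andP; split; lra.
have [tx|xt'] := ltP t x.
  exists (t + 1); split; first by lra.
    by move=> u su ut _; rewrite !XL//; lra.
  by move=> u ut tu; exfalso; lra.
have [sx'|xs] := ltP s x; last first.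
  exists (t + 1); split; first by lra.
    by move=> u su ut _; rewrite !XR//; lra.
  by move=> u ut tu; exfalso; lra.
exists x; split => //.
  by move=> u su ut ux; rewrite !XL//; lra.
by move=> u ut xu; rewrite !XR//; lra.
Unshelve. all: by end_near. Qed.

Definition jumps X y z s t := [set u | s < u <= t /\ jump_at X y z u].

(** In a good cell the only possible jump leads from X s to X t, so the two end values decide
    whether a jump from y to z takes place. *)
Lemma gcell_jumps X y z s t : s <= t -> gcell X s t -> y != z ->
  exists tau : R, jumps X y z s t =
    if (X s == y) && (X t == z) then [set tau] else set0.
Proof.
move=> st [tau [stau H1 H2]] yz; exists tau.
have key u : jumps X y z s t u -> [/\ u = tau, X s = y & X t = z].
  move=> [/andP[su ut] [[d [d0 Hd]] Xu]].
  (* A point of the cell strictly before u at which the path still has its left limit y. *)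
  pose u' := Num.max s (u - d / 2).
  have u'1 : s <= u' by rewrite le_max lexx.
  have u'2 : u' < u by rewrite gt_max su; lra.
  have u'3 : u - d < u' by rewrite lt_max; apply/orP; right; lra.
  have Xu' : X u' = y by apply: Hd; rewrite u'3.
  have [utau|tauu|utau] := ltgtP u tau.
  - exfalso; move: yz; rewrite -Xu -Xu' !H1 ?eqxx//; lra.
  - exfalso; pose u'' := Num.max tau u'.
    have h1 : u' <= u'' by rewrite le_max lexx orbT.
    have h2 : tau <= u'' by rewrite le_max lexx.
    have h3 : u'' < u by rewrite gt_max tauu.
    have Xu'' : X u'' = y by apply: Hd; rewrite h3 andbT; lra.
    by move: yz; rewrite -Xu -Xu'' !H2 ?eqxx//; lra.
  - split => //; first by rewrite -Xu' H1//; lra.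
    by rewrite -Xu (H2 u)//; lra.
case: ifPn => [/andP[/eqP Xs /eqP Xt]|].
  have taut : tau <= t.
    rewrite leNgt; apply/negP => h; move: yz.
    by rewrite -Xs -Xt (H1 t) ?eqxx.
  apply/seteqP; split => u; first by move=> /key[].
  move=> /= ->; split; first by rewrite stau.
  split; last by rewrite H2.
  exists (tau - s); split; first by rewrite subr_gt0.
  by move=> v /andP[v1 v2]; rewrite H1//; lra.
move=> h; apply/seteqP; split => // u /key[_ Xs Xt].
by move: h; rewrite Xs Xt !eqxx.
Qed.

Lemma counting_setU (A B : set R) : finite_set A -> finite_set B -> A `&` B = set0 ->
  counting (A `|` B) = (counting A + counting B)%E :> \bar R.
Proof.
move=> fA fB AB; rewrite /counting !asboolT//; last by rewrite finite_setU.
rewrite -EFinD; congr EFin; rewrite fset_setU// cardfsU -natrD; congr (_%:R).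
by rewrite -fset_setI// AB fset_set0 cardfs0 subn0.
Qed.

Lemma counting_set1 (x : R) : counting [set x] = 1%E :> \bar R.
Proof. by rewrite /counting asboolT// fset_set1 cardfs1. Qed.

Lemma counting_set0 : counting (set0 : set R) = 0%E :> \bar R.
Proof. by rewrite /counting asboolT// fset_set0 cardfs0. Qed.

Section Grid.
Variables (X : R -> V) (d : R) (N : nat).
Hypotheses (d0 : 0 <= d)
  (good : forall j, (j < N)%N -> gcell X (j%:R * d) (j.+1%:R * d)).

Let gridS j : j%:R * d <= j.+1%:R * d.
Proof. by rewrite ler_wpM2r// ler_nat. Qed.

(** Grid versions of the jump count and, next, of the occupation time. They see the path only at
    grid times, so their law is determined by the finite-dimensional distributions. *)
Definition dcount k y z : R :=
  \sum_(j < k) ((X (j%:R * d) == y) && (X (j.+1%:R * d) == z))%:R.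
Definition docc k y : R := \sum_(j < k) d * (X (j%:R * d) == y)%:R.

Lemma grid_count k y z : (k <= N)%N -> y != z ->
  finite_set (jumps X y z 0 (k%:R * d)) /\
  counting (jumps X y z 0 (k%:R * d)) = (dcount k y z)%:E.
Proof.
move=> + yz; elim: k => [_|k IH kN].
  rewrite mul0r (_ : jumps _ _ _ _ _ = set0).
    by rewrite counting_set0 /dcount big_ord0.
  by apply/seteqP; split => // u [/andP[h1 h2] _]; move: (lt_le_trans h1 h2); rewrite ltxx.
have [fk ck] := IH (ltnW kN).
have [tau Htau] := gcell_jumps (gridS k) (good kN) yz.
have E : jumps X y z 0 (k.+1%:R * d) = jumps X y z 0 (k%:R * d) `|`
      jumps X y z (k%:R * d) (k.+1%:R * d).
  apply/seteqP; split => u.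
    move=> [/andP[h1 h2] j]; case: (leP u (k%:R * d)) => h; [left|right]; split => //.
      by rewrite h1.
    by rewrite h.
  move=> [[/andP[h1 h2] j]|[/andP[h1 h2] j]]; split => //.
    by rewrite h1 (le_trans h2).
  by rewrite h2 andbT (le_lt_trans _ h1)// mulr_ge0.
have fin : finite_set (jumps X y z (k%:R * d) (k.+1%:R * d)) by rewrite Htau; case: ifP.
split; first by rewrite E finite_setU.
rewrite E counting_setU//; last first.
  apply/seteqP; split => // u [[/andP[_ h1] _] [/andP[h2 _] _]].
  by move: (le_lt_trans h1 h2); rewrite ltxx.
rewrite ck Htau /dcount big_ord_recr/= EFinD; congr (_ + _)%E.
by case: ifP => _; rewrite ?counting_set1 ?counting_set0.
Qed.

Let occ k y := [set u | 0 <= u < k%:R * d /\ X u = y].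

(** Without a change between the end values the path is constant on the half-open cell and the
    left-end rule is exact; otherwise the error is at most the length of the cell. *)
Lemma gcell_occ s t y : s <= t -> gcell X s t ->
  let C := [set u | s <= u < t /\ X u = y] in
  measurable C /\ exists c : R, leb C = c%:E /\
   `|c - (t - s) * (X s == y)%:R| <= (t - s) * (X s != X t)%:R.
Proof.
move=> st [tau [stau H1 H2]] C.
pose tau' := Num.min tau t.
have t1 : s <= tau' by rewrite le_min (ltW stau).
have t2 : tau' <= t by rewrite ge_min lexx orbT.
have CE : C = (if X s == y then `[s, tau'[%classic else set0) `|`
              (if X t == y then `[tau', t[%classic else set0).
  apply/seteqP; split => u.
    move=> [/andP[su ut] Xu]; case: (ltP u tau) => utau.
      left; have := H1 u su (ltW ut) utau; rewrite Xu => <-; rewrite eqxx /= in_itv/= su.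
      by rewrite lt_min utau.
    right; have := H2 u (ltW ut) utau; rewrite Xu => <-; rewrite eqxx /= in_itv/= ut andbT.
    by rewrite ge_min utau.
  move=> [|]; case: ifPn => //= /eqP Xe; rewrite in_itv/= => /andP[h1 h2].
    split; first by rewrite h1 (lt_le_trans h2).
    move: h2; rewrite lt_min => /andP[ut uttt].
    by rewrite H1// ltW.
  split; first by rewrite h2 andbT (le_trans t1).
  case: (ltP u tau) => utau; last by rewrite H2// ltW.
  by move: h1; rewrite ge_min => /orP[|]; rewrite leNgt ?utau ?h2.
have mC : measurable C by rewrite CE; apply: measurableU; case: ifP.
split => //.
have Cst : C `<=` `[s, t] by move=> u [/andP[h1 h2] _] /=; rewrite in_itv/= h1 ltW.
have lebC : (leb C <= (t - s)%:E)%E.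
  by rewrite -leb_itvcc//; apply: le_measure => //; rewrite inE.
have Cfin : leb C \is a fin_num.
  by rewrite ge0_fin_numE//; apply: (le_lt_trans lebC); rewrite ltry.
exists (fine (leb C)); split; first by rewrite fineK.
have c0 : 0 <= fine (leb C) by rewrite fine_ge0.
have c1 : fine (leb C) <= t - s by rewrite -lee_fin fineK.
case: (eqVneq (X s) (X t)) => [Xst|_] /=; last first.
  rewrite mulr1; case: (X s == y); rewrite ?mulr1 ?mulr0 ler_norml; lra.
rewrite mulr0 normr_le0 subr_eq0; apply/eqP.
have -> : C = if X s == y then `[s, t[%classic else set0.
  rewrite CE -Xst; case: ifP => _; last by rewrite setU0.
  by rewrite -itv_bndbnd_setU// bnd_simp.
case: ifP => _; rewrite ?measure0 ?mulr0// mulr1.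
rewrite lebesgue_measure_itv/= lte_fin; case: ltP => // ts.
by apply/eqP; rewrite eq_sym subr_eq0 eq_le st ts.
Qed.

Lemma grid_occ k y : (k <= N)%N -> measurable (occ k y) /\
  exists c : R, leb (occ k y) = c%:E /\
   `|c - docc k y| <= d * \sum_(j < k) (X (j%:R * d) != X (j.+1%:R * d))%:R.
Proof.
elim: k => [_|k IH kN].
  have -> : occ 0 y = set0.
    apply/seteqP; split => // u [/andP[h1 h2] _].
    by move: (le_lt_trans h1 h2); rewrite mul0r ltxx.
  split => //; exists 0; rewrite measure0; split => //.
  by rewrite /docc !big_ord0 subr0 normr0 mulr0.
have [mk [c [Hc cb]]] := IH (ltnW kN).
have [mC [c' [Hc' cb']]] := gcell_occ y (gridS k) (good kN).
move: mC Hc' cb'; set C := [set u | _ /\ _] => mC Hc' cb'.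
have E : occ k.+1 y = occ k y `|` C.
  apply/seteqP; split => u.
    move=> [/andP[h1 h2] j]; case: (ltP u (k%:R * d)) => h; [left|right]; split => //.
      by rewrite h1.
    by rewrite h.
  move=> [[/andP[h1 h2] j]|[/andP[h1 h2] j]]; split => //.
    by rewrite h1 (lt_le_trans h2).
  by rewrite h2 andbT (le_trans _ h1)// mulr_ge0.
rewrite E; split; first exact: measurableU.
exists (c + c'); split.
  have -> : leb (occ k y `|` C) = (leb (occ k y) + leb C)%E; last by rewrite Hc Hc' EFinD.
  apply: measureU => //; apply/seteqP; split => // u [[/andP[_ h1] _] [/andP[h2 _] _]].
  by move: (lt_le_trans h1 h2); rewrite ltxx.
rewrite /docc !big_ord_recr/= mulrDr.
have -> (a b a' b' : R) : a + a' - (b + b') = (a - b) + (a' - b') by ring.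
apply: (le_trans (ler_normD _ _)); apply: lerD => //.
have dE : k.+1%:R * d - k%:R * d = d by rewrite -natr1; ring.
by move: cb'; rewrite dE.
Qed.

End Grid.

(** Each cell with a change of value is counted by exactly one ordered pair of distinct states, so
    the number of inexact cells is the total jump count. *)
Lemma sum_neq_dcount X d N :
  \sum_(j < N) (X (j%:R * d) != X (j.+1%:R * d))%:R =
  \sum_(yz : V * V | yz.1 != yz.2) dcount X d N yz.1 yz.2 :> R.
Proof.
rewrite /dcount exchange_big/=; apply: eq_bigr => j _.
set a := X _; set b := X _.
case: (eqVneq a b) => [ab|ab] /=.
  rewrite big1// => -[y z] /= yz; case: eqP => //= ay; case: eqP => //= bz.
  by move: yz; rewrite -ay -bz ab eqxx.
rewrite (bigD1 (a, b))//= !eqxx/= big1 ?addr0// => -[y z] /= /andP[yz neq].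
case: eqP => //= ay; case: eqP => //= bz.
by move: neq; rewrite -ay -bz eqxx.
Qed.

(** Once all cells are good, jump counts are exact and occupation times are off by at most the mesh
    times the number of jumps. The threshold N0 depends on the path, which suffices for the
    pointwise limit [dS_cvg]. *)
Lemma path_discretization X (T : R) : cadlag X -> 0 < T ->
  exists N0 : nat, forall N, (N0 <= N)%N ->
   let d := T / N.+1%:R in
   (forall y z, y != z -> fine (counting [set t | 0 < t <= T /\ jump_at X y z t]) =
       dcount X d N.+1 y z) /\
   (forall y, `|fine (leb [set t | 0 <= t <= T /\ X t = y]) - docc X d N.+1 y| <=
      d * \sum_(yz : V * V | yz.1 != yz.2)
            fine (counting [set t | 0 < t <= T /\ jump_at X yz.1 yz.2 t])).
Proof.
move=> cX T0; have [e e0 He] := cadlag_gcell T cX.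
exists (Num.truncn (T / e)) => N NN d.
have n0 : 0 < N.+1%:R :> R by rewrite ltr0n.
have d0 : 0 <= d by rewrite divr_ge0// ltW.
have dT : N.+1%:R * d = T by rewrite /d mulrC divfK// gt_eqF.
have de : d <= e.
  rewrite /d ler_pdivrMr// mulrC -ler_pdivrMr//.
  have : T / e < (Num.truncn (T / e)).+1%:R by rewrite truncnS_gt.
  by move=> /ltW/le_trans; apply; rewrite ler_nat.
have good j : (j < N.+1)%N -> gcell X (j%:R * d) (j.+1%:R * d).
  move=> jN; apply: He.
  - by rewrite mulr_ge0.
  - by rewrite -dT ler_wpM2r// ler_nat ltnW.
  - by rewrite ler_wpM2r// ler_nat.
  - apply: le_trans de; rewrite -natr1; lra.
have cnt y z : y != z -> fine (counting [set t | 0 < t <= T /\ jump_at X y z t]) =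
       dcount X d N.+1 y z.
  move=> yz; have [_] := grid_count d0 good (leqnn _) yz.
  by rewrite dT => ->.
split => // y.
have [mo [c [Hc cb]]] := grid_occ d0 good y (leqnn _).
have -> : fine (leb [set t | 0 <= t <= T /\ X t = y]) = c.
  have : leb [set u | 0 <= u < N.+1%:R * d /\ X u = y] =
         leb [set t | 0 <= t <= T /\ X t = y].
    rewrite dT; move: mo; rewrite dT => mo.
    have -> : [set t | 0 <= t <= T /\ X t = y] =
        [set u | 0 <= u < T /\ X u = y] `|` (if X T == y then [set T] else set0).
      apply/seteqP; split => u.
        move=> [/andP[h1]]; rewrite le_eqVlt => /orP[/eqP ->|h2] Xu.
          by right; rewrite Xu eqxx.
        by left; split => //; rewrite h1.
      move=> [[/andP[h1 h2] Xu]|]; first by split => //; rewrite h1 ltW.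
      case: ifPn => // /eqP XT /= ->; split => //; by rewrite lexx andbT ltW.
    set B := if _ then _ else _.
    set A := [set u | 0 <= u < T /\ X u = y].
    have -> : leb (A `|` B) = (leb A + leb B)%E; last first.
      by rewrite /B; case: ifP => _; rewrite ?measure0 ?lebesgue_measure_set1 adde0.
    apply: measureU => //.
    - by rewrite /B; case: ifP.
    - rewrite /B; apply/seteqP; split => // u [[/andP[_ h] _]]; case: ifP => // _ /= uT.
      by move: h; rewrite uT ltxx.
  by move=> <-; rewrite Hc.
apply: (le_trans cb); rewrite ler_wpM2l// sum_neq_dcount.
by apply: ler_sum => yz h; rewrite cnt.
Qed.

End Paths.

(** * Transition probabilities *)
Section Rates.
Variables (R : realType) (V : finType).
Implicit Types (r : rates R V).

(** The assumptions transported from positive times and from one period to all real times: the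
    Floquet solutions and the time-reversed system live on the whole line. *)
Definition goodrates (T0 : R) r (m M : R) :=
  [/\ 0 < m /\ 0 < M, (forall y z, lbm (r y z)) /\ (forall y z t, 0 <= r y z t <= M),
      (forall y z, Defs.periodic T0 (r y z)) /\ (forall y t, r y y t = 0),
      (forall y z t, edge r y z -> m <= r y z t) /\
      (forall y z t, ~~ edge r y z -> r y z t = 0) &
      forall y z, connect (edge r) y z].

Lemma edge_neq r y z : edge r y z -> y != z.
Proof. by move=> /asboolP[]. Qed.

Lemma periodic_nat (T0 : R) f (k : nat) t : Defs.periodic T0 f -> f (t + k%:R * T0) = f t.
Proof.
move=> pf; elim: k => [|k IH]; first by rewrite mul0r addr0.
by rewrite -natr1 mulrDl mul1r addrA pf.
Qed.

Lemma periodic_reduce (T0 t : R) : 0 < T0 ->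
  exists2 t' : R, 0 <= t' < T0 & forall f, Defs.periodic T0 f -> f t = f t'.
Proof.
move=> T00; pose k := Num.floor (t / T0); exists (t - k%:~R * T0).
  have := floor_itv (t / T0); rewrite -/k ler_pdivlMr// ltr_pdivrMr// => /andP[h1 h2].
  move: h2; rewrite intrD mulrDl mul1r => h2.
  by apply/andP; split; lra.
move=> f pf; case: k => j; first by rewrite -{1}(subrK (j%:R * T0) t) (periodic_nat _ _ pf).
rewrite NegzE mulrNz -mulNr opprK.
by rewrite (periodic_nat _ _ pf).
Qed.

Lemma rates_assumptions_good (T0 : R) r : 0 < T0 -> rates_assumptions T0 r ->
  exists m M, goodrates T0 r m M.
Proof.
move=> T00 [[r0 mr] ir pr rd [a1 con [M HM] [m [m0 Hm]] _]].
(* The representative is taken in (0, T0], with 0 moved to T0, because edges and (A1) only speak of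
   positive times. *)
have red t : exists2 t' : R, 0 < t' <= T0 & forall y z, r y z t = r y z t'.
  have [t' /andP[h1 h2] H] := periodic_reduce t T00.
  move: h1; rewrite le_eqVlt => /orP[/eqP h1|h1]; last first.
    by exists t'; [rewrite h1 ltW|move=> y z; exact: H].
  exists T0; first by rewrite T00 lexx.
  by move=> y z; rewrite (H _ (pr y z)) -h1 -(pr y z 0) add0r.
have nonedge y z t : ~~ edge r y z -> r y z t = 0.
  move=> /asboolPn ne; have [yz|yz] := eqVneq y z; first by rewrite yz rd.
  have [t' /andP[t'0 _] ->] := red t.
  apply/eqP; rewrite eq_le r0 andbT leNgt; apply/negP => h; apply: ne; split => //.
  by apply: a1; exists t'.
have rM y z t : r y z t <= `|M| + 1.
  have [e|e] := boolP (edge r y z); last by rewrite nonedge// addr_ge0.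
  have [t' /andP[t'0 t'T] ->] := red t.
  have := HM y z t' e; rewrite (ltW t'0) t'T => /(_ isT) h.
  by apply: (le_trans h); apply: (le_trans (ler_norm M)); rewrite lerDl.
exists m, (`|M| + 1); split.
- by split => //; rewrite ltr_wpDl.
- split; last by move=> y z t; rewrite r0 rM.
  move=> y z; split; first exact: mr.
  move=> a b; exists (`|M| + 1); split; first by rewrite addr_ge0.
  by move=> t _; rewrite ger0_norm.
- by [].
- split => // y z t e; have [t' /andP[t'0 t'T] ->] := red t.
  by apply: Hm => //; rewrite (ltW t'0).
- exact: con.
Qed.

End Rates.

(** * Short-time expansion of the transition probabilities and of the weighted chain *)

Section Transition.
Variables (R : realType) (V : finType) (T0 : R) (r : rates R V) (m M : R).
Hypothesis gr : goodrates T0 r m M.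
Variable (p : R -> R -> V -> V -> R).
Hypothesis kol : kolmogorov r p.
Local Notation leb := (@lebesgue_measure R).
Let n : R := #|V|%:R.
Let n0 : 0 <= n. Proof. by rewrite ler0n. Qed.

Definition exitr y t : R := \sum_z r y z t.

Lemma lbm_r y z : lbm (r y z). Proof. by case: gr => _ []. Qed.
Lemma r_ge0 y z t : 0 <= r y z t. Proof. by case: gr => _ [_ h] _ _ _; case/andP: (h y z t). Qed.
Lemma r_leM y z t : r y z t <= M. Proof. by case: gr => _ [_ h] _ _ _; case/andP: (h y z t). Qed.
Lemma M_gt0 : 0 < M. Proof. by case: gr => [[]]. Qed.
Lemma rdiag y t : r y y t = 0. Proof. by case: gr => _ _ []. Qed.

Lemma lbm_exitr y : lbm (exitr y).
Proof. by apply: lbm_sum => z; exact: lbm_r. Qed.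

Lemma exitr_ge0 y t : 0 <= exitr y t.
Proof. by apply: sumr_ge0 => z _; exact: r_ge0. Qed.

Lemma exitr_le y t : exitr y t <= n * M.
Proof. by apply: sum_le_card => z; exact: r_leM. Qed.

Lemma genE u c b : gen r u c b = r c b u - (c == b)%:R * exitr c u.
Proof.
rewrite /gen; case: eqP => [->|_]; last by rewrite mul0r subr0.
by rewrite mul1r rdiag sub0r.
Qed.

Lemma lbm_gen c b : lbm (fun u => gen r u c b).
Proof.
rewrite (_ : (fun u => _) = (fun u => r c b u - (c == b)%:R * exitr c u)).
  apply: lbmB; first exact: lbm_r.
  by apply: lbmM; [exact: lbm_cst|exact: lbm_exitr].
by apply/funext => u; rewrite genE.
Qed.

Let G := (n + 1) * M.
Let G0 : 0 < G. Proof. by rewrite mulr_gt0 ?M_gt0// ltr_wpDl. Qed.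

Lemma gen_le u c b : `|gen r u c b| <= G.
Proof.
have MG : M <= G by rewrite ler_peMl ?(ltW M_gt0)// lerDr.
have nG : n * M <= G by rewrite ler_wpM2r ?(ltW M_gt0)// lerDl.
rewrite /gen; case: ifP => _.
  by rewrite normrN ger0_norm ?exitr_ge0//; apply: le_trans nG; exact: exitr_le.
by rewrite ger0_norm ?r_ge0//; apply: le_trans MG; exact: r_leM.
Qed.

(** The forward equation is inserted into itself once. This needs a bound on p that is uniform in
    the starting time s: continuity first gives some bound on [s, s + 1], and Gronwall then gives
    the bound B, which does not depend on s. *)
Lemma transition_expansion : exists2 C : R, 0 <= C &
  forall (s t : R) a b, 0 <= s -> s <= t -> t - s <= 1 ->
   `|p s t a b - (a == b)%:R - RI s t (fun u => gen r u a b)| <= C * (t - s) ^+ 2.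
Proof.
pose B := 2 * expR (2 * ((n + 1) * G) * 1).
have B0 : 0 <= B by rewrite mulr_ge0// expR_ge0.
have G0' := ltW G0.
exists (n * (n * B * G) * G); first by rewrite mulr_ge0 ?(mulr_ge0 n0)// mulr_ge0// mulr_ge0.
move=> s t a b s0 st ts.
pose D := `[s, s + 1]%classic.
pose P u c : R := p s u a c.
(* [kolmogorov] only provides an integrable integrand; continuity in the second time comes from p
   being an indefinite integral. *)
have Pcont c : {within D, continuous (P^~ c)}.
  have int1 : leb.-integrable D (EFin \o (fun u => \sum_(c' : V) p s u a c' * gen r u c' c)).
    have h01 : 0 <= s <= s + 1 by apply/andP; split; lra.
    by have [int1 _] := @kol s (s + 1) a c h01; exact: int1.
  have := @parameterized_integral_continuous R s (s + 1) _ _ int1.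
  have h : s <= s + 1 by rewrite lerDl.
  move=> /(_ h) cont.
  have : {within D, continuous (fun u => (a == c)%:R + parameterized_integral leb s u
     (fun u => \sum_(c' : V) p s u a c' * gen r u c' c))}.
    by move=> u; apply: cvgD; [exact: cvg_cst|exact: cont].
  apply: subspace_eq_continuous => u; rewrite inE /D/= in_itv/= => /andP[su us].
  have su' : 0 <= s <= u by rewrite s0.
  exact/esym/((@kol s u a c su').2).
(* Cut off outside [s, s + 1], so that the calculus of [lbm] functions on the whole line applies. *)
pose P' u c : R := ((P^~ c) \_ D) u.
have lP' c : lbm (P'^~ c).
  split.
    apply/(measurable_restrictT _ _).1; first exact: measurable_itv.
    by apply: subspace_continuous_measurable_fun; [exact: measurable_itv|exact: Pcont].
  have : compact ((P^~ c) @` D) by apply: continuous_compact => //; exact: segment_compact.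
  move=> /compact_bounded[K [Kr HK]] x y; exists (`|K| + 1); split; first by rewrite addr_ge0.
  move=> u _; rewrite /P' patchE; case: ifPn => [uD|_]; last by rewrite normr0 addr_ge0.
  apply: (HK (`|K| + 1)); first by rewrite (le_lt_trans (ler_norm K))// ltrDl.
  by exists u => //; exact: set_mem.
have P'E u c : s <= u <= s + 1 -> P' u c = P u c.
  by move=> h; rewrite /P' patchE mem_set//= /D/= in_itv.
pose f c u : R := \sum_c' P' u c' * gen r u c' c.
have lf c : lbm (f c) by apply: lbm_sum => c'; apply: lbmM => //; exact: lbm_gen.
have PE u c : s <= u <= s + 1 -> P u c = (a == c)%:R + RI s u (f c).
  move=> /andP[su us]; rewrite /P (kol a c _).2 ?s0//; congr (_ + _).
  apply: eq_RI => v /andP[sv vu]; apply: eq_bigr => c' _.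
  by rewrite P'E// sv (le_trans vu).
pose E u : R := \sum_c `|P' (u + s) c|.
have lE : lbm E by apply: lbm_sum => c; apply: lbm_norm; exact: (lbm_shift s (lP' c)).
have E0 u : 0 <= E u by apply: sumr_ge0.
have shiftRI u g : lbm g -> RI s (u + s) g = RI 0 u (fun v => g (v + s)).
  by move=> lg; rewrite -{1}(add0r s) RI_shift.
have fle c u : `|f c (u + s)| <= G * E u.
  rewrite /f /E mulr_sumr; apply: (le_trans (ler_norm_sum _ _ _)); apply: ler_sum => c' _.
  by rewrite normrM mulrC; apply: ler_wpM2r => //; exact: gen_le.
have Ele (u : R) : 0 <= u <= 1 -> E u <= 1 + ((n + 1) * G) * RI 0 u E.
  move=> /andP[u0 u1].
  have us : s <= u + s <= s + 1 by apply/andP; split; lra.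
  have i0 : 0 <= RI 0 u E by exact: RI_ge0.
  apply: (@le_trans _ _ (\sum_c ((a == c)%:R + G * RI 0 u E))).
    apply: ler_sum => c _; rewrite P'E// PE//; apply: (le_trans (ler_normD _ _)).
    apply: lerD; first by rewrite ger0_norm.
    rewrite shiftRI// -RIZ// ler_norml; apply/andP; split.
      have -> : - RI 0 u (fun v => G * E v) = RI 0 u (fun v => (-1) * (G * E v)).
        by rewrite [RHS]RIZ ?mulN1r//; exact: (lbmM (lbm_cst G) lE).
      apply: RI_le.
      - exact: (lbmM (lbm_cst (-1)) (lbmM (lbm_cst G) lE)).
      - exact: (lbm_shift s (lf c)).
      - by move=> v _; rewrite mulN1r; have := fle c v; rewrite ler_norml => /andP[].
    apply: RI_le.
    - exact: (lbm_shift s (lf c)).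
    - exact: (lbmM (lbm_cst G) lE).
    - by move=> v _; have := fle c v; rewrite ler_norml => /andP[].
  rewrite big_split/= sumr_const; apply: lerD.
    by rewrite (bigD1 a)//= eqxx big1 ?addr0// => c; rewrite eq_sym => /negbTE ->.
  rewrite -mulr_natl -mulrA ler_wpM2r//; first by rewrite mulr_ge0// ltW.
  by rewrite -/n lerDl.
have PB u c : s <= u <= s + 1 -> `|P' u c| <= B.
  move=> /andP[h1 h2]; have us : 0 <= u - s <= 1 by apply/andP; split; lra.
  have K0 : 0 < (n + 1) * G by rewrite mulr_gt0// ltr_wpDl.
  have := gronwall ler01 K0 ler01 lE Ele us; rewrite mulr1; apply: le_trans.
  by rewrite /E subrK (bigD1 c)//= lerDl sumr_ge0.
have Pd u c : s <= u <= t -> `|P' u c - (a == c)%:R| <= n * B * G * (t - s).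
  move=> /andP[h1 h2]; have us : s <= u <= s + 1 by apply/andP; split; lra.
  rewrite P'E// PE// addrC addKr.
  apply: (@le_trans _ _ (n * B * G * (u - s))); last first.
    apply: ler_wpM2l; first exact: (mulr_ge0 (mulr_ge0 n0 B0) G0').
    by rewrite lerD2r.
  apply: RI_bound => // v /andP[v1 v2]; rewrite /f.
  apply: (le_trans (ler_norm_sum _ _ _)); rewrite -mulrA; apply: sum_le_card => c'.
  rewrite normrM; apply: ler_pM => //; last exact: gen_le.
  by apply: PB; apply/andP; split; lra.
have us : s <= t <= s + 1 by apply/andP; split; lra.
rewrite -/(P t b) PE//.
have -> (x y z : R) : x + y - x - z = y - z by ring.
rewrite -RIB//; last exact: lbm_gen.
have -> : n * (n * B * G) * G * (t - s) ^+ 2 = n * (n * B * G * (t - s) * G) * (t - s) by ring.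
apply: RI_bound => //; first by apply: lbmB => //; exact: lbm_gen.
move=> u ut.
have -> : f b u - gen r u a b = \sum_c (P' u c - (a == c)%:R) * gen r u c b.
  rewrite /f; under [RHS]eq_bigr => c _ do rewrite mulrBl.
  rewrite sumrB; congr (_ - _); rewrite (bigD1 a)//= eqxx mul1r big1 ?addr0// => c.
  by rewrite eq_sym => /negbTE ->; rewrite mul0r.
apply: (le_trans (ler_norm_sum _ _ _)); apply: sum_le_card => c.
rewrite normrM; apply: ler_pM => //; last exact: gen_le.
exact: Pd.
Qed.

Lemma expR_quad (x : R) : `|x| <= 1 / 2 -> 0 <= expR x - 1 - x <= 2 * x ^+ 2.
Proof.
rewrite ler_norml => /andP[h1 h2].
have l1 := expR_ge1Dx x; have l2 := expR_ge1Dx (- x).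
apply/andP; split; first by lra.
have x1 : 0 < 1 - x by lra.
have : expR x <= (1 - x)^-1.
  rewrite -[expR x]invrK -expRN lef_pV2 ?posrE ?expR_gt0//; lra.
have : (1 - x)^-1 <= 1 + x + 2 * x ^+ 2.
  rewrite -[leLHS]mul1r ler_pdivrMr//; nra.
lra.
Qed.

Variables (h : V -> R) (g : V -> V -> R).
(** The Feynman-Kac generator of the tilt: a jump from y to z is weighted by expR (g y z), and time
    spent at y is rewarded at rate h y. *)
Definition Amx (t : R) (y z : V) : R :=
  r y z t * expR (g y z) + (y == z)%:R * (h y - exitr y t).
Definition backsol (u : R -> V -> R) := (forall y, lbm (u^~ y)) /\
  forall (s t : R) y, s <= t -> u s y - u t y = RI s t (fun v => \sum_z Amx v y z * u v z).
(** Weight of one cell of length d as seen from its two end values: the whole cell is charged to its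
    left end, and different end values count as one jump. *)
Definition qw (d : R) y z : R := expR (d * h y + (if y == z then 0 else g y z)).

Lemma lbm_Amx : lbmx Amx.
Proof.
move=> y z; apply: lbmD.
  by apply: lbmM; [exact: lbm_r|exact: lbm_cst].
by apply: lbmM; [exact: lbm_cst|apply: lbmB; [exact: lbm_cst|exact: lbm_exitr]].
Qed.

(** The weighted one-step expectation of u reproduces u up to order d^2. C1 collects the error of
    the expansion of p; C2 that of linearizing the weight; C3 that of freezing u at the end of the
    cell in the backward equation, plus the cross term between exit and reward. *)
Lemma one_step (u : R -> V -> R) (T : R) : 0 <= T -> backsol u ->
  exists C d0 : R, [/\ 0 <= C, 0 < d0 & forall (s t : R) y, 0 <= s -> s <= t -> t <= T -> t - s <= d0 ->
   `|\sum_z p s t y z * qw (t - s) y z * u t z - u s y| <= C * (t - s) ^+ 2].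
Proof.
move=> T0' [lu bu].
have [Cp Cp0 HCp] := transition_expansion.
pose H : R := \sum_y `|h y|.
have H0 : 0 <= H by exact: sumr_ge0.
have hH y : `|h y| <= H by rewrite /H (bigD1 y)//= lerDl sumr_ge0.
(* Bounds the weight [qw]: the reward factor is at most 2 as soon as d |h| <= 1 / 2. *)
pose Q := 2 * \sum_(y : V) \sum_(z : V) expR (g y z) + 2.
have gQ y z : expR (g y z) <= \sum_(y : V) \sum_(z : V) expR (g y z).
  rewrite (bigD1 y)//= (bigD1 z)//= -addrA lerDl.
  apply: addr_ge0; apply: sumr_ge0 => i _; first exact: expR_ge0.
  by apply: sumr_ge0 => j _; exact: expR_ge0.
have Q2 : 2 <= Q.
  by rewrite /Q lerDr mulr_ge0// sumr_ge0// => *; apply: sumr_ge0 => *; exact: expR_ge0.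
have Q0 : 0 <= Q by lra.
have gQ' y z : 2 * expR (g y z) <= Q by have := gQ y z; rewrite /Q; lra.
have [U U0 HU] : exists2 U : R, 0 <= U & forall (t : R) z, 0 <= t <= T -> `|u t z| <= U.
  have /choice[b Hb] := fun y => (lu y).2 0 T.
  exists (\sum_y b y); first by apply: sumr_ge0 => y _; exact: (Hb y).1.
  move=> s y sT; apply: (le_trans ((Hb y).2 s sT)).
  by rewrite (bigD1 y)//= lerDl sumr_ge0// => i _; exact: (Hb i).1.
pose K := M * Q + H + n * M.
have K0 : 0 <= K by rewrite /K !addr_ge0 ?mulr_ge0 ?(ltW M_gt0).
have AK t y z : `|Amx t y z| <= K.
  rewrite /Amx /K -addrA; apply: (le_trans (ler_normD _ _)); apply: lerD.
    rewrite normrM !ger0_norm ?r_ge0 ?expR_ge0//; apply: ler_pM => //; rewrite ?r_ge0 ?expR_ge0//.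
      exact: r_leM.
    have := gQ' y z; have := expR_ge0 (g y z); lra.
  case: (y == z); rewrite ?mul0r ?normr0 ?mul1r; last by rewrite addr_ge0 ?mulr_ge0 ?(ltW M_gt0).
  apply: (le_trans (ler_normB _ _)); apply: lerD => //.
  by rewrite ger0_norm ?exitr_ge0//; exact: exitr_le.
(* The first bound is for [transition_expansion], the second makes d |h| <= 1 / 2 as required by
   [expR_quad]. *)
pose d0 := Num.min 1 (1 / (2 * (H + 1))).
have d00 : 0 < d0 by rewrite lt_min ltr01 divr_gt0// mulr_gt0// ltr_wpDl.
pose C1 := n * (Cp * Q * U).
pose C2 := n * ((G + 1) * (2 * H ^+ 2 + 2 * H * Q + 2 * H) * U).
pose C3 := n * (K * (n * (K * U))) + n * M * H * U.
exists (C1 + C2 + C3), d0; split => //.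
  have G1 : 0 <= G + 1 by rewrite addr_ge0// ltW.
  have H1 : 0 <= 2 * H ^+ 2 + 2 * H * Q + 2 * H by rewrite !addr_ge0// !mulr_ge0// sqr_ge0.
  have C10 : 0 <= C1 := mulr_ge0 n0 (mulr_ge0 (mulr_ge0 Cp0 Q0) U0).
  have C20 : 0 <= C2 := mulr_ge0 n0 (mulr_ge0 (mulr_ge0 G1 H1) U0).
  have C30 : 0 <= C3.
    apply: (addr_ge0 (mulr_ge0 n0 (mulr_ge0 K0 (mulr_ge0 n0 (mulr_ge0 K0 U0))))).
    exact: (mulr_ge0 (mulr_ge0 (mulr_ge0 n0 (ltW M_gt0)) H0) U0).
  exact: (addr_ge0 (addr_ge0 C10 C20) C30).
move=> s t y s0 st tT tsd; set d := t - s.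
have d_ge0 : 0 <= d by rewrite subr_ge0.
have d1 : d <= 1 by rewrite (le_trans tsd)// ge_min lexx.
have dH : d * H <= 1 / 2.
  have : d <= 1 / (2 * (H + 1)) by rewrite (le_trans tsd)// ge_min lexx orbT.
  rewrite ler_pdivlMr ?mulr_gt0 ?ltr_wpDl//; nra.
have dh : `|d * h y| <= 1 / 2.
  by rewrite normrM (ger0_norm d_ge0); apply: le_trans dH; rewrite ler_wpM2l.
have /andP[ex1 ex2] := expR_quad dh.
have sqd : (d * h y) ^+ 2 <= H ^+ 2 * d ^+ 2.
  rewrite exprMn mulrC ler_wpM2r ?sqr_ge0//.
  rewrite -(real_normK (num_real (h y))) ler_sqr ?nnegrE//.
have uT z : `|u t z| <= U by apply: HU; rewrite tT (le_trans s0).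
have sT v : s <= v <= t -> 0 <= v <= T by move=> /andP[h1 h2]; apply/andP; split; lra.
have qQ z : `|qw d y z| <= Q.
  rewrite /qw ger0_norm ?expR_ge0// expRD.
  have e2 : expR (d * h y) <= 2.
    move: dh; rewrite ler_norml => /andP[dh1 dh2]; have : (d * h y) ^+ 2 <= 1 / 4 by nra.
    lra.
  case: (y == z); first by rewrite expR0 mulr1; lra.
  have := gQ' y z; have := expR_ge0 (g y z); have := expR_ge0 (d * h y).
  by move: (expR (d * h y)) e2 => e e2; move: (expR (g y z)) => e' *; nra.
pose q0 z := if y == z then 1 + d * h y else expR (g y z).
pose L z := RI s t (fun v => gen r v y z).
have LG z : `|L z| <= G * d.
  by apply: RI_bound => //; [exact: lbm_gen|move=> v _; exact: gen_le].
have split3 : \sum_z p s t y z * qw d y z * u t z - u s y =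
   \sum_z (p s t y z - (y == z)%:R - L z) * qw d y z * u t z +
   \sum_z ((y == z)%:R + L z) * (qw d y z - q0 z) * u t z +
   (\sum_z ((y == z)%:R + L z) * q0 z * u t z - u s y).
  rewrite !addrA; congr (_ - _); rewrite -!big_split; apply: eq_bigr => z _ /=; ring.
rewrite split3 2!mulrDl.
apply: (le_trans (ler_normD _ _)); apply: lerD; first apply: (le_trans (ler_normD _ _)); first apply: lerD.
- rewrite /C1 -mulrA; apply: (le_trans (ler_norm_sum _ _ _)); apply: sum_le_card => z.
  rewrite !normrM (_ : Cp * Q * U * d ^+ 2 = (Cp * d ^+ 2) * Q * U); last by ring.
  by do 2!(apply: ler_pM => //; rewrite ?mulr_ge0//); exact: HCp.
- rewrite /C2 -mulrA; apply: (le_trans (ler_norm_sum _ _ _)); apply: sum_le_card => z.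
  rewrite !normrM [leRHS]mulrAC; apply: ler_pM => //.
  have LG' : `|L z| <= G * d by exact: LG.
  have GdG : G * d <= G by rewrite ler_piMr// ltW.
  rewrite /q0 /qw; case: eqP => [yz|_].
    rewrite addr0.
    have -> : expR (d * h y) - (1 + d * h y) = expR (d * h y) - 1 - d * h y by ring.
    rewrite [X in _ * X]ger0_norm//.
    rewrite -[leRHS]mulrA; apply: ler_pM => //.
      by apply: (le_trans (ler_normD _ _)); rewrite normr1; lra.
    apply: (le_trans ex2).
    rewrite [leRHS](_ : _ = 2 * (H ^+ 2 * d ^+ 2) + 2 * H * Q * d ^+ 2 + 2 * H * d ^+ 2); last by ring.
    have : 0 <= 2 * H * Q * d ^+ 2 by rewrite !mulr_ge0// sqr_ge0.
    have : 0 <= 2 * H * d ^+ 2 by rewrite !mulr_ge0// sqr_ge0.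
    by move: sqd; lra.
  rewrite add0r expRD.
  have -> : expR (d * h y) * expR (g y z) - expR (g y z) = (expR (d * h y) - 1) * expR (g y z) by ring.
  rewrite normrM (ger0_norm (expR_ge0 (g y z))).
  have e1 : `|expR (d * h y) - 1| <= 2 * (H * d).
    have dhH : `|d * h y| <= H * d.
      by rewrite normrM (ger0_norm d_ge0) mulrC ler_wpM2r.
    move: dhH dh; rewrite !ler_norml => /andP[a1 a2] /andP[b1 b2].
    have : (d * h y) ^+ 2 <= (H * d) / 2 by nra.
    by move=> ?; apply/andP; split; lra.
  have -> : (G + 1) * (2 * H ^+ 2 + 2 * H * Q + 2 * H) * d ^+ 2 =
     ((G + 1) * d) * ((2 * H ^+ 2 + 2 * H * Q + 2 * H) * d) by ring.
  apply: ler_pM => //.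
    by apply: (le_trans LG'); rewrite ler_wpM2r// lerDl.
  apply: (@le_trans _ _ (2 * (H * d) * Q)).
    apply: ler_pM => //.
    by have := gQ' y z; have := expR_ge0 (g y z); lra.
  have : 0 <= H ^+ 2 * d by rewrite mulr_ge0// sqr_ge0.
  have : 0 <= H * d by rewrite mulr_ge0.
  have -> : 2 * (H * d) * Q = 2 * H * Q * d by ring.
  by rewrite !mulrDl; lra.
- have Ez z : ((y == z)%:R + L z) * q0 z =
      (y == z)%:R + RI s t (fun v => Amx v y z) - (y == z)%:R * (RI s t (exitr y) * (d * h y)).
    rewrite /L /q0.
    have -> : RI s t (fun v => Amx v y z) =
       RI s t (r y z) * expR (g y z) + (y == z)%:R * (h y * d - RI s t (exitr y)).
      rewrite RID; [|by apply: lbmM; [exact: lbm_r|exact: lbm_cst]|].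
        rewrite RIZ; last by apply: lbmB; [exact: lbm_cst|exact: lbm_exitr].
        rewrite RIB; [|exact: lbm_cst|exact: lbm_exitr]; rewrite RI_cst//; congr (_ + _).
        under eq_RI => v _ do rewrite mulrC.
        by rewrite RIZ 1?mulrC//; exact: lbm_r.
      by apply: lbmM; [exact: lbm_cst|apply: lbmB; [exact: lbm_cst|exact: lbm_exitr]].
    have -> : RI s t (fun v => gen r v y z) = RI s t (r y z) - (y == z)%:R * RI s t (exitr y).
      under eq_RI => v _ do rewrite genE.
      rewrite RIB; [|exact: lbm_r|by apply: lbmM; [exact: lbm_cst|exact: lbm_exitr]].
      by rewrite RIZ//; exact: lbm_exitr.
    case: eqP => [<-|_] /=; last by ring.
    have -> : RI s t (r y y) = 0.
      by under eq_RI => v _ do rewrite rdiag; rewrite RI_cst// mul0r.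
    by ring.
  under eq_bigr => z _ do rewrite Ez.
  have -> : \sum_z ((y == z)%:R + RI s t (fun v => Amx v y z) -
      (y == z)%:R * (RI s t (exitr y) * (d * h y))) * u t z - u s y =
     (\sum_z RI s t (fun v => Amx v y z) * u t z - (u s y - u t y)) -
     RI s t (exitr y) * (d * h y) * u t y.
    under eq_bigr => z _ do rewrite mulrBl mulrDl.
    rewrite sumrB big_split/=.
    have one (F : V -> R) : \sum_z (y == z)%:R * F z = F y.
      rewrite (bigD1 y)//= eqxx mul1r big1 ?addr0// => z; rewrite eq_sym => /negbTE ->.
      by rewrite mul0r.
    rewrite one; under [X in _ - X - _ = _]eq_bigr => z _ do rewrite -mulrA.
    by rewrite one; ring.
  apply: (le_trans (ler_normB _ _)); rewrite /C3 [leRHS]mulrDl; apply: lerD.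
    rewrite bu//.
    have -> : \sum_z RI s t (fun v => Amx v y z) * u t z =
        RI s t (fun v => \sum_z Amx v y z * u t z).
      rewrite RI_sum; last by move=> z; apply: lbmM; [exact: lbm_Amx|exact: lbm_cst].
      apply: eq_bigr => z _; under [RHS]eq_RI => v _ do rewrite mulrC.
      by rewrite RIZ 1?mulrC//; exact: lbm_Amx.
    rewrite -RIB; last 2 first.
    + by apply: lbm_sum => z; apply: lbmM; [exact: lbm_Amx|exact: lbm_cst].
    + by apply: lbm_sum => z; apply: lbmM; [exact: lbm_Amx|exact: lu].
    have -> : n * (K * (n * (K * U))) * d ^+ 2 = n * (K * (n * (K * U) * d)) * d by ring.
    apply: RI_bound => //.
      by apply: lbmB; apply: lbm_sum => z; apply: lbmM; try exact: lbm_Amx; [exact: lbm_cst|exact: lu].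
    move=> v vst; rewrite -sumrB; apply: (le_trans (ler_norm_sum _ _ _)); apply: sum_le_card => z.
    rewrite -mulrBr normrM; apply: ler_pM => //.
    case/andP: vst => sv vt.
    rewrite distrC bu//.
    apply: (@le_trans _ _ (n * (K * U) * (t - v))); last first.
      by rewrite ler_wpM2l ?mulr_ge0// /d; lra.
    apply: RI_bound => //.
      by apply: lbm_sum => z'; apply: lbmM; [exact: lbm_Amx|exact: lu].
    move=> w /andP[vw wt]; apply: (le_trans (ler_norm_sum _ _ _)); apply: sum_le_card => z'.
    rewrite normrM; apply: ler_pM => //; apply: HU; apply/andP; split; lra.
  rewrite !normrM (_ : n * M * H * U * d ^+ 2 = (n * M * d) * (d * H) * U); last by ring.
  apply: ler_pM => //.
  apply: ler_pM => //.
    apply: RI_bound => //; first exact: lbm_exitr.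
    by move=> v _; rewrite ger0_norm ?exitr_ge0//; exact: exitr_le.
  by rewrite (ger0_norm d_ge0) ler_wpM2l.
Qed.

End Transition.

(** * The tilted chain *)
Section Chain.
Variables (R : realType) (V : finType) (T0 : R) (r : rates R V) (m M : R).
Hypothesis gr : goodrates T0 r m M.
Variables (d : measure_display) (Omega : measurableType d)
    (P : probability Omega R) (xi : Omega -> R -> V)
    (p : R -> R -> V -> V -> R) (x : V).
Hypothesis kol : kolmogorov r p.
Hypothesis xiX : forall w, cadlag (xi w).
Hypothesis mxi : forall t y, 0 <= t -> measurable [set w | xi w t = y].
Hypothesis fdd : forall (n : nat) (ts : nat -> R) (ys : nat -> V),
     0 <= ts 0%N -> (forall i, (i < n)%N -> ts i <= ts i.+1) ->
     P [set w | forall i, (i <= n)%N -> xi w (ts i) = ys i] =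
     (p 0 (ts 0%N) x (ys 0%N) *
        \prod_(i < n) p (ts i) (ts i.+1) (ys i) (ys i.+1))%:E.

Lemma measurable_ind (t : R) y : 0 <= t ->
  measurable_fun setT (fun w => (xi w t == y)%:R : R).
Proof.
move=> t0; rewrite (_ : (fun w => _) = \1_[set w | xi w t = y]).
  by apply: measurable_indic; exact: mxi.
apply/funext => w; rewrite indicE; congr (_%:R); congr nat_of_bool.
by apply/eqP/idP => [h|/set_mem//]; exact: mem_set.
Qed.

Lemma measurable_state (F : V -> R) (t : R) : 0 <= t ->
  measurable_fun setT (fun w => F (xi w t)).
Proof.
move=> t0; rewrite (_ : (fun w => _) = (fun w => \sum_y F y * (xi w t == y)%:R)).
  apply: measurable_sum => y; apply: measurable_funM; first exact: measurable_cst.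
  exact: measurable_ind.
apply/funext => w; rewrite (bigD1 (xi w t))//= eqxx mulr1 big1 ?addr0// => y.
by rewrite eq_sym => /negbTE ->; rewrite mulr0.
Qed.

Lemma measurable_state2 (F : V -> V -> R) (s t : R) : 0 <= s -> 0 <= t ->
  measurable_fun setT (fun w => F (xi w s) (xi w t)).
Proof.
move=> s0 t0; rewrite (_ : (fun w => _) = (fun w => \sum_y F y (xi w t) * (xi w s == y)%:R)).
  apply: measurable_sum => y; apply: measurable_funM; last exact: measurable_ind.
  exact: measurable_state.
apply/funext => w; rewrite (bigD1 (xi w s))//= eqxx mulr1 big1 ?addr0// => y.
by rewrite eq_sym => /negbTE ->; rewrite mulr0.
Qed.

Section Weights.
Variables (del : R) (q : V -> V -> R).
Hypotheses (del0 : 0 <= del) (q0 : forall y z, 0 <= q y z).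
Let ts (j : nat) : R := j%:R * del.
Let ts0 j : 0 <= ts j. Proof. by rewrite mulr_ge0. Qed.

Definition Zw k w : R := \prod_(j < k) q (xi w (j%:R * del)) (xi w (j.+1%:R * del)).
(** Unnormalized mass of the weighted chain at the k-th grid time. The base case is [p 0 0 x z]
    rather than a Kronecker symbol in order to match the finite-dimensional distributions
    literally. *)
Fixpoint alpha k z : R := if k is k'.+1 then
  \sum_y alpha k' y * (p (k'%:R * del) (k'.+1%:R * del) y z * q y z) else p 0 0 x z.
Let Ind k N (ys : nat -> V) w : R := \prod_(i < N.+1 | (k <= i)%N) (xi w (ts i) == ys i)%:R.

Lemma measurable_Zw k : measurable_fun setT (Zw k).
Proof.
rewrite /Zw; elim: k => [|k IH].
  by under eq_fun do rewrite big_ord0; exact: measurable_cst.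
under eq_fun do rewrite big_ord_recr/=.
by apply: measurable_funM => //; apply: measurable_state2; exact: ts0.
Qed.

Lemma Zw_ge0 k w : 0 <= Zw k w.
Proof. by apply: prodr_ge0 => j _. Qed.

Let Ind_ge0 k N ys w : 0 <= Ind k N ys w.
Proof. by apply: prodr_ge0 => j _. Qed.

Let measurable_Ind k N ys : measurable_fun setT (Ind k N ys).
Proof.
rewrite /Ind; elim: (index_enum _) => [|i s IH].
  by under eq_fun do rewrite big_nil; exact: measurable_cst.
case ki : (k <= i)%N; under eq_fun do rewrite big_cons ki; last exact: IH.
by apply: measurable_funM => //; exact: measurable_ind.
Qed.

Let upd (ys : nat -> V) k y i := if i == k then y else ys i.

Let Ind_upd k N ys y w : (k < N)%N ->
  Ind k N (upd ys k y) w = (xi w (ts k) == y)%:R * Ind k.+1 N ys w.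
Proof.
move=> kN; have kN1 : (k < N.+1)%N by exact: ltnW.
rewrite /Ind (bigD1 (Ordinal kN1))//= /upd eqxx; congr (_ * _).
apply: eq_big => [i|i /andP[ki ik]].
  by rewrite (ltn_neqAle k i) andbC -val_eqE/= eq_sym.
by rewrite ifN//; move: ik; rewrite -val_eqE.
Qed.

Let step k N ys w : (k < N)%N -> Zw k.+1 w * Ind k.+1 N ys w =
  \sum_y q y (ys k.+1) * (Zw k w * Ind k N (upd ys k y) w).
Proof.
move=> kN; under eq_bigr => y _ do rewrite Ind_upd//.
rewrite (bigD1 (xi w (ts k)))//= eqxx mul1r big1 ?addr0; last first.
  by move=> y; rewrite eq_sym => /negbTE ->; rewrite mul0r !mulr0.
rewrite /Zw big_ord_recr/= -/(ts k) -/(ts k.+1).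
have [e|ne] := eqVneq (xi w (ts k.+1)) (ys k.+1); first by rewrite e; ring.
have -> : Ind k.+1 N ys w = 0; last by rewrite !mulr0.
have kN1 : (k.+1 < N.+1)%N by [].
by rewrite /Ind (bigD1 (Ordinal kN1))//= (negbTE ne) mul0r.
Qed.

(** The grid values from k up to N are all prescribed by [Ind], so that the base case k = 0
    prescribes the entire grid path and is an instance of [fdd]. Each induction step sums over the
    value at one more early time. *)
Let weight_int k N ys : (k <= N)%N ->
  (\int[P]_w (Zw k w * Ind k N ys w)%:E = (alpha k (ys k) *
    \prod_(k <= i < N) p (ts i) (ts i.+1) (ys i) (ys i.+1))%:E)%E.
Proof.
elim: k ys => [|k IH] ys kN.
  pose S := [set w | forall i, (i <= N)%N -> xi w (ts i) = ys i].
  have SE : S = \bigcap_(i in `I_N.+1) [set w | xi w (ts i) = ys i].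
    apply/seteqP; split => w h i; first by move=> /= iN; exact: h.
    by move=> iN; exact: h.
  have mS : measurable S.
    by rewrite SE; apply: fin_bigcap_measurable => // i _; exact: mxi.
  have -> : (\int[P]_w (Zw 0 w * Ind 0 N ys w)%:E = \int[P]_w (\1_S w)%:E)%E.
    apply: eq_integral => w _; congr EFin; rewrite /Zw big_ord0 mul1r indicE.
    have [Sw|Sw] := boolP (w \in S).
      move/set_mem: Sw => Sw; rewrite /Ind big1// => i _.
      by rewrite Sw ?eqxx// -ltnS.
    move: Sw; rewrite notin_setE => /existsNP[i /not_implyP[iN ne]].
    have iN1 : (i < N.+1)%N by [].
    rewrite /Ind (bigD1 (Ordinal iN1))//=.
    by move/eqP/negbTE: ne => ->; rewrite mul0r.
  transitivity (P S); first by rewrite integral_indic// setIT.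
  rewrite /S fdd//; last first.
    by move=> i _; rewrite /ts ler_wpM2r// ler_nat.
  by rewrite /ts mul0r big_mkord.
under eq_integral => w _ do rewrite step// -sumEFin.
rewrite ge0_integral_sum//; last 2 first.
- move=> y; apply/measurable_EFinP; apply: measurable_funM; first exact: measurable_cst.
  by apply: measurable_funM; [exact: measurable_Zw|exact: measurable_Ind].
- by move=> y w _; rewrite lee_fin !mulr_ge0// Zw_ge0.
under [LHS]eq_bigr => y _.
  under eq_integral => w _ do rewrite EFinM.
  rewrite ge0_integralZl_EFin//; last 2 first.
  - by move=> w _; rewrite lee_fin mulr_ge0// Zw_ge0.
  - by apply/measurable_EFinP; apply: measurable_funM; [exact: measurable_Zw|exact: measurable_Ind].
  rewrite IH; last exact: ltnW.
  over.
rewrite /= -?sumEFin.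
under eq_bigr => y _ do rewrite -EFinM.
rewrite sumEFin; congr EFin; rewrite mulr_suml; apply: eq_bigr => y _.
rewrite (big_ltn kN) /upd eqxx (_ : (k.+1 == k) = false); last by rewrite gtn_eqF.
rewrite (@eq_big_nat _ _ _ k.+1 N _ (fun i => p (ts i) (ts i.+1) (ys i) (ys i.+1))).
  by rewrite /ts; ring.
move=> i /andP[ki iN]; rewrite !ifN//; last by rewrite gtn_eqF.
by rewrite gtn_eqF// ltnS ltnW.
Qed.

Lemma weight_end k z : (\int[P]_w (Zw k w * (xi w (k%:R * del) == z)%:R)%:E = (alpha k z)%:E)%E.
Proof.
have := @weight_int k k (fun=> z) (leqnn _); rewrite big_geq// mulr1 => <-.
apply: eq_integral => w _; congr EFin; congr (_ * _).
rewrite /Ind (bigD1 ord_max)//= big1 ?mulr1// => i /andP[ki ne].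
by exfalso; move: ne; rewrite -val_eqE/= eqn_leq ki -ltnS ltn_ord.
Qed.

(** The sign is read off the expectation in [weight_end], since the signs of [p] are not among the
    hypotheses. *)
Lemma alpha_ge0 k z : 0 <= alpha k z.
Proof.
rewrite -lee_fin -weight_end; apply: integral_ge0 => w _.
by rewrite lee_fin mulr_ge0// Zw_ge0.
Qed.

Lemma weight_state k (F : V -> R) : (forall z, 0 <= F z) ->
  (\int[P]_w (Zw k w * F (xi w (k%:R * del)))%:E = (\sum_z alpha k z * F z)%:E)%E.
Proof.
move=> F0.
have -> : (\int[P]_w (Zw k w * F (xi w (k%:R * del)))%:E =
   \int[P]_w (\sum_z (F z)%:E * (Zw k w * (xi w (k%:R * del) == z)%:R)%:E))%E.
  apply: eq_integral => w _.
  rewrite (eq_bigr (fun z => (F z * (Zw k w * (xi w (k%:R * del) == z)%:R))%:E)); last first.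
    by move=> z _; rewrite EFinM.
  rewrite sumEFin; congr EFin.
  rewrite (bigD1 (xi w (k%:R * del)))//= eqxx mulr1 big1 ?addr0 1?mulrC// => z.
  by rewrite eq_sym => /negbTE ->; rewrite !mulr0.
have mZ z : measurable_fun setT (fun w => (Zw k w * (xi w (k%:R * del) == z)%:R)%:E).
  apply/measurable_EFinP; apply: measurable_funM; first exact: measurable_Zw.
  by apply: measurable_ind; exact: ts0.
rewrite ge0_integral_sum//; last 2 first.
- by move=> z; apply: emeasurable_funM => //; exact: measurable_cst.
- by move=> z w _; rewrite mule_ge0// lee_fin// mulr_ge0// Zw_ge0.
under eq_bigr => z _.
  rewrite ge0_integralZl_EFin//; last first.
    by move=> w _; rewrite lee_fin mulr_ge0// Zw_ge0.
  rewrite weight_end -EFinM mulrC; over.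
by rewrite sumEFin.
Qed.

End Weights.

Section Tilt.
Variables (T : R) (h : V -> R) (g : V -> V -> R) (u : R -> V -> R) (b : R).
Hypotheses (T_gt0 : 0 < T) (bu : backsol r h g u) (b0 : 0 < b)
  (ub : forall (t : R) z, 0 <= t <= T -> b <= u t z).

Let mesh (N : nat) : R := T / N.+1%:R.
Let mesh_ge0 N : 0 <= mesh N. Proof. by rewrite divr_ge0// ltW. Qed.
Let meshT N : N.+1%:R * mesh N = T.
Proof. by rewrite /mesh mulrC divfK// pnatr_eq0. Qed.
Let qN N := qw h g (mesh N).
Let qN0 N y z : 0 <= qN N y z. Proof. exact: expR_ge0. Qed.

Definition amass N := \sum_z alpha (mesh N) (qN N) N.+1 z * u T z.

(** Pairing the mass with u along the grid gives an almost constant sequence: each step changes it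
    by a relative amount of order mesh^2, and N + 1 steps accumulate a relative error of order 1 /
    (N + 1). *)
Lemma amass_cvg : amass N @[N --> \oo] --> u 0 x.
Proof.
have [C [d0 [C0 d00 HC]]] := one_step gr kol (ltW T_gt0) bu.
have bx : b <= u 0 x by apply: ub; rewrite lexx ltW.
have u0 : 0 < u 0 x by exact: lt_le_trans bx.
have key N : mesh N <= d0 -> `|amass N - u 0 x| <= u 0 x * (expR (C / b * T ^+ 2 / N.+1%:R) - 1).
  move=> Nd.
  have n0 : 0 < N.+1%:R :> R by rewrite ltr0n.
  (* [one_step] gives an absolute error C mesh^2 per unit of mass; the lower bound b on u turns it
     into an error relative to a k. *)
  pose y := C / b * (mesh N) ^+ 2.
  have y0 : 0 <= y by rewrite mulr_ge0 ?sqr_ge0// divr_ge0// ltW.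
  pose a k := \sum_z alpha (mesh N) (qN N) k z * u (k%:R * mesh N) z.
  have a0 : a 0%N = u 0 x.
    rewrite /a mul0r /= (bigD1 x)//= (@kol 0 0 x x _).2 ?lexx//.
    rewrite eqxx [Rintegral _ _ _]RI_same addr0 mul1r big1 ?addr0// => z zx.
    rewrite (@kol 0 0 x z _).2 ?lexx// [Rintegral _ _ _]RI_same addr0.
    by rewrite eq_sym (negbTE zx) mul0r.
  have al k z : 0 <= alpha (mesh N) (qN N) k z by exact: alpha_ge0.
  have ab k : (k <= N.+1)%N -> \sum_z alpha (mesh N) (qN N) k z * b <= a k.
    move=> kN; apply: ler_sum => z _; rewrite ler_wpM2l//; apply: ub.
    by rewrite mulr_ge0//= -(meshT N) ler_wpM2r// ler_nat.
  have stepa k : (k <= N)%N -> `|a k.+1 - a k| <= y * a k.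
    move=> kN.
    have -> : a k.+1 = \sum_y alpha (mesh N) (qN N) k y *
       \sum_z p (k%:R * mesh N) (k.+1%:R * mesh N) y z * qN N y z * u (k.+1%:R * mesh N) z.
      rewrite /a /=; under eq_bigr => z _ do rewrite mulr_suml.
      rewrite exchange_big/=; apply: eq_bigr => z _; rewrite mulr_sumr.
      by apply: eq_bigr => z' _; rewrite -mulrA.
    rewrite {1}/a -sumrB; apply: (le_trans (ler_norm_sum _ _ _)).
    apply: (@le_trans _ _ (\sum_z alpha (mesh N) (qN N) k z * (C * mesh N ^+ 2))).
      apply: ler_sum => z _; rewrite -mulrBr normrM ger0_norm// ler_wpM2l//.
      have dE : k.+1%:R * mesh N - k%:R * mesh N = mesh N by rewrite -natr1; ring.
      have := HC (k%:R * mesh N) (k.+1%:R * mesh N) z.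
      rewrite dE; apply => //.
      - by rewrite mulr_ge0.
      - by rewrite ler_wpM2r// ler_nat.
      - by rewrite -(meshT N) ler_wpM2r// ler_nat ltnS.
    rewrite -mulr_suml.
    have := ab k (leqW kN); rewrite -mulr_suml => h1.
    have -> : y * a k = C * mesh N ^+ 2 * (a k / b) by rewrite /y; field; rewrite gt_eqF.
    rewrite mulrC; apply: ler_wpM2l; first by apply: mulr_ge0 => //; exact: sqr_ge0.
    by rewrite ler_pdivlMr.
  have ind k : (k <= N.+1)%N -> `|a k - u 0 x| <= u 0 x * ((1 + y) ^+ k - 1).
    elim: k => [_|k IH kN]; first by rewrite a0 subrr normr0 expr0 subrr mulr0.
    have IH' := IH (ltnW kN).
    have ak : a k <= u 0 x * (1 + y) ^+ k.
      by move: IH'; rewrite ler_norml => /andP[_]; lra.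
    have := stepa k kN.
    have -> : a k.+1 - u 0 x = (a k.+1 - a k) + (a k - u 0 x) by ring.
    move=> h1; apply: (le_trans (ler_normD _ _)); rewrite exprS.
    have h2 : y * a k <= y * (u 0 x * (1 + y) ^+ k) by rewrite ler_wpM2l.
    lra.
  have -> : amass N = a N.+1 by rewrite /amass /a meshT.
  apply: (le_trans (ind N.+1 (leqnn _))); rewrite ler_wpM2l ?(ltW u0)// lerD2r.
  have -> : C / b * T ^+ 2 / N.+1%:R = y *+ N.+1.
    by rewrite /y /mesh -mulr_natl; field; rewrite !gt_eqF.
  rewrite -mulr_natl expRM_natl lerXn2r ?nnegrE ?addr_ge0 ?expR_ge0//; exact: expR_ge1Dx.
have lim0 : u 0 x * (expR (C / b * T ^+ 2 / N.+1%:R) - 1) @[N --> \oo] --> 0.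
  suff: u 0 x * (expR (C / b * T ^+ 2 / N.+1%:R) - 1) @[N --> \oo] --> u 0 x * (expR (C / b * T ^+ 2 * 0) - 1).
    by rewrite mulr0 expR0 subrr mulr0.
  apply: cvgM; first exact: cvg_cst.
  apply: cvgB; last exact: cvg_cst.
  apply: continuous_cvg; first exact: continuous_expR.
  by apply: cvgM; [exact: cvg_cst|exact: cvg_harmonic].
apply/cvgrPdist_le => e e0.
have md : \forall N \near \oo, mesh N <= d0.
  have mT : mesh N @[N --> \oo] --> T * 0 by apply: cvgM; [exact: cvg_cst|exact: cvg_harmonic].
  rewrite mulr0 in mT; move/cvgrPdist_le: mT => /(_ _ d00); apply: filterS => N.
  by rewrite sub0r normrN ger0_norm.
move/cvgrPdist_le: lim0 => /(_ _ e0) lim0.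
near=> N.
rewrite distrC; apply: (@le_trans _ _ (u 0 x * (expR (C / b * T ^+ 2 / N.+1%:R) - 1))).
  by apply: key; near: N.
have : `|0 - u 0 x * (expR (C / b * T ^+ 2 / N.+1%:R) - 1)| <= e by near: N.
by rewrite sub0r normrN ler_norml => /andP[].
Unshelve. all: by end_near. Qed.

Definition dS N w : R := \sum_y h y * docc (xi w) (mesh N) N.+1 y +
  \sum_(yz : V * V | yz.1 != yz.2) g yz.1 yz.2 * dcount (xi w) (mesh N) N.+1 yz.1 yz.2.

Definition cS w : R :=
  \sum_y h y * fine (@lebesgue_measure R [set t | 0 <= t <= T /\ xi w t = y]) +
  \sum_(yz : V * V | yz.1 != yz.2) g yz.1 yz.2 *
     fine (counting [set t : R | 0 < t <= T /\ jump_at (xi w) yz.1 yz.2 t]).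

Lemma dS_Zw N w : expR (dS N w) = Zw (mesh N) (qN N) N.+1 w.
Proof.
rewrite /Zw /qN /qw -expR_sum; congr expR; rewrite /dS /docc /dcount big_split/=; congr (_ + _).
  under eq_bigr => y _ do rewrite mulr_sumr.
  rewrite exchange_big/=; apply: eq_bigr => j _.
  rewrite (bigD1 (xi w (j%:R * mesh N)))//= eqxx big1 ?addr0; first by rewrite mulr1 mulrC.
  by move=> y; rewrite eq_sym => /negbTE ->; rewrite !mulr0.
under eq_bigr => y _ do rewrite mulr_sumr.
rewrite exchange_big/=; apply: eq_bigr => j _.
set a := xi w _; set c := xi w _.
have [ac|ac] := eqVneq a c.
  rewrite big1// => -[y z] /= yz; case: eqP => //= ay; last by rewrite mulr0.
  case: eqP => //= cz; last by rewrite mulr0.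
  by move: yz; rewrite -ay -cz ac eqxx.
rewrite (bigD1 (a, c))//= !eqxx/= mulr1 big1 ?addr0// => -[y z] /= /andP[yz neq].
case: eqP => //= ay; last by rewrite mulr0.
case: eqP => //= cz; last by rewrite mulr0.
by move: neq; rewrite -ay -cz eqxx.
Qed.

(** Jump counts on the grid are eventually exact, and occupation times are off by the mesh times a
    jump count that does not depend on N. *)
Lemma dS_cvg w : dS N w @[N --> \oo] --> cS w.
Proof.
have [N0 HN0] := path_discretization (xiX w) T_gt0.
rewrite /dS /cS; apply: cvgD.
  apply: cvg_sumr => y; apply: cvgM; first exact: cvg_cst.
  set J := \sum_(yz : V * V | yz.1 != yz.2)
     fine (counting [set t : R | 0 < t <= T /\ jump_at (xi w) yz.1 yz.2 t]) : R.
  have mJ : mesh N * J @[N --> \oo] --> 0.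
    rewrite (_ : 0 = T * 0 * J); last by rewrite mulr0 mul0r.
    by apply: cvgM; [apply: cvgM; [exact: cvg_cst|exact: cvg_harmonic]|exact: cvg_cst].
  apply/cvgrPdist_le => e e0; move/cvgrPdist_le: mJ => /(_ _ e0) mJ.
  near=> N.
  have := (HN0 N _).2 y; rewrite -/J => /(_ _) H; apply: (le_trans (H _)); last first.
    have : `|0 - mesh N * J| <= e by near: N.
    by rewrite sub0r normrN ler_norml => /andP[].
  by near: N; exists N0.
rewrite [X in _ --> X]big_mkcond; under eq_cvg do rewrite big_mkcond.
apply: cvg_sumr => -[y z] /=; case: ifPn => yz; last exact: cvg_cst.
apply: cvgM; first exact: cvg_cst.
apply: cvg_near_cst; near=> N; rewrite (HN0 N _).1//.
by near: N; exists N0.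
Unshelve. all: by end_near. Qed.

Lemma measurable_dS N : measurable_fun setT (dS N).
Proof.
have mt j : 0 <= j%:R * mesh N by rewrite mulr_ge0.
apply: measurable_funD.
  apply: measurable_sum => y; apply: measurable_funM; first exact: measurable_cst.
  apply: measurable_sum => j; apply: measurable_funM; first exact: measurable_cst.
  exact: measurable_ind.
rewrite (_ : (fun w => \sum_(yz | _) _) = (fun w => \sum_(yz : V * V) (if yz.1 != yz.2 then
   g yz.1 yz.2 * dcount (xi w) (mesh N) N.+1 yz.1 yz.2 else 0))); last first.
  by apply/funext => w; rewrite big_mkcond.
apply: measurable_sum => -[y z] /=; case: (y != z); last exact: measurable_cst.
apply: measurable_funM; first exact: measurable_cst.
apply: measurable_sum => j.
exact: (measurable_state2 (fun a c => ((a == y) && (c == z))%:R)).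
Qed.

(** Exact jump counts and occupation times depend on uncountably many times; their measurability
    comes from being a pointwise limit of functions of finitely many values of the chain. *)
Lemma measurable_cS : measurable_fun setT cS.
Proof.
apply: (@measurable_fun_cvg _ _ _ _ dS) => //; first exact: measurable_dS.
by move=> w _; exact: dS_cvg.
Qed.

Definition fN N w : R := expR (dS N w) * u T (xi w T).
Definition fw w : R := expR (cS w) * u T (xi w T).

Lemma uT_ge z : b <= u T z. Proof. by apply: ub; rewrite lexx ltW. Qed.
Lemma uT_gt0 z : 0 < u T z. Proof. exact: lt_le_trans b0 (uT_ge z). Qed.

Lemma measurable_fN N : measurable_fun setT (fN N).
Proof.
apply: measurable_funM; last by apply: measurable_state; exact: ltW.
by apply: measurableT_comp => //; exact: measurable_dS.
Qed.

Lemma measurable_fw : measurable_fun setT fw.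
Proof.
apply: measurable_funM; last by apply: measurable_state; exact: ltW.
by apply: measurableT_comp => //; exact: measurable_cS.
Qed.

Lemma fN_ge0 N w : 0 <= fN N w.
Proof. by rewrite mulr_ge0 ?expR_ge0// ltW// uT_gt0. Qed.

Lemma fw_ge0 w : 0 <= fw w.
Proof. by rewrite mulr_ge0 ?expR_ge0// ltW// uT_gt0. Qed.

Lemma fN_int N : (\int[P]_w (fN N w)%:E = (amass N)%:E)%E.
Proof.
rewrite /amass -weight_state//; last by move=> z; rewrite ltW// uT_gt0.
by apply: eq_integral => w _; rewrite /fN dS_Zw meshT.
Qed.

Lemma fN_cvg w : fN N w @[N --> \oo] --> fw w.
Proof.
apply: cvgM; last exact: cvg_cst.
by apply: continuous_cvg; [exact: continuous_expR|exact: dS_cvg].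
Qed.

(** Fatou along the grids. The reverse inequality, [fw_lower], needs uniform integrability. *)
Lemma fw_le : (\int[P]_w (fw w)%:E <= (u 0 x)%:E)%E.
Proof.
have := @fatou _ _ _ P setT measurableT (fun N w => (fN N w)%:E).
have -> : (\int[P]_w limn_einf (fun N => (fN N w)%:E) = \int[P]_w (fw w)%:E)%E.
  apply: eq_integral => w _; have := @cvg_limn_einf_sup R (fun N => (fN N w)%:E) (fw w)%:E.
  by case=> //; apply: cvg_EFin; [exact: nearW|exact: fN_cvg].
move=> H; apply: (le_trans (H _ _)).
- by move=> N; apply/measurable_EFinP; exact: measurable_fN.
- by move=> N w _; rewrite lee_fin fN_ge0.
have -> : limn_einf (fun N => \int[P]_w (fN N w)%:E)%E = (u 0 x)%:E => //.
have := @cvg_limn_einf_sup R (fun N => \int[P]_w (fN N w)%:E)%E (u 0 x)%:E.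
case=> //; under eq_cvg do rewrite fN_int.
by apply: cvg_EFin; [exact: nearW|exact: amass_cvg].
Qed.

End Tilt.
End Chain.

(** * Exponential moments and the state space *)
Section Mgf.
Variables (R : realType) (V : finType) (T0 : R) (r : rates R V) (m M : R).
Hypothesis gr : goodrates T0 r m M.
Variables (d : measure_display) (Omega : measurableType d)
    (P : probability Omega R) (xi : Omega -> R -> V)
    (p : R -> R -> V -> V -> R) (x : V).
Hypothesis kol : kolmogorov r p.
Hypothesis xiX : forall w, cadlag (xi w).
Hypothesis mxi : forall t y, 0 <= t -> measurable [set w | xi w t = y].
Hypothesis fdd : forall (n : nat) (ts : nat -> R) (ys : nat -> V),
     0 <= ts 0%N -> (forall i, (i < n)%N -> ts i <= ts i.+1) ->
     P [set w | forall i, (i <= n)%N -> xi w (ts i) = ys i] =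
     (p 0 (ts 0%N) x (ys 0%N) *
        \prod_(i < n) p (ts i) (ts i.+1) (ys i) (ys i.+1))%:E.

Section Lower.
Variables (T : R) (h : V -> R) (g : V -> V -> R) (u u2 : R -> V -> R) (b b2 : R).
Hypotheses (T_gt0 : 0 < T) (bu : backsol r h g u) (b0 : 0 < b)
  (ub : forall (t : R) z, 0 <= t <= T -> b <= u t z).
Let h2 y := 2 * h y.
Let g2 y z := 2 * g y z.
Hypotheses (bu2 : backsol r h2 g2 u2) (b20 : 0 < b2)
  (ub2 : forall (t : R) z, 0 <= t <= T -> b2 <= u2 t z).

Let f N w := fN xi T h g u N w.
Let f2 N w := fN xi T h2 g2 u2 N w.
Let fl w := fw xi T h g u w.
Let mf N : measurable_fun setT (f N) := measurable_fN mxi h g u T_gt0 N.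
Let mf2 N : measurable_fun setT (f2 N) := measurable_fN mxi h2 g2 u2 T_gt0 N.
Let mfl : measurable_fun setT fl := measurable_fw xiX mxi h g u T_gt0.
Let f0 N w : 0 <= f N w := fN_ge0 xi h g T_gt0 b0 ub N w.
Let f20 N w : 0 <= f2 N w := fN_ge0 xi h2 g2 T_gt0 b20 ub2 N w.
Let fl0 w : 0 <= fl w := fw_ge0 xi h g T_gt0 b0 ub w.

(** The square of the exponential weight is the weight for the doubled tilt, whose expectations
    converge by [amass_cvg]. Second moments are therefore bounded, truncation at a level B loses at
    most a multiple of 1 / B, and bounded convergence handles the truncated part. *)
Lemma fw_lower : ((u 0 x)%:E <= \int[P]_w (fw xi T h g u w)%:E)%E.
Proof.
pose U := \sum_z u T z.
have uTp z : 0 < u T z by exact: (uT_gt0 T_gt0 b0 ub).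
have u2T z : b2 <= u2 T z by exact: (uT_ge T_gt0 ub2).
have U0 : 0 <= U by apply: sumr_ge0 => z _; exact: ltW.
have uU z : u T z <= U by rewrite /U (bigD1 z)//= lerDl sumr_ge0// => i _; exact: ltW.
(* Compares u^2, at most U^2, with u2, at least b2, at time T. *)
pose K := U ^+ 2 / b2.
have K0 : 0 <= K by rewrite divr_ge0 ?sqr_ge0// ltW.
have ff2 N w : f N w ^+ 2 <= K * f2 N w.
  rewrite /f /f2 /fN exprMn.
  have -> : expR (dS xi T h2 g2 N w) = expR (dS xi T h g N w) ^+ 2.
    rewrite -expRM_natl; congr expR; rewrite /dS mulrDr !mulr_sumr; congr (_ + _);
      by apply: eq_bigr => ? _; rewrite mulrA.
  rewrite [leRHS]mulrCA; apply: ler_wpM2l; first by rewrite sqr_ge0.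
  apply: (@le_trans _ _ (U ^+ 2)); first by rewrite ler_sqr ?nnegrE// ltW.
  by rewrite /K mulrAC ler_pdivlMr// ler_wpM2l// sqr_ge0.
have c1 := amass_cvg gr kol mxi fdd T_gt0 bu b0 ub.
have c2 := amass_cvg gr kol mxi fdd T_gt0 bu2 b20 ub2.
have int1 N : (\int[P]_w (f N w)%:E = (amass p x T h g u N)%:E)%E.
  exact: (fN_int mxi fdd h g T_gt0 b0 ub).
have int2 N : (\int[P]_w (f2 N w)%:E = (amass p x T h2 g2 u2 N)%:E)%E.
  exact: (fN_int mxi fdd h2 g2 T_gt0 b20 ub2).
pose D := K * (u2 0 x + 1).
have D0 : 0 <= D.
  apply: mulr_ge0 => //; apply: addr_ge0 => //.
  by apply: (le_trans (ltW b20)); apply: ub2; rewrite lexx ltW.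
have key (B e : R) : 0 < B -> 0 < e -> ((u 0 x - e - D / B)%:E <= \int[P]_w (fl w)%:E)%E.
  move=> B0 e0.
  pose gN N w := Num.min (f N w) B.
  pose gl w := Num.min (fl w) B.
  have mg N : measurable_fun setT (gN N) by apply: measurable_minr => //; exact: mf.
  have mgl : measurable_fun setT gl by apply: measurable_minr => //; exact: mfl.
  have g0 N w : 0 <= gN N w by rewrite le_min f0 ltW.
  have bd N w : f N w <= gN N w + K / B * f2 N w.
    have h1 := ff2 N w; have h3 := f0 N w; have h4 := f20 N w.
    rewrite /gN; case: (lerP (f N w) B) => fB.
      by rewrite lerDl mulr_ge0// divr_ge0// ltW.
    apply: (@le_trans _ _ (K * f2 N w / B)); last by rewrite mulrAC lerDr ltW.
    rewrite ler_pdivlMr//; apply: le_trans h1; rewrite expr2 ler_wpM2l// ltW//.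
  have intg N : ((amass p x T h g u N - K / B * amass p x T h2 g2 u2 N)%:E <= \int[P]_w (gN N w)%:E)%E.
    rewrite EFinB leeBlDr// EFinM -int1 -int2 -ge0_integralZl_EFin//; last 3 first.
    - by move=> w _; rewrite lee_fin f20.
    - by apply/measurable_EFinP; exact: mf2.
    - by rewrite divr_ge0// ltW.
    rewrite -ge0_integralD//; last 4 first.
    - by move=> w _; rewrite lee_fin g0.
    - by apply/measurable_EFinP; exact: mg.
    - by move=> w _; rewrite -EFinM lee_fin mulr_ge0 ?f20// divr_ge0// ltW.
    - by apply: emeasurable_funM; [exact: measurable_cst|apply/measurable_EFinP; exact: mf2].
    apply: ge0_le_integral => //.
    - by move=> w _; rewrite lee_fin f0.
    - by apply/measurable_EFinP; exact: mf.
    - apply: emeasurable_funD; first by apply/measurable_EFinP; exact: mg.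
      by apply: emeasurable_funM; [exact: measurable_cst|apply/measurable_EFinP; exact: mf2].
    - by move=> w _; rewrite -EFinM -EFinD lee_fin bd.
  have gcvg : (\int[P]_w (gN N w)%:E @[N --> \oo] --> \int[P]_w (gl w)%:E)%E.
    have := @dominated_convergence _ _ _ P setT measurableT (fun N w => (gN N w)%:E)
      (fun w => (gl w)%:E) (fun=> B%:E).
    case=> //.
    - by move=> N; apply/measurable_EFinP; exact: mg.
    - by apply/measurable_EFinP; exact: mgl.
    - apply: aeW => w _; apply: cvg_EFin; first exact: nearW.
      have fc : f N w @[N --> \oo] --> fl w by apply: fN_cvg.
      rewrite /gN /gl.
      have := @continuous_min R R id (fun=> B) (fl w) (@cvg_id _ _) (cvg_cst _).
      by move=> /(_ _) hc; exact: (cvg_comp _ _ fc hc).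
    - by apply: finite_measure_integrable_cst.
    - by apply: aeW => w N _; rewrite lee_fin ger0_norm// ge_min lexx orbT.
  apply: (@le_trans _ _ (\int[P]_w (gl w)%:E)%E); last first.
    apply: ge0_le_integral => //.
    - by move=> w _; rewrite lee_fin le_min fl0 ltW.
    - by apply/measurable_EFinP; exact: mgl.
    - by apply/measurable_EFinP; exact: mfl.
    - by move=> w _; rewrite lee_fin ge_min lexx.
  have <- := cvg_lim (@ereal_hausdorff R) gcvg.
  apply: lime_ge; first by apply/cvg_ex; eexists; exact: gcvg.
  move/cvgrPdist_le: c1 => /(_ _ e0) c1'.
  move/cvgrPdist_le: c2 => /(_ _ ltr01) c2'.
  near=> N; apply: le_trans (intg N); rewrite lee_fin.
  have : `|u 0 x - amass p x T h g u N| <= e by near: N.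
  have : `|u2 0 x - amass p x T h2 g2 u2 N| <= 1 by near: N.
  rewrite !ler_norml => /andP[a1 a2] /andP[a3 a4].
  have : K / B * amass p x T h2 g2 u2 N <= D / B.
    rewrite /D mulrAC ler_wpM2r ?invr_ge0 ?(ltW B0)// ler_wpM2l//; lra.
  lra.
apply/lee_addgt0Pr => e e0.
have e2 : 0 < e / 2 by rewrite divr_gt0.
pose B := 2 * D / e + 1.
have B0 : 0 < B := ltr_wpDl (divr_ge0 (mulr_ge0 (ler0n _ 2) D0) (ltW e0)) ltr01.
have := key B (e / 2) B0 e2; move: (\int[P]_w _)%E => I hI.
have DB : D / B <= e / 2.
  rewrite ler_pdivrMr// /B.
  have -> : e / 2 * (2 * D / e + 1) = D + e / 2 by field; rewrite gt_eqF.
  by rewrite lerDl ltW.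
apply: (@le_trans _ _ ((u 0 x - e / 2 - D / B)%:E + e%:E)%E); last exact: leeD2r.
rewrite -EFinD lee_fin; lra.
Unshelve. all: by end_near. Qed.

End Lower.

Definition pairing (h : V -> R) (g : V -> V -> R) (pt : state_space R V) : R :=
  \sum_y h y * pt.1 y + \sum_y \sum_z g y z * pt.2 y z.

Definition emp (T : R) (w : Omega) : state_space R V :=
  (emp_measure T (xi w), emp_flow r T (xi w)).

Lemma cS_emp (T : R) h g w : 0 < T -> (forall y z, ~~ edge r y z -> g y z = 0) ->
  cS xi T h g w = T * pairing h g (emp T w).
Proof.
move=> T_gt0 g0; rewrite /cS /pairing mulrDr mulr_sumr; congr (_ + _).
  apply: eq_bigr => y _; rewrite /emp/= /emp_measure mulrCA [T * (_ * _)]mulrA.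
  by rewrite divff ?gt_eqF// mul1r.
rewrite mulr_sumr; under [RHS]eq_bigr => y _ do rewrite mulr_sumr.
rewrite pair_big/= big_mkcond/=; apply: eq_bigr => -[y z] _ /=.
rewrite /emp_flow; case: ifPn => yz.
  have [e|e] := boolP (edge r y z); last by rewrite g0// !mul0r mulr0.
  by rewrite mulrCA [T * (_ * _)]mulrA divff ?gt_eqF// mul1r.
by rewrite ifN ?mulr0//; apply: contra yz; exact: edge_neq.
Qed.

(** For h = 1 and g = 0 the grid exponent [dS] equals T at every mesh, and so does its limit
    [cS]. *)
Lemma emp_mass (T : R) w : 0 < T -> \sum_y emp_measure T (xi w) y = 1.
Proof.
move=> T_gt0.
have c : dS xi T (fun=> 1) (fun _ _ => 0) N w @[N --> \oo] --> cS xi T (fun=> 1) (fun _ _ => 0) w.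
  exact: dS_cvg.
have c' : dS xi T (fun=> 1) (fun _ _ => 0) N w @[N --> \oo] --> T.
  rewrite (_ : (fun N => _) = (fun=> T)); first exact: cvg_cst.
  apply/funext => N; rewrite /dS [X in _ + X]big1 ?addr0; last by move=> yz _; rewrite mul0r.
  under eq_bigr => y _ do rewrite mul1r /docc.
  rewrite exchange_big/=.
  rewrite (eq_bigr (fun=> T / N.+1%:R)).
    by rewrite sumr_const card_ord -[LHS]mulr_natr divfK// pnatr_eq0.
  move=> j _; rewrite (bigD1 (xi w (j%:R * (T / N.+1%:R))))//= eqxx mulr1 big1 ?addr0// => y.
  by rewrite eq_sym => /negbTE ->; rewrite mulr0.
have := etrans (esym (cvg_lim (@Rhausdorff R) c)) (cvg_lim (@Rhausdorff R) c').
rewrite cS_emp// /pairing.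
rewrite [X in _ * (_ + X)]big1 ?addr0; last by move=> y _; rewrite big1// => z _; rewrite mul0r.
under eq_bigr => y _ do rewrite mul1r.
by move=> /(_ _ _)/eqP; rewrite -[eqbRHS]mulr1 => /eqP /mulfI; apply; rewrite gt_eqF.
Qed.

Lemma emp_measure_ge0 (T : R) w y : 0 < T -> 0 <= emp_measure T (xi w) y.
Proof. by move=> T_gt0; rewrite mulr_ge0 ?invr_ge0 ?fine_ge0// ltW. Qed.

Lemma emp_flow_ge0 (T : R) w y z : 0 < T -> 0 <= emp_flow r T (xi w) y z.
Proof.
move=> T_gt0; rewrite /emp_flow; case: ifP => // _.
rewrite mulr_ge0 ?invr_ge0 ?(ltW T_gt0)// fine_ge0//.
Qed.

Lemma emp_flow_nonedge (T : R) w y z : ~~ edge r y z -> emp_flow r T (xi w) y z = 0.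
Proof. by rewrite /emp_flow => /negbTE ->. Qed.

Lemma measurable_emp_measure (T : R) y : 0 < T ->
  measurable_fun setT (fun w => emp_measure T (xi w) y).
Proof.
move=> T_gt0; rewrite (_ : (fun w => _) =
   (fun w => T^-1 * cS xi T (fun y' => (y' == y)%:R) (fun _ _ => 0) w)).
  by apply: measurable_funM; [exact: measurable_cst|exact: measurable_cS].
apply/funext => w; rewrite cS_emp// mulrA mulVf ?gt_eqF// mul1r /pairing.
rewrite [X in _ = _ + X]big1 ?addr0; last by move=> a _; rewrite big1// => z _; rewrite mul0r.
rewrite (bigD1 y)//= eqxx mul1r big1 ?addr0// => a /negbTE ->.
by rewrite mul0r.
Qed.

Lemma measurable_emp_flow (T : R) y z : 0 < T ->
  measurable_fun setT (fun w => emp_flow r T (xi w) y z).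
Proof.
move=> T_gt0; have [e|e] := boolP (edge r y z); last first.
  by under eq_fun do rewrite emp_flow_nonedge//; exact: measurable_cst.
rewrite (_ : (fun w => _) =
   (fun w => T^-1 * cS xi T (fun=> 0) (fun a c => ((a == y) && (c == z))%:R) w)).
  by apply: measurable_funM; [exact: measurable_cst|exact: measurable_cS].
apply/funext => w; rewrite cS_emp//; last first.
  by move=> a c ne; case: eqP => //= ay; case: eqP => //= cz; move: ne; rewrite ay cz e.
rewrite mulrA mulVf ?gt_eqF// mul1r /pairing.
rewrite [X in _ = X + _]big1 ?add0r; last by move=> a _; rewrite mul0r.
rewrite (bigD1 y)//= (bigD1 z)//= !eqxx mul1r [X in _ + X + _]big1 ?addr0; last first.
  by move=> c /negbTE ->; rewrite andbF mul0r.
rewrite big1 ?addr0// => a /negbTE ->.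
by rewrite big1// => c _; rewrite mul0r.
Qed.

End Mgf.

(** * Topology and measurability in the state space *)

Section StateSpace.
Variables (R : realType) (V : finType).

Definition near_pt (e : R) (a b : state_space R V) :=
  (forall y, `|a.1 y - b.1 y| < e) /\ (forall y z, `|a.2 y z - b.2 y z| < e).

Lemma ptws_cvg (T : topologicalType) (F : set_system (V -> T)) (FF : Filter F)
  (f : V -> T) : (forall y, (fun g : V -> T => g y) @ F --> f y) ->
  {ptws, F --> f}.
Proof.
move=> H; apply/cvg_sup => y; apply/cvg_image.
  by rewrite eqEsubset; split=> v // _; exists (cst v).
move=> W /= Wf; exists (@^~ y @^-1` W); first exact: H.
by rewrite eqEsubset; split => [j [? + <-//]|j Wj]; exists (fun _ => j).
Qed.

(** Otherwise there would be points outside G in the boxes of radius 1 / (k + 1) around pt; they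
    converge in each coordinate, hence in the product topology, to pt. *)
Lemma state_nbhs (pt : state_space R V) (G : set (state_space R V)) : nbhs pt G ->
  exists2 e : R, 0 < e & forall pt', near_pt e pt pt' -> G pt'.
Proof.
move=> Gpt; apply: contrapT => /forall2NP H.
have /choice[q Hq] : forall k : nat, exists pt', near_pt k.+1%:R^-1 pt pt' /\ ~ G pt'.
  move=> k; have [|/existsNP[pt' /not_implyP[h1 h2]]] := H k.+1%:R^-1.
    by rewrite invr_gt0 ltr0n.
  by exists pt'.
have inv0 (e : R) : 0 < e -> \forall k \near \oo, k.+1%:R^-1 <= e.
  move=> e0; have := @cvg_harmonic R => /cvgrPdist_le/(_ _ e0); apply: filterS => k.
  by rewrite sub0r normrN ger0_norm ?invr_ge0.
have qcvg : q k @[k --> \oo] --> pt.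
  rewrite [pt]surjective_pairing.
  apply: (@cvg_trans _ (((q k).1, (q k).2) @[k --> \oo])).
    by apply: near_eq_cvg; apply: nearW => k; rewrite -surjective_pairing.
  have c1 : (q k).1 @[k --> \oo] --> (pt.1 : {ptws V -> R}).
    apply: ptws_cvg => y; apply/cvgrPdist_le => e e0.
    apply: filterS (inv0 e e0) => k ke; have [[h _] _] := Hq k.
    exact: ltW (lt_le_trans (h y) ke).
  have c2 : (q k).2 @[k --> \oo] --> (pt.2 : {ptws V -> {ptws V -> R}}).
    apply: ptws_cvg => y; apply: ptws_cvg => z; apply/cvgrPdist_le => e e0.
    apply: filterS (inv0 e e0) => k ke; have [[_ h] _] := Hq k.
    exact: ltW (lt_le_trans (h y z) ke).
  exact: (cvg_pair c1 c2).
have := qcvg G Gpt; rewrite nbhs_simpl => -[N _ /(_ N (leqnn N))].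
by have [_] := Hq N.
Qed.

Lemma coord1_continuous y : continuous (fun pt : state_space R V => pt.1 y).
Proof.
move=> pt; apply: (@continuous_comp _ _ _ (fun q : state_space R V => q.1)
  (fun f : {ptws V -> R} => f y)); first exact: cvg_fst.
exact: (@proj_continuous V (fun=> R) y).
Qed.

Lemma coord2_continuous y z : continuous (fun pt : state_space R V => pt.2 y z).
Proof.
move=> pt; apply: (@continuous_comp _ _ _ (fun q : state_space R V => q.2)
  (fun f : {ptws V -> {ptws V -> R}} => f y z)); first exact: cvg_snd.
apply: (@continuous_comp _ _ _ (fun f : {ptws V -> {ptws V -> R}} => f y)
  (fun f : {ptws V -> R} => f z)).
  exact: (@proj_continuous V (fun=> {ptws V -> R}) y).
exact: (@proj_continuous V (fun=> R) z).
Qed.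

Lemma near_pt_nbhs (pt : state_space R V) (e : R) : 0 < e -> nbhs pt (near_pt e pt).
Proof.
move=> e0.
have n1 y : nbhs pt [set q : state_space R V | `|pt.1 y - q.1 y| < e].
  by have := @coord1_continuous y pt; move/cvgrPdist_lt => /(_ _ e0).
have n2 y z : nbhs pt [set q : state_space R V | `|pt.2 y z - q.2 y z| < e].
  by have := @coord2_continuous y z pt; move/cvgrPdist_lt => /(_ _ e0).
have h1 : nbhs pt [set q : state_space R V | forall y, `|pt.1 y - q.1 y| < e].
  exact: (@filter_forall _ V (fun y q => `|pt.1 y - q.1 y| < e) (nbhs pt) (nbhs_filter pt)).
have h2 : nbhs pt [set q : state_space R V | forall y z, `|pt.2 y z - q.2 y z| < e].
  apply: (@filter_forall _ V (fun y q => forall z, `|pt.2 y z - q.2 y z| < e) (nbhs pt) (nbhs_filter pt)) => y.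
  by apply: (@filter_forall _ V (fun z q => `|pt.2 y z - q.2 y z| < e) (nbhs pt) (nbhs_filter pt)) => z; exact: n2.
by apply: filterS2 h1 h2 => q a1 a2; split.
Qed.

Lemma pairing_continuous h g : continuous (@pairing R V h g).
Proof.
move=> pt; have FF : Filter (nbhs pt) by exact: nbhs_filter.
apply: (@cvgD _ _ _ _ FF (fun q : state_space R V => \sum_y h y * q.1 y)
   (fun q => \sum_y \sum_z g y z * q.2 y z)).
  apply: (@cvg_sumr R V (state_space R V) (nbhs pt) FF _ (fun y q => h y * q.1 y)
     (fun y => h y * pt.1 y)) => y.
  apply: (@cvgM _ _ _ FF (fun=> h y) (fun q : state_space R V => q.1 y)); first exact: cvg_cst.
  exact: coord1_continuous.
apply: (@cvg_sumr R V (state_space R V) (nbhs pt) FF _ (fun y q => \sum_z g y z * q.2 y z)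
     (fun y => \sum_z g y z * pt.2 y z)) => y.
apply: (@cvg_sumr R V (state_space R V) (nbhs pt) FF _ (fun z q => g y z * q.2 y z)
     (fun z => g y z * pt.2 y z)) => z.
apply: (@cvgM _ _ _ FF (fun=> g y z) (fun q : state_space R V => q.2 y z)); first exact: cvg_cst.
exact: coord2_continuous.
Qed.

Lemma box_compact (B : R) : compact [set pt : state_space R V |
  (forall y, 0 <= pt.1 y <= B) /\ (forall y z, 0 <= pt.2 y z <= B)].
Proof.
have c1 : compact ([set f | forall i, `[0, B]%classic (f i)] : set {ptws V -> R}).
  exact: (@tychonoff V (fun=> R) (fun=> `[0, B]%classic) (fun=> @segment_compact R 0 B)).
have c2 : compact ([set f | forall i j, `[0, B]%classic (f i j)] : set {ptws V -> {ptws V -> R}}).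
  exact: (@tychonoff V (fun=> {ptws V -> R})
     (fun=> [set f | forall i, `[0, B]%classic (f i)]) (fun=> c1)).
have := compact_setX c1 c2; congr compact.
Qed.

(** Measurability is known coordinate by coordinate. An open set is the countable union of the boxes
    with rational centre and radius 1 / (k + 1) contained in it, and the preimage of a box is a
    finite intersection of coordinate events. *)
Lemma measurable_open_preimage (d : measure_display) (Omega : measurableType d)
  (X : Omega -> state_space R V) (G : set (state_space R V)) : open G ->
  (forall y, measurable_fun setT (fun w => (X w).1 y)) ->
  (forall y z, measurable_fun setT (fun w => (X w).2 y z)) ->
  measurable [set w | G (X w)].
Proof.
move=> oG m1 m2.
pose I := ({ffun V -> rat} * {ffun V * V -> rat} * nat)%type.
pose ctr (i : I) : state_space R V :=
  ((fun y => ratr (i.1.1 y)), (fun y z => ratr (i.1.2 (y, z)))).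
pose rad (i : I) : R := i.2.+1%:R^-1.
pose S (i : I) := [set w | near_pt (rad i) (ctr i) (X w) /\
   forall pt, near_pt (rad i) (ctr i) pt -> G pt].
have -> : [set w | G (X w)] = \bigcup_i S i.
  apply/seteqP; split => w /=; last by move=> [i _ [h1 h2]]; exact: h2.
  move=> Gw; have [e e0 He] : exists2 e : R, 0 < e & forall pt', near_pt e (X w) pt' -> G pt'.
    by apply: state_nbhs; apply: open_nbhs_nbhs.
  pose k := Num.truncn (2 / e).
  (* The rational centre lies within one radius of the point, so the whole box lies within two. *)
  have ke : 2 * k.+1%:R^-1 <= e.
    rewrite ler_pdivrMr ?ltr0n// mulrC -ler_pdivrMr//.
    by rewrite ltW// truncnS_gt.
  have k0 : 0 < k.+1%:R^-1 :> R by rewrite invr_gt0 ltr0n.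
  have dens (a : R) : exists q : rat, `|ratr q - a| < k.+1%:R^-1.
    move: (k.+1%:R^-1) k0 => i i0.
    have lt2 : a - i < a + i by lra.
    have [q] := @rat_in_itvoo R _ _ lt2.
    rewrite in_itv/= => /andP[q1 q2]; exists q; rewrite ltr_norml; apply/andP; split; lra.
  have /choice[q1 Hq1] := fun y => dens ((X w).1 y).
  have /choice[q2 Hq2] := fun yz : V * V => dens ((X w).2 yz.1 yz.2).
  exists ([ffun y => q1 y], [ffun yz => q2 yz], k) => //; split.
    split => [y|y z] /=; rewrite ffunE; first exact: Hq1.
    exact: Hq2 (y, z).
  move=> pt [/= h1 h2]; apply: He; split => [y|y z].
    have := h1 y; have := Hq1 y; rewrite /rad/= ffunE !ltr_norml; move: (k.+1%:R^-1) ke => i ke /andP[? ?] /andP[? ?].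
    by apply/andP; split; lra.
  have := h2 y z; have := Hq2 (y, z); rewrite /rad/= ffunE !ltr_norml; move: (k.+1%:R^-1) ke => i ke /andP[? ?] /andP[? ?].
  by apply/andP; split; lra.
apply: countable_bigcupT_measurable; first exact: (@countableP ({ffun V -> rat} * {ffun V * V -> rat} * nat)%type).
move=> i.
have [Hi|Hi] := pselect (forall pt, near_pt (rad i) (ctr i) pt -> G pt); last first.
  by rewrite (_ : S i = set0) //; apply/seteqP; split => // w [].
have -> : S i = (\bigcap_(y in [set: V]) [set w | `|(ctr i).1 y - (X w).1 y| < rad i]) `&`
    (\bigcap_(yz in [set: V * V]) [set w | `|(ctr i).2 yz.1 yz.2 - (X w).2 yz.1 yz.2| < rad i]).
  apply/seteqP; split => w.
    by move=> [[h1 h2] _]; split => [y _|[y z] _] /=; [exact: h1|exact: h2].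
  by move=> [h1 h2]; split => //; split => [y|y z]; [exact: h1|exact: (h2 (y, z))].
have mlt (f : Omega -> R) c e : measurable_fun setT f -> measurable [set w | `|c - f w| < e].
  move=> mf; have mg : measurable_fun setT (fun w => `|c - f w|).
    apply: measurableT_comp => //; apply: measurable_funB => //; exact: measurable_cst.
  have := mg measurableT `]-oo, e[%classic (measurable_itv _); rewrite setTI.
  congr measurable; apply/seteqP; split => w /=; by rewrite in_itv.
by apply: measurableI; apply: fin_bigcap_measurable => // *; apply: mlt.
Qed.

End StateSpace.

(** * Integrals, lower limits and the relative entropy *)
Section Integrable.
Variable R : realType.
Implicit Types (f g : R -> R) (a b c : R).
Local Notation leb := (@lebesgue_measure R).

(** The flow of a general admissible path is integrable but not bounded, so the rules for [RI] are
    established again under this weaker condition. *)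
Definition itg a b f := leb.-integrable `[a, b] (EFin \o f).

Lemma itgD a b f g : itg a b f -> itg a b g -> itg a b (fun t => f t + g t).
Proof. by move=> hf hg; apply: (integrableD _ hf hg). Qed.

Lemma itgZ a b c f : itg a b f -> itg a b (fun t => c * f t).
Proof.
move=> hf; have : leb.-integrable `[a, b] (fun t => c%:E * (EFin \o f) t)%E by apply: integrableZl.
by apply: eq_integrable => // t _; rewrite /= EFinM.
Qed.

Lemma itgB a b f g : itg a b f -> itg a b g -> itg a b (fun t => f t - g t).
Proof.
move=> hf hg; have := itgD hf (itgZ (-1) hg).
by congr itg; apply/funext => t; rewrite mulN1r.
Qed.

Lemma itg_sum (I : Type) (s : seq I) a b (f : I -> R -> R) :
  (forall i, itg a b (f i)) -> itg a b (fun t => \sum_(i <- s) f i t).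
Proof.
move=> hf; elim: s => [|i s IH].
  rewrite (_ : (fun t => _) = fun=> 0); first exact: lbm_integrable (lbm_cst 0).
  by apply/funext => t; rewrite big_nil.
rewrite (_ : (fun t => _) = fun t => f i t + \sum_(j <- s) f j t); first exact: itgD.
by apply/funext => t; rewrite big_cons.
Qed.

Lemma itgM a b f g : lbm f -> itg a b g -> itg a b (fun t => f t * g t).
Proof.
move=> [mf hf] hg; have [C [C0 HC]] := hf a b.
have bf : [bounded f t | t in `[a, b]%classic].
  exists C; split; first exact: num_real.
  move=> K CK t /=; rewrite in_itv/= => tab.
  exact: le_trans (HC _ tab) (ltW CK).
have mf' : measurable_fun `[a, b]%classic f by exact: measurable_funS mf.
have : leb.-integrable `[a, b] ((EFin \o f) \* (EFin \o g))%E by apply: integrableMr.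
by apply: eq_integrable => // t _; rewrite /= EFinM.
Qed.

Lemma itg_norm a b f : itg a b f -> itg a b (fun t => `|f t|).
Proof. by move=> hf; exact: (integrable_abse hf). Qed.

Lemma RIDi a b f g : itg a b f -> itg a b g ->
  RI a b (fun t => f t + g t) = RI a b f + RI a b g.
Proof. by move=> *; apply: RintegralD. Qed.

Lemma RIBi a b f g : itg a b f -> itg a b g ->
  RI a b (fun t => f t - g t) = RI a b f - RI a b g.
Proof. by move=> *; apply: RintegralB. Qed.

Lemma RIZi a b f c : itg a b f -> RI a b (fun t => c * f t) = c * RI a b f.
Proof. by move=> *; apply: RintegralZl. Qed.

Lemma RI_sumi (I : Type) (s : seq I) a b (f : I -> R -> R) :
  (forall i, itg a b (f i)) ->
  RI a b (fun t => \sum_(i <- s) f i t) = \sum_(i <- s) RI a b (f i).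
Proof.
move=> hf; elim: s => [|i s IH].
  under eq_RI => t _ do rewrite big_nil.
  by rewrite big_nil /RI Rintegral_cst// mul0r.
under eq_RI => t _ do rewrite big_cons.
by rewrite big_cons RIDi ?IH//; exact: itg_sum.
Qed.

Lemma RI_lei a b f g : itg a b f -> itg a b g -> (forall t, a <= t <= b -> f t <= g t) ->
  RI a b f <= RI a b g.
Proof. by move=> *; apply: le_Rintegral. Qed.

Lemma RI_EFin a b f : itg a b f -> (\int[leb]_(t in `[a, b]) (f t)%:E = (RI a b f)%:E)%E.
Proof. by move=> hf; rewrite /RI /Rintegral fineK//; apply: integrable_fin_num. Qed.

Lemma itg_ge0 a b f c : measurable_fun setT f -> (forall t, 0 <= f t) ->
  (\int[leb]_(t in `[a, b]) (f t)%:E = c%:E)%E -> itg a b f.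
Proof.
move=> mf f0 fc; apply/integrableP; split.
  by apply/measurable_EFinP; exact: measurable_funS mf.
under eq_integral => t _ do rewrite /= ger0_norm//.
by rewrite fc ltry.
Qed.

Lemma integral_le_ge0 (D : set R) (f g : R -> \bar R) : measurable D ->
  measurable_fun D f -> measurable_fun D g ->
  (forall t, D t -> (0 <= g t)%E) -> (forall t, D t -> (f t <= g t)%E) ->
  (\int[leb]_(t in D) f t <= \int[leb]_(t in D) g t)%E.
Proof.
move=> mD mf mg g0 fg; rewrite integralE.
apply: (@le_trans _ _ (\int[leb]_(t in D) f^\+ t)%E).
  rewrite -[leRHS]sube0; apply: leeB => //; exact: integral_ge0.
apply: ge0_le_integral => //; first exact: measurable_funepos.
by move=> t Dt; rewrite funeposE ge_max fg// g0.
Qed.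

Lemma RI_dominated_ae2 (f_ : nat -> R -> R) f g a b :
  (forall n, measurable_fun setT (f_ n)) -> measurable_fun setT f -> itg a b g ->
  {ae leb, forall t, `[a, b]%classic t ->
     (forall n, `|f_ n t| <= g t) /\ f_ n t @[n --> \oo] --> f t} ->
  RI a b (f_ n) @[n --> \oo] --> RI a b f /\ itg a b f.
Proof.
move=> mf_ mf ig cvf.
have := @dominated_convergence _ _ R leb `[a, b]%classic (measurable_itv _)
  (fun n => EFin \o f_ n) (EFin \o f) (EFin \o g).
case=> //.
- by move=> n; apply/measurable_EFinP; exact: measurable_funS (mf_ n).
- by apply/measurable_EFinP; exact: measurable_funS mf.
- apply: filterS cvf; first exact: (ae_filter_ringOfSetsType leb).
  move=> t h tab /=.
  by apply: cvg_EFin; [exact: nearW|exact: (h tab).2].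
- apply: filterS cvf; first exact: (ae_filter_ringOfSetsType leb).
  by move=> t h n tab /=; rewrite lee_fin; exact: (h tab).1.
move=> int1 _ h; split => //; rewrite /RI /Rintegral.
apply: fine_cvg; rewrite fineK//.
exact: integrable_fin_num.
Qed.

Lemma RI_dominated_ae (f_ : nat -> R -> R) f g a b :
  (forall n, measurable_fun setT (f_ n)) -> measurable_fun setT f -> itg a b g ->
  (forall n t, a <= t <= b -> `|f_ n t| <= g t) ->
  {ae leb, forall t, `[a, b]%classic t -> f_ n t @[n --> \oo] --> f t} ->
  RI a b (f_ n) @[n --> \oo] --> RI a b f /\ itg a b f.
Proof.
move=> mf_ mf ig hg cvf; apply: RI_dominated_ae2 ig _ => //.
apply: filterS cvf; first exact: (ae_filter_ringOfSetsType leb).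
move=> t h tab; split; last exact: h.
by move=> k; apply: hg; move: tab; rewrite /= in_itv.
Qed.

Lemma is_derive_RI a f x : continuous f -> a < x ->
  is_derive x 1 (fun t => RI a t f) (f x).
Proof.
move=> cf ax.
have [] := @continuous_FTC1 R f (BLeft a) x (x + 1) _ _ _ (cf x).
- by rewrite ltrDl.
- exact: lbm_integrable (lbm_cont cf).
- have : (BLeft a < BRight x :> itv_bound R)%O by rewrite bnd_simp ltW.
  by [].
by move=> h1 h2; apply: DeriveDef; [exact: h1|rewrite -derive1E; exact: h2].
Qed.

Lemma is_derive_avg f (d x : R) : continuous f -> 0 <= d ->
  is_derive x 1 (fun s => RI s (s + d) f) (f (x + d) - f x).
Proof.
(* A fixed base point to the left of x: near x the moving integral is a difference of two indefinite
   integrals from a, plus a constant. *)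
move=> cf d0; have lf := lbm_cont cf; pose a := x - 1.
have ax : a < x by rewrite /a gtrBl.
have cfd : continuous (fun s => f (s + d)).
  move=> s; apply: (@continuous_comp _ _ _ (fun s => s + d) f); last exact: cf.
  by apply: cvgD; [exact: cvg_id|exact: cvg_cst].
have h := is_deriveD (is_deriveB (is_derive_RI cfd ax) (is_derive_RI cf ax))
  (is_derive_cst (RI a (a + d) f : R) x 1).
rewrite addr0 in h.
apply: near_eq_is_derive h.
have : \forall s \near x, a < s by exact: (@cvgr_gt _ _ _ _ id x (@cvg_id _ _)).
apply: filterS => s /ltW as_.
rewrite /= /GRing.add/= /GRing.opp/= -RI_shift//.
have h1 : a <= a + d by rewrite lerDl.
have h2 : a + d <= s + d by rewrite lerD2r.
have h3 : s <= s + d by rewrite lerDl.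
have := RI_chasles lf h1 h2; rewrite (RI_chasles lf as_ h3) => h4.
by change (RI (a + d) (s + d) f - RI a s f + RI a (a + d) f = RI s (s + d) f); lra.
Qed.

Lemma avg_cvg f (t : R) : lbm f -> {for t, continuous f} ->
  k.+1%:R * RI t (t + k.+1%:R^-1) f @[k --> \oo] --> f t.
Proof.
move=> lf cf; apply/cvgrPdist_le => /= e e0.
have /cvgrPdist_le/(_ e e0) := cf; rewrite near_simpl => /nbhs_ballP[d /= d0 Hd].
have dk : \forall k \near \oo, (k.+1%:R^-1 : R) < d.
  have /cvgrPdist_lt/(_ d d0) := @cvg_harmonic R; apply: filterS => k.
  by rewrite sub0r normrN ger0_norm ?invr_ge0.
apply: filterS dk => k kd.
have k0 : 0 < k.+1%:R^-1 :> R by rewrite invr_gt0 ltr0n.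
have tk : t <= t + k.+1%:R^-1 by rewrite lerDl ltW.
have -> : f t - k.+1%:R * RI t (t + k.+1%:R^-1) f =
   k.+1%:R * RI t (t + k.+1%:R^-1) (fun s => f t - f s).
  rewrite RIB//; last exact: lbm_cst.
  by rewrite RI_cst// addrAC subrr add0r mulrBr mulrCA divff ?mulr1// pnatr_eq0.
rewrite normrM ger0_norm//.
have : `|RI t (t + k.+1%:R^-1) (fun s => f t - f s)| <= e * (t + k.+1%:R^-1 - t).
  apply: RI_bound => //; first by apply: lbmB => //; exact: lbm_cst.
  move=> s /andP[ts st]; apply: Hd; rewrite /ball/= ler0_norm ?subr_le0// opprB.
  by rewrite ltrBlDl (le_lt_trans st)// ltrD2l.
rewrite addrAC subrr add0r => h.
apply: le_trans (ler_wpM2l _ h) _ => //.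
by rewrite mulrCA divff ?mulr1// pnatr_eq0.
Qed.

Lemma derivable_cont f : (forall t, derivable f t 1) -> continuous f.
Proof. by move=> h x; apply: differentiable_continuous; apply/derivable1_diffP. Qed.

Lemma prim_C1 f a b : (forall t, derivable f t 1) -> continuous f^`()%classic ->
  prim_on a b f f^`()%classic.
Proof.
move=> df cf' s t _ + _; rewrite le_eqVlt => /orP[/eqP ->|st].
  by rewrite subrr RI_same.
have cf := derivable_cont df.
rewrite /RI /Rintegral (@continuous_FTC2 R f^`()%classic f s t st); [by []| | |by []].
- exact: continuous_subspaceT.
- split.
  + by move=> x _.
  + by apply: cvg_at_right_filter; exact: cf.
  + by apply: cvg_at_left_filter; exact: cf.
Qed.

End Integrable.

(** * Lower and upper limits of extended real sequences *)

Section LimInf.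
Variable R : realType.
Implicit Types (u v : nat -> \bar R).
Local Open Scope ereal_scope.

Lemma limn_einf_ge u (l : \bar R) : (\forall n \near \oo, l <= u n) -> l <= limn_einf u.
Proof.
move=> [N _ HN]; rewrite limn_einf_lim; apply: lime_ge; first exact: is_cvg_einfs.
exists N => // n /= Nn; apply: le_ereal_inf_tmp => _ [k /= nk <-]; apply: HN.
exact: leq_trans nk.
Qed.

Lemma limn_esup_le u (l : \bar R) : (\forall n \near \oo, u n <= l) -> limn_esup u <= l.
Proof.
move=> [N _ HN]; rewrite limn_esup_lim; apply: lime_le; first exact: is_cvg_esups.
exists N => // n /= Nn; apply: ge_ereal_sup => _ [k /= nk <-]; apply: HN.
exact: leq_trans nk.
Qed.

Lemma le_limn_einf u v : (forall n, u n <= v n) -> limn_einf u <= limn_einf v.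
Proof.
move=> uv; rewrite !limn_einf_lim; apply: lee_lim; [exact: is_cvg_einfs|exact: is_cvg_einfs|].
apply: nearW => n; apply: le_ereal_inf_tmp => _ [k /= nk <-]; apply: le_trans (uv k).
by apply: ereal_inf_lbound; exists k.
Qed.

Lemma limn_einfD u v : (forall n, 0 <= u n) -> (forall n, 0 <= v n) ->
  limn_einf u + limn_einf v <= limn_einf (fun n => u n + v n).
Proof.
move=> u0 v0; rewrite !limn_einf_lim.
have e0 (w : nat -> \bar R) : (forall n, 0 <= w n) -> 0 <= limn (einfs w).
  by move=> w0; rewrite -limn_einf_lim; apply: limn_einf_ge; exact: nearW.
have dd : limn (einfs u) +? limn (einfs v) by apply: ge0_adde_def; rewrite inE e0.
rewrite -limeD//; [|exact: is_cvg_einfs|exact: is_cvg_einfs].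
apply: lee_lim; [|exact: is_cvg_einfs|].
  by apply: is_cvgeD => //; exact: is_cvg_einfs.
apply: nearW => n; apply: le_ereal_inf_tmp => _ [k /= nk <-].
by apply: leeD; apply: ereal_inf_lbound; exists k.
Qed.

Lemma limn_einf_sum (I : Type) (s : seq I) (w : I -> nat -> \bar R) :
  (forall i n, 0 <= w i n) ->
  \sum_(i <- s) limn_einf (w i) <= limn_einf (fun n => \sum_(i <- s) w i n).
Proof.
move=> w0; elim: s => [|i s IH].
  by rewrite big_nil; apply: limn_einf_ge; apply: nearW => n; rewrite big_nil.
rewrite big_cons; apply: (le_trans (leeD (lexx _) IH)).
have -> : (fun n => \sum_(j <- i :: s) w j n) = (fun n => w i n + \sum_(j <- s) w j n).
  by apply/funext => n; rewrite big_cons.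
by apply: limn_einfD => // n; exact: sume_ge0.
Qed.

End LimInf.

(** * The entropy function and its convex duality *)

Section RelativeEntropy.
Variable R : realType.
Implicit Types (q p a : R).

(** [Phi] in q is the Legendre transform of a -> p (expR a - 1). Measuring a from the optimal slope
    ln (q / p) reduces the inequality to expR w >= 1 + w. *)
Lemma Phi_fenchel q p a : 0 <= q -> 0 <= p ->
  ((q * a - p * (expR a - 1))%:E <= Phi q p)%E.
Proof.
rewrite /Phi => q0 p0; case: eqP => [->|/eqP qn]; first rewrite lee_fin.
  by have := expR_ge0 a; nra.
case: eqP => [_|/eqP pn]; first by rewrite leey.
have qp : 0 < q by rewrite lt_def qn.
have pp : 0 < p by rewrite lt_def pn.
rewrite lee_fin; pose w := a - ln (q / p).
have -> : a = ln (q / p) + w by rewrite /w; ring.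
rewrite expRD lnK ?posrE ?divr_gt0//.
have -> : p * (q / p * expR w - 1) = q * expR w - p by field.
by have := expR_ge1Dx w; nra.
Qed.

Lemma Phi_ge0 q p : 0 <= q -> 0 <= p -> (0 <= Phi q p)%E.
Proof.
move=> q0 p0; have := Phi_fenchel 0 q0 p0.
by rewrite mulr0 expR0 subrr mulr0 subr0.
Qed.

Lemma Phi_expR p a : 0 <= p ->
  Phi (p * expR a) p = (p * expR a * a - p * (expR a - 1))%:E.
Proof.
move=> p0; rewrite /Phi mulf_eq0 (gt_eqF (expR_gt0 a)) orbF.
case: eqP => [->|/eqP pn]; first by rewrite !mul0r subrr.
have -> : p * expR a / p = expR a by field.
by rewrite expRK; congr EFin; ring.
Qed.

(** Converse of [Phi_fenchel]: [Phi] is the supremum of functions that are linear in (q, p) jointly.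
    Joint convexity and lower semicontinuity follow at once, boundary values included. *)
Lemma Phi_le_sup q p (L : \bar R) : 0 <= q -> 0 <= p ->
  (forall a, ((q * a - p * (expR a - 1))%:E <= L)%E) -> (Phi q p <= L)%E.
Proof.
rewrite /Phi => q0 p0 H; case: eqP => [qe|/eqP qn].
  apply/lee_addgt0Pr => e e0.
  (* For q = 0 the value p is only approached as a tends to minus infinity; with expR a = e / (p +
     1) the loss p expR a is at most e. *)
  have e1 : 0 < e / (p + 1) by rewrite divr_gt0// ltr_wpDl.
  apply: (@le_trans _ _ ((p - p * (e / (p + 1)))%:E + e%:E)%E).
    rewrite -EFinD lee_fin.
    have : p * (e / (p + 1)) <= e.
      by rewrite mulrA ler_pdivrMr ?ltr_wpDl// mulrC ler_pM2l// lerDl.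
    lra.
  apply: leeD2r; have := H (ln (e / (p + 1))).
  rewrite qe mul0r lnK ?posrE//; congr (_ <= _)%E; congr EFin; ring.
have qp : 0 < q by rewrite lt_def qn.
case: eqP => [pe|/eqP pn].
  (* For p = 0 the linear functions are q a, which exceed any real l: the slope with q a = l + 1
     refutes it. *)
  rewrite leye_eq; case: L H => [l| |] H //.
    have := H ((l + 1) / q); rewrite pe mul0r subr0 lee_fin mulrC divfK//.
    by move=> h; exfalso; lra.
  by have := H 0.
have pp : 0 < p by rewrite lt_def pn.
have := H (ln (q / p)); rewrite lnK ?posrE ?divr_gt0//.
congr (_ <= _)%E; congr EFin; by field.
Qed.

Lemma Phi_convex q1 q2 p1 p2 l : 0 <= q1 -> 0 <= q2 -> 0 <= p1 -> 0 <= p2 -> 0 <= l <= 1 ->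
  (Phi (l * q1 + (1 - l) * q2) (l * p1 + (1 - l) * p2) <=
   l%:E * Phi q1 p1 + (1 - l)%:E * Phi q2 p2)%E.
Proof.
move=> q10 q20 p10 p20 /andP[l0 l1].
have l1' : 0 <= 1 - l by rewrite subr_ge0.
apply: Phi_le_sup => [||a].
- exact: (addr_ge0 (mulr_ge0 l0 q10) (mulr_ge0 l1' q20)).
- exact: (addr_ge0 (mulr_ge0 l0 p10) (mulr_ge0 l1' p20)).
have -> : (l * q1 + (1 - l) * q2) * a - (l * p1 + (1 - l) * p2) * (expR a - 1) =
  l * (q1 * a - p1 * (expR a - 1)) + (1 - l) * (q2 * a - p2 * (expR a - 1)) by ring.
rewrite EFinD 2!EFinM; apply: leeD; apply: lee_wpmul2l; rewrite ?lee_fin//; exact: Phi_fenchel.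
Qed.

Lemma Phi_lsc (q_ p_ : nat -> R) q p : (forall k, 0 <= q_ k) -> (forall k, 0 <= p_ k) ->
  q_ k @[k --> \oo] --> q -> p_ k @[k --> \oo] --> p ->
  (Phi q p <= limn_einf (fun k => Phi (q_ k) (p_ k)))%E.
Proof.
move=> q0 p0 cq cp.
have q_ge0 : 0 <= q.
  by rewrite -(cvg_lim (@Rhausdorff R) cq); apply: limr_ge; [apply/cvg_ex; exists q|exact: nearW].
have p_ge0 : 0 <= p.
  by rewrite -(cvg_lim (@Rhausdorff R) cp); apply: limr_ge; [apply/cvg_ex; exists p|exact: nearW].
apply: Phi_le_sup => // a.
have c : (q_ k * a - p_ k * (expR a - 1))%:E @[k --> \oo] --> (q * a - p * (expR a - 1))%:E.
  apply: cvg_EFin; first exact: nearW.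
  by apply: cvgB; apply: cvgM => //; exact: cvg_cst.
have [<- _] := cvg_limn_einf_sup c.
by apply: le_limn_einf => k; exact: Phi_fenchel.
Qed.

Lemma Phi_pos q p : 0 <= q -> 0 < p -> Phi q p = (q * ln q - q * ln p - q + p)%:E.
Proof.
move=> q0 p0; rewrite /Phi; case: eqP => [->|/eqP qn].
  by congr EFin; ring.
rewrite (gt_eqF p0); congr EFin.
have qp : 0 < q by rewrite lt_def qn.
rewrite ln_div ?posrE//; ring.
Qed.

Lemma measurable_Phi (q p : R -> R) : (forall t, 0 <= q t) -> (forall t, 0 <= p t) ->
  measurable_fun setT q -> measurable_fun setT p ->
  measurable_fun setT (fun t => Phi (q t) (p t)).
Proof.
move=> q0 p0 mq mp.
rewrite (_ : (fun t => _) = (fun t => if q t == 0 then (p t)%:E else if p t == 0 then +oo%E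
   else (q t * ln (q t) - q t * ln (p t) - q t + p t)%:E)); last first.
  apply/funext => t; have [pe|pn] := eqVneq (p t) 0; first by rewrite /Phi pe eqxx.
  rewrite -Phi_pos//; last by rewrite lt_def pn p0.
  by rewrite /Phi; case: eqP => // _; rewrite (negbTE pn).
apply: measurable_fun_ifT.
- by apply: measurable_fun_eqr => //; exact: measurable_cst.
- exact/measurable_EFinP.
apply: measurable_fun_ifT.
- by apply: measurable_fun_eqr => //; exact: measurable_cst.
- exact: measurable_cst.
apply/measurable_EFinP; apply: measurable_funD => //; apply: measurable_funB => //.
by apply: measurable_funB; apply: measurable_funM => //; exact: measurableT_comp.
Qed.

(** This is [Phi q 1] for q >= 0: strictly convex, superlinear and independent of the occupation,
    hence suited to select an L^1-convergent sequence. *)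
Definition phi1 q : R := q * ln q - q + 1.

Lemma measurable_phi1 : measurable_fun setT phi1.
Proof.
apply: measurable_funD; last exact: measurable_cst.
apply: measurable_funB => //; apply: measurable_funM => //; exact: measurable_ln.
Qed.

Lemma phi1_ge0 q : 0 <= q -> 0 <= phi1 q.
Proof.
move=> q0; have := Phi_ge0 q0 ler01; rewrite Phi_pos// ln1 mulr0 lee_fin /phi1; lra.
Qed.

Lemma phi1_le1 q : 0 <= q <= 1 -> phi1 q <= 1.
Proof.
move=> /andP[q0 q1]; have := ln_le0 q1; rewrite /phi1; nra.
Qed.

(** Replacing the reference intensity p by 1 adds q ln p - p + 1; thus a bound on the cost and on
    the integral of q bounds the superlinear functional of q. *)
Lemma phi1_Phi q p K : 0 <= q -> 0 <= p <= K -> 1 <= K ->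
  ((phi1 q)%:E <= Phi q p + (q * ln K + 1)%:E)%E.
Proof.
move=> q0 /andP[p0 pK] K1; have K0 : 0 < K by lra.
have lK : 0 <= ln K by exact: ln_ge0.
have [pe|pn] := eqVneq p 0.
  rewrite /Phi pe eqxx; case: eqP => [->|_]; last by rewrite addye// leey.
  by rewrite -EFinD lee_fin /phi1; lra.
have pp : 0 < p by rewrite lt_def pn.
rewrite Phi_pos// -EFinD lee_fin /phi1.
have : ln p <= ln K by rewrite ler_ln ?posrE.
move: (q * ln q) => X; nra.
Qed.

(* The convexity gap of phi1 at the midpoint m of a and b equals Phi a m + Phi b m. *)
Lemma phi1_gap a b eta : 0 <= a -> 0 <= b -> 0 < eta <= 1 / 2 ->
  `|a - b| <= (phi1 a + phi1 b - 2 * phi1 ((a + b) / 2)) / eta + 2 * eta * (a + b).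
Proof.
move=> a0 b0 /andP[e0 e1]; set m := (a + b) / 2.
have m0 : 0 <= m by rewrite /m; lra.
have [me|mn] := eqVneq m 0.
  have [-> ->] : a = 0 /\ b = 0 by split; apply/eqP; rewrite eq_le; rewrite /m in me; apply/andP; split; lra.
  by rewrite me subrr normr0 addr0 mulr0 addr0 divr_ge0 ?(ltW e0)//; lra.
have mp : 0 < m by rewrite lt_def mn.
have key x : 0 <= x -> `|x - m| <= (x * ln x - x * ln m - x + m) / eta + 2 * eta * m.
  move=> x0.
  (* Fenchel at a slope s of size eta, with the sign of x - m, costs m (expR s - 1 - s), at most 2
     eta^2 m; dividing by eta gives the two terms. *)
  have f (s : R) : `|s| = eta -> (x - m) * s <= (x * ln x - x * ln m - x + m) + 2 * eta ^+ 2 * m.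
    move=> sE; have := Phi_fenchel s x0 m0; rewrite Phi_pos// lee_fin.
    have /expR_quad /andP[_] : `|s| <= 1 / 2 by rewrite sE.
    have -> : s ^+ 2 = eta ^+ 2 by rewrite -sE real_normK// num_real.
    move: (x * ln x - x * ln m - x + m) => P; nra.
  have e0' : eta != 0 by rewrite gt_eqF.
  have -> : (x * ln x - x * ln m - x + m) / eta + 2 * eta * m =
     ((x * ln x - x * ln m - x + m) + 2 * eta ^+ 2 * m) / eta by field.
  rewrite ler_pdivlMr//; have [xm|xm] := leP m x; [rewrite ger0_norm ?subr_ge0//|].
    by apply: f; rewrite ger0_norm// ltW.
  rewrite ltr0_norm ?subr_lt0//; have := f (- eta); rewrite normrN ger0_norm ?(ltW e0)// => /(_ erefl).
  by rewrite mulrN mulNr.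
have ka := key a a0; have kb := key b b0.
have -> : (phi1 a + phi1 b - 2 * phi1 m) = (a * ln a - a * ln m - a + m) + (b * ln b - b * ln m - b + m).
  have ab : a + b = 2 * m by rewrite /m; field.
  rewrite /phi1; move: ab {key ka kb mp mn m0}; move: m => m' ab.
  have -> : b = 2 * m' - a by lra.
  by ring.
rewrite mulrDl.
have : `|a - b| <= `|a - m| + `|b - m| by rewrite (distrC b) ler_distD.
have : 2 * eta * (a + b) = 2 * eta * m + 2 * eta * m by rewrite /m; field.
lra.
Qed.

End RelativeEntropy.

(** * The tilted periodic path *)
Section Tilted.
Variables (R : realType) (V : finType) (T0 : R) (r : rates R V) (m M : R).
Hypothesis gr : goodrates T0 r m M.
Hypothesis T00 : 0 < T0.
Variable x0 : V.
Local Notation leb := (@lebesgue_measure R).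
Implicit Types (H : V -> R) (g : V -> V -> R) (v u w : R -> V -> R).
Let n : R := #|V|%:R.

(** Transposing and reversing time turns the backward equation for u into a forward equation, so
    existence, uniqueness and stability apply to it as well. *)
Definition Arev H g (s : R) (z y : V) : R := Amx r H g (- s) y z.

(* v solves v' = v A forwards and u solves u' = - A u backwards; over one period they are
   multiplied by rho and rho^-1, so that u * v / sum (u * v) is T0-periodic. *)
Definition tilted H g (rho : R) v u :=
  eigsol (Amx r H g) T0 rho v /\ eigsol (Arev H g) T0 rho (fun t => u (- t)).

Lemma Amx_ge0 H g t y z : n * M <= H y -> 0 <= Amx r H g t y z.
Proof.
move=> nH; apply: addr_ge0; first exact: mulr_ge0 (r_ge0 gr _ _ _) (expR_ge0 _).
apply: mulr_ge0 => //; rewrite subr_ge0; apply: le_trans nH; exact: (exitr_le gr).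
Qed.

Definition Cb H g : R := \sum_y \sum_z M * expR (g y z) + \sum_y `|H y| + 1.

Lemma sum_ge1 (F : V -> R) y : (forall y, 0 <= F y) -> F y <= \sum_y F y.
Proof. by move=> F0; rewrite (bigD1 y)//= lerDl sumr_ge0. Qed.

Lemma Cb_gt0 H g : 0 < Cb H g.
Proof.
apply: ltr_wpDl => //; apply: addr_ge0; apply: sumr_ge0 => y _ //.
by apply: sumr_ge0 => z _; rewrite mulr_ge0 ?expR_ge0 ?(ltW (M_gt0 gr)).
Qed.

Lemma Amx_le H g t y z : Amx r H g t y z <= Cb H g.
Proof.
have Me (a b : V) : 0 <= M * expR (g a b) by rewrite mulr_ge0 ?expR_ge0 ?(ltW (M_gt0 gr)).
rewrite /Amx /Cb -addrA; apply: lerD.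
  apply: (@le_trans _ _ (M * expR (g y z))).
    by apply: ler_wpM2r; [exact: expR_ge0|exact: (r_leM gr)].
  apply: (le_trans (@sum_ge1 (fun z => M * expR (g y z)) z _)) => //.
  apply: (@sum_ge1 (fun y => \sum_z M * expR (g y z)) y) => a.
  exact: sumr_ge0.
have h0 : `|H y| <= \sum_y `|H y| by apply: (@sum_ge1 (fun y => `|H y|)).
have := exitr_ge0 gr y t; have := ler_norm (H y).
by case: (y == z); rewrite ?mul1r ?mul0r; have := normr_ge0 (H y); lra.
Qed.

Lemma Amx_edge g : exists2 m' : R, 0 < m' & forall H t y z, n * M <= H y -> edge r y z ->
  m' <= Amx r H g t y z.
Proof.
have m0 : 0 < m by case: gr => [[]].
have [k k0 Hk] := @exists_pos_lb R (V * V)%type (fun yz => m * expR (g yz.1 yz.2))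
  (fun yz => mulr_gt0 m0 (expR_gt0 _)).
exists k => // H t y z nH e; apply: (le_trans (Hk (y, z))) => /=.
rewrite /Amx (negbTE (edge_neq e)) mul0r addr0 ler_wpM2r ?expR_ge0//.
by case: gr => _ _ _ [h _] _; exact: h.
Qed.

Lemma r_per y z : Defs.periodic T0 (r y z).
Proof. by case: gr => _ _ []. Qed.

Lemma Amx_per H g t y z : Amx r H g (t + T0) y z = Amx r H g t y z.
Proof.
rewrite /Amx r_per; congr (_ + _ * (_ - _)).
by apply: eq_bigr => c _; rewrite r_per.
Qed.

Lemma lbmx_Arev H g : lbmx (Arev H g).
Proof. by move=> z y; apply: (@lbm_opp R (fun t => Amx r H g t y z)); exact: (lbm_Amx gr). Qed.

Lemma backsol_Arev H g (rho : R) w : eigsol (Arev H g) T0 rho w -> backsol r H g (fun t => w (- t)).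
Proof.
move=> [_ [_ lw] _ _ pw]; split; first by move=> y; exact: (lbm_opp (lw y)).
move=> s t y st; rewrite pw ?lerN2// RI_opp; last by apply: lbm_vmul => //; exact: lbmx_Arev.
apply: eq_RI => a _; apply: eq_bigr => c _; by rewrite /Arev opprK mulrC.
Qed.

Lemma backsol_prim H g u y a b : backsol r H g u ->
  prim_on a b (u^~ y) (fun t => - \sum_z Amx r H g t y z * u t z).
Proof.
move=> [lu bu] s t _ st _.
have -> : RI s t (fun t => - \sum_z Amx r H g t y z * u t z) =
    RI s t (fun t => -1 * \sum_z Amx r H g t y z * u t z).
  by apply: eq_RI => x _; rewrite mulN1r.
rewrite RIZ -?bu//; first by rewrite mulN1r opprB.
by apply: lbm_sum => z; apply: lbmM => //; exact: (lbm_Amx gr).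
Qed.

Lemma lbm_Au H g u y : (forall y, lbm (u^~ y)) ->
  lbm (fun t => - \sum_z Amx r H g t y z * u t z).
Proof.
by move=> lu; apply: lbmN; apply: lbm_sum => z; apply: lbmM => //; exact: (lbm_Amx gr).
Qed.

(** The derivative of the pairing of u and v is the pairing of v with - A u plus that of v A with u,
    which cancel. *)
Lemma prodsol_const H g v u : backsol r H g u -> (forall y, lbm (v^~ y)) ->
  (forall (s t : R) z, s <= t -> v t z - v s z = RI s t (fun a => vmul v (Amx r H g) a z)) ->
  forall s t : R, \sum_y u t y * v t y = \sum_y u s y * v s y.
Proof.
move=> bu lv pv.
have le (s t : R) : s <= t -> \sum_y u t y * v t y = \sum_y u s y * v s y.
  move=> st; apply/eqP; rewrite -subr_eq0 -sumrB; apply/eqP.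
  have lA := lbm_Amx gr H g.
  have E y : u t y * v t y - u s y * v s y = RI s t (fun t =>
      - (\sum_z Amx r H g t y z * u t z) * v t y + u t y * vmul v (Amx r H g) t y).
    apply: (@prim_mul R (u^~ y) (v^~ y) _ _ s t) => //.
    - exact: lbm_Au bu.1.
    - exact: lbm_vmul.
    - exact: bu.1.
    - exact: backsol_prim.
    - by move=> a b _ ab _; exact: pv.
  under eq_bigr => y _ do rewrite E.
  rewrite -RI_sum; last first.
    move=> y; apply: lbmD; apply: lbmM => //; [exact: lbm_Au bu.1|exact: bu.1|exact: lbm_vmul].
  rewrite (@eq_RI _ _ (fun=> 0)) ?RI_cst ?mul0r// => a _.
  rewrite big_split/=; apply/eqP; rewrite addr_eq0 -sumrN; apply/eqP.
  under eq_bigr => y _ do rewrite mulNr mulr_suml.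
  under [RHS]eq_bigr => y _ do rewrite /vmul mulr_sumr.
  rewrite sumrN sumrN; congr (- _); rewrite exchange_big/=.
  by apply: eq_bigr => y _; apply: eq_bigr => z _; ring.
by move=> s t; have [|/ltW] := leP s t; [exact: le|move=> /le].
Qed.

(** Existence is applied to the forward and to the reversed system. The two multipliers coincide:
    the positive pairing of the solutions is constant, yet over one period it is multiplied by rho /
    rho2. *)
Lemma tilted_exists H g : (forall y, n * M <= H y) -> exists rho v u, tilted H g rho v u.
Proof.
move=> nH; have [m' m'0 Hm'] := Amx_edge g.
have con : forall y z, connect (edge r) y z by case: gr.
have [rho [v ev]] := @eigsol_exists R V x0 (Amx r H g) (Cb H g) m' T0 (edge r)
  (lbm_Amx gr H g) (fun t y z => Amx_ge0 g t z (nH y)) (Amx_le H g) (Cb_gt0 H g) T00 m'0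
  (fun t y z e => Hm' H t y z (nH y) e) con (Amx_per H g).
have [rho2 [w ew]] := @eigsol_exists R V x0 (Arev H g) (Cb H g) m' T0
  (fun z y => edge r y z)
  (lbmx_Arev H g) (fun t z y => Amx_ge0 g (- t) z (nH y)) (fun t z y => Amx_le H g (- t) y z)
  (Cb_gt0 H g) T00 m'0
  (fun t z y e => Hm' H (- t) y z (nH y) e)
  (fun z y => etrans (connect_rev (edge r) z y) (con y z))
  (fun t z y => etrans (esym (Amx_per H g (- (t + T0)) y z))
    (congr1 (fun s => Amx r H g s y z) (ltac:(ring) : - (t + T0) + T0 = - t))).
exists rho, v, (fun t => w (- t)); split => //.
suff -> : rho = rho2 by under eq_fun do rewrite opprK.
have [rho0 [v0 lv] vq _ vp] := ev; have [rho20 [w0 lw] wq _ wp] := ew.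
have := prodsol_const (backsol_Arev ew) lv vp 0 T0.
have -> : \sum_y w (- T0) y * v T0 y = rho / rho2 * \sum_y w (- 0) y * v 0 y.
  rewrite mulr_sumr; apply: eq_bigr => y _.
  have -> : v T0 y = rho * v 0 y by rewrite -vq add0r.
  have -> : w (- 0) y = rho2 * w (- T0) y by rewrite -wq addNr oppr0.
  by field; rewrite gt_eqF.
have S0 : 0 < \sum_y w (- 0) y * v 0 y.
  rewrite (bigD1 x0)//=; apply: ltr_pwDl; first exact: mulr_gt0.
  by apply: sumr_ge0 => y _; rewrite mulr_ge0// ltW.
move: (\sum_y _) S0 => S S0 /eqP; rewrite -subr_eq0 -[X in _ - X]mul1r -mulrBl mulf_eq0.
rewrite (gt_eqF S0) orbF subr_eq0 => /eqP h.
by rewrite -[RHS]mul1r -h divfK// gt_eqF.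
Qed.

Lemma It_ge0 t (mu : V -> R) (Q : V -> V -> R) : (forall y, 0 <= mu y) ->
  (forall y z, 0 <= Q y z) -> (0 <= It r t mu Q)%E.
Proof.
move=> mu0 Q0; apply: sume_ge0 => y _; apply: sume_ge0 => z _; case: ifP => // _.
by apply: Phi_ge0 => //; rewrite mulr_ge0 ?(r_ge0 gr).
Qed.

Lemma measurable_It (mu : R -> V -> R) (Q : R -> V -> V -> R) : (forall t y, 0 <= mu t y) ->
  (forall t y z, 0 <= Q t y z) -> (forall y, measurable_fun setT (mu^~ y)) ->
  (forall y z, measurable_fun setT (fun t => Q t y z)) ->
  measurable_fun setT (fun t => It r t (mu t) (Q t)).
Proof.
move=> mu0 Q0 mmu mQ; apply: emeasurable_sum => y; apply: emeasurable_sum => z.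
case: (edge r y z); last exact: measurable_cst.
apply: measurable_Phi => //.
  by move=> t; rewrite mulr_ge0 ?(r_ge0 gr).
by apply: measurable_funM => //; exact: (lbm_r gr y z).1.
Qed.

Section Pair.
Variables (H : V -> R) (g : V -> V -> R) (rho : R) (v u : R -> V -> R).
Hypothesis tl : tilted H g rho v u.
Let A := Amx r H g.

Lemma t_rho : 0 < rho. Proof. by case: tl => -[]. Qed.

Lemma t_v t y : 0 < v t y. Proof. by case: tl => -[_ [h _]]. Qed.

Lemma t_u t y : 0 < u t y.
Proof. by case: tl => _ [_ [h _] _ _ _]; have := h (- t) y; rewrite opprK. Qed.

Lemma t_lv y : lbm (v^~ y). Proof. by case: tl => -[_ [_ h]]. Qed.

Lemma t_bs : backsol r H g u.
Proof.
by case: tl => _ /backsol_Arev; congr backsol; apply/funext => t; rewrite opprK.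
Qed.

Lemma t_lu y : lbm (u^~ y). Proof. by have [h _] := t_bs. Qed.

Lemma t_vper t y : v (t + T0) y = rho * v t y. Proof. by case: tl => -[]. Qed.

Lemma t_uper t y : u (t + T0) y = rho^-1 * u t y.
Proof.
case: tl => _ [_ _ h _ _]; have := h (- (t + T0)) y.
rewrite (_ : - (- (t + T0) + T0) = t) ?opprK => [->|]; last by ring.
by rewrite mulrA mulVf ?mul1r// gt_eqF// t_rho.
Qed.

Lemma t_vp (s t : R) z : s <= t -> v t z - v s z = RI s t (fun a => vmul v A a z).
Proof. by case: tl => -[_ _ _ _ h] _; exact: h. Qed.

Definition tN : R := \sum_y u 0 y * v 0 y.

Lemma t_const t : \sum_y u t y * v t y = tN.
Proof. exact: (prodsol_const t_bs t_lv t_vp 0 t). Qed.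

Lemma tN_gt0 : 0 < tN.
Proof.
rewrite /tN (bigD1 x0)//=; apply: ltr_pwDl; first exact: mulr_gt0 (t_u _ _) (t_v _ _).
by apply: sumr_ge0 => y _; apply: mulr_ge0; apply: ltW; [exact: t_u|exact: t_v].
Qed.

Lemma t_ucont y : continuous (u^~ y).
Proof.
apply: (@prim_cont R (fun t => - \sum_z A t y z * u t z)).
  by apply: lbm_Au; exact: t_lu.
by move=> a b; exact: (@backsol_prim H g u y a b t_bs).
Qed.

Lemma t_luinv y : lbm (fun t => (u t y)^-1).
Proof. by apply: lbm_cont => t; apply: cvgV; [rewrite gt_eqF// t_u|exact: t_ucont]. Qed.

Definition tkap : R := ln rho / T0.
(** The logarithm of u falls by ln rho over each period; the linear term compensates this and makes
    [tF] periodic, so that it can act as a test function. [tG] is its derivative. *)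
Definition tF y t : R := ln (u t y) + tkap * t.
Definition tG y t : R := tkap - (\sum_z A t y z * u t z) / u t y.

Lemma lbm_tG y : lbm (tG y).
Proof.
apply: lbmB; first exact: lbm_cst.
apply: lbmM; last exact: t_luinv.
by apply: lbm_sum => z; apply: lbmM; [exact: (lbm_Amx gr)|exact: t_lu].
Qed.

Lemma tF_prim y a b : prim_on a b (tF y) (tG y).
Proof.
have [ab|ba] := leP a b; last first.
  by move=> s t as_ st tb; move: ba; rewrite ltNge (le_trans as_ (le_trans st tb)).
have [C [C0 HC]] := (t_luinv y).2 a b.
have e0 : 0 < (C + 1)^-1 by rewrite invr_gt0 ltr_wpDl.
have ue t : a <= t <= b -> (C + 1)^-1 <= u t y.
  move=> /HC; rewrite ger0_norm ?invr_ge0 ?(ltW (t_u _ _))// => h.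
  rewrite -[leRHS]invrK lef_pV2 ?posrE ?invr_gt0 ?t_u ?ltr_wpDl//; lra.
have pl := prim_ln ab (@lbm_Au H g u y t_lu) (t_lu y) (t_luinv y) e0 ue (@backsol_prim H g u y a b t_bs).
move=> s t as_ st tb; rewrite /tF.
have -> : ln (u t y) + tkap * t - (ln (u s y) + tkap * s) =
   tkap * (t - s) + (ln (u t y) - ln (u s y)) by ring.
rewrite (pl s t as_ st tb) -RI_cst// -RID; last 2 first.
- exact: lbm_cst.
- by apply: lbmM; [exact: (@lbm_Au H g u y t_lu)|exact: t_luinv].
by apply: eq_RI => x _; rewrite mulNr.
Qed.

Lemma tF_cont y : continuous (tF y).
Proof. exact: prim_cont (lbm_tG y) (tF_prim y). Qed.

Lemma lbm_tF y : lbm (tF y). Proof. exact: lbm_cont (@tF_cont y). Qed.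

Lemma tF_per y : Defs.periodic T0 (tF y).
Proof.
move=> t; rewrite /tF t_uper lnM ?posrE ?invr_gt0 ?t_rho ?t_u// lnV ?posrE ?t_rho//.
by rewrite /tkap; field; rewrite gt_eqF.
Qed.

(** The left side is the Fenchel minorant of the cost at the slopes g y z + tF z - tF y. For these
    slopes the exponential part collapses by the equation for u, and summation by parts turns the tF
    terms of Q into a divergence. *)
Lemma tilt_identity t (mu : V -> R) (Q : V -> V -> R) :
  (forall y z, ~~ edge r y z -> Q y z = 0) ->
  \sum_y \sum_z (if edge r y z then
     Q y z * (g y z + tF z t - tF y t) - mu y * r y z t * (expR (g y z + tF z t - tF y t) - 1)
     else 0) =
  \sum_y \sum_z g y z * Q y z + \sum_y H y * mu y - tkap * \sum_y mu y +
  \sum_y mu y * tG y t - \sum_y div Q y * tF y t.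
Proof.
move=> Q0.
(* The exponential of the slope is expR (g y z) u z / u y, so summing over z gives (A u) y / u y - H
   y, which is tkap - tG y - H y. *)
have E1 y : \sum_z mu y * r y z t * (expR (g y z + tF z t - tF y t) - 1) =
    mu y * (tkap - tG y t - H y).
  have -> : tkap - tG y t - H y = \sum_z r y z t * (expR (g y z) * u t z / u t y - 1).
    under eq_bigr => z _ do rewrite mulrBr mulr1.
    rewrite sumrB -/(exitr r y t).
    have -> : \sum_z r y z t * (expR (g y z) * u t z / u t y) =
      (\sum_z A t y z * u t z - (H y - exitr r y t) * u t y) / u t y.
      have -> : \sum_z A t y z * u t z = \sum_z r y z t * expR (g y z) * u t z +
          (H y - exitr r y t) * u t y.
        rewrite /A /Amx; under eq_bigr => z _ do rewrite mulrDl.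
        rewrite big_split/=; congr (_ + _); rewrite (bigD1 y)//= eqxx mul1r big1 ?addr0// => z.
        by rewrite eq_sym => /negbTE ->; rewrite !mul0r.
      by rewrite addrK mulr_suml; apply: eq_bigr => z _; rewrite !mulrA.
    by rewrite /tG; field; rewrite gt_eqF// t_u.
  rewrite mulr_sumr; apply: eq_bigr => z _; rewrite -mulrA; congr (_ * (_ * (_ - 1))).
  have -> : g y z + tF z t - tF y t = g y z + ln (u t z) - ln (u t y) by rewrite /tF; ring.
  by rewrite expRB expRD !lnK ?posrE ?t_u.
transitivity (\sum_y (\sum_z Q y z * (g y z + tF z t - tF y t) -
   mu y * (tkap - tG y t - H y))).
  apply: eq_bigr => y _; rewrite -E1 -sumrB; apply: eq_bigr => z _; case: ifPn => // ne.
  rewrite Q0//; have -> : r y z t = 0 by case: gr => _ _ _ [_ h] _; exact: h.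
  by ring.
rewrite sumrB.
have -> : \sum_y \sum_z Q y z * (g y z + tF z t - tF y t) =
   \sum_y \sum_z g y z * Q y z - \sum_y div Q y * tF y t.
  have -> : \sum_y div Q y * tF y t = \sum_y \sum_z Q y z * tF y t - \sum_y \sum_z Q y z * tF z t.
    rewrite [X in _ - X]exchange_big -sumrB; apply: eq_bigr => y _.
    by rewrite /div mulrBl !mulr_suml.
  rewrite opprB addrA -big_split/= -sumrB; apply: eq_bigr => y _.
  by rewrite -big_split/= -sumrB; apply: eq_bigr => z _; ring.
have -> : \sum_y mu y * (tkap - tG y t - H y) =
   tkap * (\sum_y mu y) - \sum_y mu y * tG y t - \sum_y H y * mu y.
  by rewrite mulr_sumr -!sumrB; apply: eq_bigr => y _; ring.
ring.
Qed.

(* The occupation and the flow of the chain conditioned by the Doob transform u of the tilted chain. *)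
Definition pmu t y : R := u t y * v t y / tN.
Definition pQ t y z : R := v t y * r y z t * expR (g y z) * u t z / tN.
Definition tpt : state_space R V :=
  (fun y => T0^-1 * RI 0 T0 (pmu^~ y), fun y z => T0^-1 * RI 0 T0 (fun t => pQ t y z)).

Lemma lbm_pmu y : lbm (pmu^~ y).
Proof. by apply: lbmM; [apply: lbmM; [exact: t_lu|exact: t_lv]|exact: lbm_cst]. Qed.

Lemma lbm_pQ y z : lbm (fun t => pQ t y z).
Proof.
apply: lbmM; last exact: lbm_cst.
apply: lbmM; last exact: t_lu.
apply: lbmM; last exact: lbm_cst.
by apply: lbmM; [exact: t_lv|exact: (lbm_r gr)].
Qed.

Lemma lbm_divpQ y : lbm (fun t => div (pQ t) y).
Proof. by apply: lbmB; apply: lbm_sum => z; exact: lbm_pQ. Qed.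

Lemma pmu_ge0 t y : 0 <= pmu t y.
Proof.
by rewrite divr_ge0 ?mulr_ge0 ?(ltW tN_gt0) ?(ltW (t_u _ _)) ?(ltW (t_v _ _)).
Qed.

Lemma pQ_ge0 t y z : 0 <= pQ t y z.
Proof.
rewrite divr_ge0 ?(ltW tN_gt0)// mulr_ge0 ?(ltW (t_u _ _))// mulr_ge0 ?expR_ge0//.
by rewrite mulr_ge0 ?(ltW (t_v _ _)) ?(r_ge0 gr).
Qed.

Lemma pmu_sum t : \sum_y pmu t y = 1.
Proof. by rewrite -mulr_suml t_const divff// gt_eqF// tN_gt0. Qed.

(** Product rule for u v: the diagonal contributions, reward and exit rate, cancel between the two
    equations, and the jump terms left over are the inflow and outflow of [pQ]. *)
Lemma pmu_prim y a b : prim_on a b (pmu^~ y) (fun t => - div (pQ t) y).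
Proof.
have [ab|ba] := leP a b; last first.
  by move=> s t as_ st tb; move: ba; rewrite ltNge (le_trans as_ (le_trans st tb)).
move=> s t as_ st tb; rewrite /pmu -mulrBl.
have lA : lbmx A := lbm_Amx gr H g.
have E := @prim_mul R (u^~ y) (v^~ y) _ _ a b ab (@lbm_Au H g u y t_lu) (lbm_vmul y t_lv lA)
  (t_lu y) (t_lv y) (@backsol_prim H g u y a b t_bs) (fun s t _ st _ => t_vp y st) s t as_ st tb.
rewrite E mulrC -RIZ; last first.
  exact: (lbmD (lbmM (@lbm_Au H g u y t_lu) (t_lv y)) (lbmM (t_lu y) (lbm_vmul y t_lv lA))).
apply: eq_RI => x _; rewrite /div opprB.
have diag (K : V -> R) c : \sum_z (r y z x * expR (g y z) + (y == z)%:R * c) * K z =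
   \sum_z r y z x * expR (g y z) * K z + c * K y.
  under eq_bigr => z _ do rewrite mulrDl.
  rewrite big_split/=; congr (_ + _); rewrite (bigD1 y)//= eqxx mul1r big1 ?addr0// => z.
  by rewrite eq_sym => /negbTE ->; rewrite !mul0r.
have -> : \sum_z Amx r H g x y z * u x z =
   \sum_z r y z x * expR (g y z) * u x z + (H y - exitr r y x) * u x y by exact: diag.
have -> : vmul v A x y = \sum_z v x z * (r z y x * expR (g z y)) + v x y * (H y - exitr r y x).
  rewrite /vmul /A /Amx; under eq_bigr => z _ do rewrite mulrDr.
  rewrite big_split/=; congr (_ + _); rewrite (bigD1 y)//= eqxx mul1r big1 ?addr0// => z.
  by move=> /negbTE ->; rewrite mul0r mulr0.
have -> : \sum_z pQ x z y = (\sum_z v x z * (r z y x * expR (g z y))) * u x y / tN.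
  by rewrite !mulr_suml; apply: eq_bigr => z _; rewrite /pQ; ring.
have -> : \sum_z pQ x y z = (\sum_z r y z x * expR (g y z) * u x z) * v x y / tN.
  by rewrite !mulr_suml; apply: eq_bigr => z _; rewrite /pQ; ring.
ring.
Qed.

Lemma pmu_per t : pmu (t + T0) = pmu t.
Proof.
apply/funext => y; rewrite /pmu t_uper t_vper; congr (_ / _).
by field; rewrite gt_eqF// t_rho.
Qed.

Lemma pQ_per t : pQ (t + T0) = pQ t.
Proof.
apply/funext => y; apply/funext => z; rewrite /pQ t_uper t_vper r_per; congr (_ / _).
by field; rewrite gt_eqF// t_rho.
Qed.

(** Integration by parts. Since [pmu] is itself Lipschitz, f only needs a bounded derivative in the
    integral sense, so [tF] can be inserted without smoothing. *)
Lemma path_weak y (f f' : R -> R) : lbm f -> lbm f' -> prim_on 0 T0 f f' -> f T0 = f 0 ->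
  RI 0 T0 (fun t => pmu t y * f' t) = RI 0 T0 (fun t => div (pQ t) y * f t).
Proof.
move=> lf lf' pf fT.
have E := @prim_mul R (pmu^~ y) f _ _ 0 T0 (ltW T00) (lbmN (lbm_divpQ y)) lf' (lbm_pmu y) lf
  (@pmu_prim y 0 T0) pf 0 T0 (lexx _) (ltW T00) (lexx _).
move: E; rewrite -{1}[T0]add0r pmu_per fT subrr => /esym.
rewrite RID; last 2 first.
- by apply: lbmM => //; exact: lbmN (lbm_divpQ y).
- by apply: lbmM => //; exact: lbm_pmu.
have -> : RI 0 T0 (fun t => - div (pQ t) y * f t) = RI 0 T0 (fun t => -1 * (div (pQ t) y * f t)).
  by apply: eq_RI => t _; rewrite mulN1r mulNr.
rewrite RIZ; last by apply: lbmM => //; exact: lbm_divpQ.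
by move=> h; lra.
Qed.

Lemma path_admissible : admissible r T0 tpt.1 tpt.2 pmu pQ.
Proof.
split.
- split; first by move=> t; rewrite pmu_per pQ_per.
  by move=> t; split; [move=> y; exact: pmu_ge0|exact: pmu_sum].
- move=> t y z; split; first exact: pQ_ge0.
  move=> ne; rewrite /pQ; have -> : r y z t = 0 by case: gr => _ _ _ [_ h] _; exact: h.
  by rewrite mulr0 !mul0r.
- by split => [y|y z]; [exact: (lbm_pmu y).1|exact: (lbm_pQ y z).1].
- move=> f tf.
  have cf y : continuous (f y) by apply: derivable_cont; case: (tf y).
  have lf' y : lbm (f y)^`()%classic by apply: lbm_cont; case: (tf y).
  change (RI 0 T0 (fun s => \sum_y pmu s y * (f y)^`()%classic s) =
    RI 0 T0 (fun s => \sum_y div (pQ s) y * f y s)).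
  rewrite RI_sum; last by move=> y; apply: lbmM; [exact: lbm_pmu|exact: lf'].
  rewrite RI_sum; last by move=> y; apply: lbmM; [exact: lbm_divpQ|exact: lbm_cont].
  apply: eq_bigr => y _; apply: path_weak => //; first exact: lbm_cont.
    by apply: prim_C1; case: (tf y).
  by case: (tf y) => h _ _; rewrite -{1}[T0]add0r h.
- split => [y|y z] /=.
    rewrite RI_EFin; last exact: lbm_integrable (lbm_pmu y).
    by rewrite mulrA divff ?mul1r// gt_eqF.
  rewrite RI_EFin; last exact: lbm_integrable (lbm_pQ y z).
  by rewrite mulrA divff ?mul1r// gt_eqF.
Qed.

(** The right side of [tilt_identity] integrated over a period. The two remaining integrals are the
    two sides of the weak continuity equation tested against [tF]. *)
Lemma RI_identity (pt : state_space R V) (mu : R -> V -> R) (Q : R -> V -> V -> R) :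
  (forall y, itg 0 T0 (mu^~ y)) -> (forall y z, itg 0 T0 (fun t => Q t y z)) ->
  (forall y, RI 0 T0 (mu^~ y) = T0 * pt.1 y) ->
  (forall y z, RI 0 T0 (fun t => Q t y z) = T0 * pt.2 y z) ->
  (forall t, \sum_y mu t y = 1) ->
  let rhs := fun t => \sum_y \sum_z g y z * Q t y z + \sum_y H y * mu t y - tkap * \sum_y mu t y +
     \sum_y mu t y * tG y t - \sum_y div (Q t) y * tF y t in
  itg 0 T0 rhs /\
  RI 0 T0 rhs = T0 * (pairing H g pt - tkap) + RI 0 T0 (fun t => \sum_y mu t y * tG y t) -
    RI 0 T0 (fun t => \sum_y div (Q t) y * tF y t).
Proof.
move=> imu iQ Emu EQ s1 rhs.
have i1 y : itg 0 T0 (fun t => \sum_z g y z * Q t y z) by apply: itg_sum => z; exact: itgZ.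
have i1' : itg 0 T0 (fun t => \sum_y \sum_z g y z * Q t y z) by apply: itg_sum.
have i2 : itg 0 T0 (fun t => \sum_y H y * mu t y) by apply: itg_sum => y; exact: itgZ.
have i3' : itg 0 T0 (fun t => \sum_y mu t y) by apply: itg_sum.
have i3 : itg 0 T0 (fun t => tkap * \sum_y mu t y) by apply: itgZ.
have i4 : itg 0 T0 (fun t => \sum_y mu t y * tG y t).
  apply: itg_sum => y; under eq_fun do rewrite mulrC.
  by apply: itgM => //; exact: lbm_tG.
have id y : itg 0 T0 (fun t => div (Q t) y) by apply: itgB; exact: itg_sum.
have i5 : itg 0 T0 (fun t => \sum_y div (Q t) y * tF y t).
  apply: itg_sum => y; under eq_fun do rewrite mulrC.
  by apply: itgM => //; exact: lbm_tF.
have i12 := itgD i1' i2; have i123 := itgB i12 i3; have i1234 := itgD i123 i4.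
split; first exact: itgB i1234 i5.
rewrite /rhs RIBi// RIDi// RIBi// RIDi// RIZi//; congr (_ + _ - _).
have -> : RI 0 T0 (fun t => \sum_y \sum_z g y z * Q t y z) = \sum_y \sum_z g y z * (T0 * pt.2 y z).
  rewrite RI_sumi//; apply: eq_bigr => y _; rewrite RI_sumi; last by move=> z; exact: itgZ.
  by apply: eq_bigr => z _; rewrite RIZi// EQ.
have -> : RI 0 T0 (fun t => \sum_y H y * mu t y) = \sum_y H y * (T0 * pt.1 y).
  rewrite RI_sumi; last by move=> y; exact: itgZ.
  by apply: eq_bigr => y _; rewrite RIZi// Emu.
have -> : RI 0 T0 (fun t => \sum_y mu t y) = T0.
  under eq_RI => t _ do rewrite s1.
  by rewrite RI_cst ?(ltW T00)// mul1r subr0.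
rewrite /pairing mulrBr mulrDr !mulr_sumr [tkap * T0]mulrC; congr (_ - _).
rewrite addrC; congr (_ + _); apply: eq_bigr => y _; first by rewrite mulrCA.
by rewrite mulr_sumr; apply: eq_bigr => z _; rewrite mulrCA.
Qed.

(** Equality case of Fenchel: [pQ] is [pmu] times the rate times the exponential of exactly the
    slope used in [tilt_identity]. *)
Lemma path_cost : (\int[leb]_(t in `[0%R, T0]) It r t (pmu t) (pQ t) =
  (T0 * (pairing H g tpt - tkap))%:E)%E.
Proof.
have Tn : T0 != 0 by rewrite gt_eqF.
have [irhs Erhs] := @RI_identity tpt pmu pQ (fun y => lbm_integrable 0 T0 (lbm_pmu y))
  (fun y z => lbm_integrable 0 T0 (lbm_pQ y z))
  (fun y => ltac:(by rewrite /= mulrA divff// mul1r))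
  (fun y z => ltac:(by rewrite /= mulrA divff// mul1r)) pmu_sum.
have E t : It r t (pmu t) (pQ t) = (\sum_y \sum_z g y z * pQ t y z + \sum_y H y * pmu t y
   - tkap * \sum_y pmu t y +
     \sum_y pmu t y * tG y t - \sum_y div (pQ t) y * tF y t)%:E.
  have Q0 y z : ~~ edge r y z -> pQ t y z = 0.
    by case: path_admissible => _ /(_ t y z)[].
  rewrite -(tilt_identity t (pmu t) Q0) /It -sumEFin; apply: eq_bigr => y _.
  rewrite -sumEFin; apply: eq_bigr => z _; case: ifPn => // e.
  have -> : pQ t y z = pmu t y * r y z t * expR (g y z + tF z t - tF y t).
    have -> : g y z + tF z t - tF y t = g y z + ln (u t z) - ln (u t y) by rewrite /tF; ring.
    rewrite expRB expRD !lnK ?posrE ?t_u// /pQ /pmu; field.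
    by rewrite !gt_eqF ?tN_gt0 ?t_u.
  by rewrite Phi_expR// mulr_ge0 ?pmu_ge0 ?(r_ge0 gr).
under eq_integral => t _ do rewrite E.
rewrite RI_EFin// Erhs; congr EFin.
have -> : RI 0 T0 (fun t => \sum_y pmu t y * tG y t) =
  RI 0 T0 (fun t => \sum_y div (pQ t) y * tF y t).
  rewrite RI_sum; last by move=> y; apply: lbmM; [exact: lbm_pmu|exact: lbm_tG].
  rewrite RI_sum; last by move=> y; apply: lbmM; [exact: lbm_divpQ|exact: lbm_tF].
  apply: eq_bigr => y _; apply: path_weak; [exact: lbm_tF|exact: lbm_tG|exact: tF_prim|].
  by rewrite -{1}[T0]add0r tF_per.
by rewrite addrK.
Qed.

(** * Lower bound on the cost of an arbitrary admissible path *)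

Section LowerCost.
Hypothesis disc : leb.-negligible ([set t : R | 0 <= t <= T0] `&`
  [set t | exists y z, ~ {for t, continuous (r y z)}]).
Variables (pt : state_space R V) (mu : R -> V -> R) (Q : R -> V -> V -> R).
Hypothesis adm : admissible r T0 pt.1 pt.2 mu Q.

Let mu0 t y : 0 <= mu t y. Proof. by case: adm => -[_ /(_ t)[h _]]. Qed.
Let mu1 t : \sum_y mu t y = 1. Proof. by case: adm => -[_ /(_ t)[_ h]]. Qed.
Let Q0 t y z : 0 <= Q t y z. Proof. by case: adm => _ /(_ t y z)[]. Qed.
Let mmu y : measurable_fun setT (mu^~ y). Proof. by case: adm => _ _ []. Qed.
Let mQ y z : measurable_fun setT (fun t => Q t y z). Proof. by case: adm => _ _ []. Qed.
Let imu y : itg 0 T0 (mu^~ y).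
Proof. by case: adm => _ _ _ _ [h _]; apply: (itg_ge0 (mmu y)) (h y). Qed.
Let iQ y z : itg 0 T0 (fun t => Q t y z).
Proof. by case: adm => _ _ _ _ [_ h]; apply: (itg_ge0 (mQ y z)) (h y z). Qed.
Let idiv y : itg 0 T0 (fun t => div (Q t) y).
Proof. by apply: itgB; apply: itg_sum => z; exact: iQ. Qed.
Let mdiv y : measurable_fun setT (fun t => div (Q t) y).
Proof. by apply: measurable_funB; apply: measurable_sum => z; exact: mQ. Qed.
Let mule1 t y : mu t y <= 1.
Proof. by rewrite -(mu1 t); apply: sum_ge1. Qed.

Let tG_cont y t : (forall y z, {for t, continuous (r y z)}) -> {for t, continuous (tG y)}.
Proof.
move=> cr; apply: cvgB; first exact: cvg_cst.
apply: cvgM; last by apply: cvgV; [rewrite gt_eqF// t_u|exact: t_ucont].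
apply: (@cvg_sumr R V R (nbhs t) _ _ (fun z s => A s y z * u s z) (fun z => A t y z * u t z)) => z.
apply: cvgM; last exact: t_ucont.
apply: cvgD; first by apply: cvgM; [exact: cr|exact: cvg_cst].
apply: cvgM; first exact: cvg_cst.
apply: cvgB; first exact: cvg_cst.
by apply: (@cvg_sumr R V R (nbhs t) _ _ (fun z s => r y z s) (fun z => r y z t)) => c; exact: cr.
Qed.

(* The test functions in the weak equation are C^1, whereas tF is only Lipschitz:
   it is averaged over [t, t + 1/(k+1)]. *)
Lemma weak_tF : RI 0 T0 (fun t => \sum_y mu t y * tG y t) =
  RI 0 T0 (fun t => \sum_y div (Q t) y * tF y t).
Proof.
pose dk k : R := k.+1%:R^-1.
have dk0 k : 0 < dk k by rewrite invr_gt0 ltr0n.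
have dk1 k : dk k <= 1 by rewrite invf_le1 ?ltr0n// ler1n.
pose Fn k y t : R := k.+1%:R * RI t (t + dk k) (tF y).
pose Fn' k y t : R := k.+1%:R * (tF y (t + dk k) - tF y t).
have dFn k y (t : R) : is_derive t 1 (Fn k y) (Fn' k y t).
  exact: (is_deriveZ k.+1%:R (is_derive_avg t (@tF_cont y) (ltW (dk0 k)))).
have dE k y : (Fn k y)^`()%classic = Fn' k y.
  by apply/funext => t; rewrite derive1E; have [_ ->] := dFn k y t.
have cFn' k y : continuous (Fn' k y).
  move=> t; apply: cvgM; first exact: cvg_cst.
  apply: cvgB; last exact: tF_cont.
  apply: (@continuous_comp _ _ _ (fun s => s + dk k) (tF y)); last exact: tF_cont.
  by apply: cvgD; [exact: cvg_id|exact: cvg_cst].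
have tfn k : test_fun T0 (Fn k).
  move=> y; split.
  - move=> t; rewrite /Fn; congr (_ * _); rewrite (_ : t + T0 + dk k = t + dk k + T0); last by ring.
    rewrite RI_shift; last exact: lbm_tF.
    by apply: eq_RI => s _; exact: tF_per.
  - by move=> t; have [] := dFn k y t.
  - by rewrite dE; exact: cFn'.
have E k : RI 0 T0 (fun s => \sum_y mu s y * Fn' k y s) =
    RI 0 T0 (fun s => \sum_y div (Q s) y * Fn k y s).
  case: adm => _ _ _ /(_ _ (tfn k)) h _; rewrite -[RHS]h; apply: eq_RI => s _.
  by apply: eq_bigr => y _; rewrite dE.
(* Bounds are taken up to T0 + 1 because the averaging window reaches past T0 by at most 1. *)
have /choice[L HL] := fun y => (lbm_tG y).2 0 (T0 + 1).
have /choice[B HB] := fun y => (lbm_tF y).2 0 (T0 + 1).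
have T0' := ltW T00.
have bFn' k y t : 0 <= t <= T0 -> `|Fn' k y t| <= L y.
  move=> /andP[t0 tT]; rewrite /Fn' normrM ger0_norm//.
  have : `|tF y (t + dk k) - tF y t| <= L y * (t + dk k - t).
    apply: (prim_on_lip (lbm_tG y) (@tF_prim y 0 (T0 + 1)) (HL y).2) => //.
      by rewrite lerDl ltW.
    by apply: lerD.
  rewrite (_ : t + dk k - t = dk k) => [h|]; last by ring.
  apply: le_trans (ler_wpM2l _ h) _ => //.
  by rewrite mulrCA /dk divff ?mulr1// pnatr_eq0.
have bFn k y t : 0 <= t <= T0 -> `|Fn k y t| <= B y.
  move=> /andP[t0 tT]; rewrite /Fn normrM ger0_norm//.
  have : `|RI t (t + dk k) (tF y)| <= B y * (t + dk k - t).
    apply: RI_bound; [exact: lbm_tF|by rewrite lerDl ltW|].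
    move=> s /andP[ts st]; apply: (HB y).2; rewrite (le_trans t0 ts)/=.
    by apply: (le_trans st); apply: lerD.
  rewrite (_ : t + dk k - t = dk k) => [h|]; last by ring.
  apply: le_trans (ler_wpM2l _ h) _ => //.
  by rewrite mulrCA /dk divff ?mulr1// pnatr_eq0.
have cL : RI 0 T0 (fun s => \sum_y mu s y * Fn' k y s) @[k --> \oo] -->
    RI 0 T0 (fun t => \sum_y mu t y * tG y t).
  apply: (proj1 (RI_dominated_ae (g := fun=> \sum_y L y) _ _ _ _ _)).
  - move=> k; apply: measurable_sum => y; apply: measurable_funM => //.
    exact: (lbm_cont (cFn' k y)).1.
  - by apply: measurable_sum => y; apply: measurable_funM => //; exact: (lbm_tG y).1.
  - exact: lbm_integrable (lbm_cst _).
  - move=> k t tT; apply: (le_trans (ler_norm_sum _ _ _)); apply: ler_sum => y _.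
    rewrite normrM (ger0_norm (mu0 t y)) -[leRHS]mul1r.
    by apply: ler_pM => //; exact: bFn'.
  (* This is the use of (A4): at almost every t all rates are continuous, hence so is [tG], and its
     averages over shrinking windows converge to its value. *)
  - apply: negligibleS disc => t /= /not_implyP[]; rewrite in_itv/= => tab nc; split => //.
    apply: contrapT => cr; apply: nc.
    have cr' y z : {for t, continuous (r y z)} by apply: contrapT => h; apply: cr; exists y, z.
    apply: cvg_sumr => y; apply: cvgM; first exact: cvg_cst.
    rewrite (_ : (fun k => _) = (fun k => k.+1%:R * RI t (t + k.+1%:R^-1) (tG y))).
      by apply: avg_cvg; [exact: lbm_tG|exact: tG_cont].
    apply/funext => k; rewrite /Fn' (@tF_prim y t (t + dk k) t (t + dk k))//.
    by rewrite lerDl ltW.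
have cR : RI 0 T0 (fun s => \sum_y mu s y * Fn' k y s) @[k --> \oo] -->
    RI 0 T0 (fun t => \sum_y div (Q t) y * tF y t).
  rewrite (_ : (fun k => _) = (fun k => RI 0 T0 (fun s => \sum_y div (Q s) y * Fn k y s))); last first.
    by apply/funext => k; rewrite E.
  apply: (proj1 (RI_dominated_ae (g := fun t => \sum_y B y * `|div (Q t) y|) _ _ _ _ _)).
  - move=> k; apply: measurable_sum => y; apply: measurable_funM => //.
    apply: (lbm_cont _).1; apply: derivable_cont => t; by have [] := dFn k y t.
  - by apply: measurable_sum => y; apply: measurable_funM => //; exact: (lbm_tF y).1.
  - by apply: itg_sum => y; apply: itgZ; exact: itg_norm.
  - move=> k t tT; apply: (le_trans (ler_norm_sum _ _ _)); apply: ler_sum => y _.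
    by rewrite normrM mulrC ler_wpM2r//; exact: bFn.
  - apply: aeW => t _; apply: cvg_sumr => y; apply: cvgM; first exact: cvg_cst.
    by apply: avg_cvg; [exact: lbm_tF|exact: tF_cont].
exact: (cvg_unique (@Rhausdorff R) cL cR).
Qed.

(** Fenchel at every time and edge, integrated; by [weak_tF] the test terms cancel and only the
    averages of the path remain. *)
Lemma cost_lower : ((T0 * (pairing H g pt - tkap))%:E <=
  \int[leb]_(t in `[0%R, T0]) It r t (mu t) (Q t))%E.
Proof.
have Emu y : RI 0 T0 (mu^~ y) = T0 * pt.1 y.
  by case: adm => _ _ _ _ [/(_ y) h _]; rewrite /RI /Rintegral h.
have EQ y z : RI 0 T0 (fun t => Q t y z) = T0 * pt.2 y z.
  by case: adm => _ _ _ _ [_ /(_ y z) h]; rewrite /RI /Rintegral h.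
have [irhs Erhs] := RI_identity imu iQ Emu EQ mu1.
move: Erhs; rewrite weak_tF addrK => <-; rewrite -RI_EFin//.
apply: integral_le_ge0 => //.
- exact: measurable_int irhs.
- by apply: measurable_funS (measurable_It mu0 Q0 mmu mQ).
- by move=> t _; apply: It_ge0.
move=> t _; have Qe y z : ~~ edge r y z -> Q t y z = 0 by case: adm => _ /(_ t y z)[].
rewrite -(tilt_identity t (mu t) Qe) -sumEFin; apply: lee_sum => y _.
rewrite -sumEFin; apply: lee_sum => z _; case: ifP => // _.
by apply: Phi_fenchel => //; rewrite mulr_ge0 ?(r_ge0 gr).
Qed.

End LowerCost.

End Pair.

End Tilted.

(** * Compactness from strict convexity *)
Section ConvexCompactness.
Variables (R : realType) (I : finType) (a b : R).
Local Notation leb := (@lebesgue_measure R).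
Implicit Types (x y : R -> I -> R).

(* Near-minimizers of the strictly convex functional sum of RI phi1 over a decreasing sequence of
   convex sets are L^1-Cauchy, by the quantitative convexity phi1_gap. *)
Lemma convex_L1_cauchy (S : nat -> set (R -> I -> R)) (C D : R) :
  (forall k, S k !=set0) -> (forall k, S k.+1 `<=` S k) ->
  (forall k x y, S k x -> S k y -> S k (fun t i => (x t i + y t i) / 2)) ->
  (forall x, S 0%N x -> [/\ (forall t i, 0 <= x t i), (forall i, itg a b (x^~ i)),
     (forall i, itg a b (fun t => phi1 (x t i))), \sum_i RI a b (x^~ i) <= D &
     \sum_i RI a b (fun t => phi1 (x t i)) <= C]) ->
  exists x : nat -> R -> I -> R, forall j, S j (x j) /\
    \sum_i RI a b (fun t => `|x j.+1 t i - x j t i|) <= 2^-1 ^+ j.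
Proof.
move=> ne dec mid prop.
have decle k l : (k <= l)%N -> S l `<=` S k.
  elim: l => [|l IH]; first by rewrite leqn0 => /eqP ->.
  by rewrite leq_eqVlt => /orP[/eqP <-//|kl] x /dec /IH; apply.
have S0 k x : S k x -> S 0%N x by exact: decle.
pose F x : R := \sum_i RI a b (fun t => phi1 (x t i)).
have F0 k x : S k x -> 0 <= F x.
  move=> /S0/prop[x0 _ _ _ _]; apply: sumr_ge0 => i _; apply: RI_ge0 => t _.
  exact: phi1_ge0.
pose mm k := inf (F @` S k).
have hlb k : has_lbound (F @` S k) by exists 0 => _ [x Sx <-]; exact: F0 Sx.
have ne' k : F @` S k !=set0 by have [x Sx] := ne k; exists (F x), x.
have mle k x : S k x -> mm k <= F x by move=> Sx; apply: ge_inf => //; exists x.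
have mC k : mm k <= C.
  have [x Sx] := ne k; apply: (le_trans (mle k x Sx)).
  by have [] := prop x (S0 _ _ Sx).
have mono k l : (k <= l)%N -> mm k <= mm l.
  by move=> kl; apply: lb_le_inf => // _ [x Sx <-]; apply: mle; exact: decle Sx.
have /choice[p Hp] : forall k, exists x, S k x /\ F x <= mm k + k.+1%:R^-1.
  move=> k; have k0 : 0 < k.+1%:R^-1 :> R by rewrite invr_gt0 ltr0n.
  have [_ [x Sx <-] /ltW h] := inf_adherent k0 (conj (ne' k) (hlb k)).
  by exists x.
pose s := sup (range mm).
have hs : has_sup (range mm).
  by split; [exists (mm 0%N), 0%N|exists C => _ [k _ <-]; exact: mC].
have ms k : mm k <= s by apply: ub_le_sup; [exact: hs.2|exists k].
(* The midpoint of p k and p l stays in S k, so F there is at least mm k, while F (p l) is at most s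
   plus 1 / (k + 1): the total convexity gap is at most s - mm k + 2 / (k + 1). *)
have L1 k l eta : (k <= l)%N -> 0 < eta <= 1 / 2 ->
    \sum_i RI a b (fun t => `|p l t i - p k t i|) <=
      ((s - mm k) + 2 * k.+1%:R^-1) / eta + 2 * eta * (2 * D).
  move=> kl etab; have /andP[eta0 _] := etab.
  have [Sk Fk] := Hp k; have [Sl Fl] := Hp l.
  have Slk := decle _ _ kl _ Sl.
  have Sm := mid k _ _ Slk Sk.
  set pm := (fun t i => _) in Sm.
  have Fm := mle k _ Sm.
  have [l0 il pl Dl _] := prop _ (S0 _ _ Sl); have [k0 ik pk Dk _] := prop _ (S0 _ _ Sk).
  have [_ _ pmi _ _] := prop _ (S0 _ _ Sm).
  have igap i : itg a b (fun t => phi1 (p l t i) + phi1 (p k t i) - 2 * phi1 (pm t i)).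
    by apply: itgB; [exact: itgD|exact: itgZ].
  apply: (@le_trans _ _ (\sum_i (eta^-1 * (RI a b (fun t => phi1 (p l t i)) +
      RI a b (fun t => phi1 (p k t i)) - 2 * RI a b (fun t => phi1 (pm t i))) +
      2 * eta * (RI a b (p l ^~ i) + RI a b (p k ^~ i))))).
    apply: ler_sum => i _; rewrite -RIDi// -RIZi// -RIBi; [|exact: itgD|exact: itgZ].
    rewrite -RIZi// -RIDi// -RIZi; last exact: itgD.
    rewrite -RIDi; [|exact: itgZ|by apply: itgZ; exact: itgD].
    apply: RI_lei.
    - by apply: itg_norm; exact: itgB.
    - by apply: itgD; apply: itgZ => //; exact: itgD.
    - by move=> t _; rewrite [eta^-1 * _]mulrC; exact: phi1_gap.
  rewrite big_split/= -!mulr_sumr sumrB !big_split/= -mulr_sumr; apply: lerD.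
    rewrite mulrC ler_wpM2r ?invr_ge0 ?(ltW eta0)// -/(F (p l)) -/(F (p k)) -/(F pm).
    have kl1 : l.+1%:R^-1 <= k.+1%:R^-1 :> R by rewrite lef_pV2 ?posrE ?ltr0n// ler_nat ltnS.
    have := ms l; move: Fk Fl kl1; move: (l.+1%:R^-1) (k.+1%:R^-1) => i1 i2; lra.
  by rewrite ler_wpM2l ?mulr_ge0 ?(ltW eta0)//; lra.
have key (eps : R) : 0 < eps -> exists K, forall k l, (K <= k)%N -> (k <= l)%N ->
    \sum_i RI a b (fun t => `|p l t i - p k t i|) <= eps.
  move=> eps0; pose eta := Num.min (1 / 2) (eps / (8 * (`|D| + 1))).
  have D1 : 0 < 8 * (`|D| + 1) by rewrite mulr_gt0// ltr_wpDl.
  have eta0 : 0 < eta by rewrite lt_min divr_gt0 ?divr_gt0.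
  have eta1 : 0 < eta <= 1 / 2 by rewrite eta0 ge_min lexx.
  have eta2 : 2 * eta * (2 * D) <= eps / 2.
    have : eta <= eps / (8 * (`|D| + 1)) by rewrite ge_min lexx orbT.
    rewrite ler_pdivlMr// => h; have := ler_norm D; have := normr_ge0 D; nra.
  have e4 : 0 < eta * eps / 4 by rewrite divr_gt0 ?mulr_gt0.
  have [_ [K1 _ <-] HK1] := sup_adherent e4 hs.
  have [K2 HK2] : exists K2 : nat, forall k, (K2 <= k)%N -> 2 * k.+1%:R^-1 <= eta * eps / 4.
    exists (Num.truncn (2 / (eta * eps / 4))) => k Kk.
    rewrite ler_pdivrMr ?ltr0n// mulrC -ler_pdivrMr//.
    apply: ltW; apply: lt_le_trans (truncnS_gt _) _.
    by rewrite ler_nat ltnS.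
  exists (maxn K1 K2) => k l; rewrite geq_max => /andP[K1k K2k] kl.
  apply: (le_trans (L1 k l eta kl eta1)).
  have h1 := HK2 k K2k; have h2 := mono _ _ K1k.
  have : ((s - mm k) + 2 * k.+1%:R^-1) / eta <= eps / 2.
    rewrite ler_pdivrMr//; rewrite -/s in HK1; move: h1; move: (k.+1%:R^-1) => i1 h1; lra.
  move: (((s - mm k) + 2 * k.+1%:R^-1) / eta) => X; lra.
have /choice[K HK] : forall j, exists K, forall k l, (K <= k)%N -> (k <= l)%N ->
    \sum_i RI a b (fun t => `|p l t i - p k t i|) <= 2^-1 ^+ j.
  by move=> j; apply: key; rewrite exprn_gt0// invr_gt0.
(* Nondecreasing and above both K j and j: consecutive terms are then 2^-j close, and the j-th term
   still belongs to S j. *)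
pose phi j := (\sum_(i < j.+1) K i + j)%N.
have phiK j : (K j <= phi j)%N.
  by rewrite /phi big_ord_recr/= -addnA addnCA leq_addr.
have phij j : (j <= phi j)%N by rewrite leq_addl.
have phiS j : (phi j <= phi j.+1)%N.
  by rewrite /phi (big_ord_recr j.+1)/= leq_add// leq_addr.
exists (fun j => p (phi j)) => j; split; first by apply: (decle _ _ (phij j)); exact: (Hp _).1.
exact: HK.
Qed.

(** Total variation of the sequence at time t. Geometric speed makes its integral at most 2, hence
    it is finite almost everywhere; there it yields convergence, and it provides an integrable
    majorant valid for all terms. *)
Definition tvar (x : nat -> R -> I -> R) (t : R) : \bar R :=
  (\sum_(0 <= j <oo) (\sum_i `|x j.+1 t i - x j t i|)%:E)%E.

Section Fast.
Variable x : nat -> R -> I -> R.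
Hypotheses (mx : forall j i, measurable_fun setT (fun t => x j t i))
  (ix : forall j i, itg a b (fun t => x j t i))
  (dx : forall j, \sum_i RI a b (fun t => `|x j.+1 t i - x j t i|) <= 2^-1 ^+ j).

Let dj j t : R := \sum_i `|x j.+1 t i - x j t i|.
Let dj0 j t : 0 <= dj j t. Proof. exact: sumr_ge0. Qed.
Let mdj j : measurable_fun setT (dj j).
Proof.
apply: measurable_sum => i; apply: measurableT_comp => //.
by apply: measurable_funB; exact: mx.
Qed.
Let idj j : itg a b (dj j).
Proof. by apply: itg_sum => i; apply: itg_norm; apply: itgB; exact: ix. Qed.

Lemma measurable_tvar : measurable_fun setT (tvar x).
Proof.
rewrite /tvar; apply: (@ge0_emeasurable_sum _ _ R setT (fun j t => (dj j t)%:E) xpredT).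
  by move=> k t _ _; rewrite lee_fin dj0.
by move=> k _; apply/measurable_EFinP; exact: mdj.
Qed.

Lemma tvar_ge0 t : (0 <= tvar x t)%E.
Proof. by apply: nneseries_ge0 => j _ _; rewrite lee_fin dj0. Qed.

Lemma tvar_int : (\int[leb]_(t in `[a, b]) tvar x t <= 2%:E)%E.
Proof.
rewrite /tvar (@integral_nneseries _ _ R leb `[a, b]%classic _ (fun j t => (dj j t)%:E))//; last 2 first.
- by move=> j; apply/measurable_EFinP; exact: measurable_funS (mdj j).
- by move=> j t _; rewrite lee_fin dj0.
apply: lime_le.
  by apply: is_cvg_nneseries => j _ _; apply: integral_ge0 => t _; rewrite lee_fin dj0.
apply: nearW => k.
have -> : (\sum_(0 <= j < k) \int[leb]_(t in `[a, b]) (dj j t)%:E =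
   (\sum_(0 <= j < k) RI a b (dj j))%:E)%E.
  by rewrite -sumEFin; apply: eq_bigr => j _; rewrite RI_EFin.
rewrite lee_fin.
apply: (@le_trans _ _ (\sum_(0 <= j < k) 2^-1 ^+ j)).
  apply: ler_sum => j _; rewrite RI_sumi; first exact: dx.
  by move=> i; apply: itg_norm; apply: itgB; exact: ix.
have -> : \sum_(0 <= j < k) 2^-1 ^+ j = 2 - 2 * 2^-1 ^+ k :> R.
  elim: k => [|k IH]; first by rewrite big_geq// expr0; ring.
  by rewrite big_nat_recr//= IH exprS; field.
by rewrite gerBl mulr_ge0// exprn_ge0// invr_ge0.
Qed.

Lemma tvar_ae : {ae leb, forall t, `[a, b]%classic t -> (tvar x t < +oo)%E}.
Proof.
have it : leb.-integrable `[a, b] (tvar x).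
  apply/integrableP; split; first exact: measurable_funS measurable_tvar.
  under eq_integral => t _ do rewrite gee0_abs ?tvar_ge0//.
  by apply: (le_lt_trans tvar_int); rewrite ltry.
have : {ae leb, forall t, `[a, b]%classic t -> tvar x t \is a fin_num} by apply: integrable_ae.
apply: filterS; first exact: (ae_filter_ringOfSetsType leb).
by move=> t h tab; have := h tab; rewrite ge0_fin_numE// tvar_ge0.
Qed.

Lemma tvar_sum t k : (tvar x t < +oo)%E -> \sum_(0 <= j < k) dj j t <= fine (tvar x t).
Proof.
move=> h; rewrite -lee_fin fineK ?ge0_fin_numE ?tvar_ge0//.
rewrite -sumEFin; apply: (@nneseries_lim_ge R (fun j => (dj j t)%:E) xpredT 0 k).
by move=> j _ _; rewrite lee_fin dj0.
Qed.

Let djE j t i : `|x j.+1 t i - x j t i| <= dj j t.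
Proof. by rewrite /dj (bigD1 i)//= lerDl sumr_ge0. Qed.

Let tele t i k : x k t i = x 0%N t i + \sum_(0 <= j < k) (x j.+1 t i - x j t i).
Proof. by rewrite telescope_sumr// addrC subrK. Qed.

Lemma tvar_cvg t i : (tvar x t < +oo)%E -> cvgn (fun j => x j t i).
Proof.
move=> h.
have -> : (fun j => x j t i) =
    (fun k => x 0%N t i + series (fun j => x j.+1 t i - x j t i) k).
  by apply/funext => k; rewrite tele seriesEnat.
apply: is_cvgD; first exact: is_cvg_cst.
apply: normed_cvg; apply: nondecreasing_is_cvgn.
  by apply/nondecreasing_seqP => k; rewrite /normed_series_of !seriesEnat/= big_nat_recr//= lerDl.
exists (fine (tvar x t)) => _ [k _ <-]; rewrite /normed_series_of seriesEnat/=.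
apply: le_trans (tvar_sum k h); apply: ler_sum => j _; exact: djE.
Qed.

Lemma tvar_bound t j i : (tvar x t < +oo)%E -> `|x j t i| <= `|x 0%N t i| + fine (tvar x t).
Proof.
move=> h; rewrite tele; apply: (le_trans (ler_normD _ _)); rewrite lerD2l.
apply: (le_trans (ler_norm_sum _ _ _)); apply: le_trans (tvar_sum j h).
by apply: ler_sum => k _; exact: djE.
Qed.

Lemma itg_tvar : itg a b (fun t => fine (tvar x t)).
Proof.
apply/integrableP; split.
  apply/measurable_EFinP; apply: measurable_funS (_ : measurable_fun setT _) => //.
  by apply: measurableT_comp; [exact: fine_measurable|exact: measurable_tvar].
apply: (@le_lt_trans _ _ (\int[leb]_(t in `[a, b]) tvar x t)%E); last first.
  by apply: (le_lt_trans tvar_int); rewrite ltry.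
apply: ge0_le_integral => //.
- apply/measurable_EFinP; apply: measurable_funS (_ : measurable_fun setT _) => //.
  apply: measurableT_comp => //.
  by apply: measurableT_comp; [exact: fine_measurable|exact: measurable_tvar].
- exact: measurable_funS measurable_tvar.
- move=> t _ /=; rewrite ger0_norm ?fine_ge0 ?tvar_ge0//.
  by have := tvar_ge0 t; case: (tvar x t) => [c| |] //= _; rewrite leey.
Qed.

End Fast.

End ConvexCompactness.

(** * The rate functional *)
Section RateFunction.
Variables (R : realType) (V : finType) (T0 : R) (r : rates R V) (m M : R).
Hypothesis gr : goodrates T0 r m M.
Hypothesis T00 : 0 < T0.
Variable x0 : V.
Local Notation leb := (@lebesgue_measure R).
Implicit Types (mu : R -> V -> R) (Q : R -> V -> V -> R).

Definition cost mu Q : \bar R := (\int[leb]_(t in `[0%R, T0]) It r t (mu t) (Q t))%E.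

Lemma adm_facts pt1 pt2 mu Q : admissible r T0 pt1 pt2 mu Q ->
  [/\ (forall t y, 0 <= mu t y <= 1), (forall t y z, 0 <= Q t y z),
      (forall y, itg 0 T0 (mu^~ y) /\ RI 0 T0 (mu^~ y) = T0 * pt1 y) &
      (forall y z, itg 0 T0 (fun t => Q t y z) /\ RI 0 T0 (fun t => Q t y z) = T0 * pt2 y z)].
Proof.
case=> -[_ pr] Qc [mmu mQ] _ [imu iQ]; split.
- move=> t y; have [h0 h1] := pr t; rewrite h0 -h1; exact: sum_ge1.
- by move=> t y z; have [] := Qc t y z.
- move=> y; split; last by rewrite /RI /Rintegral imu.
  by apply: (itg_ge0 (mmu y)) (imu y) => t; have [] := pr t.
- move=> y z; split; last by rewrite /RI /Rintegral iQ.
  by apply: (itg_ge0 (mQ y z)) (iQ y z) => t; have [] := Qc t y z.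
Qed.

Lemma adm_measurable_It pt1 pt2 mu Q : admissible r T0 pt1 pt2 mu Q ->
  measurable_fun setT (fun t => It r t (mu t) (Q t)).
Proof.
move=> adm; have [h1 h2 _ _] := adm_facts adm; case: adm => _ _ [mmu mQ] _ _.
by apply: (measurable_It gr) => // t y; case/andP: (h1 t y).
Qed.

Lemma adm_It_ge0 pt1 pt2 mu Q t : admissible r T0 pt1 pt2 mu Q -> (0 <= It r t (mu t) (Q t))%E.
Proof.
move=> adm; have [h1 h2 _ _] := adm_facts adm.
by apply: (It_ge0 gr) => // y; case/andP: (h1 t y).
Qed.

Lemma cost_ge0 pt1 pt2 mu Q : admissible r T0 pt1 pt2 mu Q -> (0 <= cost mu Q)%E.
Proof. by move=> adm; apply: integral_ge0 => t _; exact: adm_It_ge0 adm. Qed.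

Lemma adm_test pt1 pt2 mu Q f : admissible r T0 pt1 pt2 mu Q -> test_fun T0 f ->
  itg 0 T0 (fun t => \sum_y mu t y * (f y)^`()%classic t) /\
  itg 0 T0 (fun t => \sum_y div (Q t) y * f y t).
Proof.
move=> adm tf; have [_ _ h1 h2] := adm_facts adm; split; apply: itg_sum => y.
  under eq_fun do rewrite mulrC.
  by apply: itgM; [apply: lbm_cont; case: (tf y)|case: (h1 y)].
under eq_fun do rewrite mulrC.
apply: itgM; first by apply: lbm_cont; apply: derivable_cont; case: (tf y).
by apply: itgB; apply: itg_sum => z; [case: (h2 y z)|case: (h2 z y)].
Qed.

Section Convex.
Variables (l : R) (mu1 mu2 : R -> V -> R) (Q1 Q2 : R -> V -> V -> R).
Variables (a1 b1 : V -> R) (a2 b2 : V -> V -> R).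
Hypotheses (l01 : 0 <= l <= 1) (adm1 : admissible r T0 a1 a2 mu1 Q1)
  (adm2 : admissible r T0 b1 b2 mu2 Q2).

Let l0 : 0 <= l. Proof. by case/andP: l01. Qed.
Let l1 : 0 <= 1 - l. Proof. by case/andP: l01 => _; rewrite subr_ge0. Qed.

Lemma admissible_conv : admissible r T0 (fun y => l * a1 y + (1 - l) * b1 y)
  (fun y z => l * a2 y z + (1 - l) * b2 y z)
  (fun t y => l * mu1 t y + (1 - l) * mu2 t y)
  (fun t y z => l * Q1 t y z + (1 - l) * Q2 t y z).
Proof.
have [f11 f12 f13 f14] := adm_facts adm1; have [f21 f22 f23 f24] := adm_facts adm2.
have it := adm_test adm1; have it2 := adm_test adm2.
move: (adm1) (adm2) => [[per1 pr1] Qc1 [m1 n1] w1 _] [[per2 pr2] Qc2 [m2 n2] w2 _].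
split.
- split.
    by move=> t; have [-> ->] := per1 t; have [-> ->] := per2 t.
  move=> t; split.
    by move=> y; case/andP: (f11 t y) => *; case/andP: (f21 t y) => *; exact: addr_ge0 (mulr_ge0 _ _) (mulr_ge0 _ _).
  by rewrite big_split/= -!mulr_sumr (pr1 t).2 (pr2 t).2; ring.
- move=> t y z; split; first by apply: addr_ge0; apply: mulr_ge0.
  by move=> e; rewrite (Qc1 t y z).2// (Qc2 t y z).2//; ring.
- split => [y|y z]; apply: measurable_funD; apply: measurable_funM => //; exact: measurable_cst.
- move=> f tf; have [i1 i2] := it f tf; have [i3 i4] := it2 f tf.
  have E1 : RI 0 T0 (fun s => \sum_y (l * mu1 s y + (1 - l) * mu2 s y) * (f y)^`()%classic s) =
     l * RI 0 T0 (fun s => \sum_y mu1 s y * (f y)^`()%classic s) +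
     (1 - l) * RI 0 T0 (fun s => \sum_y mu2 s y * (f y)^`()%classic s).
    rewrite -(RIZi l i1) -(RIZi (1 - l) i3) -RIDi; [|exact: itgZ|exact: itgZ].
    apply: eq_RI => t _; rewrite !mulr_sumr -big_split/=; apply: eq_bigr => y _; ring.
  have E2 : RI 0 T0 (fun s => \sum_y div (fun y z => l * Q1 s y z + (1 - l) * Q2 s y z) y * f y s) =
     l * RI 0 T0 (fun s => \sum_y div (Q1 s) y * f y s) +
     (1 - l) * RI 0 T0 (fun s => \sum_y div (Q2 s) y * f y s).
    rewrite -(RIZi l i2) -(RIZi (1 - l) i4) -RIDi; [|exact: itgZ|exact: itgZ].
    apply: eq_RI => t _; rewrite !mulr_sumr -big_split/=; apply: eq_bigr => y _.
    by rewrite /div !big_split/= -!mulr_sumr; ring.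
  by rewrite [LHS]E1 [RHS]E2; congr (_ * _ + _ * _); [exact: w1|exact: w2].
- split => [y|y z].
    have [i1 e1] := f13 y; have [i2 e2] := f23 y.
    rewrite RI_EFin; last by apply: itgD; exact: itgZ.
    rewrite RIDi; [|exact: itgZ|exact: itgZ].
    by rewrite RIZi// RIZi// e1 e2; congr EFin; ring.
  have [i1 e1] := f14 y z; have [i2 e2] := f24 y z.
  rewrite RI_EFin; last by apply: itgD; exact: itgZ.
  rewrite RIDi; [|exact: itgZ|exact: itgZ].
    by rewrite RIZi// RIZi// e1 e2; congr EFin; ring.
Qed.

Lemma cost_conv : (cost (fun t y => (l * mu1 t y + (1 - l) * mu2 t y)%R)
  (fun t y z => (l * Q1 t y z + (1 - l) * Q2 t y z)%R) <=
  l%:E * cost mu1 Q1 + (1 - l)%:E * cost mu2 Q2)%E.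
Proof.
have [f11 f12 _ _] := adm_facts adm1; have [f21 f22 _ _] := adm_facts adm2.
have mI1 : measurable_fun `[0, T0]%classic (fun t => It r t (mu1 t) (Q1 t)).
  exact: measurable_funS (adm_measurable_It adm1).
have mI2 : measurable_fun `[0, T0]%classic (fun t => It r t (mu2 t) (Q2 t)).
  exact: measurable_funS (adm_measurable_It adm2).
have I1 t := adm_It_ge0 t adm1; have I2 t := adm_It_ge0 t adm2.
rewrite /cost -ge0_integralZl_EFin// -ge0_integralZl_EFin// -ge0_integralD//; last 4 first.
- by move=> t _; rewrite mule_ge0// lee_fin.
- by apply: emeasurable_funM => //; exact: measurable_cst.
- by move=> t _; rewrite mule_ge0// lee_fin.
- by apply: emeasurable_funM => //; exact: measurable_cst.
apply: ge0_le_integral => //.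
- by move=> t _; exact: (adm_It_ge0 t admissible_conv).
- exact: measurable_funS (adm_measurable_It admissible_conv).
- by apply: emeasurable_funD; apply: emeasurable_funM => //; exact: measurable_cst.
move=> t _.
have P1 y z : (0 <= (if edge r y z then Phi (Q1 t y z) (mu1 t y * r y z t) else 0))%E.
  case: ifP => // _; apply: Phi_ge0 => //; apply: mulr_ge0; last exact: (r_ge0 gr).
  by case/andP: (f11 t y).
have P2 y z : (0 <= (if edge r y z then Phi (Q2 t y z) (mu2 t y * r y z t) else 0))%E.
  case: ifP => // _; apply: Phi_ge0 => //; apply: mulr_ge0; last exact: (r_ge0 gr).
  by case/andP: (f21 t y).
rewrite /It ge0_sume_distrr; last by move=> y _; apply: sume_ge0.
rewrite ge0_sume_distrr; last by move=> y _; apply: sume_ge0.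
rewrite -big_split/=; apply: lee_sum => y _.
rewrite ge0_sume_distrr// ge0_sume_distrr// -big_split/=; apply: lee_sum => z _.
case: ifP => [_|_]; last by rewrite !mule0 adde0.
have -> : (l * mu1 t y + (1 - l) * mu2 t y) * r y z t =
   l * (mu1 t y * r y z t) + (1 - l) * (mu2 t y * r y z t) by ring.
by apply: Phi_convex => //; apply: mulr_ge0; rewrite ?(r_ge0 gr)//;
  [case/andP: (f11 t y)|case/andP: (f21 t y)].
Qed.

End Convex.

Lemma Ibar_le pt mu Q (c : R) : admissible r T0 pt.1 pt.2 mu Q -> (cost mu Q <= (T0 * c)%:E)%E ->
  (Ibar r T0 pt <= c%:E)%E.
Proof.
move=> adm h; apply: ge_ereal_inf; exists ((T0^-1)%:E * cost mu Q)%E; first by exists mu, Q.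
by rewrite lee_pdivrMl// -EFinM.
Qed.

Lemma Ibar_lt pt (c : R) : (Ibar r T0 pt < c%:E)%E ->
  exists mu Q, admissible r T0 pt.1 pt.2 mu Q /\ (cost mu Q < (T0 * c)%:E)%E.
Proof.
move=> /ereal_inf_lt[_ [mu [Q [adm ->]]]]; rewrite lte_pdivrMl// -EFinM => h.
by exists mu, Q.
Qed.

Lemma Ibar_ge0 pt : (0 <= Ibar r T0 pt)%E.
Proof.
apply: le_ereal_inf_tmp => _ [mu [Q [adm ->]]].
by rewrite mule_ge0 ?lee_fin ?invr_ge0 ?(ltW T00)//; exact: cost_ge0 adm.
Qed.

Lemma Ibar_convex : convex_functional (Ibar r T0).
Proof.
move=> a b l l01; have /andP[l0 l1] := l01.
have conv (pt pt' : state_space R V) : (forall y, pt.1 y = pt'.1 y) ->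
    (forall y z, pt.2 y z = pt'.2 y z) -> pt = pt'.
  case: pt pt' => [p1 p2] [q1 q2] /= h1 h2; congr pair; first exact/funext.
  by apply/funext => y; apply/funext => z; exact: h2.
(* The end points are separated because a zero weight makes the product with an infinite value equal
   to 0; for interior l an infinite value makes the right side infinite. *)
have [->|ln0] := eqVneq l 0.
  rewrite mul0e add0e subr0 mul1e le_eqVlt; apply/orP; left; apply/eqP; congr Ibar.
  by apply: conv => [y|y z] /=; ring.
have [->|ln1] := eqVneq l 1.
  rewrite subrr mul0e adde0 mul1e le_eqVlt; apply/orP; left; apply/eqP; congr Ibar.
  by apply: conv => [y|y z] /=; ring.
have lp : 0 < l by rewrite lt_def ln0.
have lp1 : 0 < 1 - l by rewrite subr_gt0 lt_def eq_sym ln1.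
have := Ibar_ge0 a; case Ea : (Ibar r T0 a) => [ia| |] // _; last first.
  have h : (0 <= (1 - l)%:E * Ibar r T0 b)%E by rewrite mule_ge0 ?lee_fin ?(ltW lp1)// Ibar_ge0.
  by rewrite gt0_muley ?lte_fin// addye ?leey// -ltNye (lt_le_trans _ h)// ltNy0.
have := Ibar_ge0 b; case Eb : (Ibar r T0 b) => [ib| |] // _; last first.
  by rewrite gt0_muley ?lte_fin// addey ?leey.
apply/lee_addgt0Pr => e e0.
have [mu1 [Q1 [adm1 c1]]] : exists mu Q, admissible r T0 a.1 a.2 mu Q /\ (cost mu Q < (T0 * (ia + e))%:E)%E.
  by apply: Ibar_lt; rewrite Ea lte_fin ltrDl.
have [mu2 [Q2 [adm2 c2]]] : exists mu Q, admissible r T0 b.1 b.2 mu Q /\ (cost mu Q < (T0 * (ib + e))%:E)%E.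
  by apply: Ibar_lt; rewrite Eb lte_fin ltrDl.
rewrite -!EFinM -!EFinD.
apply: (Ibar_le (pt := (_, _)) (admissible_conv l01 adm1 adm2)).
apply: (le_trans (cost_conv l01 adm1 adm2)).
apply: (@le_trans _ _ (l%:E * (T0 * (ia + e))%:E + (1 - l)%:E * (T0 * (ib + e))%:E)%E).
  by apply: leeD; apply: lee_wpmul2l; rewrite ?lee_fin ?(ltW lp1)// ltW.
by rewrite -!EFinM -EFinD lee_fin le_eqVlt; apply/orP; left; apply/eqP; ring.
Qed.

Lemma Phi_le_It t (mu : V -> R) (Q : V -> V -> R) y z : (forall y, 0 <= mu y) ->
  (forall y z, 0 <= Q y z) -> edge r y z -> (Phi (Q y z) (mu y * r y z t) <= It r t mu Q)%E.
Proof.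
move=> mu0 Q0 e.
have P0 a b : (0 <= (if edge r a b then Phi (Q a b) (mu a * r a b t) else 0))%E.
  by case: ifP => // _; apply: Phi_ge0 => //; rewrite mulr_ge0 ?(r_ge0 gr).
rewrite /It (bigD1 y)//= (bigD1 z)//= e -addeA leeDl// adde_ge0//; last by apply: sume_ge0 => a _; exact: sume_ge0.
exact: sume_ge0.
Qed.

(** Bound on the integrated flow through one edge at total cost c: Fenchel at slope 1 gives Q <= Phi
    Q p + p (e - 1), with intensity p <= M. *)
Definition Bq (c : R) : R := c + T0 * (M * (expR 1 - 1)).

Lemma coord_bounds pt1 pt2 mu Q (c : R) : admissible r T0 pt1 pt2 mu Q ->
  (cost mu Q <= c%:E)%E -> forall y z,
  [/\ RI 0 T0 (fun t => Q t y z) <= Bq c, itg 0 T0 (fun t => phi1 (Q t y z)) &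
      RI 0 T0 (fun t => phi1 (Q t y z)) <= c + ln (M + 1) * Bq c + T0].
Proof.
move=> adm cc y z; have [f1 f2 f3 f4] := adm_facts adm.
have c0 : 0 <= c by rewrite -lee_fin; apply: le_trans cc; exact: cost_ge0 adm.
have M0 := M_gt0 gr; have T0' := ltW T00.
have lM : 0 <= ln (M + 1) by apply: ln_ge0; lra.
have e1 : 1 <= expR 1 :> R by have := expR_ge1Dx (1 : R); lra.
have e10 : 0 <= expR 1 - 1 :> R by rewrite subr_ge0.
have Bq0 : 0 <= Bq c := addr_ge0 c0 (mulr_ge0 T0' (mulr_ge0 (ltW M0) e10)).
have [iQ _] := f4 y z.
have mQ : measurable_fun setT (fun t => Q t y z) by case: adm => _ _ [].
have [e|ne] := boolP (edge r y z); last first.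
  have Qz t : Q t y z = 0 by case: adm => _ /(_ t y z)[_ ->].
  have -> : (fun t => Q t y z) = (fun=> 0) by apply/funext.
  have -> : (fun t => phi1 (Q t y z)) = (fun=> 1) by apply/funext => t; rewrite Qz /phi1; ring.
  rewrite !RI_cst// mul0r subr0 mul1r; split => //; first exact: lbm_integrable (lbm_cst 1).
  by rewrite lerDr addr_ge0// mulr_ge0.
have mIt : measurable_fun `[0, T0]%classic (fun t => It r t (mu t) (Q t)).
  exact: measurable_funS (adm_measurable_It adm).
have It0 t := adm_It_ge0 t adm.
have PhiIt t : (Phi (Q t y z) (mu t y * r y z t) <= It r t (mu t) (Q t))%E.
  by apply: Phi_le_It => // a; case/andP: (f1 t a).
have mur t : 0 <= mu t y * r y z t <= M.
  case/andP: (f1 t y) => h1 h2; have h3 := r_ge0 gr y z t; have h4 := r_leM gr y z t.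
  by rewrite mulr_ge0//= -[M]mul1r; apply: ler_pM.
(* Applied twice: to Q itself with k1 = 0, and then to [phi1] of Q, where the bound just obtained
   for Q is used. *)
have gen (f : R -> R) (k1 k2 : R) : measurable_fun setT f -> (forall t, 0 <= f t) -> 0 <= k1 -> 0 <= k2 ->
    (forall t, ((f t)%:E <= It r t (mu t) (Q t) + (k1 * Q t y z + k2)%:E)%E) ->
    itg 0 T0 f /\ RI 0 T0 f <= c + k1 * RI 0 T0 (fun t => Q t y z) + k2 * T0.
  move=> mf f0 k10 k20 hf.
  have i2 : itg 0 T0 (fun t => k1 * Q t y z + k2).
    by apply: itgD; [exact: itgZ|exact: lbm_integrable (lbm_cst k2)].
  have H : (\int[leb]_(t in `[0%R, T0]) (f t)%:E <=
      (c + k1 * RI 0 T0 (fun t => Q t y z) + k2 * T0)%:E)%E.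
    apply: (@le_trans _ _ (\int[leb]_(t in `[0%R, T0]) (It r t (mu t) (Q t) + (k1 * Q t y z + k2)%:E))%E).
      apply: ge0_le_integral => //.
      - by move=> t _; rewrite lee_fin.
      - by apply/measurable_EFinP; exact: measurable_funS mf.
      - by apply: emeasurable_funD => //; exact: measurable_int i2.
    rewrite ge0_integralD//; last 2 first.
    - by move=> t _; rewrite lee_fin addr_ge0// mulr_ge0.
    - exact: measurable_int i2.
    rewrite RI_EFin// RIDi//; [|exact: itgZ|exact: lbm_integrable (lbm_cst k2)].
    rewrite RIZi// RI_cst//.
    have -> : c + k1 * RI 0 T0 (fun t => Q t y z) + k2 * T0 =
      c + (k1 * RI 0 T0 (fun t => Q t y z) + k2 * (T0 - 0)) by ring.
    by rewrite [leRHS]EFinD; apply: leeD; first exact: cc.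
  have iff : itg 0 T0 f.
    apply/integrableP; split; first by apply/measurable_EFinP; exact: measurable_funS mf.
    under eq_integral => t _ do rewrite /= ger0_norm//.
    by apply: (le_lt_trans H); rewrite ltry.
  by split => //; move: H; rewrite RI_EFin// lee_fin.
have b1 t : ((Q t y z)%:E <= It r t (mu t) (Q t) + (0 * Q t y z + M * (expR 1 - 1))%:E)%E.
  have /andP[p0 pM] := mur t.
  have := Phi_fenchel 1 (f2 t y z) p0; rewrite mulr1 EFinB leeBlDr// => h.
  apply: (le_trans h); apply: leeD; first exact: PhiIt.
  by rewrite lee_fin mul0r add0r ler_wpM2r.
have b2 t : ((phi1 (Q t y z))%:E <= It r t (mu t) (Q t) + (ln (M + 1) * Q t y z + 1)%:E)%E.
  have M1 : 1 <= M + 1 by lra.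
  have mM : 0 <= mu t y * r y z t <= M + 1 by case/andP: (mur t) => -> /=; lra.
  apply: (le_trans (phi1_Phi (f2 t y z) mM M1)); apply: leeD; first exact: PhiIt.
  by rewrite mulrC.
have [_ h1] := gen _ _ _ mQ (fun t => f2 t y z) (lexx 0) (mulr_ge0 (ltW M0) e10) b1.
have h1' : RI 0 T0 (fun t => Q t y z) <= Bq c by rewrite /Bq; lra.
have [h2 h3] := gen _ _ _ (measurableT_comp (@measurable_phi1 R) mQ)
  (fun t => phi1_ge0 (f2 t y z)) lM ler01 b2.
split => //; apply: (le_trans h3); rewrite mul1r lerD2r lerD2l ler_wpM2l//.
Qed.

Section Closed.
Variables (a : R) (pt : state_space R V).
Hypothesis clpt : closure [set pt' | (Ibar r T0 pt' <= a%:E)%E] pt.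

Let I := (V + V * V)%type.
Let xm (x : R -> I -> R) t y := x t (inl y).
Let xq (x : R -> I -> R) t y z := x t (inr (y, z)).
(** Pairs admissible for a point 1 / (k + 1) close to pt and optimal up to 1 / (k + 1). Occupations
    and flows are merged into one index type so that [convex_L1_cauchy] treats them together.
    Near-optimality is relative to a, which keeps these sets closed under midpoints. *)
Let S k : set (R -> I -> R) := [set x | exists pt' : state_space R V,
  [/\ near_pt k.+1%:R^-1 pt pt', admissible r T0 pt'.1 pt'.2 (xm x) (xq x) &
      (cost (xm x) (xq x) <= (T0 * (a + k.+1%:R^-1))%:E)%E]].

Let inv_gt0 k : 0 < k.+1%:R^-1 :> R. Proof. by rewrite invr_gt0 ltr0n. Qed.

Let S_ne k : S k !=set0.
Proof.
have [pt' [Ia npt]] := clpt (near_pt_nbhs pt (inv_gt0 k)).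
have : (Ibar r T0 pt' < (a + k.+1%:R^-1)%:E)%E.
  by apply: (le_lt_trans Ia); rewrite lte_fin ltrDl.
move=> /Ibar_lt[mu [Q [adm c]]].
exists (fun t i => match i with inl y => mu t y | inr yz => Q t yz.1 yz.2 end), pt'.
by split => //; exact: ltW.
Qed.

Let S_dec k : S k.+1 `<=` S k.
Proof.
have kk : k.+2%:R^-1 <= k.+1%:R^-1 :> R by rewrite lef_pV2 ?posrE ?ltr0n// ler_nat.
move=> x [pt' [[n1 n2] adm c]]; exists pt'; split => //.
  by split => [y|y z]; [apply: lt_le_trans (n1 y) _|apply: lt_le_trans (n2 y z) _].
by apply: (le_trans c); rewrite lee_fin ler_pM2l// lerD2l.
Qed.

Let S_mid k x x' : S k x -> S k x' -> S k (fun t i => (x t i + x' t i) / 2).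
Proof.
move=> [p1 [[n11 n12] adm1 c1]] [p2 [[n21 n22] adm2 c2]].
have -> : (fun t i => (x t i + x' t i) / 2) = (fun t i => 2^-1 * x t i + (1 - 2^-1) * x' t i).
  by apply/funext => t; apply/funext => i; field.
have l01 : 0 <= (2^-1 : R) <= 1 by rewrite invr_ge0 ler0n/= invf_le1// ler1n.
exists ((fun y => 2^-1 * p1.1 y + (1 - 2^-1) * p2.1 y),
  (fun y z => 2^-1 * p1.2 y z + (1 - 2^-1) * p2.2 y z)); split.
- have half (b c d e : R) : `|b - c| < e -> `|b - d| < e -> `|b - (2^-1 * c + (1 - 2^-1) * d)| < e.
    rewrite !ltr_norml => /andP[? ?] /andP[? ?]; apply/andP; split; lra.
  by split => [y|y z] /=; apply: half.
- exact: (admissible_conv l01 adm1 adm2).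
- apply: (le_trans (cost_conv l01 adm1 adm2)).
  apply: (@le_trans _ _ (2^-1%:E * (T0 * (a + k.+1%:R^-1))%:E + (1 - 2^-1)%:E * (T0 * (a + k.+1%:R^-1))%:E)%E).
    by apply: leeD; apply: lee_wpmul2l => //; rewrite lee_fin; lra.
  by rewrite -!EFinM -EFinD lee_fin le_eqVlt; apply/orP; left; apply/eqP; field.
Qed.

Let c0 := T0 * (a + 1).
Let cD := \sum_(i : I) (T0 + Bq c0).
Let cC := \sum_(i : I) (T0 + (c0 + ln (M + 1) * Bq c0 + T0)).

Let S_prop x : S 0%N x -> [/\ (forall t i, 0 <= x t i), (forall i, itg 0 T0 (x^~ i)),
     (forall i, itg 0 T0 (fun t => phi1 (x t i))), \sum_i RI 0 T0 (x^~ i) <= cD &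
     \sum_i RI 0 T0 (fun t => phi1 (x t i)) <= cC].
Proof.
move=> [p1 [_ adm]]; rewrite invr1 -/c0 => cst.
have [f1 f2 f3 f4] := adm_facts adm; have cb := coord_bounds adm cst.
have c00 : 0 <= c0 by rewrite -lee_fin; apply: le_trans cst; exact: cost_ge0 adm.
have M0 := M_gt0 gr; have T0' := ltW T00.
have lM : 0 <= ln (M + 1) by apply: ln_ge0; lra.
have e1 : 1 <= expR 1 :> R by have := expR_ge1Dx (1 : R); lra.
have e10 : 0 <= expR 1 - 1 :> R by rewrite subr_ge0.
have Bq0 : 0 <= Bq c0 := addr_ge0 c00 (mulr_ge0 T0' (mulr_ge0 (ltW M0) e10)).
have X0 : 0 <= c0 + ln (M + 1) * Bq c0 + T0 by rewrite !addr_ge0// mulr_ge0.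
have mm y : measurable_fun setT (fun t => x t (inl y)) by case: adm => _ _ [h _] _ _; exact: h.
have ip y : itg 0 T0 (fun t => phi1 (x t (inl y))).
  apply: lbm_integrable; split; first exact: (measurableT_comp (@measurable_phi1 R) (mm y)).
  move=> b c; exists 1; split => // t _; rewrite ger0_norm; first exact/phi1_le1/f1.
  by apply: phi1_ge0; case/andP: (f1 t y).
split.
- by move=> t [y|[y z]]; [case/andP: (f1 t y)|exact: f2].
- by move=> [y|[y z]]; [exact: (f3 y).1|exact: (f4 y z).1].
- by move=> [y|[y z]]; [exact: ip|case: (cb y z)].
- apply: ler_sum => -[y|[y z]] _.
    apply: (@le_trans _ _ (RI 0 T0 (fun=> 1))); last by rewrite RI_cst// mul1r subr0 lerDl.
    apply: RI_lei; [exact: (f3 y).1|exact: lbm_integrable (lbm_cst 1)|].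
    by move=> t _; case/andP: (f1 t y).
  by have [h _ _] := cb y z; apply: (le_trans h); rewrite lerDr.
- apply: ler_sum => -[y|[y z]] _.
    apply: (@le_trans _ _ (RI 0 T0 (fun=> 1))); last by rewrite RI_cst// mul1r subr0 lerDl.
    apply: RI_lei; [exact: ip|exact: lbm_integrable (lbm_cst 1)|].
    by move=> t _; apply: phi1_le1; exact: f1.
  by have [_ _ h] := cb y z; apply: (le_trans h); rewrite lerDr.
Qed.

(** The selected pairs converge almost everywhere under an integrable majorant, so all linear
    constraints pass to the limit, while the cost passes by lower semicontinuity of [Phi] and
    Fatou. *)
Lemma Ibar_closure : (Ibar r T0 pt <= a%:E)%E.
Proof.
have [x Hx] := convex_L1_cauchy S_ne S_dec S_mid S_prop.
have Sx j : S j (x j) by case: (Hx j).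
have Sx0 j : S 0%N (x j).
  have : S j (x j) := Sx j; elim: j (x j) => [//|j IH] y /S_dec; exact: IH.
have /choice[q Hq] := Sx.
have adm j : admissible r T0 (q j).1 (q j).2 (xm (x j)) (xq (x j)) by case: (Hq j).
have mx j i : measurable_fun setT (fun t => x j t i).
  by case: (adm j) => _ _ [h1 h2] _ _; case: i => [y|[y z]]; [exact: h1|exact: h2].
have ix j i : itg 0 T0 (fun t => x j t i) by have [] := S_prop (Sx0 j).
have xge0 j t i : 0 <= x j t i by have [] := S_prop (Sx0 j).
have dx j := (Hx j).2.
have perx j t i : x j (t + T0) i = x j t i.
  case: (adm j) => -[/(_ t)[h1 h2] _] _ _ _ _.
  by case: i => [y|[y z]]; [exact: (congr1 (fun f => f y) h1)|exact: (congr1 (fun f => f y z) h2)].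
(* The exceptional set is periodic too, so changing the paths on it does not destroy periodicity. *)
have pertv t : tvar x (t + T0) = tvar x t.
  rewrite /tvar; congr (limn _); apply/funext => k; apply: eq_bigr => j _; congr EFin.
  by apply: eq_bigr => i _; rewrite !perx.
(* On the exceptional null set the path is replaced by the Dirac mass at x0 with zero flow, since
   admissibility asks for a probability at every single time. *)
pose dflt (i : I) : R := if i is inl y then (y == x0)%:R else 0.
pose zt j t i := if (tvar x t < +oo)%E then x j t i else dflt i.
pose xl t i := limn (fun j => zt j t i).
have cz t i : zt j t i @[j --> \oo] --> xl t i.
  have : cvgn (fun j => zt j t i); last by [].
  rewrite /zt; case h : (tvar x t < +oo)%E; first exact: tvar_cvg.
  exact: is_cvg_cst.
have mgood : measurable_fun setT (fun t => (tvar x t < +oo)%E).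
  by apply: measurable_fun_lte; [exact: measurable_tvar|exact: measurable_cst].
have mz j i : measurable_fun setT (fun t => zt j t i).
  by apply: measurable_fun_ifT => //; exact: measurable_cst.
have mxl i : measurable_fun setT (fun t => xl t i).
  by apply: (@measurable_fun_cvg _ _ _ _ (fun j t => zt j t i)) => // t _; exact: cz.
have dflt0 i : 0 <= dflt i by case: i => [y|].
have zge0 j t i : 0 <= zt j t i by rewrite /zt; case: ifP.
have xlge0 t i : 0 <= xl t i.
  by apply: limr_ge; [apply/cvg_ex; exists (xl t i); exact: cz|exact: nearW].
have zsum j t : \sum_y zt j t (inl y) = 1.
  rewrite /zt; case: (tvar x t < +oo)%E.
    by case: (adm j) => -[_ /(_ t)[_ h]] _ _ _ _; exact: h.
  by rewrite (bigD1 x0)//= eqxx big1 ?addr0// => y /negbTE ->.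
have zedge j t y z : ~~ edge r y z -> zt j t (inr (y, z)) = 0.
  by move=> e; rewrite /zt; case: ifP => // _; case: (adm j) => _ /(_ t y z)[_ h] _ _ _; exact: h.
pose gd i t := `|x 0%N t i| + fine (tvar x t).
have igd i : itg 0 T0 (gd i).
  by apply: itgD; [apply: itg_norm; exact: ix|exact: itg_tvar].
have tae := tvar_ae mx ix dx.
have good t : (tvar x t < +oo)%E -> forall i, (forall j, `|x j t i| <= gd i t) /\
    x j t i @[j --> \oo] --> xl t i.
  move=> h i; split; first by move=> j; exact: tvar_bound.
  by have := cz t i; rewrite /zt h.
have cRI i : RI 0 T0 (fun t => x j t i) @[j --> \oo] --> RI 0 T0 (fun t => xl t i) /\
    itg 0 T0 (fun t => xl t i).
  apply: (RI_dominated_ae2 _ _ (igd i)) => //.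
  apply: filterS tae; first exact: (ae_filter_ringOfSetsType leb).
  by move=> t h tab; exact: good (h tab) i.
have inv0 : (k.+1%:R^-1 : R) @[k --> \oo] --> 0 := @cvg_harmonic R.
have q1 y : (q j).1 y @[j --> \oo] --> pt.1 y.
  apply/cvgrPdist_lt => e e0; move/cvgrPdist_lt: inv0 => /(_ e e0).
  apply: filterS => k; rewrite sub0r normrN ger0_norm ?invr_ge0// => ke.
  by apply: lt_trans ke; case: (Hq k) => -[h _] _ _; exact: h.
have q2 y z : (q j).2 y z @[j --> \oo] --> pt.2 y z.
  apply/cvgrPdist_lt => e e0; move/cvgrPdist_lt: inv0 => /(_ e e0).
  apply: filterS => k; rewrite sub0r normrN ger0_norm ?invr_ge0// => ke.
  by apply: lt_trans ke; case: (Hq k) => -[_ h] _ _; exact: h.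
have admL : admissible r T0 pt.1 pt.2 (xm xl) (xq xl).
  split.
  - split.
      move=> t; have E i : xl (t + T0) i = xl t i.
        by rewrite /xl /zt pertv; congr (limn _); apply/funext => j; rewrite perx.
      by split; [apply/funext => y|apply/funext => y; apply/funext => z]; exact: E.
    move=> t; split; first by move=> y; exact: xlge0.
    have h : \sum_y zt j t (inl y) @[j --> \oo] --> \sum_y xl t (inl y).
      by apply: cvg_sumr => y; exact: cz.
    have h' : \sum_y zt j t (inl y) @[j --> \oo] --> (1 : R).
      by rewrite (_ : (fun j => _) = fun=> 1); [exact: cvg_cst|apply/funext => j; exact: zsum].
    exact: (cvg_unique (@Rhausdorff R) h h').
  - move=> t y z; split; first exact: xlge0.
    move=> e; have := cz t (inr (y, z)).
    rewrite (_ : (fun j => _) = fun=> 0); last by apply/funext => j; exact: zedge.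
    by move=> h; rewrite /xq; exact: (cvg_unique (@Rhausdorff R) h (cvg_cst _)).
  - by split => [y|y z]; exact: mxl.
  - move=> f tf.
    have lf y : lbm (f y) by apply: lbm_cont; apply: derivable_cont; case: (tf y).
    have lf' y : lbm (f y)^`()%classic by apply: lbm_cont; case: (tf y).
    have E j : RI 0 T0 (fun s => \sum_y x j s (inl y) * (f y)^`()%classic s) =
        RI 0 T0 (fun s => \sum_y div (xq (x j) s) y * f y s).
      by case: (adm j) => _ _ _ h _; exact: h.
    have cL : RI 0 T0 (fun s => \sum_y x j s (inl y) * (f y)^`()%classic s) @[j --> \oo] -->
        RI 0 T0 (fun s => \sum_y xl s (inl y) * (f y)^`()%classic s).
      apply: (proj1 (RI_dominated_ae2 (g := fun t => \sum_y `|(f y)^`()%classic t| * gd (inl y) t) _ _ _ _)).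
      - by move=> j; apply: measurable_sum => y; apply: measurable_funM => //; exact: (lf' y).1.
      - by apply: measurable_sum => y; apply: measurable_funM => //; exact: (lf' y).1.
      - by apply: itg_sum => y; apply: itgM => //; exact: lbm_norm.
      apply: filterS tae; first exact: (ae_filter_ringOfSetsType leb).
      move=> t h tab; have gt := good t (h tab); split.
        move=> j; apply: (le_trans (ler_norm_sum _ _ _)); apply: ler_sum => y _.
        by rewrite normrM mulrC ler_wpM2l//; exact: (gt _).1.
      apply: cvg_sumr => y; apply: cvgM; last exact: cvg_cst.
      exact: (gt _).2.
    have cR : RI 0 T0 (fun s => \sum_y x j s (inl y) * (f y)^`()%classic s) @[j --> \oo] -->
        RI 0 T0 (fun s => \sum_y div (xq xl s) y * f y s).
      rewrite (_ : (fun j => _) = (fun j => RI 0 T0 (fun s => \sum_y div (xq (x j) s) y * f y s)));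
        last by apply/funext => j; exact: E.
      apply: (proj1 (RI_dominated_ae2 (g := fun t => \sum_y `|f y t| *
         (\sum_z gd (inr (y, z)) t + \sum_z gd (inr (z, y)) t)) _ _ _ _)).
      - move=> j; apply: measurable_sum => y; apply: measurable_funM; last exact: (lf y).1.
        by apply: measurable_funB; apply: measurable_sum => z; exact: mx.
      - apply: measurable_sum => y; apply: measurable_funM; last exact: (lf y).1.
        by apply: measurable_funB; apply: measurable_sum => z; exact: mxl.
      - apply: itg_sum => y; apply: itgM; first exact: lbm_norm.
        by apply: itgD; apply: itg_sum => z; exact: igd.
      apply: filterS tae; first exact: (ae_filter_ringOfSetsType leb).
      move=> t h tab; have gt := good t (h tab); split.
        move=> j; apply: (le_trans (ler_norm_sum _ _ _)); apply: ler_sum => y _.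
        rewrite normrM mulrC ler_wpM2l//; apply: (le_trans (ler_normB _ _)).
        by apply: lerD; apply: (le_trans (ler_norm_sum _ _ _)); apply: ler_sum => z _; exact: (gt _).1.
      apply: cvg_sumr => y; apply: cvgM; last exact: cvg_cst.
      by apply: cvgB; apply: cvg_sumr => z; exact: (gt _).2.
    exact: (cvg_unique (@Rhausdorff R) cL cR).
  - have bar i (qq : nat -> R) c : (forall j, RI 0 T0 (fun t => x j t i) = T0 * qq j) ->
        qq j @[j --> \oo] --> c -> (\int[leb]_(t in `[0%R, T0]) (xl t i)%:E = (T0 * c)%:E)%E.
      move=> Eq cq; have [h1 h2] := cRI i; rewrite RI_EFin//; congr EFin.
      have h3 : RI 0 T0 (fun t => x j t i) @[j --> \oo] --> T0 * c.
        rewrite (_ : (fun j => _) = (fun j => T0 * qq j)); last by apply/funext.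
        by apply: cvgM => //; exact: cvg_cst.
      exact: (cvg_unique (@Rhausdorff R) h1 h3).
    split => [y|y z].
      apply: (bar (inl y) (fun j => (q j).1 y)) => // j.
      by have [_ _ h _] := adm_facts (adm j); exact: (h y).2.
    apply: (bar (inr (y, z)) (fun j => (q j).2 y z)) => // j.
    by have [_ _ _ h] := adm_facts (adm j); exact: (h y z).2.
apply: (Ibar_le admL).
have mIz j : measurable_fun setT (fun t => It r t (xm (zt j) t) (xq (zt j) t)).
  by apply: (measurable_It gr) => *; [exact: zge0|exact: zge0|exact: mz|exact: mz].
have Iz0 j t : (0 <= It r t (xm (zt j) t) (xq (zt j) t))%E.
  by apply: (It_ge0 gr) => *; exact: zge0.
have lsc t : (It r t (xm xl t) (xq xl t) <= limn_einf (fun j => It r t (xm (zt j) t) (xq (zt j) t)))%E.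
  have Pz j y z : (0 <= (if edge r y z then Phi (zt j t (inr (y, z))) (zt j t (inl y) * r y z t) else 0))%E.
    by case: ifP => // _; apply: Phi_ge0 => //; rewrite mulr_ge0 ?(r_ge0 gr).
  apply: le_trans (limn_einf_sum _ _); last by move=> y j; apply: sume_ge0 => z _; exact: Pz.
  apply: lee_sum => y _.
  apply: le_trans (limn_einf_sum _ _); last by move=> z j; exact: Pz.
  apply: lee_sum => z _; case: (edge r y z); last by apply: limn_einf_ge; exact: nearW.
  apply: Phi_lsc => [k|k||]; [exact: zge0|by rewrite mulr_ge0 ?(r_ge0 gr) ?zge0|exact: cz|].
  by apply: cvgM; [exact: cz|exact: cvg_cst].
have Ez j : (\int[leb]_(t in `[0%R, T0]) It r t (xm (zt j) t) (xq (zt j) t) = cost (xm (x j)) (xq (x j)))%E.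
  apply: ge0_ae_eq_integral => //.
  - exact: measurable_funS (mIz j).
  - exact: measurable_funS (adm_measurable_It (adm j)).
  - by move=> t _; exact: (adm_It_ge0 t (adm j)).
  apply: filterS tae; first exact: (ae_filter_ringOfSetsType leb).
  by move=> t h tab; rewrite /xm /xq /zt (h tab).
apply: (@le_trans _ _ (\int[leb]_(t in `[0%R, T0]) limn_einf (fun j => It r t (xm (zt j) t) (xq (zt j) t)))%E).
  apply: ge0_le_integral => //.
  - by move=> t _; exact: (adm_It_ge0 t admL).
  - exact: measurable_funS (adm_measurable_It admL).
  - have : measurable_fun `[0, T0]%classic
        (fun t => limn_esup (fun j => - It r t (xm (zt j) t) (xq (zt j) t)))%E.
      apply: measurable_fun_limn_esup => j; apply: measurableT_comp => //.
      exact: measurable_funS (mIz j).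
    by move=> h; apply: (measurableT_comp _ h).
apply: (le_trans (fatou _ _ _ _)) => //.
- by move=> j; exact: measurable_funS (mIz j).
apply: (@le_trans _ _ (limn_einf (fun j => (T0 * (a + j.+1%:R^-1))%:E))).
  by apply: le_limn_einf => j; rewrite Ez; case: (Hq j).
have c : (T0 * (a + j.+1%:R^-1))%:E @[j --> \oo] --> (T0 * (a + 0))%:E.
  apply: cvg_EFin; first exact: nearW.
  by apply: cvgM; [exact: cvg_cst|apply: cvgD; [exact: cvg_cst|exact: inv0]].
by have [-> _] := cvg_limn_einf_sup c; rewrite addr0.
Qed.

End Closed.

End RateFunction.

(** * A Gartner-Ellis theorem *)
Section GartnerEllis.
Variables (R : realType) (I : finType).
Implicit Types (th eta x : I -> R).

Definition dot th x : R := \sum_i th i * x i.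
Definition eps_dir (c : R) (i : I) : I -> R := fun j => c * (j == i)%:R.

Lemma dot_eps th c i x : dot (fun j => th j + eps_dir c i j) x = dot th x + c * x i.
Proof.
rewrite /dot; under eq_bigr => j _ do rewrite mulrDl.
rewrite big_split/=; congr (_ + _); rewrite (bigD1 i)//= /eps_dir eqxx mulr1 big1 ?addr0// => j.
by move=> /negbTE ->; rewrite mulr0 mul0r.
Qed.

Variables (Lam : (I -> R) -> R) (X : (I -> R) -> I -> R).
(** Convexity and smoothness of Lam enter only here: X is a global subgradient, and each of its
    components is continuous along its own coordinate line. *)
Hypothesis subgrad : forall th th', Lam th + dot (fun i => th' i - th i) (X th) <= Lam th'.
Hypothesis Xcont : forall th (c : R) i,
  X (fun j => th j + eps_dir (c / k.+1%:R) i j) i @[k --> \oo] --> X th i.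

Lemma real_cauchy (u : nat -> R) :
  (forall e : R, 0 < e -> exists N, forall k, (N <= k)%N -> `|u N - u k| < e) -> cvgn u.
Proof.
move=> h; apply: cauchy_cvg; apply: cauchy_exP => e e0; have [N HN] := h e e0.
by exists (u N); exists N => // k /= /HN.
Qed.

Lemma cvg_le_lim (u : nat -> R) (l b : R) : u k @[k --> \oo] --> l ->
  (forall k, u k <= b) -> l <= b.
Proof.
move=> c h; rewrite -(cvg_lim (@Rhausdorff R) c); apply: limr_le; last exact: nearW.
by apply/cvg_ex; exists l.
Qed.

Section Moreau.
Variables (x : I -> R) (a eps : R).
Hypotheses (eps0 : 0 < eps) (xa : forall th, dot th x - Lam th <= a).
Let nn th : R := \sum_i th i ^+ 2.
Let J th : R := Lam th - dot th x + eps / 2 * nn th.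
Let nn0 th : 0 <= nn th. Proof. by apply: sumr_ge0 => i _; rewrite sqr_ge0. Qed.
Let Jge th : - a <= J th.
Proof.
have := xa th; have : 0 <= eps / 2 * nn th by rewrite mulr_ge0// divr_ge0// ltW.
by rewrite /J; lra.
Qed.

Let Lam_mid th th' : Lam (fun i => (th i + th' i) / 2) <= (Lam th + Lam th') / 2.
Proof.
set md := (fun i => _); have h1 := subgrad md th; have h2 := subgrad md th'.
have : dot (fun i => th i - md i) (X md) + dot (fun i => th' i - md i) (X md) = 0.
  by rewrite /dot -big_split big1//= => i _; rewrite /md; field.
lra.
Qed.

Let J_mid th th' : J (fun i => (th i + th' i) / 2) <=
  (J th + J th') / 2 - eps / 8 * nn (fun i => th i - th' i).
Proof.
have h := Lam_mid th th'; rewrite /J.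
have -> : dot (fun i => (th i + th' i) / 2) x = (dot th x + dot th' x) / 2.
  by rewrite /dot -big_split/= mulr_suml; apply: eq_bigr => i _; field.
have -> : nn (fun i => (th i + th' i) / 2) =
   (nn th + nn th') / 2 - nn (fun i => th i - th' i) / 2 / 2.
  by rewrite /nn -big_split/= !mulr_suml -sumrB; apply: eq_bigr => i _; field.
lra.
Qed.

(** Midpoint strong convexity makes a minimizing sequence Cauchy. Lower semicontinuity of J at the
    limit needs no continuity of Lam, since the subgradient inequality at the limit bounds Lam from
    below by an affine function. *)
Lemma moreau_min : exists th, forall th', J th <= J th'.
Proof.
pose E := range J.
have lE : has_lbound E by exists (- a) => _ [th _ <-]; exact: Jge.
have nE : E !=set0 by exists (J (fun=> 0)), (fun=> 0).
pose j0 := inf E.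
have j0le th : j0 <= J th by apply: ge_inf => //; exists th.
have /choice[th Hth] : forall k : nat, exists th, J th <= j0 + k.+1%:R^-1.
  move=> k; have k0 : 0 < k.+1%:R^-1 :> R by rewrite invr_gt0 ltr0n.
  by have [_ [th _ <-] /ltW h] := inf_adherent k0 (conj nE lE); exists th.
have cau k l : (k <= l)%N -> nn (fun i => th k i - th l i) <= 8 / eps * k.+1%:R^-1.
  move=> kl; have h1 := Hth k; have h2 := Hth l; have h3 := J_mid (th k) (th l).
  have h4 := j0le (fun i => (th k i + th l i) / 2).
  have kl1 : l.+1%:R^-1 <= k.+1%:R^-1 :> R by rewrite lef_pV2 ?posrE ?ltr0n// ler_nat ltnS.
  have : eps / 8 * nn (fun i => th k i - th l i) <= k.+1%:R^-1.
    by move: h1 h2 kl1; move: (k.+1%:R^-1) (l.+1%:R^-1) => p q *; lra.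
  rewrite -ler_pdivlMl ?divr_gt0// => h5; apply: (le_trans h5).
  by rewrite invf_div.
have ccoord i : cvgn (fun k => th k i).
  apply: real_cauchy => e e0.
  have e2 : 0 < e ^+ 2 by rewrite exprn_gt0.
  pose N := Num.truncn (8 / eps / e ^+ 2).
  have HN : 8 / eps * N.+1%:R^-1 < e ^+ 2.
    by rewrite ltr_pdivrMr ?ltr0n// [ltRHS]mulrC -ltr_pdivrMr//; exact: truncnS_gt.
  exists N => k Nk; rewrite -(@ltr_pXn2r R 2) ?nnegrE ?(ltW e0)//.
  rewrite real_normK ?num_real//; apply: le_lt_trans HN; apply: le_trans (cau N k Nk).
  by rewrite /nn (bigD1 i)//= lerDl sumr_ge0// => j _; rewrite sqr_ge0.
pose tl i := limn (fun k => th k i).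
have ctl i : th k i @[k --> \oo] --> tl i by exact: ccoord.
exists tl => th'; apply: le_trans (j0le th').
(* J (th k) with Lam replaced by its affine minorant at the limit tl: a continuous expression whose
   limit is J tl. *)
pose G k := Lam tl + dot (fun i => th k i - tl i) (X tl) - dot (th k) x + eps / 2 * nn (th k).
apply: (@cvg_le_lim (fun k => G k - k.+1%:R^-1)).
  rewrite -[J tl]subr0; apply: cvgB; last exact: cvg_harmonic.
  have -> : J tl = Lam tl + dot (fun i => tl i - tl i) (X tl) - dot tl x + eps / 2 * nn tl.
    have -> : dot (fun i => tl i - tl i) (X tl) = 0.
      by rewrite /dot big1// => i _; rewrite subrr mul0r.
    by rewrite /J addr0.
  apply: cvgD; last first.
    apply: cvgM; first exact: cvg_cst.
    by apply: cvg_sumr => i; under eq_cvg do rewrite expr2; rewrite expr2; apply: cvgM.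
  apply: cvgB; last by apply: cvg_sumr => i; apply: cvgM => //; exact: cvg_cst.
  apply: cvgD; first exact: cvg_cst.
  apply: cvg_sumr => i; apply: cvgM; last exact: cvg_cst.
  by apply: cvgB => //; exact: cvg_cst.
move=> k; have := Hth k; have := subgrad tl (th k); rewrite /J /G.
move: (k.+1%:R^-1) => q; lra.
Qed.

(** First-order condition at the minimizer. Minimality against a small step along coordinate i and
    the subgradient inequality at the displaced point give one inequality in the limit; the sign c =
    -1 gives the other. *)
Lemma moreau_grad th : (forall th', J th <= J th') -> forall i, X th i = x i - eps * th i.
Proof.
move=> hm i.
have one (c : R) : c ^+ 2 = 1 -> c * (x i - eps * th i) <= c * X th i.
  move=> c2.
  have cX : c * (x i - eps * th i) - eps / 2 * k.+1%:R^-1 -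
     c * X (fun j => th j + eps_dir (c / k.+1%:R) i j) i @[k --> \oo] -->
     c * (x i - eps * th i) - eps / 2 * 0 - c * X th i.
    apply: cvgB; last by apply: cvgM; [exact: cvg_cst|exact: Xcont].
    apply: cvgB; first exact: cvg_cst.
    by apply: cvgM; [exact: cvg_cst|exact: cvg_harmonic].
  have := cvg_le_lim cX; rewrite mulr0 subr0 => /(_ 0) h.
  rewrite -subr_le0; apply: h => k.
  set th' := (fun j => _); pose s : R := k.+1%:R^-1.
  have s0 : 0 < s by rewrite invr_gt0 ltr0n.
  have h1 := hm th'; have h2 := subgrad th' th.
  have d1 : dot (fun j => th j - th' j) (X th') = - (c * s * X th' i).
    rewrite /dot (bigD1 i)//= /th' /eps_dir eqxx mulr1 big1 ?addr0.
      by rewrite /s; ring.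
    by move=> j /negbTE ->; rewrite mulr0 addr0 subrr mul0r.
  have d2 : dot th' x = dot th x + c * s * x i by rewrite /th' dot_eps.
  have d3 : nn th' = nn th + 2 * (c * s) * th i + s ^+ 2.
    rewrite /nn (bigD1 i)//= [in RHS](bigD1 i)//= /th' /eps_dir eqxx mulr1.
    rewrite (eq_bigr (fun j => th j ^+ 2)); last by move=> j /negbTE ->; rewrite mulr0 addr0.
    have -> : s ^+ 2 = (c * s) ^+ 2 by rewrite exprMn c2 mul1r.
    by rewrite -/s; ring.
  move: h1; rewrite /J d2 d3 => h1; move: h2; rewrite d1 => h2.
  have h3 : s * (c * (x i - eps * th i) - eps / 2 * s - c * X th' i) <= 0.
    have -> : s * (c * (x i - eps * th i) - eps / 2 * s - c * X th' i) =
      c * s * x i - eps / 2 * (2 * (c * s) * th i + s ^+ 2) - c * s * X th' i by field.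
    rewrite mulrDr mulrDr in h1 *; lra.
  by move: h3; rewrite pmulr_rle0.
have := one 1; have := one (-1); rewrite sqrrN expr1n !mulN1r !mul1r => /(_ erefl) a1 /(_ erefl) a2.
by apply/eqP; rewrite eq_le; apply/andP; split; lra.
Qed.

(** The first bound compares with the direction 0. In the second, moving from x to X th lowers the
    value of the transform at th by eps times the squared norm. *)
Lemma moreau_bound th : (forall th', J th <= J th') ->
  eps / 2 * nn th <= Lam (fun=> 0) + a /\ dot th (X th) - Lam th <= a.
Proof.
move=> hm; split.
  have := hm (fun=> 0); have := xa th; rewrite /J.
  have -> : dot (fun=> 0) x = 0 by rewrite /dot big1// => i _; rewrite mul0r.
  have -> : nn (fun=> 0) = 0 by rewrite /nn big1// => i _; rewrite expr0n.
  by rewrite mulr0; lra.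
have -> : dot th (X th) = dot th x - eps * nn th.
  rewrite /dot /nn mulr_sumr -sumrB; apply: eq_bigr => i _.
  by rewrite (moreau_grad hm); ring.
have : 0 <= eps * nn th by rewrite mulr_ge0// ltW.
by have := xa th; lra.
Qed.

End Moreau.

Lemma moreau x (a del : R) : 0 < del -> (forall th, dot th x - Lam th <= a) ->
  exists th, (forall i, `|x i - X th i| < del) /\ dot th (X th) - Lam th <= a.
Proof.
move=> d0 xa; pose L := Lam (fun=> 0) + a.
have L0 : 0 <= L.
  have := xa (fun=> 0); have -> : dot (fun=> 0) x = 0 by rewrite /dot big1// => i _; rewrite mul0r.
  by rewrite /L; lra.
(* The displacement satisfies (eps th i)^2 <= 2 eps L, and this choice makes the right side smaller
   than del^2. *)
pose eps := del ^+ 2 / (2 * L + 1) / 2.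
have L1 : 0 < 2 * L + 1 by lra.
have e0 : 0 < eps by rewrite !divr_gt0// exprn_gt0.
have [th hm] := moreau_min e0 xa; have [h1 h2] := moreau_bound e0 xa hm.
exists th; split => // i; rewrite (moreau_grad hm) opprB addrC subrK.
rewrite -(@ltr_pXn2r R 2) ?nnegrE ?(ltW d0)// real_normK ?num_real//.
have : (eps * th i) ^+ 2 <= 2 * eps * L.
  have h3 : th i ^+ 2 <= \sum_i th i ^+ 2.
    by rewrite (bigD1 i)//= lerDl sumr_ge0// => j _; rewrite sqr_ge0.
  have -> : (eps * th i) ^+ 2 = 2 * eps * (eps / 2 * th i ^+ 2) by field.
  have h4 : eps / 2 * th i ^+ 2 <= eps / 2 * \sum_i th i ^+ 2 by rewrite ler_pM2l// divr_gt0.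
  apply: ler_wpM2l; first exact: ltW (mulr_gt0 (ltr0n _ 2) e0).
  exact: (le_trans h4 h1).
move=> /le_lt_trans; apply.
have -> : 2 * eps * L = del ^+ 2 * (L / (2 * L + 1)) by rewrite /eps; field; rewrite gt_eqF.
rewrite -[ltRHS]mulr1 ltr_pM2l ?exprn_gt0// ltr_pdivrMr// mul1r; lra.
Qed.

(** * From exponential moments to probabilities *)

Section Chebyshev.
Variables (d : measure_display) (Omega : measurableType d) (P : probability Omega R).
Variables (Y : nat -> Omega -> I -> R) (s : nat -> R).
Hypotheses (mY : forall n i, measurable_fun setT (fun w => Y n w i))
  (s0 : forall n, 0 < s n)
  (sy : forall A : R, \forall n \near \oo, A <= s n)
  (mgf_le : forall th, exists2 C : R, 0 < C & forall n,
     (\int[P]_w (expR (s n * dot th (Y n w)))%:E <= (C * expR (s n * Lam th))%:E)%E)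
  (mgf_ge : forall th, exists2 C : R, 0 < C & forall n,
     ((C * expR (s n * Lam th))%:E <= \int[P]_w (expR (s n * dot th (Y n w)))%:E)%E).

Let mdot th n : measurable_fun setT (fun w => dot th (Y n w)).
Proof. by apply: measurable_sum => i; apply: measurable_funM => //; exact: measurable_cst. Qed.

Let mexp th n b : measurable_fun setT (fun w => expR (s n * (dot th (Y n w) - b))).
Proof.
apply: measurableT_comp => //; apply: measurable_funM; first exact: measurable_cst.
by apply: measurable_funB => //; exact: measurable_cst.
Qed.

Let int_exp th : exists2 C : R, 0 < C & forall n b,
  (\int[P]_w (expR (s n * (dot th (Y n w) - b)))%:E <= (C * expR (s n * (Lam th - b)))%:E)%E.
Proof.
have [C C0 HC] := mgf_le th; exists C => // n b.
under eq_integral => w _ do rewrite mulrBr expRD mulrC EFinM.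
rewrite ge0_integralZl_EFin ?expR_ge0//; last first.
  apply/measurable_EFinP; apply: measurableT_comp => //.
  by apply: measurable_funM => //; exact: measurable_cst.
apply: (@le_trans _ _ ((expR (- (s n * b)))%:E * (C * expR (s n * Lam th))%:E)%E).
  by apply: lee_wpmul2l => //; rewrite lee_fin expR_ge0.
by rewrite -EFinM lee_fin mulrBr expRD le_eqVlt; apply/orP; left; apply/eqP; ring.
Qed.

(** Exponential Chebyshev inequality with a union bound: on A one of the summed exponentials is at
    least 1. The constant must not depend on n, so the finite list is fixed beforehand. *)
Lemma halfspaces_upper (a : R) (ths : seq (I -> R)) : exists2 K : R, 0 < K & forall n (A : set Omega),
  measurable A ->
  (forall w, A w -> exists2 th, List.In th ths & a <= dot th (Y n w) - Lam th) ->
  (P A <= (K * expR (- (s n * a)))%:E)%E.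
Proof.
have key : exists2 K : R, 0 <= K & forall n,
   (\int[P]_w (\sum_(th <- ths) expR (s n * (dot th (Y n w) - (a + Lam th))))%:E <=
    (K * expR (- (s n * a)))%:E)%E.
  elim: ths => [|th ths [K K0 HK]].
    exists 0 => // n; under eq_integral => w _ do rewrite big_nil.
    by rewrite integral0 mul0r.
  have [C C0 HC] := int_exp th; exists (C + K); first by rewrite addr_ge0// ltW.
  move=> n; under eq_integral => w _ do rewrite big_cons EFinD.
  rewrite ge0_integralD; [|exact: measurableT|by move=> w _; rewrite lee_fin expR_ge0|
    by apply/measurable_EFinP; exact: mexp|
    by move=> w _; rewrite lee_fin sumr_ge0// => *; exact: expR_ge0|
    by apply/measurable_EFinP; apply: measurable_sum => *; exact: mexp].
  rewrite mulrDl EFinD; apply: leeD => //; apply: (le_trans (HC n _)).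
  by rewrite (_ : Lam th - (a + Lam th) = - a) ?mulrN//; ring.
have [K K0 HK] := key; exists (K + 1); first by rewrite ltr_wpDl.
move=> n A mA HA; apply: (@le_trans _ _ (K * expR (- (s n * a)))%:E); last first.
  by rewrite lee_fin ler_wpM2r ?expR_ge0// lerDl.
apply: le_trans (HK n).
have <- : (\int[P]_w (\1_A w)%:E = P A)%E by rewrite integral_indic// setIT.
apply: ge0_le_integral => //.
- by apply/measurable_EFinP; exact: measurable_indic.
- by apply/measurable_EFinP; apply: measurable_sum => *; exact: mexp.
move=> w _; rewrite lee_fin indicE; have [Aw|_] := boolP (w \in A); last first.
  by rewrite sumr_ge0// => *; exact: expR_ge0.
have [th thin h] := HA w (set_mem Aw).
elim: ths thin {HK HA key} => [//|t ts IH] /= [->|/IH h2]; rewrite big_cons; last first.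
  by apply: (le_trans h2); rewrite lerDr expR_ge0.
rewrite -[leLHS]addr0; apply: lerD; last by rewrite sumr_ge0// => *; exact: expR_ge0.
by rewrite -expR0 ler_expR mulr_ge0 ?(ltW (s0 n))//; lra.
Qed.

Lemma measurable_cube n x (del : R) : measurable [set w | forall i, `|x i - Y n w i| < del].
Proof.
have -> : [set w | forall i, `|x i - Y n w i| < del] =
    \bigcap_(i in [set: I]) [set w | `|x i - Y n w i| < del].
  by apply/seteqP; split => w h i; [move=> _; exact: h|exact: h].
apply: fin_bigcap_measurable => // i _.
have mg : measurable_fun setT (fun w => `|x i - Y n w i|).
  by apply: measurableT_comp => //; apply: measurable_funB => //; exact: measurable_cst.
have := mg measurableT `]-oo, del[%classic (measurable_itv _); rewrite setTI.
congr measurable; apply/seteqP; split => w /=; by rewrite in_itv.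
Qed.

(** A change of measure carried out on moments. The moment at th is split over the cube around X th
    and its complement; the complement is covered by the half-spaces beyond the faces, where a
    further small tilt th' shows an exponentially smaller contribution. The cube must therefore
    carry at least half of the moment. *)
Lemma tilted_lower th (del : R) : 0 < del -> exists2 c : R, 0 < c & \forall n \near \oo,
  ((c * expR (- (s n * (dot th (X th) - Lam th + del * \sum_i `|th i|))))%:E <=
    P [set w | forall i, (`|X th i - Y n w i| < del)%R])%E.
Proof.
move=> d0.
pose T := (I * bool)%type; pose sg (t : T) : R := (-1) ^+ t.2.
have sg2 t : sg t ^+ 2 = 1 by rewrite /sg -exprM mulnC exprM sqrrN !expr1n.
have nsg t : `|sg t| = 1 by rewrite /sg normrX normrN1 expr1n.
(* One direction per face, given by a coordinate and a sign. The step is small enough that the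
   gradient component moves by at most del / 2, half the distance to the face. *)
have /choice[k Hk] : forall t : T, exists k : nat,
    `|X th t.1 - X (fun j => th j + eps_dir (sg t / k.+1%:R) t.1 j) t.1| <= del / 2.
  move=> t; have /cvgrPdist_le/(_ (del / 2)) := @Xcont th (sg t) t.1.
  by rewrite divr_gt0// => /(_ isT)[k _ /(_ k (leqnn _))]; exists k.
pose q t : R := (k t).+1%:R^-1.
have q0 t : 0 < q t by rewrite invr_gt0 ltr0n.
pose th' t := (fun j => th j + eps_dir (sg t * q t) t.1 j).
have /choice[C HC] : forall t, exists C : R, 0 < C /\ forall n b,
    (\int[P]_w (expR (s n * (dot (th' t) (Y n w) - b)))%:E <= (C * expR (s n * (Lam (th' t) - b)))%:E)%E.
  by move=> t; have [C C0 HC] := int_exp (th' t); exists C.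
have [c c0 Hc] := mgf_ge th.
(* Beyond face t the extra tilt sg t q t Y exceeds b t, so there the moment at th is dominated by
   the one at th' minus b; by [Lam'] this replacement lowers the rate by q t del / 2. *)
pose b t := sg t * q t * X th t.1 + q t * del.
have Lam' t : Lam (th' t) - b t <= Lam th - q t * del / 2.
  have := subgrad (th' t) th.
  have -> : dot (fun j => th j - th' t j) (X (th' t)) = - (sg t * q t * X (th' t) t.1).
    rewrite /dot (bigD1 t.1)//= /th' /eps_dir eqxx mulr1 big1 ?addr0; first by ring.
    by move=> j /negbTE ->; rewrite mulr0 addr0 subrr mul0r.
  have : sg t * q t * (X (th' t) t.1 - X th t.1) <= q t * (del / 2).
    apply: (le_trans (ler_norm _)); rewrite !normrM nsg mul1r (ger0_norm (ltW (q0 t))).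
    by rewrite ler_pM2l// distrC; exact: Hk.
  rewrite /b; lra.
pose K n := expR (s n * (dot th (X th) + del * \sum_i `|th i|)).
pose E n := [set w | forall i, `|X th i - Y n w i| < del].
have mE n : measurable (E n) by exact: measurable_cube.
have pw n w : expR (s n * dot th (Y n w)) <= K n * \1_(E n) w +
    \sum_t expR (s n * (dot (th' t) (Y n w) - b t)).
  have S0 : 0 <= \sum_t expR (s n * (dot (th' t) (Y n w) - b t)).
    by apply: sumr_ge0 => t _; exact: expR_ge0.
  rewrite indicE; have [Ew|nE] := boolP (w \in E n).
    rewrite mulr1; apply: (@le_trans _ _ (K n)); last by rewrite lerDl.
    rewrite ler_expR ler_pM2l//; rewrite -lerBlDl /dot -sumrB mulr_sumr; apply: ler_sum => i _.
    rewrite -mulrBr; apply: (le_trans (ler_norm _)); rewrite normrM mulrC ler_wpM2r//.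
    by rewrite distrC ltW//; exact: (set_mem Ew i).
  rewrite mulr0 add0r; move: nE; rewrite notin_setE => /existsNP[i /negP]; rewrite -leNgt => h.
  have [t ti ht] : exists2 t : T, t.1 = i & del <= sg t * (Y n w i - X th i).
    move: h; rewrite ler_normr => /orP[h|h].
      by exists (i, true) => //=; rewrite /sg expr1 mulN1r opprB.
    by exists (i, false) => //=; rewrite /sg expr0 mul1r -opprB.
  rewrite (bigD1 t)//= -[leLHS]addr0; apply: lerD; last by apply: sumr_ge0 => *; exact: expR_ge0.
  rewrite ler_expR ler_pM2l// /th' dot_eps /b ti.
  have : q t * del <= q t * (sg t * (Y n w i - X th i)) by rewrite ler_pM2l.
  lra.
have main n : c * expR (s n * Lam th) <= K n * fine (P (E n)) +
    \sum_t C t * expR (s n * (Lam th - q t * del / 2)).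
  rewrite -lee_fin; apply: (le_trans (Hc n)).
  have PE : (P (E n) = (fine (P (E n)))%:E)%E by rewrite fineK// fin_num_measure.
  apply: (@le_trans _ _ (\int[P]_w ((K n * \1_(E n) w)%:E + \sum_t (expR (s n * (dot (th' t) (Y n w) - b t)))%:E))%E).
    apply: ge0_le_integral => //.
    - apply/measurable_EFinP; apply: measurableT_comp => //.
      by apply: measurable_funM => //; exact: measurable_cst.
    - apply: emeasurable_funD; first apply/measurable_EFinP.
        by apply: measurable_funM; [exact: measurable_cst|exact: measurable_indic].
      by apply: emeasurable_sum => t; apply/measurable_EFinP; exact: mexp.
    - by move=> w _; rewrite sumEFin -EFinD lee_fin; exact: pw.
  rewrite ge0_integralD; [|exact: measurableT|by move=> w _; rewrite lee_fin mulr_ge0 ?expR_ge0|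
    by apply/measurable_EFinP; apply: measurable_funM; [exact: measurable_cst|exact: measurable_indic]|
    by move=> w _; apply: sume_ge0 => t _; rewrite lee_fin expR_ge0|
    by apply: emeasurable_sum => t; apply/measurable_EFinP; exact: mexp].
  rewrite EFinD; apply: leeD.
    under eq_integral => w _ do rewrite EFinM.
    rewrite ge0_integralZl_EFin ?expR_ge0//; last first.
      by apply/measurable_EFinP; exact: measurable_indic.
    by rewrite integral_indic// setIT EFinM -PE.
  rewrite ge0_integral_sum; [|exact: measurableT|by move=> t; apply/measurable_EFinP; exact: mexp|
    by move=> t w _; rewrite lee_fin expR_ge0].
  rewrite -sumEFin; apply: lee_sum => t _.
  have [C0 h] := HC t; apply: (le_trans (h n (b t))).
  by rewrite lee_fin ler_pM2l// ler_expR ler_pM2l.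
(* Relative to expR (s n Lam th) the faces contribute at most Ct times a decaying exponential,
   eventually below c / 2. *)
pose Ct := \sum_t C t.
have Ct0 : 0 <= Ct by apply: sumr_ge0 => t _; exact: ltW (HC t).1.
have [q1 q10 Hq1] := @exists_pos_lb R T q q0.
have small : \forall n \near \oo, Ct * expR (- (s n * (q1 * del / 2))) <= c / 2.
  pose z := q1 * del / 2; have z0 : 0 < z by rewrite divr_gt0// mulr_gt0.
  have := sy (2 * Ct / c / z); apply: filterS => n hn.
  have h1 : 2 * Ct / c <= s n * z by rewrite -ler_pdivrMr.
  have h2 : 2 * Ct / c <= expR (s n * z) by have := expR_ge1Dx (s n * z); lra.
  rewrite expRN ler_pdivrMr ?expR_gt0//.
  move: h2; rewrite ler_pdivrMr// => h2; lra.
exists (c / 2); first by rewrite divr_gt0.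
apply: filterS small => n sn.
have PE : (P (E n) = (fine (P (E n)))%:E)%E by rewrite fineK// fin_num_measure.
rewrite -/(E n) PE lee_fin.
have h1 := main n.
have h2 : \sum_t C t * expR (s n * (Lam th - q t * del / 2)) <=
    c / 2 * expR (s n * Lam th).
  apply: (@le_trans _ _ (expR (s n * Lam th) * (Ct * expR (- (s n * (q1 * del / 2)))))).
    rewrite /Ct mulr_suml mulr_sumr; apply: ler_sum => t _.
    rewrite mulrCA; apply: ler_wpM2l; first exact: ltW (HC t).1.
    rewrite -expRD ler_expR.
    have : s n * (q1 * del / 2) <= s n * (q t * del / 2).
      by rewrite ler_pM2l// ler_pM2r// ler_pM2r//; exact: Hq1.
    lra.
  by rewrite mulrC ler_wpM2r// expR_ge0.
have h3 : c / 2 * expR (s n * Lam th) <= K n * fine (P (E n)) by lra.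
rewrite -(ler_pM2l (expR_gt0 (s n * (dot th (X th) + del * \sum_i `|th i|)))) -/(K n).
apply: le_trans h3; rewrite /K mulrCA -expRD ler_pM2l ?divr_gt0// ler_expR.
by rewrite le_eqVlt; apply/orP; left; apply/eqP; ring.
Qed.

End Chebyshev.
End GartnerEllis.

(** * The cumulant generating function *)
Section Stability.
Variables (R : realType) (V : finType) (T0 : R) (r : rates R V) (m M : R).
Hypothesis gr : goodrates T0 r m M.
Hypothesis T00 : 0 < T0.
Variable x0 : V.
Let n : R := #|V|%:R.
Variables (H : V -> R) (g : V -> V -> R) (rho : R) (v u : R -> V -> R).
Variables (Hk : nat -> V -> R) (gk : nat -> V -> V -> R) (rk : nat -> R)
  (vk uk : nat -> R -> V -> R).
Hypotheses (nH : forall y, n * M <= H y) (nHk : forall k y, n * M <= Hk k y)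
  (tl : tilted T0 r H g rho v u) (tlk : forall k, tilted T0 r (Hk k) (gk k) (rk k) (vk k) (uk k))
  (cH : forall y, Hk k y @[k --> \oo] --> H y)
  (cg : forall y z, gk k y z @[k --> \oo] --> g y z).

Let forall_near (P : V -> nat -> Prop) : (forall y, \forall k \near \oo, P y k) ->
  \forall k \near \oo, forall y, P y k.
Proof. by move=> h; exact: (@filter_forall _ V P \oo eventually_filter h). Qed.

Let cexp y z : expR (gk k y z) @[k --> \oo] --> expR (g y z).
Proof. by apply: continuous_cvg; [exact: continuous_expR|exact: cg]. Qed.

Let Aclose (e : R) : 0 < e -> \forall k \near \oo, forall t y z,
  `|Amx r H g t y z - Amx r (Hk k) (gk k) t y z| <= e.
Proof.
move=> e0; have M0 := M_gt0 gr.
have e1 : 0 < e / (2 * M) by rewrite divr_gt0// mulr_gt0.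
have e2 : 0 < e / 2 by rewrite divr_gt0.
have n1 : \forall k \near \oo, forall y z, `|expR (g y z) - expR (gk k y z)| <= e / (2 * M).
  by apply: forall_near => y; apply: forall_near => z; have /cvgrPdist_le/(_ _ e1) := @cexp y z.
have n2 : \forall k \near \oo, forall y, `|H y - Hk k y| <= e / 2.
  by apply: forall_near => y; have /cvgrPdist_le/(_ _ e2) := @cH y.
apply: filterS2 n1 n2 => k h1 h2 t y z; rewrite /Amx.
have -> : r y z t * expR (g y z) + (y == z)%:R * (H y - exitr r y t) -
  (r y z t * expR (gk k y z) + (y == z)%:R * (Hk k y - exitr r y t)) =
  r y z t * (expR (g y z) - expR (gk k y z)) + (y == z)%:R * (H y - Hk k y) by ring.
apply: (le_trans (ler_normD _ _)); rewrite [leRHS](_ : e = M * (e / (2 * M)) + 1 * (e / 2)); last first.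
  by field; rewrite gt_eqF.
rewrite !normrM; apply: lerD; apply: ler_pM => //.
  by rewrite ger0_norm ?(r_ge0 gr) ?(r_leM gr).
by case: (y == z); rewrite ?normr1 ?normr0.
Qed.

Let stab (eps : R) : 0 < eps -> \forall k \near \oo,
  (forall (t : R) z, 0 <= t <= T0 -> `|v t z - vk k t z| <= eps /\ `|u (- t) z - uk k (- t) z| <= eps) /\
  `|rho - rk k| <= eps.
Proof.
move=> eps0; have [m' m'0 Hm'] := Amx_edge gr g.
have con : forall y z, connect (edge r) y z by case: gr.
have [tv tu] := tl.
(* The extra 1 lets one constant bound every matrix within distance 1, as [eigsol_stab] requires a
   common bound. *)
have C0 : 0 < Cb M H g + 1 by rewrite addr_gt0// (Cb_gt0 gr).
have AC t y z : Amx r H g t y z <= Cb M H g + 1.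
  by apply: (le_trans (Amx_le gr H g t y z)); rewrite lerDl.
have [d1 d10 S1] := @eigsol_stab R V x0 (Amx r H g) (Cb M H g + 1) m' T0 (edge r)
  (lbm_Amx gr H g) (fun t y z => Amx_ge0 gr g t z (nH y)) AC C0 T00 m'0
  (fun t y z e => Hm' H t y z (nH y) e) con rho v eps tv eps0.
have [d2 d20 S2] := @eigsol_stab R V x0 (Arev r H g) (Cb M H g + 1) m' T0
  (fun z y => edge r y z) (lbmx_Arev gr H g) (fun t z y => Amx_ge0 gr g (- t) z (nH y))
  (fun t z y => AC (- t) y z) C0 T00 m'0 (fun t z y e => Hm' H (- t) y z (nH y) e)
  (fun z y => etrans (connect_rev (edge r) z y) (con y z)) rho _ eps tu eps0.
have d0 : 0 < Num.min 1 (Num.min d1 d2) by rewrite !lt_min ltr01 d10 d20.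
apply: filterS (Aclose d0) => k hk.
have [tvk tuk] := tlk k.
have hk1 t y z : `|Amx r H g t y z - Amx r (Hk k) (gk k) t y z| <= 1.
  by apply: (le_trans (hk t y z)); rewrite ge_min lexx.
have hkd1 t y z : `|Amx r H g t y z - Amx r (Hk k) (gk k) t y z| <= d1.
  by apply: (le_trans (hk t y z)); rewrite ge_min ge_min lexx orbT.
have hkd2 t y z : `|Amx r H g t y z - Amx r (Hk k) (gk k) t y z| <= d2.
  by apply: (le_trans (hk t y z)); rewrite ge_min ge_min lexx !orbT.
have AkC t y z : Amx r (Hk k) (gk k) t y z <= Cb M H g + 1.
  have := hk1 t y z; rewrite ler_norml => /andP[h _]; have := Amx_le gr H g t y z; lra.
have [a1 a2] := S1 _ _ _ (lbm_Amx gr (Hk k) (gk k)) (fun t y z => Amx_ge0 gr (gk k) t z (nHk k y))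
  AkC tvk (fun t y z _ => hkd1 t y z).
have [b1 _] := S2 _ _ _ (lbmx_Arev gr (Hk k) (gk k)) (fun t z y => Amx_ge0 gr (gk k) (- t) z (nHk k y))
  (fun t z y => AkC (- t) y z) tuk (fun t z y _ => hkd2 (- t) y z).
by split => // t z tT; split; [exact: a1|exact: b1].
Qed.

Let cr : rk k @[k --> \oo] --> rho.
Proof. by apply/cvgrPdist_le => e e0; apply: filterS (stab e0) => k []. Qed.

Let cv t z : 0 <= t <= T0 -> vk k t z @[k --> \oo] --> v t z.
Proof.
by move=> tT; apply/cvgrPdist_le => e e0; apply: filterS (stab e0) => k [/(_ t z tT)[]].
Qed.

(** Stability controls the reversed solution, that is u on [- T0, 0]; one period carries it over to
    [0, T0]. *)
Let uE t z : u t z = rho^-1 * u (- (T0 - t)) z.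
Proof. by rewrite -(t_uper tl); congr u; ring. Qed.
Let ukE k t z : uk k t z = (rk k)^-1 * uk k (- (T0 - t)) z.
Proof. by rewrite -(t_uper (tlk k)); congr (uk k); ring. Qed.

Let cu t z : 0 <= t <= T0 -> uk k t z @[k --> \oo] --> u t z.
Proof.
move=> /andP[t0 tT]; rewrite uE; under eq_cvg do rewrite ukE.
apply: cvgM; first by apply: cvgV; [rewrite gt_eqF// (t_rho tl)|exact: cr].
have tT' : 0 <= T0 - t <= T0 by apply/andP; split; lra.
by apply/cvgrPdist_le => e e0; apply: filterS (stab e0) => k [/(_ _ z tT')[]].
Qed.

Let cN : tN (vk k) (uk k) @[k --> \oo] --> tN v u.
Proof.
have t0 : 0 <= (0 : R) <= T0 by apply/andP; split => //; exact: ltW.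
by apply: cvg_sumr => y; apply: cvgM; [exact: cu|exact: cv].
Qed.

Let N0 : 0 < tN v u. Proof. exact: (tN_gt0 x0 tl). Qed.

(** Dominated convergence when the common bound holds only for large k: the first terms are
    dropped. *)
Let shift_RI (f_ : nat -> R -> R) (f : R -> R) (B : R) : (forall k, lbm (f_ k)) -> lbm f ->
  (\forall k \near \oo, forall t, 0 <= t <= T0 -> `|f_ k t| <= B) ->
  (forall t, 0 <= t <= T0 -> f_ k t @[k --> \oo] --> f t) ->
  RI 0 T0 (f_ k) @[k --> \oo] --> RI 0 T0 f.
Proof.
move=> lf_ lf [K _ HK] cf; rewrite -(cvg_shiftn K).
apply: (@RI_dominated R (fun k => f_ (k + K)%N) f 0 T0 B) => //.
  by move=> k t; apply: HK; rewrite /= leq_addl.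
by move=> t tT; have := cf t tT; rewrite -(cvg_shiftn K).
Qed.

Lemma tpt_cvg1 y : (tpt T0 r (gk k) (vk k) (uk k)).1 y @[k --> \oo] --> (tpt T0 r g v u).1 y.
Proof.
rewrite /tpt /=; apply: cvgM; first exact: cvg_cst.
apply: (@shift_RI (fun k t => pmu (vk k) (uk k) t y) _ 1).
- by move=> k; exact: (lbm_pmu gr (tlk k)).
- exact: (lbm_pmu gr tl).
- apply: nearW => k t _; rewrite ger0_norm ?(pmu_ge0 x0 (tlk k))//.
  rewrite -(pmu_sum gr x0 (tlk k) t); apply: (@sum_ge1 R V (fun y => pmu (vk k) (uk k) t y)) => z.
  exact: (pmu_ge0 x0 (tlk k)).
- move=> t tT; apply: cvgM; first by apply: cvgM; [exact: cu|exact: cv].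
  by apply: cvgV; [rewrite gt_eqF|exact: cN].
Qed.

Lemma tpt_cvg2 y z : (tpt T0 r (gk k) (vk k) (uk k)).2 y z @[k --> \oo] --> (tpt T0 r g v u).2 y z.
Proof.
rewrite /tpt /=; apply: cvgM; first exact: cvg_cst.
have [Bv [Bv0 HBv]] := (t_lv tl y).2 0 T0.
have [Bu [Bu0 HBu]] := (t_lu gr tl z).2 (- T0) 0.
have rho0 := t_rho tl.
(* Factor by factor: numerators within 1 of their limits, and the denominators rho and tN at least
   half of theirs. *)
pose B := (Bv + 1) * M * (expR (g y z) + 1) * ((rho / 2)^-1 * (Bu + 1)) / (tN v u / 2).
apply: (@shift_RI (fun k t => pQ r (gk k) (vk k) (uk k) t y z) _ B).
- by move=> k; exact: (lbm_pQ gr (tlk k)).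
- exact: (lbm_pQ gr tl).
- have r2 : 0 < rho / 2 by rewrite divr_gt0.
  have N2 : 0 < tN v u / 2 by rewrite divr_gt0.
  have s1 := stab ltr01; have s2 := stab r2.
  have /cvgrPdist_le/(_ _ N2) s3 := cN; have /cvgrPdist_le/(_ _ ltr01) s4 := @cexp y z.
  near=> k.
  have [h1 _] : (forall (t : R) z, 0 <= t <= T0 ->
     `|v t z - vk k t z| <= 1 /\ `|u (- t) z - uk k (- t) z| <= 1) /\ `|rho - rk k| <= 1 by near: k.
  have [_ h2] : (forall (t : R) z, 0 <= t <= T0 ->
     `|v t z - vk k t z| <= rho / 2 /\ `|u (- t) z - uk k (- t) z| <= rho / 2) /\ `|rho - rk k| <= rho / 2.
    by near: k.
  have h3 : `|tN v u - tN (vk k) (uk k)| <= tN v u / 2 by near: k.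
  have h4 : `|expR (g y z) - expR (gk k y z)| <= 1 by near: k.
  move=> t tT; have /andP[t0 tT'] := tT.
  rewrite ger0_norm ?(pQ_ge0 gr x0 (tlk k))//.
  have vB : vk k t y <= Bv + 1.
    have [+ _] := h1 t y tT; have := HBv t tT; rewrite !ler_norml => /andP[? ?] /andP[? ?]; lra.
  have tT2 : 0 <= T0 - t <= T0 by apply/andP; split; lra.
  have uB : uk k (- (T0 - t)) z <= Bu + 1.
    have [_ +] := h1 (T0 - t) z tT2.
    have := HBu (- (T0 - t)); rewrite !ler_norml => /(_ _)/andP[].
      by apply/andP; split; lra.
    by move=> ? ? /andP[? ?]; lra.
  have rB : rho / 2 <= rk k by move: h2; rewrite ler_norml => /andP[? ?]; lra.
  have NB : tN v u / 2 <= tN (vk k) (uk k) by move: h3; rewrite ler_norml => /andP[? ?]; lra.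
  have gB : expR (gk k y z) <= expR (g y z) + 1 by move: h4; rewrite ler_norml => /andP[? ?]; lra.
  have rk0 := t_rho (tlk k); have Nk0 := tN_gt0 x0 (tlk k).
  have vk0 := ltW (t_v (tlk k) t y).
  have uk0 := ltW (t_u (tlk k) (- (T0 - t)) z).
  rewrite /pQ ukE /B.
  have p1 : vk k t y * r y z t <= (Bv + 1) * M.
    by apply: ler_pM => //; rewrite ?(r_ge0 gr) ?(r_leM gr).
  have p10 : 0 <= vk k t y * r y z t by rewrite mulr_ge0 ?(r_ge0 gr).
  have p2 : vk k t y * r y z t * expR (gk k y z) <= (Bv + 1) * M * (expR (g y z) + 1).
    by apply: ler_pM => //; exact: expR_ge0.
  have p20 : 0 <= vk k t y * r y z t * expR (gk k y z) by rewrite mulr_ge0 ?expR_ge0.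
  have p3 : (rk k)^-1 * uk k (- (T0 - t)) z <= (rho / 2)^-1 * (Bu + 1).
    by apply: ler_pM => //; rewrite ?invr_ge0 ?(ltW rk0)// lef_pV2 ?posrE.
  have p30 : 0 <= (rk k)^-1 * uk k (- (T0 - t)) z by rewrite mulr_ge0 ?invr_ge0 ?(ltW rk0).
  apply: ler_pM; [exact: mulr_ge0|by rewrite invr_ge0 ltW|exact: ler_pM|].
  by rewrite lef_pV2 ?posrE.
- move=> t tT; apply: cvgM; last by apply: cvgV; [rewrite gt_eqF|exact: cN].
  apply: cvgM; last exact: cu.
  apply: cvgM; last exact: cexp.
  by apply: cvgM; [exact: cv|exact: cvg_cst].
Unshelve. all: by end_near. Qed.

End Stability.

(** * The family of tilts, its generating function and duality with the rate functional *)

Section Family.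
Variables (R : realType) (V : finType) (T0 : R) (r : rates R V) (m M : R).
Hypothesis gr : goodrates T0 r m M.
Hypothesis T00 : 0 < T0.
Variable x0 : V.
Hypothesis disc : (@lebesgue_measure R).-negligible ([set t : R | 0 <= t <= T0] `&`
  [set t | exists y z, ~ {for t, continuous (r y z)}]).
Let n : R := #|V|%:R.
Let I := (V + V * V)%type.
Implicit Types (th : I -> R).

Definition vec (pt : state_space R V) (i : V + V * V) : R :=
  match i with inl y => pt.1 y | inr yz => pt.2 yz.1 yz.2 end.
(* Components of th outside the edges are ignored. The constant cc makes the tilted matrix
   nonnegative; it is subtracted again in Lam. *)
Definition gg th y z : R := if edge r y z then th (inr (y, z)) else 0.
Definition cc th : R := \sum_y `|th (inl y)| + n * M.
Definition HH th y : R := th (inl y) + cc th.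

Lemma HH_ge th y : n * M <= HH th y.
Proof.
have h : `|th (inl y)| <= \sum_y `|th (inl y)| by apply: (@sum_ge1 R V (fun y => `|th (inl y)|)).
by rewrite /HH /cc; move: h; rewrite -normrN; have := ler_norm (- th (inl y)); lra.
Qed.

(** The occupation has mass one, so the shift by [cc] contributes a constant; the components ignored
    by [gg] meet zero flow. *)
Lemma pairing_dot th (pt : state_space R V) : \sum_y pt.1 y = 1 ->
  (forall y z, ~~ edge r y z -> pt.2 y z = 0) ->
  pairing (HH th) (gg th) pt = dot th (vec pt) + cc th.
Proof.
move=> s1 e0; rewrite /pairing /dot.
rewrite big_sumType/=.
under eq_bigr => y _ do rewrite /HH mulrDl.
rewrite big_split/= -mulr_sumr s1 mulr1 -addrA [cc th + _]addrC addrA; congr (_ + _ + _).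
rewrite pair_bigA/=; apply: eq_bigr => -[y z] _ /=; rewrite /gg; case: ifPn => // ne.
by rewrite mul0r e0// mulr0.
Qed.

Lemma adm_pt pt1 pt2 mu Q : admissible r T0 pt1 pt2 mu Q ->
  \sum_y pt1 y = 1 /\ forall y z, ~~ edge r y z -> pt2 y z = 0.
Proof.
move=> adm; have [f1 f2 f3 f4] := adm_facts adm; have Tn : T0 != 0 by rewrite gt_eqF.
split.
  apply: (mulfI Tn); rewrite mulr1 mulr_sumr.
  under eq_bigr => y _ do rewrite -(f3 y).2.
  rewrite -RI_sumi; last by move=> y; exact: (f3 y).1.
  have s t : \sum_y mu t y = 1 by case: adm => -[_ /(_ t)[]].
  under eq_RI => t _ do rewrite s.
  by rewrite RI_cst ?(ltW T00)// mul1r subr0.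
move=> y z ne; apply: (mulfI Tn); rewrite mulr0 -(f4 y z).2.
have -> : (fun t => Q t y z) = (fun=> 0).
  by apply/funext => t; case: adm => _ /(_ t y z)[_ ->].
by rewrite RI_cst ?(ltW T00)// mul0r.
Qed.

Variables (rho : (I -> R) -> R) (v u : (I -> R) -> R -> V -> R).
Hypothesis TL : forall th, tilted T0 r (HH th) (gg th) (rho th) (v th) (u th).

(* The scaled cumulant generating function and its gradient. *)
Definition Lam th : R := tkap T0 (rho th) - cc th.
Definition Xpt th : state_space R V := tpt T0 r (gg th) (v th) (u th).
Definition Xv th : I -> R := vec (Xpt th).

Lemma Ibar_Xpt th : (Ibar r T0 (Xpt th) <= (dot th (Xv th) - Lam th)%:E)%E.
Proof.
have adm := path_admissible gr T00 x0 (TL th).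
have [s1 e0] := adm_pt adm.
apply: (Ibar_le T00 adm).
rewrite /cost (path_cost gr T00 x0 (TL th)) lee_fin ler_pM2l// pairing_dot//.
rewrite /Lam /Xv /Xpt; lra.
Qed.

Lemma Ibar_ge th pt : ((dot th (vec pt) - Lam th)%:E <= Ibar r T0 pt)%E.
Proof.
apply: le_ereal_inf_tmp => _ [mu [Q [adm ->]]].
have [s1 e0] := adm_pt adm.
have := cost_lower gr T00 (TL th) disc adm.
rewrite pairing_dot// -[X in (_ <= X)%E -> _]/(cost T0 r mu Q) => h.
rewrite lee_pdivlMl// -EFinM; apply: le_trans h; rewrite lee_fin ler_pM2l// /Lam; lra.
Qed.

(** [Ibar] at [Xpt th] is eliminated between its lower bound in direction th' and its upper bound in
    direction th. *)
Lemma Lam_subgrad th th' : Lam th + dot (fun i => th' i - th i) (Xv th) <= Lam th'.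
Proof.
have := le_trans (Ibar_ge th' (Xpt th)) (Ibar_Xpt th); rewrite lee_fin -/(Xv th).
have -> : dot (fun i => th' i - th i) (Xv th) = dot th' (Xv th) - dot th (Xv th).
  by rewrite /dot -sumrB; apply: eq_bigr => i _; rewrite mulrBl.
lra.
Qed.

Lemma Xv_cont th (c : R) i :
  Xv (fun j => th j + eps_dir (c / k.+1%:R) i j) i @[k --> \oo] --> Xv th i.
Proof.
pose tk k : I -> R := fun j => th j + eps_dir (c / k.+1%:R) i j.
have ct j : tk k j @[k --> \oo] --> th j.
  rewrite -[th j]addr0; apply: cvgD; first exact: cvg_cst.
  rewrite (_ : 0 = c * 0 * (j == i)%:R); last by rewrite mulr0 mul0r.
  apply: cvgM; last exact: cvg_cst.
  by apply: cvgM; [exact: cvg_cst|exact: cvg_harmonic].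
have cH y : HH (tk k) y @[k --> \oo] --> HH th y.
  apply: cvgD; first exact: ct.
  apply: cvgD; last exact: cvg_cst.
  by apply: cvg_sumr => z; apply: cvg_norm; exact: ct.
have cg y z : gg (tk k) y z @[k --> \oo] --> gg th y z.
  by rewrite /gg; case: (edge r y z); [exact: ct|exact: cvg_cst].
have h1 y := tpt_cvg1 gr T00 x0 (HH_ge th) (fun k => HH_ge (tk k)) (TL th) (fun k => TL (tk k)) cH cg y.
have h2 y z := tpt_cvg2 gr T00 x0 (HH_ge th) (fun k => HH_ge (tk k)) (TL th) (fun k => TL (tk k)) cH cg (y := y) (z := z).
by case: i @tk ct cH cg h1 h2 => [y|[y z]] tk ct cH cg h1 h2; [exact: h1|exact: h2].
Qed.

End Family.

(** * Compact level sets *)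

Section LevelSets.
Variables (R : realType) (V : finType) (T0 : R) (r : rates R V) (m M : R).
Hypothesis gr : goodrates T0 r m M.
Hypothesis T00 : 0 < T0.
Variable x0 : V.

Lemma Ibar_closed (a : R) : closed [set pt | (Ibar r T0 pt <= a%:E)%E].
Proof. by move=> pt /(Ibar_closure gr T00 x0). Qed.

Lemma Ibar_compact (a : R) : compact [set pt | (Ibar r T0 pt <= a%:E)%E].
Proof.
(* Occupations are at most 1. Flows are bounded through an admissible pair of cost below T0 (a + 1),
   because the level a itself need not be attained at this stage. *)
pose B := Num.max 1 (Bq T0 M (T0 * (a + 1)) / T0).
apply: (@subclosed_compact _ _ [set pt : state_space R V |
  (forall y, 0 <= pt.1 y <= B) /\ (forall y z, 0 <= pt.2 y z <= B)]).
- exact: Ibar_closed.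
- exact: box_compact.
move=> pt /= Ia.
have /(Ibar_lt T00)[mu [Q [adm cq]]] : (Ibar r T0 pt < (a + 1)%:E)%E.
  by apply: (le_lt_trans Ia); rewrite lte_fin ltrDl.
have [f1 f2 f3 f4] := adm_facts adm; have [s1 e0] := adm_pt T00 adm.
have mu0 t y : 0 <= mu t y by case: adm => -[_ /(_ t)[]].
have Q0 t y z : 0 <= Q t y z by case: adm => _ /(_ t y z)[].
have p10 y : 0 <= pt.1 y by rewrite -(pmulr_rge0 _ T00) -(f3 y).2; apply: RI_ge0.
have p20 y z : 0 <= pt.2 y z by rewrite -(pmulr_rge0 _ T00) -(f4 y z).2; apply: RI_ge0.
split => [y|y z]; rewrite ?p10 ?p20/= le_max.
  by rewrite -s1 (@sum_ge1 R V pt.1).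
apply/orP; right; rewrite ler_pdivlMr// mulrC -(f4 y z).2.
by have [] := coord_bounds gr T00 adm (ltW cq) y z.
Qed.

End LevelSets.

(** * Exponential moments over whole periods *)

Section ExponentialMoments.
Variables (R : realType) (V : finType) (T0 : R) (r : rates R V) (m M : R).
Hypothesis gr : goodrates T0 r m M.
Hypothesis T00 : 0 < T0.
Variables (d : measure_display) (Omega : measurableType d)
    (P : probability Omega R) (xi : Omega -> R -> V)
    (p : R -> R -> V -> V -> R) (x : V).
Hypothesis kol : kolmogorov r p.
Hypothesis xiX : forall w, cadlag (xi w).
Hypothesis mxi : forall t y, 0 <= t -> measurable [set w | xi w t = y].
Hypothesis fdd : forall (n : nat) (ts : nat -> R) (ys : nat -> V),
     0 <= ts 0%N -> (forall i, (i < n)%N -> ts i <= ts i.+1) ->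
     P [set w | forall i, (i <= n)%N -> xi w (ts i) = ys i] =
     (p 0 (ts 0%N) x (ys 0%N) *
        \prod_(i < n) p (ts i) (ts i.+1) (ys i) (ys i.+1))%:E.
Let I := (V + V * V)%type.
Variables (rho : (I -> R) -> R) (v u : (I -> R) -> R -> V -> R).
Hypothesis TL : forall th, tilted T0 r (HH M th) (gg r th) (rho th) (v th) (u th).

Definition tn (n : nat) : R := n.+1%:R * T0.
Definition Yn (n : nat) (w : Omega) : I -> R := vec (emp r xi (tn n) w).

Lemma tn_gt0 n : 0 < tn n. Proof. by rewrite mulr_gt0. Qed.

Lemma tn_ge (A : R) : \forall n \near \oo, A <= tn n.
Proof.
exists (Num.truncn (A / T0)) => // n /= hn; rewrite /tn -ler_pdivrMr//.
apply: ltW; apply: (lt_le_trans (truncnS_gt _)); by rewrite ler_nat.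
Qed.

Lemma measurable_Yn n i : measurable_fun setT (fun w => Yn n w i).
Proof.
case: i => [y|[y z]]; first exact: (measurable_emp_measure r xiX mxi y (tn_gt0 n)).
exact: (measurable_emp_flow r xiX mxi y z (tn_gt0 n)).
Qed.

Lemma tilted_lb H g rh v' u' (T : R) : tilted T0 r H g rh v' u' ->
  exists2 b : R, 0 < b & forall (t : R) z, 0 <= t <= T -> b <= u' t z.
Proof.
move=> tl.
have /choice[C HC] : forall z, exists C : R, 0 <= C /\ forall t : R, 0 <= t <= T -> `|(u' t z)^-1| <= C.
  by move=> z; have [_ /(_ 0 T)] := t_luinv gr tl z.
have C1 z : 0 < C z + 1 by have [? _] := HC z; rewrite ltr_wpDl.
have [b b0 Hb] := @exists_pos_lb R V (fun z => (C z + 1)^-1) (fun z => etrans (invr_gt0 _) (C1 z)).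
exists b => // t z tT; apply: (le_trans (Hb z)); have up := t_u tl t z.
rewrite -[leRHS]invrK lef_pV2 ?posrE ?invr_gt0//.
have [_ /(_ t tT)] := HC z; rewrite ger0_norm ?invr_ge0 ?(ltW up)// => h.
by apply: (le_trans h); rewrite lerDl.
Qed.

Let u_n th n z : u th (tn n) z = expR (- (tn n * tkap T0 (rho th))) * u th 0 z.
Proof.
have rp := t_rho (TL th).
have : forall k : nat, u th (k%:R * T0) z = (rho th)^-1 ^+ k * u th 0 z.
  elim=> [|k IH]; first by rewrite mul0r expr0 mul1r.
  by rewrite -natr1 mulrDl mul1r (t_uper (TL th)) IH exprS mulrA.
have -> : tn n * tkap T0 (rho th) = n.+1%:R * ln (rho th).
  by rewrite /tkap /tn -mulrA [T0 * _]mulrC divfK ?gt_eqF.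
by move=> ->; congr (_ * _); rewrite -mulrN expRM_natl expRN lnK ?posrE.
Qed.

(** Here the time horizon must be a multiple of T0: u at the final time is then u at time 0 times
    the n-th power of the period factor, so [fw] is the normalized exponential moment up to a factor
    that does not grow with n. *)
Let fwE th n w : fw xi (tn n) (HH M th) (gg r th) (u th) w =
  expR (tn n * dot th (Yn n w)) * expR (- (tn n * Lam T0 M rho th)) * u th 0 (xi w (tn n)).
Proof.
rewrite /fw u_n mulrA; congr (_ * _); rewrite -!expRD; congr expR.
rewrite (@cS_emp _ _ r _ _ xi _ _ _ w (tn_gt0 n)); last by move=> y z /negbTE; rewrite /gg => ->.
rewrite pairing_dot; first by rewrite /Lam /Yn; ring.
  exact: (emp_mass r xiX w (tn_gt0 n)).
by move=> y z; exact: emp_flow_nonedge.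
Qed.

Let mexp th n : measurable_fun setT (fun w => (expR (tn n * dot th (Yn n w)))%:E).
Proof.
apply/measurable_EFinP; apply: measurableT_comp => //.
apply: measurable_funM; first exact: measurable_cst.
by apply: measurable_sum => i; apply: measurable_funM; [exact: measurable_cst|exact: measurable_Yn].
Qed.

Let mfw th n : measurable_fun setT (fun w => (fw xi (tn n) (HH M th) (gg r th) (u th) w)%:E).
Proof. by apply/measurable_EFinP; exact: (measurable_fw xiX mxi _ _ _ (tn_gt0 n)). Qed.

Let le_intZ (f g : Omega -> R) (k : R) : 0 <= k -> (forall w, 0 <= f w) -> (forall w, 0 <= g w) ->
  measurable_fun setT (EFin \o f) -> measurable_fun setT (EFin \o g) ->
  (forall w, f w <= k * g w) -> (\int[P]_w (f w)%:E <= k%:E * \int[P]_w (g w)%:E)%E.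
Proof.
move=> k0 f0 g0 mf mg fg; rewrite -ge0_integralZl_EFin//; last by move=> w _; rewrite lee_fin.
apply: ge0_le_integral => //.
- by move=> w _; rewrite lee_fin.
- by apply: emeasurable_funM => //; exact: measurable_cst.
- by move=> w _; rewrite -EFinM lee_fin.
Qed.

Lemma mgf_upper th : exists2 C : R, 0 < C & forall n,
  (\int[P]_w (expR (tn n * dot th (Yn n w)))%:E <= (C * expR (tn n * Lam T0 M rho th))%:E)%E.
Proof.
have [q q0 Hq] := @exists_pos_lb R V (u th 0) (t_u (TL th) 0).
exists (u th 0 x / q); first by rewrite divr_gt0// (t_u (TL th)).
move=> n; have [b b0 Hb] := tilted_lb (tn n) (TL th).
have h := fw_le gr kol xiX mxi fdd (tn_gt0 n) (t_bs gr (TL th)) b0 Hb.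
have k0 : 0 <= expR (tn n * Lam T0 M rho th) / q by rewrite divr_ge0 ?expR_ge0// ltW.
apply: (@le_trans _ _ ((expR (tn n * Lam T0 M rho th) / q)%:E *
   \int[P]_w (fw xi (tn n) (HH M th) (gg r th) (u th) w)%:E)%E).
  apply: le_intZ => //.
  - by move=> w; rewrite fwE !mulr_ge0 ?expR_ge0// ltW// (t_u (TL th)).
  - exact: mexp.
  - exact: mfw.
  move=> w; rewrite fwE.
  have -> : forall a e z : R, e / q * (a * expR (- (tn n * Lam T0 M rho th)) * z) =
      a * (expR (- (tn n * Lam T0 M rho th)) * e) * (z / q) by move=> a e z; ring.
  rewrite -expRD addNr expR0 mulr1 -[leLHS]mulr1 ler_wpM2l ?expR_ge0//.
  by rewrite ler_pdivlMr// mul1r.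
apply: (le_trans (lee_wpmul2l _ h)); first by rewrite lee_fin.
by rewrite -EFinM lee_fin le_eqVlt; apply/orP; left; apply/eqP; ring.
Qed.

(** Same comparison as in [mgf_upper], with the sum of u th 0 as upper bound for its values and
    [fw_lower] in place of [fw_le]. *)
Lemma mgf_lower th : exists2 C : R, 0 < C & forall n,
  ((C * expR (tn n * Lam T0 M rho th))%:E <= \int[P]_w (expR (tn n * dot th (Yn n w)))%:E)%E.
Proof.
pose q := \sum_z u th 0 z.
have Hq z : u th 0 z <= q by apply: (@sum_ge1 R V (u th 0)) => y; exact: ltW (t_u (TL th) 0 y).
have q0 : 0 < q by apply: lt_le_trans (Hq x); exact: (t_u (TL th)).
exists (u th 0 x / q); first by rewrite divr_gt0// (t_u (TL th)).
move=> n; have [b b0 Hb] := tilted_lb (tn n) (TL th).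
(* The doubled tilt required by [fw_lower]; its matrix is still nonnegative, since doubling [HH]
   keeps it above n M. *)
have [rh2 [v2 [u2 tl2]]] : exists rh2 v2 u2, tilted T0 r (fun y => 2 * HH M th y)
    (fun y z => 2 * gg r th y z) rh2 v2 u2.
  apply: (tilted_exists gr T00 x) => y.
  have nM : 0 <= #|V|%:R * M by rewrite mulr_ge0// ltW// (M_gt0 gr).
  by have := HH_ge M th y; lra.
have [b2 b20 Hb2] := tilted_lb (tn n) tl2.
have h := fw_lower gr kol xiX mxi fdd (tn_gt0 n) (t_bs gr (TL th)) b0 Hb (t_bs gr tl2) b20 Hb2.
set E := expR (tn n * Lam T0 M rho th); have E0 : 0 < E by exact: expR_gt0.
have h2 : (\int[P]_w (fw xi (tn n) (HH M th) (gg r th) (u th) w)%:E <=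
   (q / E)%:E * \int[P]_w (expR (tn n * dot th (Yn n w)))%:E)%E.
  apply: le_intZ => //.
  - by rewrite divr_ge0// ltW.
  - by move=> w; rewrite fwE !mulr_ge0 ?expR_ge0// ltW// (t_u (TL th)).
  - exact: mfw.
  - exact: mexp.
  move=> w; rewrite fwE expRN -/E mulrC [leRHS]mulrC [leRHS]mulrA [leRHS]mulrAC mulrC.
  by rewrite ler_wpM2l// mulr_ge0 ?invr_ge0 ?expR_ge0// ltW.
have := le_trans h h2; rewrite -lee_pdivrMl ?divr_gt0// -EFinM => h3.
by apply: le_trans h3; rewrite lee_fin le_eqVlt invf_div; apply/orP; left; apply/eqP; ring.
Qed.

End ExponentialMoments.

(** * The large deviation principle *)
Section LogAsymptotics.
Variable R : realType.

Lemma lne_le (s K a : R) (p : \bar R) : 0 < s -> 0 < K -> (0 <= p)%E ->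
  (p <= (K * expR (- (s * a)))%:E)%E -> (s^-1%:E * lne p <= (s^-1 * ln K - a)%:E)%E.
Proof.
move=> s0 K0 p0 pK; rewrite lee_pdivrMl// -EFinM mulrBr mulVKf ?gt_eqF//.
have -> : ln K - s * a = ln (K * expR (- (s * a))) by rewrite lnM ?posrE ?expR_gt0// expRK.
rewrite -lne_EFin ?mulr_gt0 ?expR_gt0// lee_lne// in_itv/= leey andbT//.
by rewrite lee_fin mulr_ge0 ?expR_ge0 ?ltW.
Qed.

Lemma lne_ge (s K a : R) (p : \bar R) : 0 < s -> 0 < K -> (0 <= p)%E ->
  ((K * expR (- (s * a)))%:E <= p)%E -> ((s^-1 * ln K - a)%:E <= s^-1%:E * lne p)%E.
Proof.
move=> s0 K0 p0 pK; rewrite lee_pdivlMl// -EFinM mulrBr mulVKf ?gt_eqF//.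
have -> : ln K - s * a = ln (K * expR (- (s * a))) by rewrite lnM ?posrE ?expR_gt0// expRK.
rewrite -lne_EFin ?mulr_gt0 ?expR_gt0// lee_lne// in_itv/= leey andbT//.
by rewrite lee_fin mulr_ge0 ?expR_ge0 ?ltW.
Qed.

Lemma near_small (s : nat -> R) (c e : R) : (forall n, 0 < s n) ->
  (forall A : R, \forall n \near \oo, A <= s n) -> 0 < e ->
  \forall n \near \oo, `|(s n)^-1 * c| <= e.
Proof.
move=> s0 sy e0; apply: filterS (sy (`|c| / e)) => n.
rewrite ler_pdivrMr// => h.
by rewrite normrM gtr0_norm ?invr_gt0// ler_pdivrMl.
Qed.

Lemma le_oppe_real (l i : \bar R) : (forall a : R, (a%:E < i)%E -> (l <= (- a)%:E)%E) ->
  (l <= - i)%E.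
Proof.
case: i => [i| |] H; last by rewrite /= leey.
  apply/lee_addgt0Pr => e e0; rewrite -EFinN -EFinD.
  have -> : - i + e = - (i - e) by ring.
  by apply: H; rewrite lte_fin; lra.
case: l H => [l| |] H //=.
  by exfalso; have := H (- l + 1); rewrite ltry lee_fin => /(_ isT); lra.
by have := H 0; rewrite ltry => /(_ isT).
Qed.

End LogAsymptotics.

(** * Upper and lower bounds for the empirical measure and flow *)

Section LargeDeviations.
Variables (R : realType) (V : finType) (T0 : R) (r : rates R V) (m M : R).
Hypothesis gr : goodrates T0 r m M.
Hypothesis T00 : 0 < T0.
Hypothesis disc : (@lebesgue_measure R).-negligible ([set t : R | 0 <= t <= T0] `&`
  [set t | exists y z, ~ {for t, continuous (r y z)}]).
Variables (d : measure_display) (Omega : measurableType d)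
    (P : probability Omega R) (xi : Omega -> R -> V)
    (p : R -> R -> V -> V -> R) (x : V).
Hypothesis kol : kolmogorov r p.
Hypothesis xiX : forall w, cadlag (xi w).
Hypothesis mxi : forall t y, 0 <= t -> measurable [set w | xi w t = y].
Hypothesis fdd : forall (n : nat) (ts : nat -> R) (ys : nat -> V),
     0 <= ts 0%N -> (forall i, (i < n)%N -> ts i <= ts i.+1) ->
     P [set w | forall i, (i <= n)%N -> xi w (ts i) = ys i] =
     (p 0 (ts 0%N) x (ys 0%N) *
        \prod_(i < n) p (ts i) (ts i.+1) (ys i) (ys i.+1))%:E.
Let I := (V + V * V)%type.
Variables (rho : (I -> R) -> R) (v u : (I -> R) -> R -> V -> R).
Hypothesis TL : forall th, tilted T0 r (HH M th) (gg r th) (rho th) (v th) (u th).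
Let L := Lam T0 M rho.
Let X := Xv T0 r v u.
Let Y := Yn T0 r xi.
Let s := tn T0.
Let subgrad := Lam_subgrad gr T00 x disc TL.
Let Xcont th c i := @Xv_cont _ _ _ _ _ _ gr T00 x _ _ _ TL th c i.
Let s0 : forall n, 0 < s n := tn_gt0 T00.
Let E n w : state_space R V := emp r xi (s n) w.

Lemma measurable_emp_open G n : open G -> measurable [set w | G (E n w)].
Proof.
move=> oG; apply: measurable_open_preimage => // [y|y z].
  exact: (measurable_emp_measure r xiX mxi y (s0 n)).
exact: (measurable_emp_flow r xiX mxi y z (s0 n)).
Qed.

Lemma measurable_emp_closed C n : closed C -> measurable [set w | C (E n w)].
Proof.
move=> cC; rewrite -[X in measurable X]setCK; apply: measurableC.
by apply: (@measurable_emp_open (~` C)); exact: closed_openC.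
Qed.

Lemma vec_near (e : R) (pt pt' : state_space R V) : (forall i, `|vec pt i - vec pt' i| < e) -> near_pt e pt pt'.
Proof. by move=> h; split => [y|y z]; [exact: (h (inl y))|exact: (h (inr (y, z)))]. Qed.

Lemma Ibar_dual pt (a : R) : (forall th, dot th (vec pt) - L th <= a) -> (Ibar r T0 pt <= a%:E)%E.
Proof.
move=> H; apply: (Ibar_closure gr T00 x) => U /state_nbhs[e e0 He].
have [th [h1 h2]] := moreau subgrad Xcont e0 H.
exists (Xpt T0 r v u th); split; last by apply: He; exact: vec_near.
by apply: (le_trans (Ibar_Xpt gr T00 x TL th)); rewrite lee_fin.
Qed.

Lemma dot_continuous th : continuous (fun pt : state_space R V => dot th (vec pt)).
Proof.
have -> : (fun pt : state_space R V => dot th (vec pt)) =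
    pairing (fun y => th (inl y)) (fun y z => th (inr (y, z))).
  apply/funext => pt; rewrite /dot /pairing big_sumType/= pair_bigA/=; congr (_ + _).
  by apply: eq_bigr => -[].
exact: pairing_continuous.
Qed.

(** Duality separates each point of C by a half-space of rate above a. Compactness gives a finite
    cover only inside a box; the outside is handled by one more half-space, bounding the total
    flow. *)
Lemma upper_real C (a : R) : closed C -> (a%:E < ereal_inf (Ibar r T0 @` C))%E ->
  exists2 K : R, 0 < K & forall n, (P [set w | C (E n w)] <= (K * expR (- (s n * a)))%:E)%E.
Proof.
move=> cC aC.
have sep pt : C pt -> exists th, a < dot th (vec pt) - L th.
  move=> Cpt; apply: contrapT => /forallNP H.
  have : (Ibar r T0 pt <= a%:E)%E.
    by apply: Ibar_dual => th; have /negP := H th; rewrite -leNgt.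
  apply/negP; rewrite -ltNge; apply: (lt_le_trans aC).
  by apply: ereal_inf_lbound; exists pt.
(* The total flow. If its half-space at level a is missed, all flows are below a + L th1; together
   with occupations at most 1 this places the point in the box of size B. *)
pose th1 (i : I) : R := if i is inr _ then 1 else 0.
pose B := Num.max 1 (a + L th1).
pose K := [set pt : state_space R V |
  (forall y, 0 <= pt.1 y <= B) /\ (forall y z, 0 <= pt.2 y z <= B)].
have cK : compact (K `&` C) by apply: compact_closedI => //; exact: box_compact.
(* Filter of lists that eventually contain any given finite list; compactness in near-covering form
   then yields one list of directions covering the compact part of C. *)
pose F := filter_from [set: seq (I -> R)]
  (fun l0 => [set l | forall th, List.In th l0 -> List.In th l]).
have FF : Filter F.
  apply: filter_from_filter; first by exists [::].
  move=> l1 l2 _ _; exists (l1 ++ l2) => // l h.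
  by split => th thl; apply: h; apply/List.in_or_app; [left|right].
have [ths _ /(_ ths (fun th thl => thl)) Hths] : \forall l \near F, K `&` C `<=`
    [set pt | exists2 th, List.In th l & a < dot th (vec pt) - L th].
  move/compact_near_coveringP: cK; apply => pt [_ /sep[th Hth]].
  exists ([set q : state_space R V | a + L th < dot th (vec q)], [set l | List.In th l]).
    split; last by exists [:: th] => // l; apply; left.
    apply: open_nbhs_nbhs; split; last by move: Hth => /=; lra.
    exact: (open_comp (D := [set y | a + L th < y])
      (fun q _ => @dot_continuous th q) (@open_gt R _)).
  by move=> [q l] [/= h1 h2]; exists th => //; lra.
have [K0 K00 HK] := halfspaces_upper (measurable_Yn r T00 xiX mxi) s0
  (mgf_upper gr T00 kol xiX mxi fdd TL) a (th1 :: ths).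
exists K0 => // n; apply: HK; first exact: measurable_emp_closed.
move=> w Cw; have [big|small] := leP a (dot th1 (Y n w) - L th1).
  by exists th1 => //; left.
have flow_sum : dot th1 (Y n w) = \sum_(yz : V * V) emp_flow r (s n) (xi w) yz.1 yz.2.
  rewrite /dot big_sumType/= big1 ?add0r; last by move=> y _; rewrite mul0r.
  by apply: eq_bigr => yz _; rewrite mul1r.
have [th thl ht] : [set pt | exists2 th, List.In th ths & a < dot th (vec pt) - L th] (E n w).
  apply: Hths; split => //; split => [y|y z].
    rewrite emp_measure_ge0//= le_max -(emp_mass r xiX w (s0 n)); apply/orP; left.
    by apply: (@sum_ge1 R V (emp_measure (s n) (xi w))) => z; exact: emp_measure_ge0.
  rewrite emp_flow_ge0//= le_max; apply/orP; right; apply: (@le_trans _ _ (dot th1 (Y n w))).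
    rewrite flow_sum (bigD1 (y, z))//= lerDl; apply: sumr_ge0 => yz _; exact: emp_flow_ge0.
  by move: small; rewrite -/L; lra.
by exists th; [right|exact: ltW].
Qed.

Lemma ldp_upper C : closed C ->
  (limn_esup (fun n => (s n)^-1%:E * lne (P [set w | C (E n w)])) <= - ereal_inf (Ibar r T0 @` C))%E.
Proof.
move=> cC; apply: le_oppe_real => a /(upper_real cC)[K K0 HK].
apply/lee_addgt0Pr => e e0; apply: limn_esup_le.
apply: filterS (near_small (ln K) s0 (tn_ge T00) e0) => n.
rewrite ler_norml => /andP[_ h].
by apply: (le_trans (lne_le (s0 n) K0 _ (HK n))) => //; rewrite -EFinD lee_fin; lra.
Qed.

Lemma ldp_lower G : open G ->
  (- ereal_inf (Ibar r T0 @` G) <= limn_einf (fun n => (s n)^-1%:E * lne (P [set w | G (E n w)])))%E.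
Proof.
move=> oG; rewrite leeNl; apply: le_ereal_inf_tmp => _ [pt Gpt <-]; rewrite leeNl.
have := Ibar_ge0 gr T00 pt; case Ea : (Ibar r T0 pt) => [a| |] // _; last by rewrite leNye.
have [e e0 He] := state_nbhs (open_nbhs_nbhs (conj oG Gpt)).
have dual th : dot th (vec pt) - L th <= a.
  by rewrite -lee_fin -Ea; exact: (Ibar_ge gr T00 disc TL).
have e2 : 0 < e / 2 by rewrite divr_gt0.
have [th [h1 h2]] := moreau subgrad Xcont e2 dual.
pose S := \sum_i `|th i|.
have S0 : 0 <= S by apply: sumr_ge0.
apply/lee_addgt0Pr => eps eps0.
(* The first bound keeps the cube around the exposed point inside G, the second makes the cost del S
   of the cube in [tilted_lower] at most eps / 2. *)
pose del := Num.min (e / 2) (eps / 2 / (S + 1)).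
have S1 : 0 < S + 1 by rewrite ltr_wpDl.
have d0 : 0 < del by rewrite lt_min e2 !divr_gt0.
have dS : del * S <= eps / 2.
  apply: (@le_trans _ _ (eps / 2 / (S + 1) * (S + 1))); last by rewrite divfK ?gt_eqF.
  apply: ler_pM; [exact: ltW|exact: S0|by rewrite ge_min lexx orbT|by rewrite lerDl].
have [c c0 Hc] := tilted_lower subgrad Xcont (measurable_Yn r T00 xiX mxi) s0 (tn_ge T00)
  (mgf_upper gr T00 kol xiX mxi fdd TL) (mgf_lower gr T00 kol xiX mxi fdd TL) th d0.
rewrite -leeBlDr//; apply: limn_einf_ge.
have eps2 : 0 < eps / 2 by rewrite divr_gt0.
apply: filterS2 Hc (near_small (ln c) s0 (tn_ge T00) eps2) => n Hn.
rewrite ler_norml => /andP[h3 _].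
have hP : ((c * expR (- (s n * (a + eps / 2))))%:E <= P [set w | G (E n w)])%E.
  apply: (@le_trans _ _ (P [set w | forall i, `|X th i - Y n w i| < del])).
    apply: le_trans Hn; rewrite lee_fin ler_pM2l// ler_expR lerN2 ler_pM2l//.
    by move: h2 dS; rewrite -/L -/X -/S; lra.
  apply: le_measure; rewrite ?inE.
  - exact: (measurable_cube (measurable_Yn r T00 xiX mxi)).
  - exact: measurable_emp_open.
  move=> w /= hw; apply: He; apply: vec_near => i.
  have := h1 i; have := hw i; rewrite -/X -[vec (E n w) i]/(Y n w i) => a1 a2.
  have a3 : del <= e / 2 by rewrite ge_min lexx.
  have -> : vec pt i - Y n w i = (vec pt i - X th i) + (X th i - Y n w i) by ring.
  by apply: (le_lt_trans (ler_normD _ _)); lra.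
apply: le_trans (lne_ge (s0 n) c0 _ hP) => //.
by rewrite -EFinN -EFinB lee_fin; lra.
Qed.

End LargeDeviations.

Theorem theorem1 (R : realType) (V : finType) (T0 : R) (r : rates R V)
    (d : measure_display) (Omega : measurableType d)
    (P : probability Omega R) (xi : Omega -> R -> V)
    (p : R -> R -> V -> V -> R) (x : V) :
  0 < T0 ->
  rates_assumptions T0 r ->
  kolmogorov r p ->
  (forall w, cadlag (xi w)) ->
  (forall t y, 0 <= t -> measurable [set w | xi w t = y]) ->
  (forall (n : nat) (ts : nat -> R) (ys : nat -> V),
     0 <= ts 0%N -> (forall i, (i < n)%N -> ts i <= ts i.+1) ->
     P [set w | forall i, (i <= n)%N -> xi w (ts i) = ys i] =
     (p 0 (ts 0%N) x (ys 0%N) *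
        \prod_(i < n) p (ts i) (ts i.+1) (ys i) (ys i.+1))%:E) ->
  LDP (fun (n : nat) (C : set (state_space R V)) =>
         P [set w | C (emp_measure (n.+1%:R * T0) (xi w),
                       emp_flow r (n.+1%:R * T0) (xi w))])
      (fun n : nat => n.+1%:R * T0)
      (Ibar r T0) /\
  convex_functional (Ibar r T0).
Proof.
move=> T00 ra kol xiX mxi fdd.
have [m [M gr]] := rates_assumptions_good T00 ra.
have disc : (@lebesgue_measure R).-negligible ([set t : R | 0 <= t <= T0] `&`
  [set t | exists y z, ~ {for t, continuous (r y z)}]) by case: ra => _ _ _ _ [].
have /choice[rho /choice[v /choice[u TL]]] : forall th, exists rho v u,
    tilted T0 r (HH M th) (gg r th) rho v u.
  by move=> th; apply: (tilted_exists gr T00 x); exact: HH_ge.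
split; last exact: (Ibar_convex gr T00).
split; [split; [|split]|split].
- exact: (Ibar_ge0 gr T00).
- exact: (Ibar_closed gr T00 x).
- exact: (Ibar_compact gr T00 x).
- exact: (ldp_upper gr T00 disc kol xiX mxi fdd TL).
- exact: (ldp_lower gr T00 disc kol xiX mxi fdd TL).
Qed.
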